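(* Let $f_1,f_2$ be entire functions, let $q\in L_2(0,\pi)$ be complex-valued, and let $\{\lambda_n\}_{n=1}^\infty$ be a subspectrum of the problem $L(q)$. Suppose that the sequence $\{v_n\}_{n=0}^\infty$ constructed from $f_1,f_2$ and $\{\lambda_n\}_{n=0}^\infty$ (with $\lambda_0:=0$) is incomplete in $\mathcal H$. Then there exists a complex-valued function $\tilde q\in L_2(0,\pi)$, $\tilde q\ne q$, such that $\frac12\int_0^\pi\tilde q(x)\,dx=\frac12\int_0^\pi q(x)\,dx$ and $\{\lambda_n\}_{n=1}^\infty$ is a subspectrum of $L(\tilde q)$ (with the same $f_1,f_2$).
   Context: For entire functions $f_1,f_2$ and complex-valued $q\in L_2(0,\pi)$, $L(q)$ denotes the boundary value problem $-y''(x)+q(x)y(x)=\lambda y(x)$, $x\in(0,\pi)$, with $y(0)=0$, $f_1(\lambda)y'(\pi)+f_2(\lambda)y(\pi)=0$. Prime is the derivative in $x$; for derivatives in $\lambda$ write $f^{<j>}(\lambda)=\frac1{j!}\frac{d^j}{d\lambda^j}f(\lambda)$, $j\ge0$. Let $S(x,\lambda)$ be the solution of the equation with $S(0,\lambda)=0$, $S'(0,\lambda)=1$. The eigenvalues of $L(q)$ are the zeros of the entire characteristic function $\Delta(\lambda)=f_1(\lambda)S'(\pi,\lambda)+f_2(\lambda)S(\pi,\lambda)$, and the multiplicity of an eigenvalue is its multiplicity as a zero of $\Delta$. A sequence $\{\lambda_n\}_{n=1}^\infty$ of complex numbers is a subspectrum of $L(q)$ if it consists of eigenvalues, each repeated at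 most as many times as its multiplicity; i.e. if a value $\mu$ occurs $k$ times among $\{\lambda_n\}_{n\ge1}$, then $\Delta^{<j>}(\mu)=0$ for $0\le j\le k-1$. Put $\lambda_0:=0$, $I:=\{n\ge0:\lambda_n\ne\lambda_k\ \forall k,\ 0\le k<n\}$, $m_n:=\#\{k\ge0:\lambda_k=\lambda_n\}$. Equal values in $\{\lambda_n\}_{n=0}^\infty$ are numbered consecutively: $\lambda_n=\lambda_{n+1}=\dots=\lambda_{n+m_n-1}$ for $n\in I$. Let $s(x,\lambda)=\sqrt\lambda\sin(\sqrt\lambda x)$, $c(x,\lambda)=\cos(\sqrt\lambda x)$ (entire in $\lambda$). $\mathcal H=L_2(0,\pi)\oplus L_2(0,\pi)$ is the complex Hilbert space of $h=[h_1,h_2]$ with $(g,h)_{\mathcal H}=\int_0^\pi(\overline{g_1(t)}h_1(t)+\overline{g_2(t)}h_2(t))\,dt$. Let $v(t,\lambda)=[f_1(\lambda)s(t,\lambda),\,f_2(\lambda)c(t,\lambda)]$, $v_{n+\nu}(t):=v^{<\nu>}(t,\lambda_n)$ for $n\in I$, $\nu=0,\dots,m_n-1$, $n+\nu\ge1$, and $v_0(t):=[0,1]$. This defines $\{v_n\}_{n=0}^\infty\subset\mathcal H$. *)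

(* Defs.v *)
From HB Require Import structures.
From mathcomp Require Import all_boot all_order all_algebra.
From mathcomp Require Import complex.
From mathcomp Require Import all_classical all_reals all_analysis.
Import Order.TTheory GRing.Theory Num.Theory numFieldNormedType.Exports.

Set Implicit Arguments.
Unset Strict Implicit.
Unset Printing Implicit Defensive.

Local Open Scope classical_set_scope.
Local Open Scope ring_scope.

(* Declaring the structure lets [R[i]] be used as a normed space over itself,
   so that [derivable], [derive1n], ... on [Cplx R -> Cplx R] are complex
   differentiation. *)
Definition Cplx (R : realType) : numClosedFieldType := R[i].

Definition cmod (R : realType) (z : Cplx R) : R := complex.Re `|z|.

Definition entire (R : realType) (f : Cplx R -> Cplx R) : Prop :=
  forall z, derivable f z 1.

(* f^{<j>}(z) = (1/j!) (d/dz)^j f (z) *)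
Definition taylor_coef (R : realType) (j : nat) (f : Cplx R -> Cplx R)
    (z : Cplx R) : Cplx R :=
  (j`!%:R)^-1 * derive1n j f z.

Definition cexp (R : realType) (z : Cplx R) : Cplx R :=
  Complex (expR (complex.Re z) * cos (complex.Im z))
          (expR (complex.Re z) * sin (complex.Im z)).

Definition ccos (R : realType) (z : Cplx R) : Cplx R :=
  (cexp ('i * z) + cexp (- ('i * z))) / 2.

Definition csin (R : realType) (z : Cplx R) : Cplx R :=
  (cexp ('i * z) - cexp (- ('i * z))) / (2 * 'i).

(* Both are even in the square root, hence independent of its branch and
   entire in [lambda]. *)
Definition s_fun (R : realType) (x : R) (lambda : Cplx R) : Cplx R :=
  sqrtC lambda * csin (sqrtC lambda * (Complex x 0 : Cplx R)).

Definition c_fun (R : realType) (x : R) (lambda : Cplx R) : Cplx R :=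
  ccos (sqrtC lambda * (Complex x 0 : Cplx R)).

(* Elements of L_2(0,pi) are represented by functions on the whole line of
   which only the restriction to [0,pi], up to null sets, matters. *)
Definition L2 (R : realType) (f : R -> Cplx R) : Prop :=
  [/\ measurable_fun `[0, pi] (fun x => complex.Re (f x)),
      measurable_fun `[0, pi] (fun x => complex.Im (f x)) &
      (\int[lebesgue_measure]_(x in `[0%R, pi]) (cmod (f x) ^+ 2)%:E < +oo)%E].

Definition ae_eq0pi (R : realType) (f g : R -> Cplx R) : Prop :=
  {ae @lebesgue_measure R, forall x, 0 <= x <= pi -> f x = g x}.

Definition cint (R : realType) (f : R -> Cplx R) : Cplx R :=
  Complex (Rintegral lebesgue_measure `[0, pi] (fun x => complex.Re (f x)))
          (Rintegral lebesgue_measure `[0, pi] (fun x => complex.Im (f x))).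

Definition inH (R : realType) (h : R -> Cplx R * Cplx R) : Prop :=
  L2 (fun t => (h t).1) /\ L2 (fun t => (h t).2).

Definition Hinner (R : realType) (g h : R -> Cplx R * Cplx R) : Cplx R :=
  cint (fun t => Num.conj (g t).1 * (h t).1 + Num.conj (g t).2 * (h t).2).

Definition Hnorm (R : realType) (h : R -> Cplx R * Cplx R) : R :=
  Num.sqrt (complex.Re (Hinner h h)).

Definition lincomb (R : realType) (v : nat -> R -> Cplx R * Cplx R)
    (N : nat) (a : nat -> Cplx R) : R -> Cplx R * Cplx R :=
  fun t => (\sum_(k < N) a k * (v k t).1, \sum_(k < N) a k * (v k t).2).

(* The linear span of the sequence is dense in H. *)
Definition complete_in_H (R : realType) (v : nat -> R -> Cplx R * Cplx R)
    : Prop :=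
  forall h, inH h -> forall eps : R, 0 < eps ->
    exists N a, Hnorm (fun t => h t - lincomb v N a t) < eps.

Definition abs_continuous (R : realType) (a b : R) (f : R -> Cplx R) : Prop :=
  forall eps : R, 0 < eps -> exists2 delta : R, 0 < delta &
    forall (N : nat) (l r : nat -> R),
      (forall i, (i < N)%N -> [/\ a <= l i, l i <= r i & r i <= b]) ->
      trivIset `I_N (fun i => `]l i, r i[%classic) ->
      \sum_(i < N) (r i - l i) < delta ->
      \sum_(i < N) cmod (f (r i) - f (l i)) < eps.

Definition is_rderive (R : realType) (x : R) (f : R -> Cplx R) (df : Cplx R)
    : Prop :=
  is_derive x (1 : R) (fun u => complex.Re (f u) : R) (complex.Re df : R) /\
  is_derive x (1 : R) (fun u => complex.Im (f u) : R) (complex.Im df : R).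

(* [y] is a (Caratheodory) solution of - y'' + q y = lambda y on (0,pi) and
   [y1] its derivative: y and y' are absolutely continuous on [0,pi], and the
   equation holds almost everywhere.  Continuity makes [y1] the one-sided
   derivative of [y] at the end points. *)
Definition is_solution (R : realType) (q : R -> Cplx R) (lambda : Cplx R)
    (y y1 : R -> Cplx R) : Prop :=
  [/\ abs_continuous 0 pi y,
      abs_continuous 0 pi y1,
      forall x, 0 < x < pi -> is_rderive x y (y1 x) &
      {ae @lebesgue_measure R, forall x, 0 < x < pi ->
        exists2 y2 : Cplx R, is_rderive x y1 y2 &
          - y2 + q x * y x = lambda * y x}].

(* [S x lambda] is the solution with S(0,lambda) = 0, S'(0,lambda) = 1, and
   [S1 x lambda] its derivative in [x]. *)
Definition is_S (R : realType) (q : R -> Cplx R) (S S1 : R -> Cplx R -> Cplx R)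
    : Prop :=
  forall lambda,
    [/\ is_solution q lambda (S ^~ lambda) (S1 ^~ lambda),
        S 0 lambda = 0 & S1 0 lambda = 1].

Definition Delta (R : realType) (f1 f2 : Cplx R -> Cplx R)
    (S S1 : R -> Cplx R -> Cplx R) (lambda : Cplx R) : Cplx R :=
  f1 lambda * S1 pi lambda + f2 lambda * S pi lambda.

(* [lam n], n >= 1, is the sequence; [lam 0] is ignored.  The cardinal
   comparison says that [mu] occurs at least [j + 1] times among the
   [lam n], n >= 1 (possibly infinitely often). *)
Definition subspectrum (R : realType) (f1 f2 : Cplx R -> Cplx R)
    (q : R -> Cplx R) (lam : nat -> Cplx R) : Prop :=
  exists S S1, is_S q S S1 /\
    forall (mu : Cplx R) (j : nat),
      (`I_j.+1 #<= [set n | (0 < n)%N /\ lam n = mu])%card ->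
      taylor_coef j (Delta f1 f2 S S1) mu = 0.

(* The index set I. *)
Definition first_occ (R : realType) (lam : nat -> Cplx R) : set nat :=
  [set n | forall k, (k < n)%N -> lam n <> lam k].

(* For n in I and nu < m_n (written as a cardinal comparison, m_n being
   possibly infinite), lambda_(n + nu) = lambda_n. *)
Definition numbered_consecutively (R : realType) (lam : nat -> Cplx R) : Prop :=
  forall n nu, first_occ lam n ->
    (`I_nu.+1 #<= [set k | lam k = lam n])%card -> lam (n + nu)%N = lam n.

Definition first_index (R : realType) (lam : nat -> Cplx R) (k : nat) : nat :=
  index (lam k) (mkseq lam k.+1).

(* For a consecutively numbered sequence, k = n + nu with n in I and nu < m_n
   exactly when n = first_index lam k and nu = k - n. *)
Definition v_seq (R : realType) (f1 f2 : Cplx R -> Cplx R)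
    (lam : nat -> Cplx R) (k : nat) (t : R) : Cplx R * Cplx R :=
  if k == 0%N then (0, 1) else
  let n := first_index lam k in
  (taylor_coef (k - n) (fun z => f1 z * s_fun t z) (lam n),
   taylor_coef (k - n) (fun z => f2 z * c_fun t z) (lam n)).

(* Main.v *)
Require Import Defs.
From HB Require Import structures.
From mathcomp Require Import all_boot all_order all_algebra.
From mathcomp Require Import complex.
From mathcomp Require Import all_classical all_reals all_analysis.
From mathcomp Require Import measurable_realfun.
From mathcomp Require Import ring lra.
Import Order.TTheory GRing.Theory Num.Theory numFieldNormedType.Exports.

Local Open Scope classical_set_scope.
Local Open Scope ring_scope.

(** Incompleteness of the sequence gives a nonzero [u] in H orthogonal to every
   [v_n] ([incomplete_orthogonal]).  The potential is moved in such a way that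
   the characteristic function changes exactly by what [u] prescribes.

   Transformation operator.  For a potential [p] on [0, pi], with [c] and [sn]
   for [cos (sqrt l t)] and [sin (sqrt l t) / sqrt l],
     [S pi l  = sn pi + \int_0^pi A (pi, s) sn (pi - 2 s) ds],
     [S' pi l = c pi + \int_0^pi A (pi, s) c (pi - 2 s) ds],
   where the kernel [A] lives on the triangle [0 <= s <= x <= pi] and solves the
   Volterra equation [is_kernel].  Kernels exist ([kernel_exists]), they yield
   solutions ([kernel_is_S]), and the solution is unique ([solution_unique]).

   Inverse step.  Prescribing the kernel on the side [x = pi] determines the
   potential.  Given a small square integrable [z], one solves backwards from
   [x = pi] for the increment [B] of the kernel and for [w], where [z + w] is the
   increment of the potential, so that [B (pi, s) = \int_s^pi z].  Successive
   approximations converge in a norm with the weight [exp (- gam x)], which is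
   what square integrable potentials allow ([exp_smoothing], [perturb_exists]).
   An exchange of integrals shows that the sum of the kernels is the kernel of
   the new potential ([perturbed_kernel]).  The integral of the potential changes
   by that of [z] ([perturbed_mean]), and the potential changes only if [z] is
   not zero ([perturbed_nontrivial]).

   Choice of [z].  The reflection [y -> pi - y] splits [z] into an even and an
   odd part; they are made of the conjugates of the two components of [u] and
   multiplied by a small [eps] ([fold]).  Then
     [l (Delta~ l - Delta l) = eps (u, v(., l))]      ([side_gen]).
   Orthogonality to [v_0 = [0,1]] says that [z] has mean zero, so that the
   integral of the potential is kept.  Orthogonality to the other [v_n] says that
   the right-hand side vanishes at each [lambda_n] with the required derivatives.
   Division by [l] preserves this away from zero and costs one order at zero,
   which the convention [lambda_0 = 0] has supplied in advance
   ([derive_quotient0], [occurrences0]).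

   Square integrable functions are handled as functions on the line vanishing
   outside [0, pi], with domains of integration as Boolean factors.  Three
   classical theories are developed to the extent needed: derivatives of entire
   functions (Goursat by bisection, Cauchy's formula), absolutely continuous
   functions as primitives, and the projection theorem in L_2 (Riesz-Fischer). *)

Set Implicit Arguments.
Unset Strict Implicit.
Unset Printing Implicit Defensive.

(** * Modulus, measurability and integration of complex-valued functions *)

Local Notation Re := complex.Re.
Local Notation Im := complex.Im.

(** Iverson bracket. *)
Notation "⟦ b ⟧" := ((nat_of_bool b%R)%:R)
  (at level 0, b at level 200, format "⟦ b ⟧").

Definition rc (R : realType) (x : R) : Cplx R := Complex x 0.
Arguments rc {R} x.

Section Modulus.
Context {R : realType}.
Implicit Types (z w : Cplx R) (x y : R).

Lemma ReD z w : Re (z + w) = Re z + Re w. Proof. by case: z => a b; case: w. Qed.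
Lemma ImD z w : Im (z + w) = Im z + Im w. Proof. by case: z => a b; case: w. Qed.
Lemma ReN z : Re (- z) = - Re z. Proof. by case: z. Qed.
Lemma ImN z : Im (- z) = - Im z. Proof. by case: z. Qed.
Lemma ReB z w : Re (z - w) = Re z - Re w. Proof. by rewrite ReD ReN. Qed.
Lemma ImB z w : Im (z - w) = Im z - Im w. Proof. by rewrite ImD ImN. Qed.
Lemma ReM z w : Re (z * w) = Re z * Re w - Im z * Im w.
Proof. by case: z => a b; case: w. Qed.
Lemma ImM z w : Im (z * w) = Re z * Im w + Im z * Re w.
Proof. by case: z => a b; case: w. Qed.
Lemma Re_rc x : Re (rc x) = x. Proof. by []. Qed.
Lemma Im_rc x : Im (rc x) = 0. Proof. by []. Qed.
Lemma Re0 : Re (0 : Cplx R) = 0. Proof. by []. Qed.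
Lemma Im0 : Im (0 : Cplx R) = 0. Proof. by []. Qed.
Lemma Re1 : Re (1 : Cplx R) = 1. Proof. by []. Qed.
Lemma Im1 : Im (1 : Cplx R) = 0. Proof. by []. Qed.

Lemma cplx_eq z w : Re z = Re w -> Im z = Im w -> z = w.
Proof. by case: z => a b; case: w => c d /= -> ->. Qed.

Lemma rcD x y : rc (x + y) = rc x + rc y.
Proof. by apply: cplx_eq; rewrite /= ?addr0. Qed.
Lemma rcN x : rc (- x) = - rc x.
Proof. by apply: cplx_eq; rewrite /= ?oppr0. Qed.
Lemma rcB x y : rc (x - y) = rc x - rc y. Proof. by rewrite rcD rcN. Qed.
Lemma rcM x y : rc (x * y) = rc x * rc y.
Proof. by apply: cplx_eq; rewrite /= ?mulr0 ?mul0r ?subr0 ?addr0. Qed.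
Lemma rc0 : rc 0 = 0 :> Cplx R. Proof. by []. Qed.
Lemma rc1 : rc 1 = 1 :> Cplx R. Proof. by []. Qed.
Lemma rc_nat n : rc n%:R = n%:R :> Cplx R.
Proof. by elim: n => // n ih; rewrite -natr1 rcD ih -natr1. Qed.
Lemma rcV x : rc x^-1 = (rc x)^-1.
Proof.
have [->|x0] := eqVneq x 0; first by rewrite invr0 rc0 invr0.
have rx0 : rc x != 0 by apply: contra_neq x0 => /(congr1 (@complex.Re _)).
by apply: (mulfI rx0); rewrite -rcM !mulfV.
Qed.

Lemma cmodE z : cmod z = Num.sqrt (Re z ^+ 2 + Im z ^+ 2).
Proof. by rewrite /cmod normc_def. Qed.
Lemma normcE z : `|z| = rc (cmod z).
Proof. by rewrite /cmod normc_def. Qed.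
Lemma rc_inj x y : rc x = rc y -> x = y.
Proof. by move/(congr1 (@complex.Re _)). Qed.
Lemma rc_le x y : (rc x <= rc y) = (x <= y).
Proof. by rewrite /rc lecE /= eqxx. Qed.
Lemma rc_lt x y : (rc x < rc y) = (x < y).
Proof. by rewrite /rc ltcE /= eqxx. Qed.

Lemma cmod_ge0 z : 0 <= cmod z. Proof. by rewrite cmodE sqrtr_ge0. Qed.
Lemma cmod0 : cmod (0 : Cplx R) = 0.
Proof. by rewrite cmodE /= expr0n addr0 sqrtr0. Qed.
Lemma cmodM z w : cmod (z * w) = cmod z * cmod w.
Proof. by apply: rc_inj; rewrite rcM -!normcE normrM. Qed.
Lemma cmodD z w : cmod (z + w) <= cmod z + cmod w.
Proof. by rewrite -rc_le rcD -!normcE ler_normD. Qed.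
Lemma cmodN z : cmod (- z) = cmod z.
Proof. by apply: rc_inj; rewrite -!normcE normrN. Qed.
Lemma cmodB z w : cmod (z - w) <= cmod z + cmod w.
Proof. by rewrite -(cmodN w) cmodD. Qed.
Lemma cmodBC z w : cmod (z - w) = cmod (w - z).
Proof. by rewrite -cmodN opprB. Qed.
Lemma cmod_tri z w v : cmod (z - v) <= cmod (z - w) + cmod (w - v).
Proof. by rewrite (_ : z - v = (z - w) + (w - v)) ?cmodD //; ring. Qed.
Lemma cmod_eq0 z : cmod z = 0 -> z = 0.
Proof. by move=> z0; apply/normr0_eq0; rewrite normcE z0. Qed.
Lemma cmod_gt0 z : z != 0 -> 0 < cmod z.
Proof.
move=> z0; rewrite lt_def cmod_ge0 andbT.
by apply: contra_neq z0 => /cmod_eq0.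
Qed.
Lemma cmod_rc x : cmod (rc x) = `|x|.
Proof. by rewrite cmodE /= expr0n addr0 sqrtr_sqr. Qed.
Lemma cmod1 : cmod (1 : Cplx R) = 1.
Proof. by rewrite -rc1 cmod_rc normr1. Qed.
Lemma cmodV z : cmod z^-1 = (cmod z)^-1.
Proof. by apply: rc_inj; rewrite rcV -!normcE normfV. Qed.
Lemma cmodX z n : cmod (z ^+ n) = cmod z ^+ n.
Proof. by elim: n => [|n ih]; rewrite ?expr0 ?cmod1 // !exprS cmodM ih. Qed.
Lemma cmod_sqr z : cmod z ^+ 2 = Re z ^+ 2 + Im z ^+ 2.
Proof. by rewrite cmodE sqr_sqrtr // addr_ge0 ?sqr_ge0. Qed.
Lemma cmod_conj z : cmod (Num.conj z) = cmod z.
Proof. by apply: rc_inj; rewrite -!normcE norm_conjC. Qed.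
Lemma Re_conj z : Re (Num.conj z) = Re z. Proof. by case: z. Qed.
Lemma Im_conj z : Im (Num.conj z) = - Im z. Proof. by case: z. Qed.
Lemma conj_rc x : Num.conj (rc x) = rc x.
Proof. by apply: cplx_eq; rewrite ?Re_conj ?Im_conj //= oppr0. Qed.
Lemma mul_conj z : Num.conj z * z = rc (cmod z ^+ 2).
Proof.
apply: cplx_eq; rewrite ?ReM ?ImM Re_conj Im_conj /= ?cmod_sqr //; ring.
Qed.

Lemma Re_le_cmod z : `|Re z| <= cmod z.
Proof.
rewrite cmodE -sqrtr_sqr ler_sqrt ?lerDl ?sqr_ge0 //.
by rewrite addr_ge0 ?sqr_ge0.
Qed.
Lemma Im_le_cmod z : `|Im z| <= cmod z.
Proof.
rewrite cmodE -sqrtr_sqr ler_sqrt ?lerDr ?sqr_ge0 //.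
by rewrite addr_ge0 ?sqr_ge0.
Qed.
Lemma cmod_le_ReIm z : cmod z <= `|Re z| + `|Im z|.
Proof.
rewrite (_ : z = rc (Re z) + 'i * rc (Im z)); last first.
  by apply: cplx_eq; rewrite ?ReD ?ImD ?ReM ?ImM /=; ring.
apply: le_trans (cmodD _ _) _; rewrite cmodM !cmod_rc.
rewrite !ReD !ImD !ReM !ImM /=.
rewrite (_ : cmod 'i = 1); last by apply: rc_inj; rewrite -normcE normCi.
by rewrite !(mul0r, mulr0, mul1r, subr0, addr0, add0r, sub0r, oppr0).
Qed.
Lemma cmodi : cmod ('i : Cplx R) = 1.
Proof. by apply: rc_inj; rewrite -normcE normCi. Qed.
Lemma ii : 'i * 'i = -1 :> Cplx R.
Proof. by rewrite -expr2 sqrCi. Qed.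
Lemma cmod_dist z w : cmod z - cmod w <= cmod (z - w).
Proof. by rewrite lerBlDr -{1}(subrK w z) cmodD. Qed.
Lemma cmod_nat n : cmod (n%:R : Cplx R) = n%:R.
Proof. by rewrite -rc_nat cmod_rc ger0_norm. Qed.
Lemma cmod_bool (b : bool) : cmod (b%:R : Cplx R) = b%:R.
Proof. exact: cmod_nat. Qed.

End Modulus.

Section ComplexMeasurable.
Context {R : realType}.

Definition cmeas d (T : measurableType d) (f : T -> Cplx R) : Prop :=
  measurable_fun setT (fun x => Re (f x)) /\
  measurable_fun setT (fun x => Im (f x)).

Context {d} {T : measurableType d}.
Implicit Types (f g : T -> Cplx R).

Lemma cmeas_cst (c : Cplx R) : cmeas (fun _ : T => c).
Proof. by split; exact: measurable_cst. Qed.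
Lemma cmeas_rc (f : T -> R) : measurable_fun setT f -> cmeas (fun x => rc (f x)).
Proof. by move=> mf; split => //=; exact: measurable_cst. Qed.
Lemma cmeas_if (b : T -> bool) f g : measurable_fun setT b -> cmeas f -> cmeas g ->
  cmeas (fun x => if b x then f x else g x).
Proof.
move=> mb [f1 f2] [g1 g2]; split.
  rewrite (_ : (fun x => _) = fun x => if b x then Re (f x) else Re (g x)); last first.
    by apply/funext => x; case: ifP.
  exact: measurable_fun_ifT.
rewrite (_ : (fun x => _) = fun x => if b x then Im (f x) else Im (g x)); last first.
  by apply/funext => x; case: ifP.
exact: measurable_fun_ifT.
Qed.
Lemma cmeas_bool (b : T -> bool) : measurable_fun setT b ->
  cmeas (fun x => (b x)%:R : Cplx R).
Proof.
move=> mb; rewrite (_ : (fun x => _) = (fun x => if b x then 1 else 0 : Cplx R)).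
  by apply: cmeas_if => //; exact: cmeas_cst.
by apply/funext => x; case: (b x).
Qed.
Lemma cmeasD f g : cmeas f -> cmeas g -> cmeas (fun x => f x + g x).
Proof.
move=> [f1 f2] [g1 g2]; split.
  under eq_fun do rewrite ReD; exact: measurable_funD.
under eq_fun do rewrite ImD; exact: measurable_funD.
Qed.
Lemma cmeasN f : cmeas f -> cmeas (fun x => - f x).
Proof.
move=> [f1 f2]; split.
  under eq_fun do rewrite ReN; exact: measurableT_comp.
under eq_fun do rewrite ImN; exact: measurableT_comp.
Qed.
Lemma cmeasB f g : cmeas f -> cmeas g -> cmeas (fun x => f x - g x).
Proof. by move=> mf mg; apply: cmeasD => //; exact: cmeasN. Qed.
Lemma cmeasM f g : cmeas f -> cmeas g -> cmeas (fun x => f x * g x).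
Proof.
move=> [f1 f2] [g1 g2]; split.
  by under eq_fun do rewrite ReM; apply: measurable_funB; apply: measurable_funM.
by under eq_fun do rewrite ImM; apply: measurable_funD; apply: measurable_funM.
Qed.
Lemma cmeas_conj f : cmeas f -> cmeas (fun x => Num.conj (f x)).
Proof.
move=> [f1 f2]; split.
  by under eq_fun do rewrite Re_conj.
under eq_fun do rewrite Im_conj; exact: measurableT_comp.
Qed.
Lemma measurable_cmod_sqr f : cmeas f -> measurable_fun setT (fun x => cmod (f x) ^+ 2).
Proof.
move=> [f1 f2]; under eq_fun do rewrite cmod_sqr.
by apply: measurable_funD; exact: measurable_funX.
Qed.
Lemma measurable_cmod f : cmeas f -> measurable_fun setT (fun x => cmod (f x)).
Proof.
move=> /measurable_cmod_sqr mf.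
rewrite (_ : (fun x => _) = Num.sqrt \o (fun x => cmod (f x) ^+ 2)); last first.
  by apply/funext => x /=; rewrite sqrtr_sqr ger0_norm ?cmod_ge0.
apply: measurableT_comp => //; apply: continuous_measurable_fun.
exact: sqrt_continuous.
Qed.

Lemma cmeas_comp d' (U : measurableType d') (f : U -> Cplx R) (g : T -> U) :
  cmeas f -> measurable_fun setT g -> cmeas (fun x => f (g x)).
Proof. by move=> [f1 f2] mg; split; [exact: (measurableT_comp f1)|exact: (measurableT_comp f2)]. Qed.

Definition cconv (u : nat -> Cplx R) (l : Cplx R) : Prop :=
  forall e : R, 0 < e -> exists N, forall n, (N <= n)%N -> cmod (u n - l) < e.

Lemma cmeas_lim (u : nat -> T -> Cplx R) f : (forall n, cmeas (u n)) ->
  (forall x, cconv (u ^~ x) (f x)) -> cmeas f.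
Proof.
move=> mu uf; split.
  apply: (@measurable_fun_cvg _ _ _ _ (fun n x => Re (u n x))).
    by move=> n; have [] := mu n.
  move=> x _; apply/cvgrPdist_lt => e e0; have [N hN] := uf x e e0.
  exists N => // n /= Nn; apply: le_lt_trans (hN _ Nn).
  by rewrite cmodBC -ReB Re_le_cmod.
apply: (@measurable_fun_cvg _ _ _ _ (fun n x => Im (u n x))).
  by move=> n; have [] := mu n.
move=> x _; apply/cvgrPdist_lt => e e0; have [N hN] := uf x e e0.
exists N => // n /= Nn; apply: le_lt_trans (hN _ Nn).
by rewrite cmodBC -ImB Im_le_cmod.
Qed.

End ComplexMeasurable.

Section ComplexIntegral.
Context {R : realType}.
Local Notation mu := (@lebesgue_measure R).
Implicit Types (f g h : R -> Cplx R) (a b x y : R).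

Definition rint (g : R -> R) : Prop := mu.-integrable setT (EFin \o g).
Definition IR (g : R -> R) : R := Rintegral mu setT g.

(** The integral over the whole line: all domains of integration are encoded
   by Boolean factors in the integrand, so that Fubini applies verbatim. *)
Definition CI f : Cplx R :=
  Complex (IR (fun x => Re (f x))) (IR (fun x => Im (f x))).
Definition cintb f : Prop := cmeas f /\ rint (fun x => cmod (f x)).

Lemma rint_meas (g : R -> R) : rint g -> measurable_fun setT g.
Proof. by move=> /measurable_int/measurable_EFinP. Qed.
Lemma rintD (g1 g2 : R -> R) : rint g1 -> rint g2 -> rint (fun x => g1 x + g2 x).
Proof. by move=> i1 i2; apply: (integrableD _ i1 i2). Qed.
Lemma rintZ (k : R) (g : R -> R) : rint g -> rint (fun x => k * g x).
Proof. by move=> ig; apply: (integrableZl _ k ig). Qed.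
Lemma rintN (g : R -> R) : rint g -> rint (fun x => - g x).
Proof. by move=> ig; apply: (integrableN ig). Qed.
Lemma rint0 : rint (fun=> 0).
Proof. exact: integrable0. Qed.
Lemma rint_le (g1 g2 : R -> R) : measurable_fun setT g1 ->
  (forall x, `|g1 x| <= g2 x) -> rint g2 -> rint g1.
Proof.
move=> m1 le12; apply: le_integrable => //.
  exact/measurable_EFinP.
move=> x _ /=; rewrite lee_fin; apply: le_trans (le12 x) _; exact: ler_norm.
Qed.
Lemma IR_le (g1 g2 : R -> R) : rint g1 -> rint g2 ->
  (forall x, g1 x <= g2 x) -> IR g1 <= IR g2.
Proof. by move=> i1 i2 le12; apply: le_Rintegral => // x _. Qed.
Lemma IRD (g1 g2 : R -> R) : rint g1 -> rint g2 ->
  IR (fun x => g1 x + g2 x) = IR g1 + IR g2.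
Proof. by move=> i1 i2; exact: RintegralD. Qed.
Lemma IRZ (k : R) (g : R -> R) : rint g -> IR (fun x => k * g x) = k * IR g.
Proof. by move=> i1; exact: RintegralZl. Qed.
Lemma IRN (g : R -> R) : rint g -> IR (fun x => - g x) = - IR g.
Proof.
move=> ig; under [in LHS]eq_fun do rewrite -mulN1r.
by rewrite IRZ // mulN1r.
Qed.
Lemma IR_ge0 (g : R -> R) : (forall x, 0 <= g x) -> 0 <= IR g.
Proof. by move=> g0; apply: Rintegral_ge0. Qed.
Lemma IR0 : IR (fun=> 0) = 0.
Proof. by rewrite /IR /Rintegral integral0. Qed.
Lemma rint_itv a b (k : R) : rint (fun x => k * ⟦a <= x <= b⟧).
Proof.
apply: rintZ.
rewrite (_ : (fun x => _) = \1_(`[a, b])).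
  exact: integrable_indic_itv.
by apply/funext => x; rewrite indicE mem_setE in_itv.
Qed.
Lemma IR_itv a b : a <= b -> IR (fun x => ⟦a <= x <= b⟧) = b - a.
Proof.
move=> ab; rewrite /IR /Rintegral.
rewrite (_ : (fun x => _) = (fun x => (\1_(`[a, b]%classic : set R) x)%:E)); last first.
  by apply/funext => x; rewrite indicE mem_setE in_itv.
rewrite integral_indic //= setIT lebesgue_measure_itv /= lte_fin.
by case: ltgtP ab => // -> _; rewrite subrr.
Qed.
Lemma rint_Re f : cintb f -> rint (fun x => Re (f x)).
Proof. by move=> [[m1 _] i]; apply: rint_le i => // x; exact: Re_le_cmod. Qed.
Lemma rint_Im f : cintb f -> rint (fun x => Im (f x)).
Proof. by move=> [[_ m2] i]; apply: rint_le i => // x; exact: Im_le_cmod. Qed.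

Lemma cintb_dom f (g : R -> R) : cmeas f -> (forall x, cmod (f x) <= g x) ->
  rint g -> cintb f.
Proof.
move=> mf fg ig; split => //; apply: rint_le ig.
  exact: measurable_cmod.
by move=> x; rewrite ger0_norm ?cmod_ge0.
Qed.
Lemma cintbD f g : cintb f -> cintb g -> cintb (fun x => f x + g x).
Proof.
move=> [mf jf] [mg jg]; apply: (cintb_dom (cmeasD mf mg) _ (rintD jf jg)).
by move=> x; exact: cmodD.
Qed.
Lemma cintbN f : cintb f -> cintb (fun x => - f x).
Proof.
move=> [mf jf]; apply: (cintb_dom (cmeasN mf) _ jf) => x.
by rewrite cmodN.
Qed.
Lemma cintbB f g : cintb f -> cintb g -> cintb (fun x => f x - g x).
Proof. by move=> jf jg; apply: cintbD => //; exact: cintbN. Qed.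
Lemma cintbZ c f : cintb f -> cintb (fun x => c * f x).
Proof.
move=> [mf jf]; apply: (cintb_dom _ _ (rintZ (cmod c) jf)).
  by apply: cmeasM => //; exact: cmeas_cst.
by move=> x; rewrite cmodM.
Qed.
Lemma cintb_bound f g (M : R) : cmeas f -> (forall x, cmod (f x) <= M) -> cintb g ->
  cintb (fun x => f x * g x).
Proof.
move=> mf fM [mg jg]; apply: (cintb_dom (cmeasM mf mg) _ (rintZ M jg)) => x.
by rewrite cmodM ler_wpM2r ?cmod_ge0.
Qed.
Lemma cintb_bool (b : R -> bool) g : measurable_fun setT b -> cintb g ->
  cintb (fun x => (b x)%:R * g x).
Proof.
move=> mb; apply: (@cintb_bound _ _ 1); first exact: cmeas_bool.
by move=> x; rewrite cmod_bool lern1; case: (b x).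
Qed.

Lemma CI_Re f : Re (CI f) = IR (fun x => Re (f x)). Proof. by []. Qed.
Lemma CI_Im f : Im (CI f) = IR (fun x => Im (f x)). Proof. by []. Qed.
Lemma eq_CI f g : (forall x, f x = g x) -> CI f = CI g.
Proof. by move=> fg; congr CI; apply/funext. Qed.
Lemma CI0 : CI (fun=> 0) = 0.
Proof. by apply: cplx_eq => /=; rewrite IR0. Qed.
Lemma CID f g : cintb f -> cintb g -> CI (fun x => f x + g x) = CI f + CI g.
Proof.
move=> jf jg; apply: cplx_eq => /=.
  under eq_fun do rewrite ReD; by apply: IRD; exact: rint_Re.
under eq_fun do rewrite ImD; by apply: IRD; exact: rint_Im.
Qed.
Lemma CIN f : cintb f -> CI (fun x => - f x) = - CI f.
Proof.
move=> jf; apply: cplx_eq => /=.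
  under eq_fun do rewrite ReN; by apply: IRN; exact: rint_Re.
under eq_fun do rewrite ImN; by apply: IRN; exact: rint_Im.
Qed.
Lemma CIB f g : cintb f -> cintb g -> CI (fun x => f x - g x) = CI f - CI g.
Proof. by move=> jf jg; rewrite CID ?CIN //; exact: cintbN. Qed.
Lemma CIZ c f : cintb f -> CI (fun x => c * f x) = c * CI f.
Proof.
move=> jf; have iR := rint_Re jf; have iI := rint_Im jf.
apply: cplx_eq.
  rewrite ReM /=; under eq_fun do rewrite ReM.
  rewrite IRD; [|exact: rintZ|exact/rintN/rintZ].
  by rewrite IRN; [rewrite !IRZ|exact: rintZ].
rewrite ImM /=; under eq_fun do rewrite ImM.
by rewrite IRD; [rewrite !IRZ|exact: rintZ|exact: rintZ].
Qed.

(** Rotating the value of the integral to the positive axis reduces the bound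
   to the real case. *)
Lemma CI_norm f : cintb f -> cmod (CI f) <= IR (fun x => cmod (f x)).
Proof.
move=> jf; have [mf jm] := jf.
have [c0|c0] := eqVneq (cmod (CI f)) 0.
  by rewrite c0; apply: IR_ge0 => x; exact: cmod_ge0.
have cpos : 0 < cmod (CI f) by rewrite lt_def c0 cmod_ge0.
rewrite -(ler_pM2l cpos).
have <- : Re (CI (fun x => Num.conj (CI f) * f x)) = cmod (CI f) * cmod (CI f).
  by rewrite CIZ // mul_conj.
rewrite -IRZ //; apply: IR_le; [|exact: rintZ|].
  by apply: rint_Re; exact: cintbZ.
move=> x; apply: le_trans (ler_norm _) _.
apply: le_trans (Re_le_cmod _) _.
by rewrite cmodM cmod_conj.
Qed.
Lemma CI_le f (g : R -> R) : cintb f -> rint g -> (forall x, cmod (f x) <= g x) ->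
  cmod (CI f) <= IR g.
Proof.
move=> jf ig fg; apply: le_trans (CI_norm jf) _.
by apply: IR_le => //; case: jf.
Qed.

Lemma CI_rc (g : R -> R) : CI (fun x => rc (g x)) = rc (IR g).
Proof. by apply: cplx_eq => //=; rewrite IR0. Qed.

Lemma ae_imp (P Q : R -> Prop) : (forall x, P x -> Q x) ->
  {ae mu, forall x, P x} -> {ae mu, forall x, Q x}.
Proof.
move=> PQ; apply: filterS; first exact: (ae_filter_ringOfSetsType mu).
exact: PQ.
Qed.
Lemma ae_and (P Q : R -> Prop) :
  {ae mu, forall x, P x} -> {ae mu, forall x, Q x} -> {ae mu, forall x, P x /\ Q x}.
Proof.
by apply: filterS2; [exact: (ae_filter_ringOfSetsType mu)|move=> x p q; split].
Qed.
Lemma CI_ae f g : cmeas f -> cmeas g ->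
  {ae mu, forall x, f x = g x} -> CI f = CI g.
Proof.
move=> [f1 f2] [g1 g2] fg; apply: cplx_eq => /=; congr fine; apply: ae_eq_integral => //.
- exact/measurable_EFinP.
- exact/measurable_EFinP.
- by apply: ae_imp fg => x ->.
- exact/measurable_EFinP.
- exact/measurable_EFinP.
- by apply: ae_imp fg => x ->.
Qed.
Lemma ae_neq a : {ae mu, forall x, x <> a}.
Proof.
exists [set a]; split => //; first exact: lebesgue_measure_set1.
by move=> x /= /contrapT.
Qed.
Lemma CI_point a f g : cmeas f -> cmeas g -> (forall x, x != a -> f x = g x) ->
  CI f = CI g.
Proof.
move=> mf mg fg; apply: CI_ae => //; apply: ae_imp (ae_neq a) => x xa.
by apply: fg; exact/eqP.
Qed.

Lemma IR_param d (T : measurableType d) (f : T * R -> R) :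
  measurable_fun setT f -> measurable_fun setT (fun t => IR (fun y => f (t, y))).
Proof.
move=> mf; have h (g : T * R -> \bar R) : measurable_fun setT g ->
    (forall p, (0 <= g p)%E) -> measurable_fun setT (fun t => \int[mu]_y g (t, y))%E.
  by move=> mg g0; exact: measurable_fun_fubini_tonelli_F.
apply: measurableT_comp => //=.
under eq_fun => t do rewrite integralE.
have mf' : measurable_fun setT (EFin \o f) by exact/measurable_EFinP.
apply: emeasurable_funB.
  rewrite (_ : (fun t => _) = (fun t => \int[mu]_y ((EFin \o f)^\+ (t, y)))%E).
    by apply: h; [exact: measurable_funepos|move=> p; exact: funepos_ge0].
  by apply/funext => t; apply: eq_integral => y _; rewrite unlock.
rewrite (_ : (fun t => _) = (fun t => \int[mu]_y ((EFin \o f)^\- (t, y)))%E).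
  by apply: h; [exact: measurable_funeneg|move=> p; exact: funeneg_ge0].
by apply/funext => t; apply: eq_integral => y _; rewrite unlock.
Qed.
Lemma cmeas_CI d (T : measurableType d) (f : T * R -> Cplx R) :
  cmeas f -> cmeas (fun t => CI (fun y => f (t, y))).
Proof.
move=> [f1 f2]; split => /=.
  exact: (IR_param f1).
exact: (IR_param f2).
Qed.

Lemma IR_fubini (f : R * R -> R) (g1 g2 : R -> R) : measurable_fun setT f ->
  rint g1 -> rint g2 -> (forall x y, `|f (x, y)| <= g1 x * g2 y) ->
  IR (fun x => IR (fun y => f (x, y))) = IR (fun y => IR (fun x => f (x, y))).
Proof.
move=> mf i1 i2 fg.
have i2s x : rint (fun y => f (x, y)).
  apply: (@rint_le _ (fun y => g1 x * g2 y)) => //; last exact: rintZ.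
  by apply: measurableT_comp => //; exact: measurable_fun_pair.
have i1s y : rint (fun x => f (x, y)).
  apply: (@rint_le _ (fun x => g2 y * g1 x)) => //; last exact: rintZ.
    by apply: measurableT_comp => //; exact: measurable_fun_pair.
  by move=> x; rewrite mulrC.
have jf : (mu \x mu)%E.-integrable setT (EFin \o f).
  apply/integrable12ltyP; first exact/measurable_EFinP.
  have ig : rint (fun x => IR (fun y => `|g2 y|) * `|g1 x|).
    by apply: rintZ; apply: integrable_norm.
  apply: (@le_lt_trans _ _ (\int[mu]_x (IR (fun y => `|g2 y|) * `|g1 x|)%:E)%E); last first.
    exact: (integrable_lty _ ig).
  apply: ge0_le_integral => //.
  - by move=> x _; apply: integral_ge0.
  - apply: (@measurable_fun_fubini_tonelli_F _ _ _ _ _ mu (fun z => `|(f z)%:E|)%E) => //.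
    by apply: measurableT_comp => //; exact/measurable_EFinP.
  - exact: (measurable_int _ ig).
  - move=> x _.
    rewrite (_ : (\int[mu]_y _)%E = (IR (fun y => `|f (x, y)|))%:E); last first.
      rewrite /IR /Rintegral fineK //.
      apply: integrable_fin_num => //.
      exact: (integrable_norm (i2s x)).
    rewrite lee_fin mulrC -IRZ; last exact: integrable_norm.
    apply: IR_le.
    + exact: (integrable_norm (i2s x)).
    + by apply: rintZ; exact: integrable_norm.
    + move=> y; apply: le_trans (fg x y) _.
      by rewrite -normrM ler_norm.
have := Fubini jf.
rewrite /= (_ : (fun x => \int[mu]_y (f (x, y))%:E)%E = fun x => (IR (fun y => f (x, y)))%:E).
  rewrite (_ : (fun y => \int[mu]_x (f (x, y))%:E)%E = fun y => (IR (fun x => f (x, y)))%:E).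
    by move=> /(congr1 fine).
  by apply/funext => y; rewrite /IR /Rintegral fineK //; apply: integrable_fin_num => //; exact: i1s.
by apply/funext => x; rewrite /IR /Rintegral fineK //; apply: integrable_fin_num => //; exact: i2s.
Qed.

(** Every double integral below is dominated by a product of integrable
   functions, which is all that the exchange of integrals needs. *)
Lemma CI_fubini (f : R -> R -> Cplx R) (g1 g2 : R -> R) :
  cmeas (fun p : R * R => f p.1 p.2) -> rint g1 -> rint g2 ->
  (forall x y, cmod (f x y) <= g1 x * g2 y) ->
  CI (fun x => CI (f x)) = CI (fun y => CI (f ^~ y)).
Proof.
move=> [m1 m2] i1 i2 fg; apply: cplx_eq => /=.
  apply: (@IR_fubini (fun p => Re (f p.1 p.2)) g1 g2) => // x y.
  by apply: le_trans (fg x y); exact: Re_le_cmod.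
apply: (@IR_fubini (fun p => Im (f p.1 p.2)) g1 g2) => // x y.
by apply: le_trans (fg x y); exact: Im_le_cmod.
Qed.

End ComplexIntegral.

(** * Derivatives with explicit moduli, and the fundamental theorem of calculus *)

(** One notion covers functions of a real variable (with [iota] the inclusion
   of the reals) and of a complex variable (with [iota] the identity). *)
Section Derivation.
Context {R : realType} {K : zmodType} (iota : K -> Cplx R).
Implicit Types (f g r : K -> Cplx R) (x h : K) (l m : Cplx R).

Definition small r : Prop :=
  forall e : R, 0 < e -> exists2 d : R, 0 < d &
    forall h, cmod (iota h) < d -> cmod (r h) <= e * cmod (iota h).
Definition vanish r : Prop :=
  forall e : R, 0 < e -> exists2 d : R, 0 < d &
    forall h, cmod (iota h) < d -> cmod (r h) <= e.
Definition der f x l : Prop := small (fun h => f (x + h) - f x - l * iota h).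

Lemma eq_small r s : (forall h, r h = s h) -> small r -> small s.
Proof. by move=> rs; have -> : s = r by apply/funext. Qed.
Lemma smallD r s : small r -> small s -> small (fun h => r h + s h).
Proof.
move=> sr ss e e0; have e2 : 0 < e / 2 by lra.
have [d1 d10 h1] := sr _ e2; have [d2 d20 h2] := ss _ e2.
exists (Num.min d1 d2); first by rewrite lt_min d10.
move=> h; rewrite lt_min => /andP[hd1 hd2].
apply: le_trans (cmodD _ _) _; have := h1 h hd1; have := h2 h hd2.
by have := cmod_ge0 (iota h); nra.
Qed.
Lemma smallM r b (M : R) : small r ->
  (exists2 d : R, 0 < d & forall h, cmod (iota h) < d -> cmod (b h) <= M) ->
  small (fun h => r h * b h).
Proof.
move=> sr [d1 d10 h1] e e0; pose M' := `|M| + 1.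
have M0 : 0 < M' by rewrite /M' ltr_wpDl.
have [d2 d20 h2] := sr (e / M') (divr_gt0 e0 M0).
exists (Num.min d1 d2); first by rewrite lt_min d10.
move=> h; rewrite lt_min => /andP[hd1 hd2]; rewrite cmodM.
have b1 : cmod (b h) <= M'.
  by apply: le_trans (h1 h hd1) _; rewrite /M'; have := ler_norm M; lra.
apply: (@le_trans _ _ ((e / M' * cmod (iota h)) * M')).
  by apply: ler_pM => //; try exact: cmod_ge0; exact: h2.
by rewrite mulrAC divfK // gt_eqF.
Qed.
Lemma small_lin b : vanish b -> small (fun h => iota h * b h).
Proof.
move=> vb e e0; have [d d0 hd] := vb e e0; exists d => // h hh.
by rewrite cmodM mulrC ler_wpM2r ?cmod_ge0 // hd.
Qed.
Lemma vanish_small r : small r -> vanish r.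
Proof.
move=> sr e e0; have [d d0 hd] := sr e e0; exists (Num.min d 1); first by rewrite lt_min d0 ltr01.
move=> h; rewrite lt_min => /andP[h1 h2]; apply: le_trans (hd h h1) _.
by rewrite ler_piMr // ltW.
Qed.
Lemma vanishD r s : vanish r -> vanish s -> vanish (fun h => r h + s h).
Proof.
move=> sr ss e e0; have e2 : 0 < e / 2 by lra.
have [d1 d10 h1] := sr _ e2; have [d2 d20 h2] := ss _ e2.
exists (Num.min d1 d2); first by rewrite lt_min d10.
move=> h; rewrite lt_min => /andP[hd1 hd2].
by apply: le_trans (cmodD _ _) _; have := h1 h hd1; have := h2 h hd2; lra.
Qed.
Lemma vanish_iota l : vanish (fun h => l * iota h).
Proof.
move=> e e0; exists (e / (cmod l + 1)).
  by rewrite divr_gt0 // ltr_wpDl ?cmod_ge0.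
move=> h; rewrite ltr_pdivlMr ?ltr_wpDl ?cmod_ge0 // => hh.
rewrite cmodM; have := cmod_ge0 (iota h); have := cmod_ge0 l; nra.
Qed.
Lemma der_vanish f x l : der f x l -> vanish (fun h => f (x + h) - f x).
Proof.
move=> df.
have -> : (fun h => f (x + h) - f x) =
    (fun h => (f (x + h) - f x - l * iota h) + l * iota h).
  by apply/funext => h; rewrite subrK.
by apply: vanishD; [exact: vanish_small|exact: vanish_iota].
Qed.
Lemma vanish_bound g x : vanish (fun h => g (x + h) - g x) ->
  exists2 d : R, 0 < d & forall h, cmod (iota h) < d ->
    cmod (g (x + h)) <= cmod (g x) + 1.
Proof.
move=> /(_ 1 ltr01)[d d0 hd]; exists d => // h hh.
by have := hd h hh; have := cmod_dist (g (x + h)) (g x); lra.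
Qed.

Lemma small0 : small (fun=> 0).
Proof. by move=> e e0; exists 1 => // h _; rewrite cmod0 mulr_ge0 ?cmod_ge0 ?ltW. Qed.
Lemma der_cst c x : der (fun=> c) x 0.
Proof. by apply: eq_small small0 => h; rewrite mul0r; ring. Qed.
Lemma eq_der f g x l m : (forall y, f y = g y) -> l = m -> der f x l -> der g x m.
Proof. by move=> fg <-; have -> : g = f by apply/funext. Qed.
Lemma derD f g x l m : der f x l -> der g x m -> der (fun y => f y + g y) x (l + m).
Proof. by move=> df dg; apply: eq_small (smallD df dg) => h; ring. Qed.
Lemma derM f g x l m : der f x l -> der g x m ->
  der (fun y => f y * g y) x (l * g x + f x * m).
Proof.
move=> df dg.
have s1 := smallM df (vanish_bound (der_vanish dg)).
have s2 := smallM (small_lin (der_vanish dg)) (ex_intro2 _ _ 1 ltr01 (fun h _ => lexx (cmod l))).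
have s3 := smallM dg (ex_intro2 _ _ 1 ltr01 (fun h _ => lexx (cmod (f x)))).
apply: eq_small (smallD (smallD s1 s2) s3) => h /=; ring.
Qed.
Lemma derZ c f x l : der f x l -> der (fun y => c * f y) x (c * l).
Proof. by move=> df; apply: eq_der (derM (der_cst c x) df) => //; ring. Qed.
Lemma derN f x l : der f x l -> der (fun y => - f y) x (- l).
Proof. by move=> df; apply: eq_der (derZ (-1) df) => [y|]; ring. Qed.
Lemma derB f g x l m : der f x l -> der g x m -> der (fun y => f y - g y) x (l - m).
Proof. by move=> df dg; apply: derD => //; exact: derN. Qed.

End Derivation.

Notation cder f z l := (der (fun h => h) f z l).
Notation rcder f x l := (der rc f x l).

Section DerivationRules.
Context {R : realType}.
Implicit Types (f g : Cplx R -> Cplx R) (u : R -> Cplx R) (z l m : Cplx R) (x : R).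

Lemma cder_id z : cder (fun w => w) z 1.
Proof. by apply: eq_small (small0 _) => h; ring. Qed.
Lemma rcder_rc x : rcder rc x 1.
Proof. by apply: eq_small (small0 _) => h; rewrite rcD; ring. Qed.
Lemma der_comp (K : zmodType) (iota : K -> Cplx R) f (u : K -> Cplx R) (x : K) l m :
  cder f (u x) l -> der iota u x m -> der iota (fun y => f (u y)) x (l * m).
Proof.
move=> df du.
have bu : exists2 d : R, 0 < d & forall h, cmod (iota h) < d ->
    cmod (u (x + h) - u x) <= (cmod m + 1) * cmod (iota h).
  have [d d0 hd] := du 1 ltr01; exists d => // h hh.
  have -> : u (x + h) - u x = (u (x + h) - u x - m * iota h) + m * iota h by rewrite subrK.
  by apply: le_trans (cmodD _ _) _; rewrite cmodM; have := hd h hh; lra.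
have s1 : small iota (fun h => f (u (x + h)) - f (u x) - l * (u (x + h) - u x)).
  move=> e e0; have [d1 d10 h1] := bu; pose M := cmod m + 1.
  have M0 : 0 < M by rewrite /M ltr_wpDl ?cmod_ge0.
  have [d2 d20 h2] := df (e / M) (divr_gt0 e0 M0).
  exists (Num.min d1 (d2 / M)); first by rewrite lt_min d10 divr_gt0.
  move=> h; rewrite lt_min ltr_pdivlMr // => /andP[hd1 hd2].
  have := h1 h hd1; rewrite -/M => k1.
  have /h2 : cmod (u (x + h) - u x) < d2 by apply: le_lt_trans k1 _; rewrite mulrC.
  rewrite (_ : u x + (u (x + h) - u x) = u (x + h)); last by ring.
  move=> k2; apply: le_trans k2 _; rewrite -mulrA ler_pM2l //.
  by rewrite mulrC ler_pdivrMr // mulrC.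
have s2 := smallM du (ex_intro2 _ _ 1 ltr01 (fun h _ => lexx (cmod l))).
by apply: eq_small (smallD s1 s2) => h /=; ring.
Qed.
Lemma rcder_affine (a k : R) u x l : rcder u (a + k * x) l ->
  rcder (fun y => u (a + k * y)) x (rc k * l).
Proof.
move=> du e e0; pose M := `|k| + 1; have M0 : 0 < M by rewrite /M ltr_wpDl.
have [d d0 hd] := du (e / M) (divr_gt0 e0 M0).
exists (d / M); first by rewrite divr_gt0.
move=> h; rewrite cmod_rc ltr_pdivlMr // => hh.
have kM : `|k * h| <= M * `|h| by rewrite normrM ler_wpM2r // /M; lra.
have := hd (k * h); rewrite cmod_rc => hd'.
rewrite (_ : a + k * (x + h) = a + k * x + k * h); last by ring.
rewrite (_ : rc k * l * rc h = l * rc (k * h)); last by rewrite rcM; ring.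
apply: le_trans (hd' _) _; first by apply: le_lt_trans kM _; rewrite mulrC.
by rewrite -mulrA ler_pM2l // [M^-1 * _]mulrC ler_pdivrMr // [_ * M]mulrC.
Qed.
Lemma der_uniq (K : zmodType) (iota : K -> Cplx R) (u : K -> Cplx R) (x : K) l m :
  (forall d : R, 0 < d -> exists h, 0 < cmod (iota h) < d) ->
  der iota u x l -> der iota u x m -> l = m.
Proof.
move=> ne dl dm; apply/eqP; rewrite -subr_eq0; apply/eqP/cmod_eq0/eqP.
rewrite eq_le cmod_ge0 andbT; apply/ler_addgt0Pr => e e0; rewrite add0r.
have e2 : 0 < e / 2 by lra.
have [d1 d10 h1] := dl _ e2; have [d2 d20 h2] := dm _ e2.
have [|h /andP[hp]] := ne (Num.min d1 d2); first by rewrite lt_min d10.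
rewrite lt_min => /andP[/h1 k1 /h2 k2].
rewrite -(ler_pM2r hp) -cmodM.
rewrite (_ : (l - m) * iota h = (u (x + h) - u x - m * iota h) - (u (x + h) - u x - l * iota h)); last by ring.
apply: le_trans (cmodB _ _) _; lra.
Qed.
Lemma cder_uniq f z l m : cder f z l -> cder f z m -> l = m.
Proof.
apply: der_uniq => d d0; exists (rc (d / 2)).
by rewrite cmod_rc gtr0_norm; lra.
Qed.

(** With its converse [dereps], the bridge between moduli and the derivative as
   a limit along a filter. *)
Lemma epsder (K : numFieldType) (f : K -> K) (x l : K) :
  (forall e, 0 < e -> exists2 d, 0 < d &
     forall h, `|h| < d -> `|f (x + h) - f x - l * h| <= e * `|h|) ->
  (h^-1 *: (f (h + x) - f x) @[h --> 0^']) --> l.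
Proof.
move=> H; apply/cvgrPdist_le => e e0.
have [d d0 hd] := H e e0.
near=> h.
have h0 : h != 0 by near: h; exact: nbhs_dnbhs_neq.
have hlt : `|h| < d by near: h; apply: dnbhs0_lt.
have -> : l - h^-1 *: (f (h + x) - f x) = - (h^-1 * (f (x + h) - f x - l * h)).
  rewrite (addrC h x) (_ : _ *: _ = h^-1 * (f (x + h) - f x)) //.
  by rewrite [in RHS]mulrBr mulrCA mulVf // mulr1; ring.
rewrite normrN normrM normfV mulrC ler_pdivrMr ?normr_gt0 //; exact: hd.
Unshelve. all: by end_near. Qed.

Lemma dereps (K : numFieldType) (f : K -> K) (x l : K) :
  (h^-1 *: (f (h + x) - f x) @[h --> 0^']) --> l ->
  (forall e, 0 < e -> exists2 d, 0 < d &
     forall h, `|h| < d -> `|f (x + h) - f x - l * h| <= e * `|h|).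
Proof.
move=> /cvgrPdist_le H e e0.
have [d /= d0 hd] := H e e0; exists d => // h hh.
have [->|h0] := eqVneq h 0; first by rewrite addr0 subrr mulr0 subr0 !normr0 mulr0.
have := hd h; rewrite /= sub0r normrN => /(_ hh h0) hle.
have -> : f (x + h) - f x - l * h = - ((l - h^-1 *: (f (h + x) - f x)) * h).
  rewrite (addrC h x) (_ : _ *: _ = h^-1 * (f (x + h) - f x)) //.
  by rewrite mulrBl mulrAC mulVf // mul1r; ring.
by rewrite normrN normrM ler_wpM2r.
Qed.

Lemma derivable1 (K : numFieldType) (f : K -> K) (x : K) :
  derivable f x 1 <-> cvg (h^-1 *: (f (h + x) - f x) @[h --> 0^']).
Proof.
rewrite /derivable (_ : (fun h => h^-1 *: ((f \o shift x) (h *: 1) - f x)) =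
  (fun h => h^-1 *: (f (h + x) - f x))) //.
by apply/funext => h; rewrite /= /shift /= (_ : h *: 1 = h) //; exact: mulr1.
Qed.

Lemma cder_derive f z l : cder f z l -> derivable f z 1 /\ derive1 f z = l.
Proof.
move=> df; suff H : (h^-1 *: (f (h + z) - f z) @[h --> 0^']) --> l.
  by split; [apply/derivable1; apply/cvg_ex; exists l|exact: (cvg_lim _ H)].
apply: epsder => e; rewrite ltcE /= => /andP[/eqP e1 e2].
have -> : e = rc (Re e) by apply: cplx_eq => //=.
have [d d0 hd] := df _ e2; exists (rc d); first by rewrite -rc0 rc_lt.
by move=> h; have := hd h; rewrite -rc_lt -rc_le rcM -!normcE.
Qed.
Lemma derive_cder f z : derivable f z 1 -> cder f z (derive1 f z).
Proof.
move=> /derivable1 df e e0.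
have /= [|d] := dereps df (e := rc e); first by rewrite -rc0 rc_lt.
rewrite ltcE /= => /andP[/eqP d1 d2] hd; exists (Re d) => // h hh.
have /hd : `|h| < d.
  rewrite (_ : d = rc (Re d)); last by apply: (@cplx_eq R).
  by move: hh; rewrite -rc_lt -normcE.
by move=> H; rewrite -rc_le rcM -!normcE; exact: H.
Qed.

Lemma is_deriveP (f : R -> R) x (l : R) :
  is_derive x 1 f l <->
  (forall e, 0 < e -> exists2 d, 0 < d &
     forall h, `|h| < d -> `|f (x + h) - f x - l * h| <= e * `|h|).
Proof.
split=> [[df dl]|H].
  apply: dereps; rewrite -dl -derive1E; exact/derivable1.
have {}H := epsder H; split; first by apply/derivable1; apply/cvg_ex; exists l.
by rewrite -derive1E; exact: (cvg_lim _ H).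
Qed.

Lemma rcder_is_rderive u x l : rcder u x l <-> is_rderive x u l.
Proof.
split=> [du|[/is_deriveP d1 /is_deriveP d2]].
  split; apply/is_deriveP => e e0; have [d d0 hd] := du e e0; exists d => // h hh.
    have := hd h; rewrite cmod_rc => /(_ hh); apply: le_trans.
    apply: le_trans (Re_le_cmod _); rewrite !(ReB, ReM) /=.
    by rewrite mulr0 subr0.
  have := hd h; rewrite cmod_rc => /(_ hh); apply: le_trans.
  apply: le_trans (Im_le_cmod _); rewrite !(ImB, ImM) /=.
  by rewrite mulr0 add0r.
move=> e e0; have e2 : 0 < e / 2 by lra.
have [k1 k10 h1] := d1 _ e2; have [k2 k20 h2] := d2 _ e2.
exists (Num.min k1 k2); first by rewrite lt_min k10.
move=> h; rewrite cmod_rc lt_min => /andP[/h1 j1 /h2 j2].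
apply: le_trans (cmod_le_ReIm _) _.
rewrite !(ReB, ReM, ImB, ImM) /= !mulr0 subr0 add0r; lra.
Qed.

Definition ccont (u : R -> Cplx R) (x : R) : Prop := vanish rc (fun h => u (x + h) - u x).
Lemma rcder_ccont u x l : rcder u x l -> ccont u x.
Proof. exact: der_vanish. Qed.
Lemma ccont_Re u x : ccont u x -> {for x, continuous (fun y => Re (u y))}.
Proof.
move=> cu; apply/cvgrPdist_le => e e0; have [d d0 hd] := cu e e0.
exists d => // y /= yd.
have := hd (y - x); rewrite cmod_rc distrC => /(_ yd).
rewrite subrKC -cmodN opprB => /(le_trans _); apply.
by rewrite -ReB; exact: Re_le_cmod.
Qed.
Lemma ccont_Im u x : ccont u x -> {for x, continuous (fun y => Im (u y))}.
Proof.
move=> cu; apply/cvgrPdist_le => e e0; have [d d0 hd] := cu e e0.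
exists d => // y /= yd.
have := hd (y - x); rewrite cmod_rc distrC => /(_ yd).
rewrite subrKC -cmodN opprB => /(le_trans _); apply.
by rewrite -ImB; exact: Im_le_cmod.
Qed.
Lemma ccont_cmeas u : (forall x, ccont u x) -> cmeas u.
Proof.
move=> cu; split; apply: continuous_measurable_fun => x.
  exact: ccont_Re.
exact: ccont_Im.
Qed.

(** Projecting on the direction of the increment reduces the inequality to the
   mean value theorem for a real function. *)
Lemma mean_value_ineq u v (M : R) : (forall t : R, 0 <= t <= 1 -> rcder u t (v t)) ->
  (forall t : R, 0 <= t <= 1 -> cmod (v t) <= M) -> cmod (u 1 - u 0) <= M.
Proof.
move=> du vM; set c := u 1 - u 0.
have [c0|c0] := eqVneq (cmod c) 0.
  by rewrite c0; apply: le_trans (vM 0 _); rewrite ?cmod_ge0 ?lexx ?ler01.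
have cp : 0 < cmod c by rewrite lt_def c0 cmod_ge0.
pose g t := Re (Num.conj c * u t).
have dg (t : R) : 0 <= t <= 1 -> is_derive t 1 g (Re (Num.conj c * v t)).
  by move=> /du /(derZ (Num.conj c)) /rcder_is_rderive[].
have wg : {within `[0, 1], continuous g}.
  apply: derivable_within_continuous => t; rewrite in_itv /= => tt.
  by have [] := dg t tt.
have [|//|t /andP[/= t0 t1] /esym] := @MVT R g (fun t => Re (Num.conj c * v t)) 0 1 ltr01.
  by move=> t; rewrite in_itv /= => /andP[t0 t1]; apply: dg; rewrite !ltW.
move: t0 t1; rewrite !bnd_simp => t0 t1; rewrite subr0 mulr1 -ReB -mulrBr mul_conj /= => E.
rewrite -(ler_pM2l cp) -expr2 -E.
apply: le_trans (ler_norm _) _; apply: le_trans (Re_le_cmod _) _.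
by rewrite cmodM cmod_conj ler_pM2l //; apply: vM; rewrite !ltW.
Qed.

Lemma IR_FTC (F f : R -> R) a b : a <= b -> (forall x, is_derive x 1 F (f x)) ->
  (forall x, {for x, continuous f}) ->
  IR (fun y => ⟦a <= y <= b⟧ * f y) = F b - F a.
Proof.
move=> ab dF cf.
have -> : IR (fun y => ⟦a <= y <= b⟧ * f y) = Rintegral lebesgue_measure `[a, b] f.
  rewrite /IR [RHS]Rintegral_mkcond; congr Rintegral; apply/funext => y.
  rewrite patchE mem_setE in_itv /=.
  by case: ifP => _; rewrite ?mul1r ?mul0r.
have [->|neq] := eqVneq a b.
  by rewrite set_itv1 Rintegral_set1 subrr.
have lab : a < b by rewrite lt_def eq_sym neq.
rewrite /Rintegral (@continuous_FTC2 _ _ F) //.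
- by apply: continuous_subspaceT => x; exact: cf.
- have cF x : {for x, continuous F}.
    by apply: differentiable_continuous; apply/derivable1_diffP; have [] := dF x.
  split => //.
  + by apply: cvg_at_right_filter; exact: cF.
  + by apply: cvg_at_left_filter; exact: cF.
- by move=> y _; rewrite derive1E; have [] := dF y.
Qed.
Lemma CI_FTC (F f : R -> Cplx R) a b : a <= b -> (forall x, rcder F x (f x)) ->
  (forall x, ccont f x) ->
  CI (fun y => ⟦a <= y <= b⟧ * f y) = F b - F a.
Proof.
move=> ab dF cf; apply: cplx_eq; rewrite ?CI_Re ?CI_Im.
  under eq_fun do rewrite -rc_nat ReM /= mul0r subr0.
  rewrite ReB; apply: (@IR_FTC (fun x => Re (F x))) => // x.
    by have /rcder_is_rderive[] := dF x.
  exact: ccont_Re.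
under eq_fun do rewrite -rc_nat ImM /= mul0r addr0.
rewrite ImB; apply: (@IR_FTC (fun x => Im (F x))) => // x.
  by have /rcder_is_rderive[] := dF x.
exact: ccont_Im.
Qed.

End DerivationRules.

(** * Affine substitutions and exponential weights *)
Section AffineChange.
Context {R : realType}.
Local Notation mu := (@lebesgue_measure R).

Lemma measurable_affine (a k : R) : measurable_fun setT (fun y : R => a + k * y).
Proof. by apply: measurable_funD => //; apply: measurable_funM. Qed.

(** By uniqueness of the measure it is enough to look at intervals. *)
Lemma lebesgue_measure_affine (a k : R) (k0 : k != 0) (A : set R) :
  measurable A -> mu A = (`|k|%:E * mu ((fun y : R => a + k * y)%R @^-1` A))%E.
Proof.
move=> mA; pose phi : measurableTypeR R -> measurableTypeR R := fun y => a + k * y.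
have mphi : measurable_fun setT phi by exact: measurable_affine.
pose kk : {nonneg R} := NngNum (normr_ge0 k).
pose nu : {measure set (measurableTypeR R) -> \bar R} := mscale kk (pushforward mu phi).
change (mu A = nu mphi A).
apply: lebesgue_measure_unique => // _ [[x y] /= _ <-].
rewrite /nu /= /mscale /= lebesgue_measure_itv /= lte_fin.
rewrite -[pushforward _ _ _]/(mu (phi @^-1` `]x, y]%classic)).
have [kp|kn|ke] := ltgtP k 0; last by rewrite ke eqxx in k0.
  have -> : phi @^-1` `]x, y] = `[(y - a) / k, (x - a) / k[%classic.
    apply/seteqP; split => t /=; rewrite !in_itv /= /phi.
      by move=> /andP[h1 h2]; rewrite ler_ndivrMr // ltr_ndivlMr // ; apply/andP; split; lra.
    by rewrite ler_ndivrMr // ltr_ndivlMr // => /andP[h1 h2]; apply/andP; split; lra.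
  rewrite lebesgue_measure_itv /= lte_fin ltr_nM2r ?invr_lt0 //.
  rewrite ltrD2r; case: ifP => _; last by rewrite mule0.
  rewrite -EFinB -EFinM; congr EFin; rewrite ltr0_norm //.
  by rewrite -!mulrBl mulNr mulrCA mulfV // ; ring.
have -> : phi @^-1` `]x, y] = `](x - a) / k, (y - a) / k]%classic.
  apply/seteqP; split => t /=; rewrite !in_itv /= /phi.
    by move=> /andP[h1 h2]; rewrite ltr_pdivrMr // ler_pdivlMr // ; apply/andP; split; lra.
  by rewrite ltr_pdivrMr // ler_pdivlMr // => /andP[h1 h2]; apply/andP; split; lra.
rewrite lebesgue_measure_itv /= lte_fin ltr_pM2r ?invr_gt0 //.
rewrite ltrD2r; case: ifP => _; last by rewrite mule0.
rewrite -EFinB -EFinM; congr EFin; rewrite gtr0_norm //.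
by rewrite -!mulrBl mulrCA mulfV // ; ring.
Qed.

Lemma ge0_integral_affine (a k : R) (f : R -> \bar R) : k != 0 ->
  measurable_fun setT f -> (forall x, (0 <= f x)%E) ->
  (\int[mu]_x f x = `|k|%:E * \int[mu]_x f (a + k * x)%R)%E.
Proof.
move=> k0 mf f0; pose phi : measurableTypeR R -> measurableTypeR R := fun y => a + k * y.
have mphi : measurable_fun setT phi by exact: measurable_affine.
pose kk : {nonneg R} := NngNum (normr_ge0 k).
rewrite (@eq_measure_integral _ _ _ _ (mscale kk (pushforward mu phi))); last first.
  by move=> A mA _; exact: (lebesgue_measure_affine a k0).
rewrite ge0_integral_mscale //.
by rewrite ge0_integral_pushforward.
Qed.

Lemma rint_affine (a k : R) (f : R -> R) : k != 0 -> rint f ->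
  rint (fun x => f (a + k * x)).
Proof.
move=> k0 jf; have mf := rint_meas jf.
apply/integrableP; split.
  by apply/measurable_EFinP; apply: (measurableT_comp mf); exact: measurable_affine.
have /integrableP[_] := jf; apply: contraTT; rewrite -!leNgt !leye_eq => /eqP fy.
rewrite (ge0_integral_affine a k0) //=.
  by rewrite fy gt0_muley // lte_fin normr_gt0.
by apply/measurable_EFinP; apply: measurableT_comp.
Qed.

Lemma IR_affine (a k : R) (f : R -> R) : k != 0 -> rint f ->
  IR f = `|k| * IR (fun x => f (a + k * x)).
Proof.
move=> k0 jf; have mf := rint_meas jf.
have jg := rint_affine a k0 jf.
have mf' : measurable_fun setT (EFin \o f) by exact/measurable_EFinP.
apply: EFin_inj; rewrite EFinM /IR /Rintegral !fineK; last 2 first.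
- exact: integrable_fin_num.
- exact: integrable_fin_num.
rewrite [in LHS]integralE [in RHS]integralE muleBr //; last first.
  by apply: fin_num_adde_defr; apply: integrable_pos_fin_num.
congr (_ - _)%E.
  rewrite (ge0_integral_affine a k0); [|exact: measurable_funepos|by move=> x; exact: funepos_ge0].
  by congr (_ * _)%E; apply: eq_integral => x _; rewrite unlock.
rewrite (ge0_integral_affine a k0); [|exact: measurable_funeneg|by move=> x; exact: funeneg_ge0].
by congr (_ * _)%E; apply: eq_integral => x _; rewrite unlock.
Qed.

Lemma cmeas_affine (a k : R) (f : R -> Cplx R) : cmeas f -> cmeas (fun x => f (a + k * x)).
Proof. by move=> mf; apply: cmeas_comp => //; exact: measurable_affine. Qed.
Lemma cintb_affine (a k : R) (f : R -> Cplx R) : k != 0 -> cintb f ->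
  cintb (fun x => f (a + k * x)).
Proof.
move=> k0 [mf jf]; split; first exact: cmeas_affine.
exact: (rint_affine a k0 jf).
Qed.
Lemma CI_affine (a k : R) (f : R -> Cplx R) : k != 0 -> cintb f ->
  CI f = rc `|k| * CI (fun x => f (a + k * x)).
Proof.
move=> k0 jf; apply: cplx_eq; rewrite ?ReM ?ImM ?CI_Re ?CI_Im Re_rc Im_rc mul0r ?subr0 ?addr0.
  by apply: IR_affine => //; exact: rint_Re.
by apply: IR_affine => //; exact: rint_Im.
Qed.
Lemma CI_reflect (a : R) (f : R -> Cplx R) : cintb f ->
  CI f = CI (fun x => f (a - x)).
Proof.
move=> jf; rewrite (@CI_affine a (-1)) ?oppr_eq0 ?oner_eq0 // normrN normr1 rc1 mul1r.
by apply: eq_CI => x; rewrite mulN1r.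
Qed.
End AffineChange.

Section Smoothing.
Context {R : realType}.

(** The price of moving a weight from [y] to [x]: of [exp (gam x)] for [y <= x],
   of [exp (- gam x)] for [y >= x]. *)
Definition expw (gam x y : R) : R := expR (- gam * `|x - y|).
Lemma expw_gt0 (gam x y : R) : 0 < expw gam x y. Proof. exact: expR_gt0. Qed.
Lemma expw_le1 (gam x y : R) : 0 <= gam -> expw gam x y <= 1.
Proof. by move=> g0; rewrite -expR0 ler_expR; have := normr_ge0 (x - y); nra. Qed.
Lemma measurable_expw (gam x : R) : measurable_fun setT (expw gam x).
Proof.
apply: measurableT_comp => //; apply: measurable_funM => //.
by apply: measurableT_comp => //; exact: measurable_funB.
Qed.
Lemma expw_forward (gam x y : R) : y <= x -> expR (gam * y) = expR (gam * x) * expw gam x y.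
Proof.
move=> yx; rewrite /expw -expRD ger0_norm ?subr_ge0 //; congr expR; ring.
Qed.
Lemma expw_backward (gam x y : R) : x <= y ->
  expR (- gam * y) = expR (- gam * x) * expw gam x y.
Proof.
move=> xy; rewrite /expw -expRD ler0_norm ?subr_le0 //; congr expR; ring.
Qed.
Lemma rint_expw (g : R -> R) (gam x : R) : 0 <= gam -> (forall y, 0 <= g y) -> rint g ->
  rint (fun y => g y * expw gam x y).
Proof.
move=> gam0 g0 jg; apply: (rint_le _ _ jg).
  by apply: measurable_funM; [exact: rint_meas|exact: measurable_expw].
by move=> y; rewrite normrM (ger0_norm (g0 y)) (gtr0_norm (expw_gt0 _ _ _)) ler_piMr // expw_le1.
Qed.

(** Against a square integrable density, a steep exponential weight makes
   Volterra operators contracting: near the diagonal by the Cauchy-Schwarz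
   inequality on a short interval, away from it because the weight is small. *)
Lemma exp_smoothing (g : R -> R) : (forall y, 0 <= g y) -> rint g ->
  rint (fun y => g y ^+ 2) -> forall kap : R, 0 < kap ->
  exists2 gam : R, 0 < gam & forall x, IR (fun y => g y * expw gam x y) <= kap.
Proof.
move=> g0 jg jg2 kap kap0.
set I1 := IR g; set I2 := IR (fun y => g y ^+ 2).
have I10 : 0 <= I1 by exact: IR_ge0.
have I20 : 0 <= I2 by apply: IR_ge0 => y; exact: sqr_ge0.
pose del := 2 * kap / (3 * (1 + I2)).
have del0 : 0 < del by rewrite /del divr_gt0 ?mulr_gt0 //; lra.
pose eta := del * kap / 3.
have eta0 : 0 < eta by rewrite /eta; apply: divr_gt0; [exact: mulr_gt0|lra].
pose s := 3 * I1 / kap + 1.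
have s0 : 0 < s by rewrite /s ltr_wpDl // divr_ge0 ?mulr_ge0 // ltW.
exists (s / eta); first by rewrite divr_gt0.
move=> x; set gam := s / eta; have gam0 : 0 < gam by rewrite divr_gt0.
have jg' := rint_expw x (ltW gam0) g0 jg.
pose b y := del / 2 * g y ^+ 2 + ((2 * del)^-1 * ⟦x - eta <= y <= x + eta⟧ + expR (- s) * g y).
have jb : rint b.
  apply: rintD; first exact: rintZ.
  by apply: rintD; [exact: rint_itv|exact: rintZ].
apply: (@le_trans _ _ (IR b)).
  apply: IR_le => // y; rewrite /b.
  have e1 := expw_le1 x y (ltW gam0); have e0 := expw_gt0 gam x y.
  have gy := g0 y; have es := expR_gt0 (- s).
  have [|out] := boolP (x - eta <= y <= x + eta).
    move=> _; rewrite mulr1.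
    have h : g y <= del / 2 * g y ^+ 2 + (2 * del)^-1.
      have : 0 <= (2 * del)^-1 * (del * g y - 1) ^+ 2.
        by rewrite mulr_ge0 ?sqr_ge0 // invr_ge0; lra.
      suff -> : (2 * del)^-1 * (del * g y - 1) ^+ 2 = del / 2 * g y ^+ 2 + (2 * del)^-1 - g y by rewrite subr_ge0.
      by field; rewrite gt_eqF.
    have : g y * expw gam x y <= g y by rewrite ler_piMr.
    have : 0 <= expR (- s) * g y by rewrite mulr_ge0 // ltW.
    lra.
  rewrite mulr0 add0r.
  have : expw gam x y <= expR (- s).
    rewrite ler_expR mulNr lerN2.
    have -> : s = gam * eta by rewrite /gam divfK // gt_eqF.
    rewrite ler_pM2l //; move: out; rewrite negb_and -!ltNge.
    by case/orP => h; [rewrite ger0_norm|rewrite ler0_norm]; lra.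
  have := sqr_ge0 (g y); nra.
rewrite IRD; [|exact: rintZ|by apply: rintD; [exact: rint_itv|exact: rintZ]].
rewrite IRD; [|exact: rint_itv|exact: rintZ].
rewrite !IRZ //; last first.
  by have := rint_itv (x - eta) (x + eta) 1; under [X in rint X -> _]eq_fun do rewrite mul1r.
rewrite IR_itv; last by lra.
rewrite -/I1 -/I2.
have h1 : del / 2 * I2 <= kap / 3.
  rewrite /del (_ : 2 * kap / (3 * (1 + I2)) / 2 * I2 = kap / 3 * (I2 / (1 + I2))); last first.
    by field; lra.
  by rewrite ler_piMr //; [lra|rewrite ler_pdivrMr; lra].
have h2 : (2 * del)^-1 * (x + eta - (x - eta)) = kap / 3.
  by rewrite /eta; field; rewrite gt_eqF.
have h3 : expR (- s) * I1 <= kap / 3.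
  rewrite expRN mulrC ler_pdivrMr ?expR_gt0 //.
  have : 1 + s <= expR s by exact: expR_ge1Dx.
  have -> : I1 = kap / 3 * (s - 1) by rewrite /s addrK; field; rewrite gt_eqF.
  move=> es; rewrite ler_pM2l; lra.
rewrite h2; lra.
Qed.

End Smoothing.

(** * Successive approximations *)

Section Picard.
Context {R : realType} (Om : Type).
Implicit Types (u v : Om -> Cplx R).

Lemma geometric_cauchy (u : nat -> Cplx R) (W : R) :
  (forall n, cmod (u n.+1 - u n) <= W / 2 ^+ n) ->
  forall m n, (n <= m)%N -> cmod (u m - u n) <= 2 * W / 2 ^+ n - 2 * W / 2 ^+ m.
Proof.
move=> h m n /subnK <-; elim: (m - n)%N => [|k ih].
  by rewrite add0n !subrr cmod0.
rewrite addSn; apply: le_trans (cmod_tri _ (u (k + n)%N) _) _.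
have := h (k + n)%N; rewrite exprS invfM.
set a := (2 ^+ (k + n))^-1 in ih *; move: ih; lra.
Qed.

Lemma geometric_lt (W e : R) : 0 < e -> exists N, forall n, (N <= n)%N -> W / 2 ^+ n < e.
Proof.
move=> e0; pose N := Num.bound (W / e); exists N => n Nn.
have h2n k : k%:R <= 2 ^+ k :> R.
  by rewrite -natrX ler_nat ltnW // ltn_expl.
have WN : W / e < 2 ^+ n.
  have [wn|wp] := ltP (W / e) 0; first by apply: lt_le_trans wn _; rewrite exprn_ge0.
  apply: lt_le_trans (archi_boundP wp) _.
  by apply: le_trans (h2n n); rewrite ler_nat.
by rewrite ltr_pdivrMr ?exprn_gt0 // mulrC -ltr_pdivrMr.
Qed.

Lemma cauchy_limit (u : nat -> Cplx R) (W : R) :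
  (forall n, cmod (u n.+1 - u n) <= W / 2 ^+ n) ->
  exists2 l, cconv u l & forall n, cmod (l - u n) <= 2 * W / 2 ^+ n.
Proof.
move=> hu; have hc := geometric_cauchy hu.
have W0 : 0 <= W.
  by have := hu 0%N; rewrite expr0 divr1; apply: le_trans; exact: cmod_ge0.
have pw n : 0 <= 2 * W / 2 ^+ n :> R by rewrite divr_ge0 ?mulr_ge0 // exprn_ge0.
have real_lim (v : nat -> R) : (forall m n, (n <= m)%N -> `|v m - v n| <= 2 * W / 2 ^+ n) ->
    exists l, forall e, 0 < e -> exists N, forall n, (N <= n)%N -> `|v n - l| < e.
  move=> hv; suff /cvg_ex[l /cvgrPdist_lt vl] : cvg (v @ \oo).
    exists l => e /vl[N _ hN]; exists N => n /hN /=; by rewrite distrC.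
  apply/cauchy_cvgP/cauchy_exP => e e0.
  have [N hN] := geometric_lt (2 * W) e0.
  exists (v N); exists N => // n /= Nn; rewrite /ball /= distrC.
  exact: le_lt_trans (hv _ _ Nn) (hN N (leqnn N)).
have [a ha] : exists l, forall e, 0 < e -> exists N, forall n, (N <= n)%N -> `|Re (u n) - l| < e.
  apply: real_lim => m n nm; rewrite -ReB; apply: le_trans (Re_le_cmod _) _.
  by have := hc _ _ nm; have := pw m; lra.
have [b hb] : exists l, forall e, 0 < e -> exists N, forall n, (N <= n)%N -> `|Im (u n) - l| < e.
  apply: real_lim => m n nm; rewrite -ImB; apply: le_trans (Im_le_cmod _) _.
  by have := hc _ _ nm; have := pw m; lra.
have cv : cconv u (Complex a b).
  move=> e e0; have e2 : 0 < e / 2 by lra.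
  have [N1 h1] := ha _ e2; have [N2 h2] := hb _ e2.
  exists (maxn N1 N2) => n; rewrite geq_max => /andP[n1 n2].
  apply: le_lt_trans (cmod_le_ReIm _) _; rewrite ReB ImB /=.
  by have := h1 n n1; have := h2 n n2; lra.
exists (Complex a b) => // n; apply/ler_addgt0Pr => e e0.
have [N hN] := cv e e0.
have h1 := hN (maxn N n) (leq_maxl _ _); have h2 := hc _ _ (leq_maxr N n).
have := cmod_tri (Complex a b : Cplx R) (u (maxn N n)) (u n).
rewrite (cmodBC (Complex a b : Cplx R) (u (maxn N n))); have := pw (maxn N n); lra.
Qed.

(** The class [P] records measurability; it only has to be stable under
   pointwise limits because the operator is Lipschitz pointwise. *)
Lemma picard (P : (Om -> Cplx R) -> Prop) (wt : Om -> R) (T : (Om -> Cplx R) -> Om -> Cplx R) :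
  (forall (w : nat -> Om -> Cplx R) u, (forall n, P (w n)) ->
     (forall o, cconv (w ^~ o) (u o)) -> P u) ->
  P (fun=> 0) -> (forall o, 0 <= wt o) ->
  (forall u, P u -> (forall o, cmod (u o) <= wt o) ->
     P (T u) /\ forall o, cmod (T u o) <= wt o) ->
  (forall u v (d : R), P u -> P v -> (forall o, cmod (u o) <= wt o) ->
     (forall o, cmod (v o) <= wt o) -> 0 <= d ->
     (forall o, cmod (u o - v o) <= d * wt o) ->
     forall o, cmod (T u o - T v o) <= d / 2 * wt o) ->
  exists u, [/\ P u, forall o, cmod (u o) <= wt o & forall o, u o = T u o].
Proof.
move=> Plim P0 wt0 Tself Tlip; pose w n := iter n T (fun=> 0).
have Pw n : P (w n) /\ forall o, cmod (w n o) <= wt o.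
  elim: n => [|n [p b]]; first by split => // o; rewrite cmod0.
  exact: Tself.
have step n o : cmod (w n.+1 o - w n o) <= wt o / 2 ^+ n.
  suff : cmod (w n.+1 o - w n o) <= 1 / 2 ^+ n * wt o by rewrite mul1r mulrC.
  elim: n o => [|n ih] o.
    by rewrite [w 0%N o]/= subr0 expr0 divr1 mul1r; exact: (Pw 1%N).2.
  have [p1 b1] := Pw n.+1; have [p2 b2] := Pw n.
  have := Tlip _ _ (1 / 2 ^+ n) p1 p2 b1 b2 (divr_ge0 ler01 (exprn_ge0 _ _)) ih o.
  by rewrite exprSr invfM !mul1r; apply.
have lim o : exists l, cconv (w ^~ o) l /\ forall n, cmod (l - w n o) <= 2 * wt o / 2 ^+ n.
  by have [l l1 l2] := cauchy_limit (step ^~ o); exists l.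
have [u hu] := choice lim.
have Pu : P u by apply: (Plim w) => [n|o]; [have [] := Pw n|have [] := hu o].
have bu o : cmod (u o) <= wt o.
  apply/ler_addgt0Pr => e e0; have [N hN] := (hu o).1 e e0.
  have := hN N (leqnn N); have := (Pw N).2 o; have := cmod_dist (u o) (w N o).
  rewrite cmodBC; lra.
exists u; split => // o.
apply/eqP; rewrite -subr_eq0; apply/eqP/cmod_eq0/eqP.
rewrite eq_le cmod_ge0 andbT; apply/ler_addgt0Pr => e e0; rewrite add0r.
have e4 : 0 < e / 4 by lra.
have [N hN] := geometric_lt (wt o) e4.
have [p b] := Pw N.
have hd x : cmod (u x - w N x) <= 2 / 2 ^+ N * wt x.
  by have [_ /(_ N)] := hu x; rewrite mulrAC.
have h1 := Tlip u (w N) (2 / 2 ^+ N) Pu p bu b (divr_ge0 (ler0n _ 2) (exprn_ge0 _ (ler0n _ 2))) hd o.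
have h2 : cmod (u o - w N.+1 o) <= 2 * wt o / 2 ^+ N.+1 by have [_] := hu o.
have := cmod_tri (u o) (w N.+1 o) (T u o).
rewrite (cmodBC (w N.+1 o)) [w N.+1 o]/= -/(w N) => h3.
have := hN N (leqnn N); move: h1 h2 h3; rewrite exprS invfM.
set a := (2 ^+ N)^-1; set A := cmod _; set B := cmod (_ - T (w N) o); set D := cmod _.
by move=> h1 h2 h3 h4; nra.
Qed.

End Picard.

(** * Bisection *)

(** Otherwise nested squares violating [P] shrink to a point, where they
   contradict the local hypothesis.  This serves Goursat's theorem, local
   boundedness of entire functions and, through [interval_bisection], covering
   arguments on the line. *)
Lemma square_bisection (R : realType) (P : R -> R -> R -> Prop) :
  (forall x y s, 0 < s -> P x y (s / 2) -> P (x + s / 2) y (s / 2) ->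
     P x (y + s / 2) (s / 2) -> P (x + s / 2) (y + s / 2) (s / 2) -> P x y s) ->
  (forall a b, exists2 d : R, 0 < d & forall x y s, 0 < s < d ->
     x <= a <= x + s -> y <= b <= y + s -> P x y s) ->
  forall x y s, 0 < s -> P x y s.
Proof.
move=> Pquarter Plocal x0 y0 s0 s00; apply: contrapT => nP0.
pose bad (p : R * R * R) := 0 < p.2 /\ ~ P p.1.1 p.1.2 p.2.
have next (p : R * R * R) : exists p' : R * R * R, bad p ->
    [/\ bad p', p'.2 = p.2 / 2, p.1.1 <= p'.1.1 <= p.1.1 + p.2 / 2 &
        p.1.2 <= p'.1.2 <= p.1.2 + p.2 / 2].
  have [bp|] := pselect (bad p); last by exists p.
  case: p bp => [[x y] s] [/= s1 nP]; have s2 : 0 < s / 2 by lra.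
  have [h1|h1] := pselect (P x y (s / 2)); last by exists (x, y, s / 2) => _; split => //=; lra.
  have [h2|h2] := pselect (P (x + s / 2) y (s / 2)); last by exists (x + s / 2, y, s / 2) => _; split => //=; lra.
  have [h3|h3] := pselect (P x (y + s / 2) (s / 2)); last by exists (x, y + s / 2, s / 2) => _; split => //=; lra.
  have [h4|h4] := pselect (P (x + s / 2) (y + s / 2) (s / 2)); last by exists (x + s / 2, y + s / 2, s / 2) => _; split => //=; lra.
  by case: nP; exact: Pquarter.
have [f hf] := choice next; pose p n := iter n f (x0, y0, s0).
have bp n : bad (p n) by elim: n => // n ih; have [] := hf _ ih.
have sp n : (p n).2 = s0 / 2 ^+ n.
  elim: n => [|n ih]; first by rewrite expr0 divr1.
  by have [_ + _ _] := hf _ (bp n); rewrite -[f _]/(p n.+1) => ->; rewrite ih exprSr invfM mulrA.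
have mono (c : R * R * R -> R) : (forall n, c (p n) <= c (p n.+1) <= c (p n) + (p n).2 / 2) ->
    exists a, forall n, c (p n) <= a <= c (p n) + (p n).2.
  move=> hc.
  have up m n : (n <= m)%N -> c (p n) <= c (p m) <= c (p n) + (p n).2 - (p m).2.
    move=> /subnK <-; elim: (m - n)%N => [|k /andP[ih1 ih2]]; first by rewrite add0n addrK !lexx.
    rewrite addSn; have /andP[h1 h2] := hc (k + n)%N.
    have e : (p (k + n).+1).2 = (p (k + n)%N).2 / 2.
      by rewrite !sp exprSr invfM mulrA.
    by rewrite e; apply/andP; split; lra.
  have ub n : ubound (range (c \o p)) (c (p n) + (p n).2).
    move=> _ [m _ <-] /=.
    have [mn|/ltnW nm] := leqP m n.
      have /andP[h1 _] := up _ _ mn; have [q _] := bp n; lra.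
    have /andP[_ h2] := up _ _ nm; have [q _] := bp m; lra.
  exists (sup (range (c \o p))) => n; apply/andP; split.
    apply: ub_le_sup; last by exists n.
    by exists (c (p 0%N) + (p 0%N).2); exact: ub.
  by apply: sup_le_ub; [exists (c (p 0%N)), 0%N|exact: ub].
have [a ha] : exists a, forall n, (p n).1.1 <= a <= (p n).1.1 + (p n).2.
  by apply: (mono (fun q => q.1.1)) => n; have [] := hf _ (bp n).
have [b hb] : exists a, forall n, (p n).1.2 <= a <= (p n).1.2 + (p n).2.
  by apply: (mono (fun q => q.1.2)) => n; have [] := hf _ (bp n).
have [d d0 hd] := Plocal a b.
have [N hN] := geometric_lt s0 d0.
have [q nP] := bp N; apply: nP; apply: hd => //.
by rewrite q sp hN.
Qed.

Lemma interval_bisection (R : realType) (P : R -> R -> Prop) :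
  (forall x y z, x < y -> y < z -> P x y -> P y z -> P x z) ->
  (forall a, exists2 d : R, 0 < d & forall x y, x < y -> y < x + d ->
     x <= a <= y -> P x y) ->
  forall x y, x < y -> P x y.
Proof.
move=> Padd Ploc x y xy.
have -> : y = x + (y - x) by ring.
apply: (@square_bisection R (fun x _ s => P x (x + s)) _ _ x 0 (y - x)); last by lra.
- move=> t _ s s0 h1 h2 _ _; apply: (Padd _ (t + s / 2)); [lra|lra|by []|].
  by rewrite (_ : t + s = t + s / 2 + s / 2) //; lra.
- move=> a ?; have [d d0 hd] := Ploc a; exists d => // t _ s /andP[s0 sd] ha _.
  by apply: hd => //; lra.
Qed.

(** * Primitives and absolutely continuous functions *)

Section Primitive.
Context {R : realType}.
Local Notation mu := (@lebesgue_measure R).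
Implicit Types (f g : R -> Cplx R) (x y a b : R).

Definition sqint g : Prop := cintb g /\ rint (fun x => cmod (g x) ^+ 2).
Definition prim g x : Cplx R := CI (fun u => ⟦u <= x⟧ * g u).

Lemma measurable_le_cst x : measurable_fun setT (fun u : R => u <= x).
Proof. by apply: measurable_fun_ler => //; exact: measurable_cst. Qed.
Lemma measurable_ge_cst x : measurable_fun setT (fun u : R => x <= u).
Proof. by apply: measurable_fun_ler => //; exact: measurable_cst. Qed.
Lemma measurable_lt_cst x : measurable_fun setT (fun u : R => u < x).
Proof. by apply: measurable_fun_ltr => //; exact: measurable_cst. Qed.
Lemma measurable_gt_cst x : measurable_fun setT (fun u : R => x < u).
Proof. by apply: measurable_fun_ltr => //; exact: measurable_cst. Qed.
Lemma measurable_itvcc x y : measurable_fun setT (fun u : R => x <= u <= y).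
Proof. by apply: measurable_and; [exact: measurable_ge_cst|exact: measurable_le_cst]. Qed.
Lemma measurable_itvoc x y : measurable_fun setT (fun u : R => x < u <= y).
Proof. by apply: measurable_and; [exact: measurable_gt_cst|exact: measurable_le_cst]. Qed.
Lemma measurable_itvoo x y : measurable_fun setT (fun u : R => x < u < y).
Proof. by apply: measurable_and; [exact: measurable_gt_cst|exact: measurable_lt_cst]. Qed.

Lemma rint_bool (b : R -> bool) (g : R -> R) : measurable_fun setT b -> rint g ->
  rint (fun x => ⟦b x⟧ * g x).
Proof.
move=> mb jg; have jn : rint (fun x => `|g x|) by exact: (integrable_norm jg).
apply: rint_le jn.
  apply: measurable_funM; last exact: rint_meas.
  rewrite (_ : (fun x => _) = (fun x => if b x then 1 else 0)).
    by apply: measurable_fun_ifT => //; exact: measurable_cst.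
  by apply/funext => x; case: (b x).
by move=> x; case: (b x); rewrite ?mul1r ?mul0r ?normr0.
Qed.
Lemma rint_itvcc a b : rint (fun x : R => ⟦a <= x <= b⟧).
Proof. by have := rint_itv a b 1; under [X in rint X -> _]eq_fun do rewrite mul1r. Qed.
Lemma IR_sum n (f : 'I_n -> R -> R) : (forall i, rint (f i)) ->
  rint (fun x => \sum_(i < n) f i x) /\
  IR (fun x => \sum_(i < n) f i x) = \sum_(i < n) IR (f i).
Proof.
elim: n f => [|n ih] f jf.
  rewrite big_ord0; under eq_fun do rewrite big_ord0.
  by split; [exact: rint0|exact: IR0].
have [j e] := ih (fun i => f (widen_ord (leqnSn n) i)) (fun i => jf _).
rewrite big_ord_recr /=.
rewrite (_ : (fun x => _) = (fun x => \sum_(i < n) f (widen_ord (leqnSn n) i) x + f ord_max x)).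
  by split; [exact: rintD|rewrite IRD // e].
by apply/funext => x; rewrite big_ord_recr.
Qed.

Lemma prim_diff g x y : cintb g -> x <= y ->
  prim g y - prim g x = CI (fun u => ⟦x < u <= y⟧ * g u).
Proof.
move=> jg xy; rewrite /prim -CIB; last 2 first.
- by apply: cintb_bool => //; exact: measurable_le_cst.
- by apply: cintb_bool => //; exact: measurable_le_cst.
apply: eq_CI => u; rewrite -mulrBl; congr (_ * _).
have [ux|xu] /= := leP u x; last by rewrite subr0.
by rewrite (le_trans ux xy) subrr.
Qed.
Lemma prim_diff_oo g x y : cintb g -> x <= y ->
  prim g y - prim g x = CI (fun u => ⟦x < u < y⟧ * g u).
Proof.
move=> jg xy; rewrite prim_diff //; apply: (@CI_point _ y).
- by have [] := cintb_bool (measurable_itvoc x y) jg.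
- by have [] := cintb_bool (measurable_itvoo x y) jg.
- by move=> u uy; rewrite (lt_def u y) eq_sym uy.
Qed.
Lemma prim_at0 g : cmeas g -> (forall u, u < 0 -> g u = 0) -> prim g 0 = 0.
Proof.
move=> mg g0; rewrite /prim -[RHS](@CI0 R); apply: (@CI_point _ 0).
- by apply: cmeasM => //; apply: cmeas_bool; exact: measurable_le_cst.
- exact: cmeas_cst.
- move=> u u0; have [|] := leP u 0; last by rewrite mul0r.
  by rewrite le_eqVlt (negbTE u0) /= => /g0 ->; rewrite mulr0.
Qed.


(** Cauchy-Schwarz in additive form: it suffices for all continuity
   estimates of primitives of square integrable functions. *)
Lemma prim_young g x y (k : R) : sqint g -> 0 < k -> x <= y ->
  cmod (prim g y - prim g x) <=
  k * IR (fun u => ⟦x < u < y⟧ * cmod (g u) ^+ 2) + k^-1 * (y - x).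
Proof.
move=> [jg jg2] k0 xy; rewrite prim_diff_oo //.
have j1 : rint (fun u => ⟦x < u < y⟧ * cmod (g u) ^+ 2).
  by apply: rint_bool => //; exact: measurable_itvoo.
have -> : k * IR (fun u => ⟦x < u < y⟧ * cmod (g u) ^+ 2) + k^-1 * (y - x) =
    IR (fun u => k * (⟦x < u < y⟧ * cmod (g u) ^+ 2) + k^-1 * ⟦x <= u <= y⟧).
  rewrite IRD; [|exact: rintZ|exact: rint_itv].
  by rewrite !IRZ ?IR_itv //; exact: rint_itvcc.
apply: CI_le.
- by apply: cintb_bool => //; exact: measurable_itvoo.
- by apply: rintD; [exact: rintZ|exact: rint_itv].
move=> u; rewrite cmodM cmod_bool.
have [/andP[xu uy]|] := boolP (x < u < y).
  rewrite (ltW xu) (ltW uy) !mul1r mulr1.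
  have : 0 <= k^-1 * (k * cmod (g u) - 1) ^+ 2 by rewrite mulr_ge0 ?sqr_ge0 // invr_ge0 ltW.
  have -> : k^-1 * (k * cmod (g u) - 1) ^+ 2 = k * cmod (g u) ^+ 2 + k^-1 - 2 * cmod (g u).
    by field; rewrite gt_eqF.
  have := cmod_ge0 (g u); lra.
rewrite !mul0r mulr0 add0r => _.
by rewrite mulr_ge0 // invr_ge0 ltW.
Qed.

Lemma rcder_prim g x : cintb g -> ccont g x -> rcder (prim g) x (g x).
Proof.
move=> jg cg e e0; have [d d0 hd] := cg e e0; exists d => // h; rewrite cmod_rc => hh.
have key y z : y <= z -> `|y - x| < d -> `|z - x| < d ->
    cmod (prim g z - prim g y - g x * rc (z - y)) <= e * (z - y).
  move=> yz yd zd.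
  pose k u := ⟦y < u <= z⟧ * (g u - g x).
  have j1 : cintb (fun u => ⟦y < u <= z⟧ * g u) by apply: cintb_bool => //; exact: measurable_itvoc.
  have j0 : cintb (fun u : R => g x * ⟦y < u <= z⟧ : Cplx R).
    apply: cintbZ; apply: (cintb_dom _ _ (rint_itvcc y z)).
      by apply: cmeas_bool; exact: measurable_itvoc.
    move=> u; rewrite cmod_bool ler_nat.
    by have [/andP[/ltW -> ->]|] := boolP (y < u <= z).
  have e1 : CI (fun u : R => ⟦y < u <= z⟧ : Cplx R) = rc (z - y).
    rewrite -IR_itv // -CI_rc; apply: (@CI_point _ y).
    - by apply: cmeas_bool; exact: measurable_itvoc.
    - by apply: cmeas_rc; exact: rint_meas (rint_itvcc y z).
    - by move=> u uy; rewrite rc_nat lt_def uy.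
  have -> : prim g z - prim g y - g x * rc (z - y) = CI k.
    rewrite prim_diff // -e1 -CIZ; last first.
      apply: (cintb_dom _ _ (rint_itvcc y z)).
        by apply: cmeas_bool; exact: measurable_itvoc.
      move=> u; rewrite cmod_bool ler_nat.
      by have [/andP[/ltW -> ->]|] := boolP (y < u <= z).
    by rewrite -CIB //; apply: eq_CI => u; rewrite /k mulrBr (mulrC (g x)).
  have -> : e * (z - y) = IR (fun u => e * ⟦y <= u <= z⟧).
    by rewrite IRZ ?IR_itv //; exact: rint_itvcc.
  apply: CI_le.
  - have -> : k = (fun u => ⟦y < u <= z⟧ * g u - g x * ⟦y < u <= z⟧).
      by apply/funext => u; rewrite /k mulrBr (mulrC (g x)).
    exact: cintbB.
  - exact: rint_itv.
  move=> u; rewrite /k cmodM cmod_bool.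
  have [/andP[yu uz]|] := boolP (y < u <= z); last by rewrite mul0r mulr_ge0 // ltW.
  rewrite (ltW yu) uz mul1r mulr1.
  have := hd (u - x); rewrite cmod_rc subrKC; apply.
  by move: yd zd; rewrite !ltr_norml => /andP[? ?] /andP[? ?]; apply/andP; split; lra.
have [h0|h0] := leP 0 h.
  have := key x (x + h); rewrite subrr normr0 (_ : x + h - x = h); last by ring.
  by rewrite (ger0_norm h0); apply => //; [lra|move: hh; rewrite ger0_norm].
have := key (x + h) x; rewrite subrr normr0 (_ : x + h - x = h); last by ring.
rewrite (_ : x - (x + h) = - h); last by ring.
rewrite (ltr0_norm h0) => /(_ _ _ d0) H.
rewrite -cmodN; apply: le_trans (H _ _); last 2 first.
- by lra.
- by move: hh; rewrite ltr0_norm.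
rewrite (_ : - _ = prim g x - prim g (x + h) - g x * rc (- h)) //.
by rewrite rcN; ring.
Qed.

Lemma prim_ccont g x : sqint g -> ccont (prim g) x.
Proof.
move=> sg e e0; have [jg jg2] := sg.
set I2 := IR (fun u => cmod (g u) ^+ 2).
have I20 : 0 <= I2 by apply: IR_ge0 => u; exact: sqr_ge0.
pose k := e / (2 * (1 + I2)); have k0 : 0 < k by rewrite divr_gt0 // mulr_gt0 //; lra.
exists (k * e / 2); first by rewrite divr_gt0 // mulr_gt0.
move=> h; rewrite cmod_rc => hh.
have key y z : y <= z -> z - y < k * e / 2 -> cmod (prim g z - prim g y) <= e.
  move=> yz zy; apply: le_trans (prim_young sg k0 yz) _.
  have h1 : IR (fun u => ⟦y < u < z⟧ * cmod (g u) ^+ 2) <= I2.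
    apply: IR_le => //; first by apply: rint_bool => //; exact: measurable_itvoo.
    by move=> u; case: (y < u < z); rewrite ?mul1r // mul0r sqr_ge0.
  have h2 : k * I2 <= e / 2.
    rewrite /k (_ : e / (2 * (1 + I2)) * I2 = e / 2 * (I2 / (1 + I2))); last by field; lra.
    by rewrite ler_piMr //; [lra|rewrite ler_pdivrMr; lra].
  have h3 : k^-1 * (z - y) <= e / 2.
    by rewrite mulrC ler_pdivrMr // mulrC mulrA ltW.
  have h4 : k * IR (fun u => ⟦y < u < z⟧ * cmod (g u) ^+ 2) <= k * I2 by rewrite ler_pM2l.
  lra.
have [h0|h0] := leP 0 h.
  by apply: key; [lra|move: hh; rewrite ger0_norm //; lra].
by rewrite cmodBC; apply: key; [lra|move: hh; rewrite ltr0_norm //; lra].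
Qed.

Lemma disjoint_count (N : nat) (l r : nat -> R) (u : R) :
  trivIset `I_N (fun i => `]l i, r i[%classic) ->
  \sum_(i < N) ⟦l i < u < r i⟧ <= 1 :> R.
Proof.
move=> tI.
have [[i ui]|none] := pselect (exists i : 'I_N, l i < u < r i); last first.
  rewrite big1 // => i _; case: (boolP (l i < u < r i)) => // h.
  by case: none; exists i.
rewrite (bigD1 i) //= ui big1 ?addr0 // => j ji.
case: (boolP (l j < u < r j)) => // uj.
case/eqP: ji; apply: val_inj; apply: (tI j i (ltn_ord j) (ltn_ord i)).
by exists u; split; rewrite /= in_itv.
Qed.

(** Summing [prim_young] over disjoint intervals keeps the quadratic term below
   the full integral of the square. *)
Lemma prim_abs_continuous g (c : Cplx R) a b : sqint g ->
  abs_continuous a b (fun x => c + prim g x).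
Proof.
move=> sg e e0; have [jg jg2] := sg.
set I2 := IR (fun u => cmod (g u) ^+ 2).
have I20 : 0 <= I2 by apply: IR_ge0 => u; exact: sqr_ge0.
pose k := e / (2 * (1 + I2)); have k0 : 0 < k by rewrite divr_gt0 // mulr_gt0 //; lra.
exists (k * e / 2); first by rewrite divr_gt0 // mulr_gt0.
move=> N l r lr tI sd.
have ji (i : 'I_N) : rint (fun u => ⟦l i < u < r i⟧ * cmod (g u) ^+ 2).
  by apply: rint_bool => //; exact: measurable_itvoo.
have [js es] := IR_sum ji.
apply: (@le_lt_trans _ _ (\sum_(i < N) (k * IR (fun u => ⟦l i < u < r i⟧ * cmod (g u) ^+ 2) + k^-1 * (r i - l i)))).
  apply: ler_sum => i _; have [_ ? _] := lr i (ltn_ord i).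
  rewrite (_ : c + _ - _ = prim g (r i) - prim g (l i)); last by ring.
  exact: prim_young.
rewrite big_split /= -!mulr_sumr -es.
have h1 : IR (fun x => \sum_(i < N) ⟦l i < x < r i⟧ * cmod (g x) ^+ 2) <= I2.
  apply: IR_le => // u; rewrite -mulr_suml ler_piMl ?sqr_ge0 //.
  exact: disjoint_count.
have h2 : k * I2 <= e / 2.
  rewrite /k (_ : e / (2 * (1 + I2)) * I2 = e / 2 * (I2 / (1 + I2))); last by field; lra.
  by rewrite ler_piMr //; [lra|rewrite ler_pdivrMr; lra].
have h3 : k^-1 * \sum_(i < N) (r i - l i) < e / 2.
  by rewrite mulrC ltr_pdivrMr // mulrC mulrA.
have h4 : k * IR (fun x => \sum_(i < N) ⟦l i < x < r i⟧ * cmod (g x) ^+ 2) <= k * I2 by rewrite ler_pM2l.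
lra.
Qed.

Lemma abs_continuousB f g a b : abs_continuous a b f -> abs_continuous a b g ->
  abs_continuous a b (fun x => f x - g x).
Proof.
move=> af ag e e0; have e2 : 0 < e / 2 by lra.
have [d1 d10 h1] := af _ e2; have [d2 d20 h2] := ag _ e2.
exists (Num.min d1 d2); first by rewrite lt_min d10.
move=> N l r lr tI; rewrite lt_min => /andP[s1 s2].
have {}h1 := h1 N l r lr tI s1; have {}h2 := h2 N l r lr tI s2.
apply: (@le_lt_trans _ _ (\sum_(i < N) (cmod (f (r i) - f (l i)) + cmod (g (r i) - g (l i))))).
  apply: ler_sum => i _.
  rewrite (_ : f (r i) - g (r i) - _ = (f (r i) - f (l i)) - (g (r i) - g (l i))); last by ring.
  exact: cmodB.
by rewrite big_split /=; lra.
Qed.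

(** Lebesgue's differentiation theorem for the real and the imaginary part. *)
Lemma ae_prim g : cintb g -> {ae mu, forall x, rcder (prim g) x (g x)}.
Proof.
move=> jg.
have key (f : R -> R) : rint f ->
    {ae mu, forall x, is_derive x 1 (fun y => IR (fun u => ⟦u <= y⟧ * f u)) (f x)}.
  move=> jf.
  have jf' (D : set R) : measurable D -> mu.-integrable D (EFin \o f).
    by move=> mD; apply: integrableS jf.
  have := @FTC1Ny R f (fun y => jf' _ (measurable_itv _)).
  have lf : locally_integrable [set: R] f by apply: open_integrable_locally => //; exact: openT.
  move=> /(_ lf); apply: ae_imp => x [dx e].
  have -> : (fun y => IR (fun u => ⟦u <= y⟧ * f u)) =
      (fun y => Rintegral mu `]-oo, y] f).
    apply/funext => y; rewrite [RHS]Rintegral_mkcond; congr Rintegral.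
    by apply/funext => u; rewrite patchE mem_setE in_itv /=; case: ifP; rewrite ?mul1r ?mul0r.
  split; first exact: dx.
  by rewrite -derive1E; exact: e.
have h1 := key _ (rint_Re jg); have h2 := key _ (rint_Im jg).
apply: ae_imp (ae_and h1 h2) => x [d1 d2].
apply/rcder_is_rderive; split.
  rewrite (_ : (fun u => Re (prim g u)) = (fun y => IR (fun u => ⟦u <= y⟧ * Re (g u)))) //.
  apply/funext => y; rewrite /prim CI_Re; congr IR; apply/funext => u.
  by rewrite -rc_nat ReM Re_rc Im_rc mul0r subr0.
rewrite (_ : (fun u => Im (prim g u)) = (fun y => IR (fun u => ⟦u <= y⟧ * Im (g u)))) //.
apply/funext => y; rewrite /prim CI_Im; congr IR; apply/funext => u.
by rewrite -rc_nat ImM Re_rc Im_rc mul0r addr0.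
Qed.

End Primitive.

Section AbsoluteContinuity.
Context {R : realType}.
Local Notation mu := (@lebesgue_measure R).
Implicit Types (F g : R -> Cplx R) (x y a b : R).

(** Composition with [clamp a b] extends a function on [a, b] by constants, and
   so gives access to statements about functions continuous on the line. *)
Definition clamp a b x : R := Num.max a (Num.min x b).
Lemma clamp_in a b x : a <= b -> a <= clamp a b x <= b.
Proof. by move=> ab; rewrite /clamp le_max lexx /= ge_max ab ge_min lexx orbT. Qed.
Lemma clamp_id a b x : a <= x <= b -> clamp a b x = x.
Proof. by move=> /andP[ax xb]; rewrite /clamp (min_idPl xb) (max_idPr ax). Qed.
Lemma clamp_le a b x y : x <= y -> clamp a b x <= clamp a b y.
Proof.
move=> xy; rewrite /clamp le_max2 //.
by rewrite le_min ge_min xy /= ge_min lexx orbT.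
Qed.
Lemma clamp_lip a b x y : a <= b -> x <= y -> clamp a b y - clamp a b x <= y - x.
Proof.
move=> ab xy; rewrite /clamp /Num.max /Num.min.
by repeat case: ifP; rewrite ?(rwP idP); lra.
Qed.

Lemma abs_continuous_clamp a b F : a <= b -> abs_continuous a b F ->
  forall x, ccont (fun y => F (clamp a b y)) x.
Proof.
move=> ab aF x e e0; have [d d0 hd] := aF e e0; exists d => // h; rewrite cmod_rc => hh.
have key y z : y <= z -> z - y < d -> cmod (F (clamp a b z) - F (clamp a b y)) <= e.
  move=> yz zy; have := hd 1%N (fun=> clamp a b y) (fun=> clamp a b z).
  rewrite !big_ord1 => H; apply/ltW; apply: H.
  - move=> _ _; have /andP[c1 _] := clamp_in y ab; have /andP[_ c2] := clamp_in z ab.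
    by split => //; exact: clamp_le.
  - by move=> [|//] [|//].
  - exact: le_lt_trans (clamp_lip ab yz) zy.
have [h0|h0] := leP 0 h.
  by apply: key; [lra|move: hh; rewrite ger0_norm //; lra].
by rewrite cmodBC; apply: key; [lra|move: hh; rewrite ltr0_norm //; lra].
Qed.

Lemma ccont_bounded F a b : (forall x, ccont F x) ->
  exists M, forall x, a <= x <= b -> cmod (F x) <= M.
Proof.
move=> cF; have [ab|ba] := ltP a b; last first.
  exists (cmod (F a)) => x /andP[ax xb]; suff -> : x = a by [].
  by apply/eqP; rewrite eq_le; lra.
apply: (@interval_bisection R (fun a b => exists M, forall x, a <= x <= b -> cmod (F x) <= M)) => //.
- move=> x y z _ _ [M1 h1] [M2 h2]; exists (Num.max M1 M2) => t /andP[xt tz].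
  rewrite le_max; have [ty|yt] := leP t y; first by rewrite h1 ?xt.
  by rewrite h2 ?orbT // (ltW yt).
move=> x; have [d d0 hd] := cF x 1 ltr01; exists d => // u v uv vd /andP[ux xv].
exists (cmod (F x) + 1) => t /andP[ut tv].
have := hd (t - x); rewrite cmod_rc subrKC => H.
have : cmod (F t - F x) <= 1 by apply: H; rewrite ltr_norml; lra.
by have := cmod_dist (F t) (F x); lra.
Qed.

(** Such a chain is what remains of a partition of [u, v] once the intervals on
   which the function hardly moves have been discarded. *)
Fixpoint chain (O : set R) (u : R) (s : seq (R * R)) (v : R) : Prop :=
  if s is p :: s' then
    [/\ u <= p.1, p.1 <= p.2, `]p.1, p.2[%classic `<=` O & chain O p.2 s' v]
  else u <= v.
Lemma chain_le O u s v : chain O u s v -> u <= v.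
Proof. by elim: s u => //= p s ih u [h1 h2 _ /ih]; lra. Qed.
Lemma chain_cat O u v w s1 s2 : chain O u s1 v -> chain O v s2 w -> chain O u (s1 ++ s2) w.
Proof.
elim: s1 u => /= [|p s ih] u.
  case: s2 => /= [|p s]; first by move=> ? ?; lra.
  by move=> uv [h1 h2 h3 h4]; split => //; lra.
by move=> [h1 h2 h3 h4] h5; split => //; exact: ih.
Qed.
Lemma chain_length O u s v : measurable O -> chain O u s v ->
  ((\sum_(p <- s) (p.2 - p.1))%:E <= mu (O `&` `]u, v[%classic))%E.
Proof.
move=> mO; elim: s u => [|p s ih] u /=; first by rewrite big_nil measure_ge0.
move=> [h1 h2 h3 h4]; rewrite big_cons EFinD.
have := ih _ h4; set m1 := mu _ => H.
have e1 : (p.2 - p.1)%:E = mu `]p.1, p.2[%classic.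
  rewrite lebesgue_measure_itv /= lte_fin; move: h2; rewrite le_eqVlt => /predU1P[->|->].
    by rewrite ltxx subrr.
  by rewrite EFinB.
have mI : measurable (O `&` `]p.2, v[%classic) by apply: measurableI.
apply: (@le_trans _ _ (mu (`]p.1, p.2[%classic `|` (O `&` `]p.2, v[%classic)))).
  rewrite measureU //; last first.
    apply/seteqP; split => // t [] /=; rewrite !in_itv /= => /andP[_ t1] [_ /andP[t2 _]]; lra.
  by rewrite e1; apply: leeD.
apply: le_measure; rewrite ?inE //.
- exact: measurableU.
- exact: measurableI.
have pv := chain_le h4.
move=> t [tp|[tO]] /=.
  split; first exact: h3.
  by move: tp; rewrite /= !in_itv /= => /andP[? ?]; apply/andP; split; lra.
by split => //; move: b; rewrite /= !in_itv /= => /andP[? ?]; apply/andP; split; lra.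
Qed.
Lemma chain_nth O u s v i : chain O u s v -> (i < size s)%N ->
  [/\ u <= (nth (0, 0) s i).1, (nth (0, 0) s i).1 <= (nth (0, 0) s i).2 &
      (nth (0, 0) s i).2 <= v].
Proof.
elim: s u i => // p s ih u [|i] /= [h1 h2 _ h4].
  by move=> _; split => //; exact: chain_le h4.
by rewrite ltnS => /(ih _ _ h4)[k1 k2 k3]; split => //; lra.
Qed.
Lemma chain_disjoint O u s v i j : chain O u s v -> (i < j < size s)%N ->
  (nth (0, 0) s i).2 <= (nth (0, 0) s j).1.
Proof.
elim: s u i j => [|p s ih] u i j; first by move=> _; rewrite /= ltn0 andbF.
case: i => [|i]; case: j => [|j] //= [h1 h2 _ h4] //.
  by rewrite ltnS => /(chain_nth h4)[].
by rewrite !ltnS; exact: ih h4.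
Qed.

(** An absolutely continuous function with vanishing derivative almost
   everywhere is constant: a bisection argument covers the exceptional null
   set by a chain of intervals of small total length. *)
Lemma abs_continuous_const a b F : a <= b -> abs_continuous a b F ->
  {ae mu, forall x, a < x < b -> rcder F x 0} ->
  forall x, a <= x <= b -> F x = F a.
Proof.
move=> ab aF [N [mN N0 sN]] x0 /andP[ax0 x0b].
have [->//|xa] := eqVneq x0 a.
have lax : a < x0 by rewrite lt_def xa.
apply/eqP; rewrite -subr_eq0; apply/eqP/cmod_eq0/eqP.
rewrite eq_le cmod_ge0 andbT; apply/ler_addgt0Pr => e e0; rewrite add0r.
pose e1 := e / (2 * (1 + (x0 - a))).
have e10 : 0 < e1 by rewrite divr_gt0 // mulr_gt0 //; lra.
have e2 : 0 < e / 2 by lra.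
have [d d0 hd] := aF _ e2.
(* The end points join the exceptional set, and an open set of measure less
   than [d] covers both. *)
pose N' := N `|` [set a] `|` [set x0].
have mN' : measurable N' by apply: measurableU => //; apply: measurableU.
have N'0 : mu N' = 0%E.
  apply: null_set_setU => //; [exact: measurableU| |exact: lebesgue_measure_set1].
  by apply: null_set_setU => //; exact: lebesgue_measure_set1.
have N'y : (mu N' < +oo)%E by rewrite [mu N']N'0.
have [G [oG NG Gd]] := lebesgue_regularity_outer mN' N'y d0.
have mG : measurable G by exact: open_measurable.
have muG : (mu G < d%:E)%E.
  have -> : G = (G `\` N') `|` N' by rewrite setUC setDUK.
  rewrite measureU //; last 2 first.
  - exact: measurableD.
  - by rewrite setDKI.
  by rewrite [X in (_ + X)%E](N'0) adde0.
pose P u v := a <= u -> v <= x0 -> exists2 s, chain G u s v &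
   cmod (F v - F u) <= \sum_(p <- s) cmod (F p.2 - F p.1) + e1 * (v - u).
have [s cs hs] : exists2 s, chain G a s x0 &
   cmod (F x0 - F a) <= \sum_(p <- s) cmod (F p.2 - F p.1) + e1 * (x0 - a).
  suff : P a x0 by apply.
  apply: interval_bisection lax.
    move=> u v w uv vw Puv Pvw au wx.
    have [|s1 c1 h1] := Puv au; first by lra.
    have [|//|s2 c2 h2] := Pvw; first by lra.
    exists (s1 ++ s2); first exact: chain_cat c1 c2.
    rewrite big_cat /=; apply: le_trans (cmod_tri _ (F v) _) _; lra.
  move=> t.
  have [tG|tG] := pselect (G t).
    have [r /= r0 rG] : exists2 r : R, 0 < r & ball t r `<=` G.
      by have /nbhs_ballP[r r0 h] := open_nbhs_nbhs (conj oG tG); exists r.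
    exists r => // u v uv vr /andP[ut tv] au vx.
    exists [:: (u, v)].
      split => //=; [exact: ltW|].
      move=> y; rewrite /= in_itv /= => /andP[uy yv]; apply: rG.
      by rewrite /ball /= ltr_norml; lra.
    by rewrite big_seq1 /= lerDl mulr_ge0 // ?ltW // subr_gt0.
  have [tab|tab] := boolP (a < t < x0); last first.
    have [ta|ta] := ltP t a.
      by exists (a - t) => [|u v uv vr /andP[ut tv] au vx]; lra.
    have [xt|xt] := ltP x0 t.
      by exists (t - x0) => [|u v uv vr /andP[ut tv] au vx]; lra.
    case: tG; apply: NG; move: tab; rewrite negb_and -!leNgt => /orP[h|h].
      by left; right; apply/eqP; rewrite eq_le h ta.
    by right; apply/eqP; rewrite eq_le h xt.
  have dF : rcder F t 0.
    apply: contrapT => nd; apply: tG; apply: NG; left; left; apply: sN => /= H.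
    by apply: nd; apply: H; move: tab => /andP[-> ?] /=; lra.
  have [r r0 hr] := dF e1 e10; exists r => // u v uv vr /andP[ut tv] au vx.
  exists [::] => /=; first exact: ltW.
  rewrite big_nil add0r.
  have := hr (v - t); rewrite cmod_rc subrKC mul0r subr0 ger0_norm ?subr_ge0 // => h1.
  have := hr (u - t); rewrite cmod_rc subrKC mul0r subr0 ler0_norm ?subr_le0 // => h2.
  apply: le_trans (cmod_tri _ (F t) _) _; rewrite (cmodBC (F t)).
  have {}h1 := h1 (ltac:(lra)); have {}h2 := h2 (ltac:(lra)).
  by rewrite (_ : v - u = (v - t) + - (u - t)) ?mulrDr ?lerD //; lra.
apply: le_trans hs _.
have h1 : e1 * (x0 - a) <= e / 2.
  rewrite /e1 (_ : e / _ * _ = e / 2 * ((x0 - a) / (1 + (x0 - a)))); last by field; lra.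
  by rewrite ler_piMr //; [lra|rewrite ler_pdivrMr; lra].
suff : \sum_(p <- s) cmod (F p.2 - F p.1) < e / 2 by lra.
rewrite (big_nth (0, 0)) big_mkord.
apply: (hd _ (fun i => (nth (0, 0) s i).1) (fun i => (nth (0, 0) s i).2)).
- by move=> i si; have [? ? ?] := chain_nth cs si; split => //; lra.
- move=> i j /= si sj [y []]; rewrite /= !in_itv /= => /andP[y1 y2] /andP[y3 y4].
  have [ij|ji|//] := ltngtP i j.
    by have := @chain_disjoint _ _ _ _ i j cs; rewrite ij sj => /(_ isT) ?; exfalso; lra.
  by have := @chain_disjoint _ _ _ _ j i cs; rewrite ji si => /(_ isT) ?; exfalso; lra.
rewrite -(big_mkord xpredT (fun i => (nth (0, 0) s i).2 - (nth (0, 0) s i).1)).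
rewrite -(big_nth (0, 0) xpredT (fun p => p.2 - p.1)) -lte_fin.
apply: le_lt_trans (chain_length mG cs) _.
apply: le_lt_trans muG; apply: le_measure; rewrite ?inE //.
exact: measurableI.
Qed.

(** Both sides are absolutely continuous with the same derivative almost
   everywhere. *)
Lemma abs_continuous_prim b F g : 0 <= b -> abs_continuous 0 b F -> sqint g ->
  (forall u, u < 0 -> g u = 0) ->
  {ae mu, forall x, 0 < x < b -> rcder F x (g x)} ->
  forall x, 0 <= x <= b -> F x = F 0 + prim g x.
Proof.
move=> b0 aF sg g0 dF x xb; have [jg _] := sg.
have aG := abs_continuousB aF (@prim_abs_continuous _ g (F 0) 0 b sg).
have ae0 : {ae mu, forall x, 0 < x < b -> rcder (fun y => F y - (F 0 + prim g y)) x 0}.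
  apply: ae_imp (ae_and dF (ae_prim jg)) => y [h1 h2] yb.
  have h3 := derB (h1 yb) (derD (der_cst rc (F 0) y) h2).
  by apply: eq_der h3 => // ; ring.
have := abs_continuous_const b0 aG ae0 xb.
rewrite (prim_at0 _ g0); last by case: jg.
rewrite addr0 subrr => /eqP; rewrite subr_eq0 => /eqP //.
Qed.

End AbsoluteContinuity.

(** * Entire functions *)

Section ComplexExponential.
Context {R : realType}.
Implicit Types (z w h : Cplx R) (x y : R).

Lemma Re_i : Re ('i : Cplx R) = 0. Proof. by []. Qed.
Lemma Im_i : Im ('i : Cplx R) = 1. Proof. by []. Qed.
Lemma Re_cexp z : Re (cexp z) = expR (Re z) * cos (Im z). Proof. by []. Qed.
Lemma Im_cexp z : Im (cexp z) = expR (Re z) * sin (Im z). Proof. by []. Qed.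
Definition cE := (@ReD R, @ImD R, @ReN R, @ImN R, @ReM R, @ImM R, @Re_rc R, @Im_rc R,
  Re_i, Im_i, @Re0 R, @Im0 R, @Re1 R, @Im1 R, Re_cexp, Im_cexp).

Lemma cplxE z : z = rc (Re z) + 'i * rc (Im z).
Proof. by apply: cplx_eq; rewrite !cE; ring. Qed.
Lemma cexpE z : cexp z = rc (expR (Re z)) * (rc (cos (Im z)) + 'i * rc (sin (Im z))).
Proof.
by apply: cplx_eq; rewrite !cE; ring.
Qed.
Lemma cexpD z w : cexp (z + w) = cexp z * cexp w.
Proof.
by apply: cplx_eq; rewrite !cE expRD ?cosD ?sinD; ring.
Qed.
Lemma cexp0 : cexp (0 : Cplx R) = 1.
Proof. by apply: cplx_eq; rewrite !cE expR0 ?cos0 ?sin0 ?mulr1 ?mulr0. Qed.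
Lemma cmod_cexp z : cmod (cexp z) = expR (Re z).
Proof.
rewrite cmodE /cexp /= !exprMn -mulrDr cos2Dsin2 mulr1 sqrtr_sqr.
by rewrite ger0_norm ?expR_ge0.
Qed.
Lemma cexp_neq0 z : cexp z != 0.
Proof.
apply/eqP => /(congr1 (@cmod R)); rewrite cmod_cexp cmod0 => e.
by have := expR_gt0 (Re z); rewrite e ltxx.
Qed.
Lemma cexpN z : cexp (- z) = (cexp z)^-1.
Proof.
apply: (mulfI (cexp_neq0 z)); rewrite -cexpD subrr cexp0 mulfV //.
exact: cexp_neq0.
Qed.
Lemma cexp_2pi z : cexp (z + 'i * rc (2 * pi)) = cexp z.
Proof.
rewrite cexpD [X in _ * X](_ : _ = 1) ?mulr1 //.
have t2 : 2 * pi = pi *+ 2 :> R by rewrite mulr_natl.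
by apply: cplx_eq; rewrite !cE t2 !mul0r mulr0 subrr mul1r ?add0r expR0 mul1r ?cos2pi ?sin2pi.
Qed.

Lemma small_real (f : R -> R) (p : Cplx R -> R) (l : R) : is_derive (0 : R) (1 : R) f l ->
  (forall h, `|p h| <= cmod h) ->
  small (fun h : Cplx R => h) (fun h => rc (f (p h)) - rc (f 0) - rc (l * p h)).
Proof.
move=> /is_deriveP df ph e e0; have [d d0 hd] := df e e0.
exists d => // h hh; rewrite -!rcB cmod_rc.
have := hd (p h) (le_lt_trans (ph h) hh); rewrite add0r => /le_trans; apply.
by rewrite ler_pM2l.
Qed.

Lemma cder_cexp0 : cder (@cexp R) 0 1.
Proof.
have sE := small_real (is_derive_expR 0) (@Re_le_cmod R).
have sC := small_real (is_derive_cos 0) (@Im_le_cmod R).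
have sS := small_real (is_derive_sin 0) (@Im_le_cmod R).
have bnd (p : Cplx R -> Cplx R) : (forall h, cmod (p h) <= cmod h) ->
    exists2 d : R, 0 < d & forall h, cmod h < d -> cmod (p h) <= 1.
  by move=> hp; exists 1 => // h hh; apply: le_trans (hp h) (ltW hh).
have bR : exists2 d : R, 0 < d & forall h : Cplx R, cmod h < d -> cmod (1 + rc (Re h)) <= 2.
  exists 1 => // h hh; apply: le_trans (cmodD _ _) _; rewrite cmod1 cmod_rc.
  by have := Re_le_cmod h; lra.
have bT : exists2 d : R, 0 < d & forall h : Cplx R, cmod h < d ->
    cmod (rc (cos (Im h)) + 'i * rc (sin (Im h))) <= 2.
  exists 1 => // h hh; apply: le_trans (cmodD _ _) _; rewrite cmodM cmodi mul1r !cmod_rc.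
  by have := cos_max (Im h); have := sin_max (Im h); lra.
have bi : exists2 d : R, 0 < d & forall h : Cplx R, cmod h < d -> cmod ('i : Cplx R) <= 1.
  by exists 1 => // h _; rewrite cmodi.
have s1 := smallM sE bT; have s2 := smallM sC bR; have s3 := smallM (smallM sS bR) bi.
have s4 : small (fun h : Cplx R => h) (fun h => 'i * rc (Re h) * rc (Im h)).
  move=> e e0; exists e => // h hh; rewrite !cmodM cmodi mul1r !cmod_rc.
  by have := Re_le_cmod h; have := Im_le_cmod h; have := cmod_ge0 h;
     have := normr_ge0 (Re h); have := normr_ge0 (Im h); nra.
apply: eq_small (smallD (smallD s1 s2) (smallD s3 s4)) => h.
rewrite !add0r cexp0 (cexpE h) [X in _ = _ - 1 * X](cplxE h).
rewrite expR0 cos0 sin0 !rcM !rcN rc0 rc1; ring.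
Qed.

Lemma cder_cexp z : cder (@cexp R) z (cexp z).
Proof.
have b : exists2 d : R, 0 < d & forall h : Cplx R, cmod h < d -> cmod (cexp z) <= cmod (cexp z).
  by exists 1.
apply: eq_small (smallM cder_cexp0 b) => h.
rewrite add0r cexp0 cexpD; ring.
Qed.

Lemma rcder_cexp (k : Cplx R) x : rcder (fun y => cexp (k * rc y)) x (k * cexp (k * rc x)).
Proof.
have h := der_comp (u := fun y => k * rc y) (cder_cexp (k * rc x)) (derZ k (rcder_rc x)).
by apply: eq_der h => //; ring.
Qed.
End ComplexExponential.

Section Goursat.
Context {R : realType} (f : Cplx R -> Cplx R).
Hypothesis ef : forall z, exists l, cder f z l.
Local Notation u x y := (f (rc x + 'i * rc y)).

Lemma rcder_hor (y x : R) l : cder f (rc x + 'i * rc y) l -> rcder (fun t => u t y) x l.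
Proof.
move=> df; have := der_comp (u := fun t => rc t + 'i * rc y) df (derD (rcder_rc x) (der_cst rc ('i * rc y) x)).
by apply: eq_der => //; ring.
Qed.
Lemma rcder_ver (x y : R) l : cder f (rc x + 'i * rc y) l -> rcder (fun t => u x t) y (l * 'i).
Proof.
move=> df; have := der_comp (u := fun t => rc x + 'i * rc t) df (derD (der_cst rc (rc x) y) (derZ 'i (rcder_rc y))).
by apply: eq_der => //; ring.
Qed.
Lemma ccont_hor (y x : R) : ccont (fun t => u t y) x.
Proof. by have [l /rcder_hor /rcder_ccont] := ef (rc x + 'i * rc y). Qed.
Lemma ccont_ver (x y : R) : ccont (fun t => u x t) y.
Proof. by have [l /rcder_ver /rcder_ccont] := ef (rc x + 'i * rc y). Qed.

Lemma ccont_cintb (v : R -> Cplx R) (a b : R) : (forall x, ccont v x) ->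
  cintb (fun t => ⟦a < t <= b⟧ * v t).
Proof.
move=> cv; have [M hM] := ccont_bounded a b cv.
apply: (cintb_dom _ _ (rint_itv a b `|M|)).
  apply: cmeasM; last exact: ccont_cmeas.
  by apply: cmeas_bool; exact: measurable_itvoc.
move=> t; rewrite cmodM cmod_bool.
have [/andP[t1 t2]|_] := boolP (a < t <= b); last by rewrite mul0r mulr_ge0.
rewrite (ltW t1) t2 mul1r mulr1; apply: le_trans (ler_norm _).
by apply: hM; rewrite (ltW t1) t2.
Qed.

Definition contour (x y s : R) : Cplx R :=
  (CI (fun t => ⟦x < t <= x + s⟧ * u t y) - CI (fun t => ⟦x < t <= x + s⟧ * u t (y + s)))
  + 'i * (CI (fun t => ⟦y < t <= y + s⟧ * u (x + s) t) - CI (fun t => ⟦y < t <= y + s⟧ * u x t)).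

Lemma CI_chasles (v : R -> Cplx R) (a b c : R) : (forall x, ccont v x) -> a <= b -> b <= c ->
  CI (fun t => ⟦a < t <= c⟧ * v t) =
  CI (fun t => ⟦a < t <= b⟧ * v t) + CI (fun t => ⟦b < t <= c⟧ * v t).
Proof.
move=> cv ab bc; rewrite -CID; try exact: ccont_cintb.
apply: eq_CI => t; rewrite -mulrDl; congr (_ * _).
have [tb|bt] := leP t b; rewrite ?andbT ?andbF /=.
  by rewrite (le_trans tb bc) andbT addr0.
by rewrite (le_lt_trans ab bt) add0r.
Qed.

Lemma contour_quarter (x y s : R) : 0 < s ->
  contour x y s = contour x y (s / 2) + contour (x + s / 2) y (s / 2) +
    contour x (y + s / 2) (s / 2) + contour (x + s / 2) (y + s / 2) (s / 2).
Proof.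
move=> s0; rewrite /contour.
have e z : z + s / 2 + s / 2 = z + s by lra.
rewrite !e.
have ch := ccont_hor; have cv := ccont_ver.
have h1 z : z <= z + s / 2 by rewrite lerDl; lra.
have h2 z : z + s / 2 <= z + s by rewrite lerD2l; lra.
rewrite (@CI_chasles (fun t => u t y) _ _ _ _ (h1 x) (h2 x)) //.
rewrite (@CI_chasles (fun t => u t (y + s)) _ _ _ _ (h1 x) (h2 x)) //.
rewrite (@CI_chasles (fun t => u (x + s) t) _ _ _ _ (h1 y) (h2 y)) //.
rewrite (@CI_chasles (fun t => u x t) _ _ _ _ (h1 y) (h2 y)) //.
by repeat (match goal with |- context[CI ?v] => move: (CI v) => ? end); ring.
Qed.

Lemma CI_itv_bound (v : R -> Cplx R) (a b M : R) : (forall x, ccont v x) -> a <= b -> 0 <= M ->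
  (forall t, a <= t <= b -> cmod (v t) <= M) ->
  cmod (CI (fun t => ⟦a < t <= b⟧ * v t)) <= M * (b - a).
Proof.
move=> cv ab M0 hM; rewrite -IR_itv // -IRZ; last exact: rint_itvcc.
apply: CI_le; [exact: ccont_cintb|exact: rint_itv|].
move=> t; rewrite cmodM cmod_bool.
have [/andP[t1 t2]|_] := boolP (a < t <= b); last by rewrite mul0r mulr_ge0.
by rewrite (ltW t1) t2 mul1r mulr1; apply: hM; rewrite (ltW t1) t2.
Qed.

Lemma CI_itv_cst (a b : R) (c : Cplx R) : a <= b ->
  CI (fun t : R => ⟦a < t <= b⟧ * c) = c * rc (b - a).
Proof.
move=> ab; have jb : cintb (fun t : R => ⟦a < t <= b⟧ : Cplx R).
  apply: (cintb_dom _ _ (rint_itvcc a b)).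
    by apply: cmeas_bool; exact: measurable_itvoc.
  move=> t; rewrite cmod_bool ler_nat.
  by have [/andP[/ltW -> ->]|] := boolP (a < t <= b).
rewrite (_ : (fun t => _) = (fun t : R => c * ⟦a < t <= b⟧)); last by apply/funext => t; rewrite mulrC.
rewrite CIZ //; congr (_ * _); rewrite -IR_itv // -CI_rc; apply: (@CI_point _ a).
- by case: jb.
- by apply: cmeas_rc; exact: rint_meas (rint_itvcc a b).
- by move=> t ta; rewrite rc_nat lt_def ta.
Qed.

Lemma ccontB (v w : R -> Cplx R) x : ccont v x -> ccont w x -> ccont (fun t => v t - w t) x.
Proof.
move=> cv cw e e0; have e2 : 0 < e / 2 by lra.
have [d1 d10 h1] := cv _ e2; have [d2 d20 h2] := cw _ e2.
exists (Num.min d1 d2); first by rewrite lt_min d10.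
move=> h; rewrite lt_min => /andP[/h1 k1 /h2 k2].
rewrite (_ : _ - _ = (v (x + h) - v x) - (w (x + h) - w x)); last by ring.
by apply: le_trans (cmodB _ _) _; lra.
Qed.
Lemma ccont_cst (c : Cplx R) (x : R) : ccont (fun=> c) x.
Proof. by move=> e e0; exists 1 => // h _; rewrite subrr cmod0 ltW. Qed.

(** The affine part of the increment contributes nothing around a square. *)
Lemma contour_small (e : R) (a b : R) : 0 < e -> exists2 d : R, 0 < d &
  forall x y s, 0 < s < d -> x <= a <= x + s -> y <= b <= y + s ->
    cmod (contour x y s) <= e * s ^+ 2.
Proof.
move=> e0; have [l df] := ef (rc a + 'i * rc b).
have e8 : 0 < e / 8 by lra.
have [d d0 hd] := df _ e8; exists (d / 2); first by lra.
move=> x y s /andP[s0 sd] xa yb.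
have near t t' : x <= t <= x + s -> y <= t' <= y + s ->
    cmod (u t t' - f (rc a + 'i * rc b) - l * (rc (t - a) + 'i * rc (t' - b))) <= e / 4 * s.
  move=> ht ht'.
  have hn : cmod (rc (t - a) + 'i * rc (t' - b)) <= 2 * s.
    apply: le_trans (cmodD _ _) _; rewrite cmodM cmodi mul1r !cmod_rc.
    suff : `|t - a| <= s /\ `|t' - b| <= s by lra.
    by split; rewrite ler_norml; lra.
  have := hd (rc (t - a) + 'i * rc (t' - b)) (ltac:(lra)).
  rewrite (_ : rc a + 'i * rc b + _ = rc t + 'i * rc t'); last by rewrite !rcB; ring.
  by move=> /le_trans; apply; nra.
have ch := ccont_hor; have cv := ccont_ver.
have s1 : 0 <= e / 2 * s by nra.
have -> : contour x y s =
   CI (fun t => ⟦x < t <= x + s⟧ * (u t y - u t (y + s) - (- (l * 'i * rc s)))) +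
   'i * CI (fun t => ⟦y < t <= y + s⟧ * (u (x + s) t - u x t - l * rc s)).
  have spl (v w : R -> Cplx R) (c : Cplx R) (p q : R) : (forall t, ccont v t) -> (forall t, ccont w t) -> p <= q ->
     CI (fun t => ⟦p < t <= q⟧ * (v t - w t - c)) =
     CI (fun t => ⟦p < t <= q⟧ * v t) - CI (fun t => ⟦p < t <= q⟧ * w t) - c * rc (q - p).
    move=> cv' cw' pq; rewrite -CI_itv_cst // -CIB; try exact: ccont_cintb.
    rewrite -CIB; last 2 first.
    - by apply: cintbB; exact: ccont_cintb.
    - by apply: ccont_cintb => t; exact: ccont_cst.
    by apply: eq_CI => t; ring.
  have hs z : z <= z + s by rewrite lerDl ltW.
  rewrite (spl (fun t => u t y) (fun t => u t (y + s))) //.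
  rewrite (spl (fun t => u (x + s) t) (fun t => u x t)) //.
  have zs z : z + s - z = s by ring.
  rewrite !zs /contour.
  by repeat (match goal with |- context[CI ?v] => move: (CI v) => ? end); ring.
have b1 : cmod (CI (fun t => ⟦x < t <= x + s⟧ * (u t y - u t (y + s) - (- (l * 'i * rc s))))) <= e / 2 * s * s.
  rewrite (_ : e / 2 * s * s = e / 2 * s * (x + s - x)); last by ring.
  apply: CI_itv_bound => //; first by move=> t; apply: ccontB; [exact: ccontB|exact: ccont_cst].
    by lra.
  move=> t ht; have n1 := near t y ht (ltac:(lra)); have n2 := near t (y + s) ht (ltac:(lra)).
  rewrite (_ : u t y - u t (y + s) - (- (l * 'i * rc s)) =
     (u t y - f (rc a + 'i * rc b) - l * (rc (t - a) + 'i * rc (y - b))) -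
     (u t (y + s) - f (rc a + 'i * rc b) - l * (rc (t - a) + 'i * rc (y + s - b)))).
    by apply: le_trans (cmodB _ _) _; lra.
  by rewrite !(rcB, rcD); ring.
have b2 : cmod (CI (fun t => ⟦y < t <= y + s⟧ * (u (x + s) t - u x t - l * rc s))) <= e / 2 * s * s.
  rewrite (_ : e / 2 * s * s = e / 2 * s * (y + s - y)); last by ring.
  apply: CI_itv_bound => //; first by move=> t; apply: ccontB; [exact: ccontB|exact: ccont_cst].
    by lra.
  move=> t ht; have n1 := near x t (ltac:(lra)) ht; have n2 := near (x + s) t (ltac:(lra)) ht.
  rewrite (_ : u (x + s) t - u x t - l * rc s =
     (u (x + s) t - f (rc a + 'i * rc b) - l * (rc (x + s - a) + 'i * rc (t - b))) -
     (u x t - f (rc a + 'i * rc b) - l * (rc (x - a) + 'i * rc (t - b)))).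
    by apply: le_trans (cmodB _ _) _; lra.
  by rewrite !(rcB, rcD); ring.
apply: le_trans (cmodD _ _) _; rewrite cmodM cmodi mul1r expr2; lra.
Qed.

(** Bisection for the bound by an arbitrarily small multiple of the area, which
   is additive over the quarters. *)
Lemma goursat (x y s : R) : 0 < s -> contour x y s = 0.
Proof.
move=> s0; apply/cmod_eq0/eqP; rewrite eq_le cmod_ge0 andbT; apply/ler_addgt0Pr => e e0.
rewrite add0r; pose e1 := e / s ^+ 2; have e10 : 0 < e1 by rewrite divr_gt0 // exprn_gt0.
suff : cmod (contour x y s) <= e1 * s ^+ 2 by rewrite divfK // gt_eqF // exprn_gt0.
apply: (@square_bisection R (fun x y s => cmod (contour x y s) <= e1 * s ^+ 2)) s0.
- move=> p q v v0 h1 h2 h3 h4; rewrite contour_quarter //.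
  move: h1 h2 h3 h4; rewrite (_ : (v / 2) ^+ 2 = v ^+ 2 / 4); last by field.
  move: (contour _ _ _) (contour _ _ _) (contour _ _ _) (contour _ _ _) => c1 c2 c3 c4 h1 h2 h3 h4.
  apply: le_trans (cmodD _ _) _; apply: le_trans (lerD (cmodD _ _) (lexx _)) _.
  apply: le_trans (lerD (lerD (cmodD _ _) (lexx _)) (lexx _)) _.
  by move: h1 h2 h3 h4; move: (cmod c1) (cmod c2) (cmod c3) (cmod c4) => ? ? ? ?; lra.
- by move=> a b; exact: contour_small.
Qed.

Lemma entire_bounded (r : R) : exists2 M, 0 <= M & forall z, cmod z <= r -> cmod (f z) <= M.
Proof.
have [r0|r0] := ltP r 0.
  by exists 0 => // z zr; have := cmod_ge0 z; lra.
have [M hM] : exists M, forall t t', - r <= t <= r + 1 -> - r <= t' <= r + 1 -> cmod (u t t') <= M.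
  have -> : r + 1 = - r + (2 * r + 1) by ring.
  apply: (@square_bisection R (fun x y s => exists M, forall t t', x <= t <= x + s -> y <= t' <= y + s -> cmod (u t t') <= M)); last by lra.
  - move=> x y s s0 [M1 h1] [M2 h2] [M3 h3] [M4 h4].
    exists (Num.max (Num.max M1 M2) (Num.max M3 M4)) => t t' ht ht'; rewrite !le_max.
    have [tx|xt] := leP t (x + s / 2); have [ty|yt] := leP t' (y + s / 2).
    + by rewrite h1 //; lra.
    + by rewrite h3 ?orbT //; lra.
    + by rewrite h2 ?orbT //; lra.
    + by rewrite h4 ?orbT //; lra.
  - move=> a b; have [l df] := ef (rc a + 'i * rc b).
    have [d d0 hd] := der_vanish df ltr01; exists (d / 2); first by lra.
    move=> x y s /andP[s0 sd] xa yb; exists (cmod (f (rc a + 'i * rc b)) + 1) => t t' ht ht'.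
    have hn : cmod (rc (t - a) + 'i * rc (t' - b)) < d.
      apply: le_lt_trans (cmodD _ _) _; rewrite cmodM cmodi mul1r !cmod_rc.
      suff : `|t - a| <= s /\ `|t' - b| <= s by lra.
      by split; rewrite ler_norml; lra.
    have := hd _ hn.
    rewrite (_ : rc a + 'i * rc b + _ = rc t + 'i * rc t'); last by rewrite !rcB; ring.
    by have := cmod_dist (u t t') (f (rc a + 'i * rc b)); lra.
have cu z : cmod z <= r -> cmod (f z) <= M.
  move=> zr; rewrite (cplxE z); apply: hM.
    by have := Re_le_cmod z; rewrite ler_norml; lra.
  by have := Im_le_cmod z; rewrite ler_norml; lra.
exists M => //; apply: le_trans (cmod_ge0 (f 0)) (cu 0 _); by rewrite cmod0.
Qed.

End Goursat.

Section CauchyFormula.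
Context {R : realType} (f f' : Cplx R -> Cplx R).
Hypothesis df : forall z, cder f z (f' z).
Local Notation circ := (fun t : R => cexp ('i * rc t)).
Local Notation tau := (2 * pi : R).

Lemma tau_gt0 : 0 < tau. Proof. by rewrite mulr_gt0 // pi_gt0. Qed.
Lemma cmod_circ t : cmod (circ t) = 1.
Proof. by rewrite cmod_cexp !cE mul0r mulr0 subrr expR0. Qed.
Lemma cmod_circN t : cmod (cexp (- ('i * rc t)) : Cplx R) = 1.
Proof. by rewrite cexpN cmodV cmod_circ invr1. Qed.

(** The function [f (w + e^zeta) e^(- zeta)] is entire and [2 i pi]-periodic;
   Goursat's theorem makes its integral over a period independent of the
   abscissa, and its limit at minus infinity is the derivative of [f]. *)
Let phi (w z : Cplx R) := f (w + cexp z) * cexp (- z).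
Lemma phi_entire w z : exists l, cder (phi w) z l.
Proof.
have d1 : cder (fun z => w + cexp z) z (0 + cexp z).
  by apply: derD; [exact: der_cst|exact: cder_cexp].
have d2 := der_comp (u := fun z => w + cexp z) (df (w + cexp z)) d1.
have d3 := der_comp (u := fun z => - z) (cder_cexp (- z)) (derN (cder_id z)).
by eexists; exact: (derM d2 d3).
Qed.
Lemma phi_period w x : phi w (rc x + 'i * rc tau) = phi w (rc x + 'i * rc 0).
Proof.
rewrite /phi rc0 mulr0 addr0 cexp_2pi; congr (_ * _).
by rewrite opprD cexpD !cexpN (_ : cexp ('i * rc tau) = 1) ?invr1 ?mulr1 // -[_ * _]add0r cexp_2pi cexp0.
Qed.

Let J (w : Cplx R) (x : R) := CI (fun t => ⟦0 < t <= tau⟧ * phi w (rc x + 'i * rc t)).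

Lemma J_step w x : J w (x + tau) = J w x.
Proof.
have := goursat (phi_entire w) x 0 tau_gt0; rewrite /contour add0r.
rewrite (_ : (fun t => ⟦x < t <= x + tau⟧ * phi w (rc t + 'i * rc tau)) =
             (fun t => ⟦x < t <= x + tau⟧ * phi w (rc t + 'i * rc 0))); last first.
  by apply/funext => t; rewrite phi_period.
rewrite subrr add0r => /eqP; rewrite mulf_eq0 (negbTE (neq0Ci _)) /=.
by rewrite subr_eq0 => /eqP.
Qed.
Lemma J_back w n : J w 0 = J w (- (tau * n%:R)).
Proof.
elim: n => [|n ih]; first by rewrite mulr0 oppr0.
rewrite ih -[RHS]J_step; congr J; rewrite -natr1; ring.
Qed.
Lemma CI_circN : CI (fun t => ⟦0 < t <= tau⟧ * cexp (- ('i * rc t)) : Cplx R) = 0.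
Proof.
have d1 x : rcder (fun t => 'i * cexp (- 'i * rc t) : Cplx R) x (cexp (- 'i * rc x)).
  apply: eq_der (derZ 'i (rcder_cexp (- 'i) x)) => //.
  by rewrite mulrA mulrN ii opprK mul1r.
have c1 x : ccont (fun t : R => cexp (- 'i * rc t) : Cplx R) x.
  exact: rcder_ccont (rcder_cexp (- 'i) x).
have := CI_FTC (ltW tau_gt0) d1 c1.
rewrite rc0 mulr0 cexp0 mulNr cexpN (_ : cexp ('i * rc tau) = 1) ?invr1; last first.
  by rewrite -[_ * _]add0r cexp_2pi cexp0.
rewrite subrr => <-; apply: (@CI_point _ 0).
- apply: cmeasM; first by apply: cmeas_bool; exact: measurable_itvoc.
  by apply: ccont_cmeas => x; under eq_fun do rewrite -mulNr; exact: c1.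
- apply: cmeasM; first by apply: cmeas_bool; exact: measurable_itvcc.
  exact: ccont_cmeas.
- by move=> t t0; rewrite lt_def t0 mulNr.
Qed.

(** Far to the left [cexp z] is small, so that [phi] is a difference quotient of
   [f] up to the term [f w * cexp (- z)], which integrates to zero over a
   period. *)
Lemma J_near w (e : R) : 0 < e -> exists n, cmod (J w (- (tau * n%:R)) - f' w * rc tau) <= e.
Proof.
move=> e0; have et : 0 < e / tau by rewrite divr_gt0 ?tau_gt0.
have [d d0 hd] := df w et.
have [n hn] : exists n : nat, expR (- (tau * n%:R)) < d.
  exists (Num.bound d^-1); rewrite expRN -[X in _ < X]invrK ltf_pV2 ?posrE ?invr_gt0 ?expR_gt0 //.
  have h1 : d^-1 < (Num.bound d^-1)%:R by rewrite archi_boundP // invr_ge0 ltW.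
  apply: lt_le_trans h1 _; apply: le_trans (expR_ge1Dx _).
  have := @pi_ge2 R; have : 0 <= (Num.bound d^-1)%:R :> R by []. 
  by nra.
exists n; set x := - (tau * n%:R) in hn *.
pose c := f w * rc (expR (- x)).
have cont1 t : ccont (fun t => phi w (rc x + 'i * rc t)) t by exact: (ccont_ver (phi_entire w)).
have cont2 t : ccont (fun t => c * cexp (- ('i * rc t))) t.
  under eq_fun do rewrite -mulNr.
  exact: rcder_ccont (derZ c (rcder_cexp (- 'i) t)).
have -> : J w x - f' w * rc tau =
    CI (fun t => ⟦0 < t <= tau⟧ * (phi w (rc x + 'i * rc t) - c * cexp (- ('i * rc t)) - f' w)).
  rewrite -[in LHS](subr0 tau) -CI_itv_cst ?ltW ?tau_gt0 //.
  have z0 : CI (fun t => ⟦0 < t <= tau⟧ * (c * cexp (- ('i * rc t)))) = 0.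
    rewrite (_ : (fun t => _) = (fun t => c * (⟦0 < t <= tau⟧ * cexp (- ('i * rc t))))).
      rewrite CIZ ?CI_circN ?mulr0 //; apply: ccont_cintb => t.
      under eq_fun do rewrite -mulNr; exact: rcder_ccont (rcder_cexp (- 'i) t).
    by apply/funext => t; rewrite mulrCA.
  rewrite /J -[X in X - _ = _]subr0 -z0 -CIB; try exact: ccont_cintb.
  rewrite -CIB; last 2 first.
  - by apply: cintbB; exact: ccont_cintb.
  - by apply: ccont_cintb => t; exact: ccont_cst.
  by apply: eq_CI => t; ring.
have -> : e = e / tau * (tau - 0) by rewrite subr0 divfK // gt_eqF // tau_gt0.
apply: CI_itv_bound; [|exact: ltW tau_gt0|exact: ltW|].
  by move=> t; apply: ccontB; [exact: ccontB|exact: ccont_cst].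
move=> t _; set h := cexp (rc x + 'i * rc t).
have ch : cmod h = expR x by rewrite cmod_cexp !cE mul0r mulr0 subrr addr0.
have e1 : c * cexp (- ('i * rc t)) = f w * cexp (- (rc x + 'i * rc t)).
  rewrite /c opprD [in RHS]cexpD -mulrA; congr (_ * (_ * _)).
  by apply: cplx_eq; rewrite !cE oppr0 ?cos0 ?sin0 ?mulr1 ?mulr0.
rewrite e1 /phi -/h.
rewrite (_ : _ - f' w = (f (w + h) - f w - f' w * h) * cexp (- (rc x + 'i * rc t))); last first.
  rewrite mulrBl mulrBl -(mulrA (f' w)) /h cexpN mulfV ?mulr1 //.
  exact: cexp_neq0.
rewrite cmodM cexpN cmodV -/h.
have hp : 0 < cmod h by rewrite ch expR_gt0.
by rewrite ler_pdivrMr //; apply: hd; rewrite ch.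
Qed.

(** Moving the line of integration from the imaginary axis to the left. *)
Lemma cauchy_formula w : f' w * rc tau =
  CI (fun t => ⟦0 < t <= tau⟧ * (f (w + circ t) * cexp (- ('i * rc t)))).
Proof.
have -> : CI (fun t => ⟦0 < t <= tau⟧ * (f (w + circ t) * cexp (- ('i * rc t)))) = J w 0.
  by apply: eq_CI => t; rewrite /phi rc0 add0r.
apply/eqP; rewrite eq_sym -subr_eq0; apply/eqP/cmod_eq0/eqP.
rewrite eq_le cmod_ge0 andbT; apply/ler_addgt0Pr => e e0; rewrite add0r.
by have [n hn] := J_near w e0; rewrite (J_back w n).
Qed.

End CauchyFormula.

(** * Smoothness of entire functions *)

Section EntireSmooth.
Context {R : realType}.
Implicit Types (f g : Cplx R -> Cplx R) (z w h : Cplx R).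
Local Notation circ := (fun t : R => cexp ('i * rc t)).
Local Notation tau := (2 * pi : R).

Definition has_cder f f' : Prop := forall z, cder f z (f' z).

Lemma ccont_circ (w : Cplx R) f f' (t : R) : has_cder f f' ->
  ccont (fun t => f (w + circ t) * cexp (- ('i * rc t))) t.
Proof.
move=> df.
have d1 := derD (der_cst rc w t) (rcder_cexp 'i t).
have d2 := der_comp (u := fun t => w + cexp ('i * rc t)) (df _) d1.
have := rcder_ccont (derM d2 (rcder_cexp (- 'i) t)).
by under eq_fun do rewrite mulNr.
Qed.

(** Cauchy estimates on circles of radius one: a bound for the function
   bounds the derivative, the derivative is Lipschitz, and the function is
   affine up to a quadratic error. *)
Lemma cauchy_bound f f' (r M : R) : has_cder f f' -> 0 <= M ->
  (forall z, cmod z <= r + 1 -> cmod (f z) <= M) ->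
  forall w, cmod w <= r -> cmod (f' w) <= M.
Proof.
move=> df M0 fM w wr; have t0 := @tau_gt0 R.
rewrite -(ler_pM2r t0) -[X in _ * X](gtr0_norm t0) -cmod_rc -cmodM (cauchy_formula df).
rewrite -[X in _ <= _ * X]subr0; apply: CI_itv_bound => //.
- by move=> t; exact: ccont_circ df.
- exact: ltW.
move=> t _; rewrite cmodM cmod_circN mulr1; apply: fM.
by apply: le_trans (cmodD _ _) _; rewrite cmod_circ; lra.
Qed.

Lemma segment_bound f f' (r M : R) : has_cder f f' ->
  (forall z, cmod z <= r -> cmod (f' z) <= M) ->
  forall w h, cmod w <= r -> cmod (w + h) <= r -> cmod (f (w + h) - f w) <= M * cmod h.
Proof.
move=> df fM w h wr whr.
have := @mean_value_ineq R (fun t => f (w + h * rc t)) (fun t => f' (w + h * rc t) * h) (M * cmod h).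
rewrite rc1 rc0 mulr1 mulr0 addr0; apply.
  move=> t _; have d1 := derD (der_cst rc w t) (derZ h (rcder_rc t)).
  have := der_comp (u := fun t => w + h * rc t) (df _) d1.
  by apply: eq_der => //; ring.
move=> t /andP[t0 t1]; rewrite cmodM ler_wpM2r ?cmod_ge0 //; apply: fM.
have -> : w + h * rc t = rc (1 - t) * w + rc t * (w + h) by rewrite rcB rc1; ring.
apply: le_trans (cmodD _ _) _; rewrite !cmodM !cmod_rc !ger0_norm ?subr_ge0 //.
by have := cmod_ge0 w; have := cmod_ge0 (w + h); nra.
Qed.

Lemma cauchy_lipschitz f f' (r M : R) : has_cder f f' -> 0 <= M ->
  (forall z, cmod z <= r + 2 -> cmod (f z) <= M) ->
  forall w h, cmod w <= r -> cmod (w + h) <= r -> cmod (f' (w + h) - f' w) <= M * cmod h.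
Proof.
move=> df M0 fM w h wr whr; have t0 := @tau_gt0 R.
have b1 : forall z, cmod z <= r + 1 -> cmod (f' z) <= M.
  by apply: (cauchy_bound df M0) => z zr; apply: fM; lra.
rewrite -(ler_pM2r t0) -[X in cmod _ * X](gtr0_norm t0) -cmod_rc -cmodM mulrBl.
rewrite !(cauchy_formula df) -CIB; try by apply: ccont_cintb => t; exact: ccont_circ df.
rewrite (_ : (fun t => _) = (fun t => ⟦0 < t <= tau⟧ *
    (f (w + h + circ t) * cexp (- ('i * rc t)) - f (w + circ t) * cexp (- ('i * rc t))))); last first.
  by apply/funext => t; rewrite mulrBr.
rewrite -[X in _ <= _ * X]subr0; apply: CI_itv_bound => //.
- by move=> t; apply: ccontB; exact: ccont_circ df.
- exact: ltW.
- by rewrite mulr_ge0 ?cmod_ge0.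
move=> t _; rewrite -mulrBl cmodM cmod_circN mulr1.
rewrite (_ : w + h + _ = w + circ t + h); last by ring.
apply: (segment_bound df b1).
  by apply: le_trans (cmodD _ _) _; rewrite cmod_circ; lra.
rewrite (_ : w + circ t + h = w + h + circ t); last by ring.
by apply: le_trans (cmodD _ _) _; rewrite cmod_circ; lra.
Qed.

Lemma taylor2 f f' (r M : R) : has_cder f f' -> 0 <= M ->
  (forall z, cmod z <= r + 2 -> cmod (f z) <= M) ->
  forall w h, cmod w <= r -> cmod (w + h) <= r ->
  cmod (f (w + h) - f w - f' w * h) <= M * cmod h ^+ 2.
Proof.
move=> df M0 fM w h wr whr.
have hl := cauchy_lipschitz df M0 fM.
have dg t : rcder (fun t => f (w + h * rc t) - f' w * h * rc t) t
    (f' (w + h * rc t) * h - f' w * h).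
  have d1 := derD (der_cst rc w t) (derZ h (rcder_rc t)).
  have := derB (der_comp (u := fun t => w + h * rc t) (df _) d1) (derZ (f' w * h) (rcder_rc t)).
  by apply: eq_der => //; ring.
have := @mean_value_ineq R _ _ (M * cmod h ^+ 2) (fun t _ => dg t).
rewrite rc1 rc0 !mulr1 !mulr0 addr0 subr0.
rewrite (_ : f (w + h) - f' w * h - f w = f (w + h) - f w - f' w * h); last by ring.
apply=> t /andP[t0 t1]; rewrite -mulrBl cmodM expr2 mulrA ler_wpM2r ?cmod_ge0 //.
have wt : cmod (w + h * rc t) <= r.
  have -> : w + h * rc t = rc (1 - t) * w + rc t * (w + h) by rewrite rcB rc1; ring.
  apply: le_trans (cmodD _ _) _; rewrite !cmodM !cmod_rc !ger0_norm ?subr_ge0 //.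
  by have := cmod_ge0 w; have := cmod_ge0 (w + h); nra.
apply: le_trans (hl _ _ wr wt) _; rewrite cmodM cmod_rc ger0_norm //.
by rewrite ler_wpM2l // ler_piMr ?cmod_ge0.
Qed.

Lemma quadratic_cder f z l (M : R) : 0 <= M ->
  (forall h, cmod h <= 1 -> cmod (f (z + h) - f z - l * h) <= M * cmod h ^+ 2) ->
  cder f z l.
Proof.
move=> M0 H e e0; have M1 : 0 < M + 1 by lra.
exists (Num.min 1 (e / (M + 1))); first by rewrite lt_min ltr01 divr_gt0.
move=> h; rewrite lt_min => /andP[h1]; rewrite ltr_pdivlMr // => h2.
by apply: le_trans (H h (ltW h1)) _; rewrite expr2; have := cmod_ge0 h; nra.
Qed.

Lemma has_cder_bounded f f' (r : R) : has_cder f f' ->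
  exists2 M, 0 <= M & forall z, cmod z <= r -> cmod (f z) <= M.
Proof. by move=> df; apply: entire_bounded => z; exists (f' z). Qed.

(** Cauchy's formula may be differentiated under the integral because the error
   of the first order expansion is uniformly quadratic ([taylor2]). *)
Lemma has_cder_next f f' : has_cder f f' -> exists f'', has_cder f' f''.
Proof.
move=> df; suff : forall w, exists l, cder f' w l by move=> /choice[f'' h]; exists f''.
move=> w; have t0 := @tau_gt0 R.
have [M M0 hM] := has_cder_bounded (cmod w + 5) df.
pose g t := f' (w + circ t) * cexp (- ('i * rc t)).
have cg t : ccont g t.
  have h1 : ccont (fun t : R => f' (w + circ t)) t.
    move=> e e0; have [d d0 hd] := rcder_ccont (rcder_cexp 'i t) (divr_gt0 e0 (ltr_pwDr ltr01 M0)).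
    exists d => // s sd; have /= := hd s sd; set c1 := cexp _; set c2 := cexp _ => h1.
    rewrite (_ : w + c1 = (w + c2) + (c1 - c2)); last by ring.
    apply: le_trans (cauchy_lipschitz (r := cmod w + 3) df M0 _ _ _) _.
    - by move=> z zr; apply: hM; lra.
    - by apply: le_trans (cmodD _ _) _; rewrite /c2 cmod_circ; lra.
    - rewrite (_ : w + c2 + (c1 - c2) = w + c1); last by ring.
      by apply: le_trans (cmodD _ _) _; rewrite /c1 cmod_circ; lra.
    - move: h1; rewrite ler_pdivlMr ?ltr_pwDr // => h1.
      by have := cmod_ge0 (c1 - c2); nra.
  have h2 : ccont (fun t => cexp (- ('i * rc t)) : Cplx R) t.
    under eq_fun do rewrite -mulNr; exact: rcder_ccont (rcder_cexp (- 'i) t).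
  move=> e e0; pose B := cmod (f' (w + circ t)) + 1.
  have B0 : 0 < B by rewrite ltr_wpDl ?cmod_ge0.
  have [d1 d10 k1] := h1 (e / 2) (ltac:(lra)).
  have [d2 d20 k2] := h2 (e / (2 * B)) (divr_gt0 e0 (mulr_gt0 (ltr0Sn R 1) B0)).
  exists (Num.min d1 d2); first by rewrite lt_min d10.
  move=> s; rewrite lt_min => /andP[/k1 j1 /k2 j2]; rewrite /g.
  set a1 := f' _ in j1 *; set a2 := f' _ in j1 B B0 k2 j2 *.
  set b1 := cexp _ in j2 *; set b2 := cexp _ in j2 *.
  rewrite (_ : a1 * b1 - a2 * b2 = (a1 - a2) * b1 + a2 * (b1 - b2)); last by ring.
  apply: le_trans (cmodD _ _) _; rewrite !cmodM {1}/b1 cmod_circN mulr1.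
  have : cmod a2 * cmod (b1 - b2) <= B * (e / (2 * B)).
    by apply: ler_pM; rewrite ?cmod_ge0 // /B lerDl.
  rewrite (_ : B * (e / (2 * B)) = e / 2); last by field; rewrite gt_eqF.
  lra.
exists (CI (fun t => ⟦0 < t <= tau⟧ * g t) / rc tau).
have rt0 : rc tau != 0 by apply/eqP => /(congr1 (@complex.Re R)) /= /eqP; rewrite gt_eqF.
apply: (@quadratic_cder _ _ _ M) => // h h1.
rewrite -(ler_pM2r t0) -[X in cmod _ * X](gtr0_norm t0) -cmod_rc -cmodM 2!mulrBl.
rewrite !(cauchy_formula df) (mulrAC _ h) divfK //.
have jc z : cintb (fun t => ⟦0 < t <= tau⟧ * (f (z + circ t) * cexp (- ('i * rc t)))).
  by apply: ccont_cintb => t; exact: ccont_circ df.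
have jg : cintb (fun t => ⟦0 < t <= tau⟧ * g t) by exact: ccont_cintb.
rewrite [CI _ * h]mulrC -CIZ // -CIB // -CIB; [|exact: cintbB|exact: cintbZ].
rewrite (_ : (fun t => _) = (fun t => ⟦0 < t <= tau⟧ *
    (f (w + h + circ t) * cexp (- ('i * rc t)) - f (w + circ t) * cexp (- ('i * rc t)) - h * g t))); last first.
  by apply/funext => t; ring.
rewrite -[X in _ <= _ * X]subr0; apply: CI_itv_bound => //.
- move=> t; apply: ccontB; first by apply: ccontB; exact: ccont_circ df.
  by move=> e e0; have [d d0 hd] := cg t (e / (cmod h + 1)) (divr_gt0 e0 (ltr_wpDl (cmod_ge0 h) ltr01));
    exists d => // s /hd; rewrite -mulrBr cmodM ler_pdivlMr ?ltr_wpDl ?cmod_ge0 //;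
    have := cmod_ge0 h; have := cmod_ge0 (g (t + s) - g t); nra.
- exact: ltW.
- by rewrite mulr_ge0 ?exprn_ge0 ?cmod_ge0.
move=> t _; rewrite /g.
rewrite (_ : _ - h * _ = (f (w + circ t + h) - f (w + circ t) - f' (w + circ t) * h) * cexp (- ('i * rc t))); last first.
  by rewrite (_ : w + h + _ = w + circ t + h); ring.
rewrite cmodM cmod_circN mulr1.
apply: (taylor2 (r := cmod w + 3) df M0).
- by move=> z zr; apply: hM; lra.
- by apply: le_trans (cmodD _ _) _; rewrite cmod_circ; lra.
- apply: le_trans (cmodD _ _) _; apply: le_trans (lerD (cmodD _ _) (lexx _)) _.
  by rewrite cmod_circ; lra.
Qed.

Lemma entire_has_cder f : entire f -> has_cder f (derive1 f).
Proof. by move=> ef z; exact: derive_cder. Qed.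
Lemma has_cder_derive f f' : has_cder f f' -> derive1 f = f'.
Proof. by move=> df; apply/funext => z; have [] := cder_derive (df z). Qed.
Lemma has_cder_entire f f' : has_cder f f' -> entire f.
Proof. by move=> df z; have [] := cder_derive (df z). Qed.
Lemma entire_derive1 f : entire f -> entire (derive1 f).
Proof.
by move=> /entire_has_cder /has_cder_next[f'' h]; exact: has_cder_entire h.
Qed.
Lemma entire_derive1n f n : entire f -> entire (derive1n n f).
Proof.
move=> ef; elim: n => [|n ih]; first by rewrite derive1n0.
by rewrite derive1nS; exact: entire_derive1.
Qed.

Lemma entireD f g : entire f -> entire g -> entire (fun z => f z + g z).
Proof.
move=> /entire_has_cder df /entire_has_cder dg.
by apply: (@has_cder_entire _ (fun z => derive1 f z + derive1 g z)) => z; exact: derD.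
Qed.
Lemma entireM f g : entire f -> entire g -> entire (fun z => f z * g z).
Proof.
move=> /entire_has_cder df /entire_has_cder dg.
by apply: (@has_cder_entire _ (fun z => derive1 f z * g z + f z * derive1 g z)) => z; exact: derM.
Qed.
Lemma entire_cst (c : Cplx R) : entire (fun=> c).
Proof. by apply: (@has_cder_entire _ (fun=> 0)) => z; exact: der_cst. Qed.
Lemma entire_id : entire (fun z : Cplx R => z).
Proof. by apply: (@has_cder_entire _ (fun=> 1)) => z; exact: cder_id. Qed.
Lemma entireN f : entire f -> entire (fun z => - f z).
Proof.
move=> /entire_has_cder df.
by apply: (@has_cder_entire _ (fun z => - derive1 f z)) => z; exact: derN.
Qed.

Lemma derive1nD f g n : entire f -> entire g ->
  derive1n n (fun z => f z + g z) = (fun z => derive1n n f z + derive1n n g z).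
Proof.
move=> ef eg; elim: n => [|n ih]; first by rewrite !derive1n0.
rewrite !derive1nS ih; apply: has_cder_derive => z; apply: derD.
  exact: (entire_has_cder (@entire_derive1n f n ef)).
exact: (entire_has_cder (@entire_derive1n g n eg)).
Qed.
Lemma derive1nZ f (c : Cplx R) n : entire f ->
  derive1n n (fun z => c * f z) = (fun z => c * derive1n n f z).
Proof.
move=> ef; elim: n => [|n ih]; first by rewrite !derive1n0.
rewrite !derive1nS ih; apply: has_cder_derive => z; apply: derZ.
exact: (entire_has_cder (@entire_derive1n f n ef)).
Qed.
Lemma derive1n_idM f n : entire f ->
  derive1n n.+1 (fun z => z * f z) =
  (fun z => z * derive1n n.+1 f z + n.+1%:R * derive1n n f z).
Proof.
move=> ef; elim: n => [|n ih].
  rewrite !derive1n1 derive1n0; apply: has_cder_derive => z.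
  apply: (eq_der _ _ (derM (cder_id z) (entire_has_cder ef z))) => [y|]; first by [].
  by move: (derive1 f z) (f z) => a b; ring.
rewrite [LHS]derive1nS ih; apply: has_cder_derive => z.
have d1 := derM (cder_id z) (entire_has_cder (@entire_derive1n f n.+1 ef) z).
have d2 := derZ n.+1%:R (entire_has_cder (@entire_derive1n f n ef) z).
apply: (eq_der _ _ (derD d1 d2)) => [y|]; first by [].
rewrite -!derive1nS; move: (derive1n n.+2 f z) (derive1n n.+1 f z) => a b.
by rewrite -[n.+2%:R]natr1; move: (n.+1%:R : Cplx R) => k; ring.
Qed.

End EntireSmooth.

(** * Families of entire functions depending on a real parameter *)

Section Families.
Context {R : realType}.
Implicit Types (F : R -> Cplx R -> Cplx R) (b : R -> Cplx R).

(** The families that may be integrated against a density of bounded support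
   and then differentiated under the integral any number of times. *)
Definition Fam F : Prop :=
  [/\ forall t, entire (F t), forall z, cmeas (F ^~ z) &
      forall r : R, exists2 M, 0 <= M &
        forall t z, `|t| <= r -> cmod z <= r -> cmod (F t z) <= M].

Lemma Fam_derive F : Fam F -> Fam (fun t => derive1 (F t)).
Proof.
move=> [eF mF bF]; have dF t := entire_has_cder (eF t).
split=> [t|z|r]; first exact: entire_derive1.
- pose u n t := (n.+1%:R : Cplx R) * (F t (z + rc n.+1%:R^-1) - F t z).
  apply: (@cmeas_lim _ _ _ u) => [n|t e e0].
    by apply: cmeasM; [exact: cmeas_cst|apply: cmeasB; exact: mF].
  have [d d0 hd] := dF t z (e / 2) (ltac:(lra)).
  exists (Num.bound d^-1) => n Nn.
  have n0 : 0 < n.+1%:R :> R by [].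
  have small_n : n.+1%:R^-1 < d.
    rewrite -[X in _ < X]invrK ltf_pV2 ?posrE ?invr_gt0 //.
    apply: lt_le_trans (archi_boundP (ltW _)) _; first by rewrite invr_gt0.
    by rewrite ler_nat (leq_trans Nn).
  have := hd (rc n.+1%:R^-1); rewrite cmod_rc gtr0_norm ?invr_gt0 // => /(_ small_n).
  rewrite ler_pdivlMr // -[X in _ * X](gtr0_norm n0) -cmod_rc -cmodM => h.
  apply: le_lt_trans (_ : e / 2 < e); last by lra.
  rewrite (_ : u n t - _ = (F t (z + rc n.+1%:R^-1) - F t z - derive1 (F t) z * rc n.+1%:R^-1) * rc n.+1%:R) //.
  rewrite /u -rc_nat [in RHS]mulrBl -(mulrA _ (rc _) (rc _)) -rcM mulVf ?gt_eqF // rc1 mulr1.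
  by rewrite mulrC.
- have [M M0 hM] := bF (r + 1); exists M => // t z tr zr.
  apply: (cauchy_bound (dF t) M0 _ zr) => w wr; apply: hM => //; lra.
Qed.
Lemma Fam_derive1n F n : Fam F -> Fam (fun t => derive1n n (F t)).
Proof.
move=> hF; elim: n => [|n ih].
  by rewrite (_ : (fun t => _) = F) //; apply/funext => t; rewrite derive1n0.
rewrite (_ : (fun t => _) = (fun t => derive1 (derive1n n (F t)))); first exact: Fam_derive.
by apply/funext => t; rewrite derive1nS.
Qed.
Lemma FamM F f : entire f -> Fam F -> Fam (fun t z => f z * F t z).
Proof.
move=> ef [eF mF bF]; split=> [t|z|r].
- exact: (entireM ef (eF t)).
- by apply: cmeasM => //; exact: cmeas_cst.
- have [M1 M10 h1] := has_cder_bounded r (entire_has_cder ef).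
  have [M2 M20 h2] := bF r; exists (M1 * M2); first exact: mulr_ge0.
  move=> t z tr zr; rewrite cmodM; apply: ler_pM; rewrite ?cmod_ge0 //; [exact: h1|exact: h2].
Qed.
Lemma Fam_affine F (a k : R) : Fam F -> Fam (fun t => F (a + k * t)).
Proof.
move=> [eF mF bF]; split=> [t|z|r]; first exact: eF.
- exact: (@cmeas_affine R a k (F ^~ z) (mF z)).
- have [M M0 hM] := bF (`|a| + `|k| * `|r| + `|r|); exists M => // t z tr zr; apply: hM.
    apply: le_trans (ler_normD _ _) _; rewrite normrM.
    have := ler_norm r; have := normr_ge0 r; have := normr_ge0 k; have := normr_ge0 t; nra.
  have := ler_norm r; have := normr_ge0 r; have := normr_ge0 k; have := normr_ge0 a; nra.
Qed.

Section FamIntegral.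
Variables (b : R -> Cplx R) (T : R).
Hypothesis jb : cintb b.
Hypothesis b0 : forall t, T < `|t| -> b t = 0.

Lemma Fam_cintb F z : Fam F -> cintb (fun t => b t * F t z).
Proof.
move=> [eF mF bF]; have [M M0 hM] := bF (Num.max T (cmod z)).
have [mb rb] := jb.
apply: (cintb_dom (cmeasM mb (mF z)) _ (rintZ M rb)) => t.
rewrite cmodM mulrC; have [Tt|tT] := ltP T `|t|.
  by rewrite b0 // cmod0 !mulr0.
by rewrite ler_wpM2r ?cmod_ge0 //; apply: hM; rewrite le_max ?tT ?lexx ?orbT.
Qed.
(** The error in [taylor2] is uniform in [t], hence integrable. *)
Lemma Fam_int F : Fam F ->
  has_cder (fun z => CI (fun t => b t * F t z)) (fun z => CI (fun t => b t * derive1 (F t) z)).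
Proof.
move=> hF z; have [eF mF bF] := hF; have [mb rb] := jb.
have [M M0 hM] := bF (Num.max T (cmod z + 3)).
have hF' := Fam_derive hF.
have I0 : 0 <= IR (fun t => cmod (b t)) by apply: IR_ge0 => t; exact: cmod_ge0.
apply: (@quadratic_cder _ _ _ _ (M * IR (fun t => cmod (b t)))); first exact: mulr_ge0.
move=> h h1.
have j1 := Fam_cintb (z + h) hF; have j2 := Fam_cintb z hF; have j3 := Fam_cintb z hF'.
rewrite mulrC -CIZ // -CIB // -CIB; [|exact: cintbB|exact: cintbZ].
rewrite mulrAC -IRZ //; apply: CI_le; [|exact: rintZ|].
  by apply: cintbB; [exact: cintbB|exact: cintbZ].
move=> t; rewrite (_ : _ - h * _ = b t * (F t (z + h) - F t z - derive1 (F t) z * h)); last by ring.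
rewrite cmodM mulrC; have [Tt|tT] := ltP T `|t|.
  by rewrite b0 // cmod0 !mulr0.
rewrite ler_wpM2r ?cmod_ge0 //.
apply: (taylor2 (r := cmod z + 1) (entire_has_cder (eF t)) M0).
- by move=> w wr; apply: hM; rewrite le_max ?tT //; apply/orP; right; lra.
- by lra.
- by apply: le_trans (cmodD _ _) _; lra.
Qed.
Lemma Fam_int_entire F : Fam F -> entire (fun z => CI (fun t => b t * F t z)).
Proof. by move=> hF; exact: has_cder_entire (Fam_int hF). Qed.
End FamIntegral.

Lemma Fam_int_derive1n F b (T : R) n : cintb b -> (forall t, T < `|t| -> b t = 0) -> Fam F ->
  derive1n n (fun z => CI (fun t => b t * F t z)) =
  (fun z => CI (fun t => b t * derive1n n (F t) z)).
Proof.
move=> jb b0 hF; elim: n => [|n ih].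
  by rewrite derive1n0; apply/funext => z; apply: eq_CI => t; rewrite derive1n0.
rewrite derive1nS ih (has_cder_derive (Fam_int jb b0 (Fam_derive1n n hF))).
by apply/funext => z; apply: eq_CI => t; rewrite derive1nS.
Qed.

End Families.

(** * The functions cos (sqrt l x) and sin (sqrt l x) / sqrt l *)

Section Trigonometric.
Context {R : realType}.
Implicit Types (x y t : R) (l z k : Cplx R).

(** Away from zero the principal root may be replaced by the branch closest to
   the root at the point, since [g] is even; at zero the derivative of [g]
   vanishes. *)
Lemma even_entire_sqrt (g : Cplx R -> Cplx R) : entire g -> (forall k, g (- k) = g k) ->
  entire (fun l => g (sqrtC l)).
Proof.
move=> eg even; have dg := entire_has_cder eg; have dg' := entire_has_cder (entire_derive1 eg).
suff : forall l, exists m, cder (fun l => g (sqrtC l)) l m.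
  by move=> /choice[m hm]; exact: has_cder_entire hm.
move=> l0; set k0 := sqrtC l0.
have kk l : sqrtC l ^+ 2 = l by exact: sqrtCK.
have [l00|l00] := eqVneq l0 0.
  (* at the branch point, Taylor expansion of order two of an even function *)
  have g'0 : derive1 g 0 = 0.
    have h1 := dg 0; have h2 : cder g 0 (- derive1 g 0).
      have h2 : cder g (- 0) (derive1 g 0) by rewrite oppr0.
      have := der_comp (u := fun k => - k) h2 (derN (cder_id 0)).
      by apply: eq_der => [k|]; [rewrite even|rewrite mulrN mulr1].
    have /eqP := cder_uniq h1 h2; rewrite -subr_eq0 opprK -mulr2n mulrn_eq0 /=.
    by move=> /eqP.
  set c := derive1 (derive1 g) 0.
  have [M M0 hM] := has_cder_bounded 3 dg'.
  pose G k := g k - c / 2 * (k * k).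
  have dG k : cder G k (derive1 g k - c * k).
    apply: eq_der (derB (dg k) (derZ (c / 2) (derM (cder_id k) (cder_id k)))) => //.
    by field.
  have bG (r : R) : 0 <= r -> r <= 1 -> forall k, cmod k <= r -> cmod (derive1 g k - c * k) <= M * r ^+ 2.
    move=> r0 r1 k kr; have := taylor2 (r := 1) dg' M0 _ (w := 0) (h := k).
    rewrite add0r g'0 subr0 cmod0 => /(_ _ ler01 (le_trans kr r1)) H.
    apply: le_trans (H _) _; first by move=> z zr; apply: hM; lra.
    by rewrite ler_wpM2l // ler_sqr ?nnegrE ?cmod_ge0.
  exists (c / 2) => e e0.
  have M1 : 0 < M + 1 by lra.
  exists (Num.min 1 ((e / (M + 1)) ^+ 2)); first by rewrite lt_min ltr01 exprn_gt0 // divr_gt0.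
  move=> l; rewrite lt_min => /andP[l1 l2].
  rewrite l00 add0r; set k := sqrtC l; rewrite (_ : sqrtC 0 = 0); last by rewrite sqrtC0.
  have ck : cmod k ^+ 2 = cmod l by rewrite -cmodX kk.
  have k1 : cmod k <= 1 by rewrite -(@ler_sqr R) ?nnegrE ?cmod_ge0 // ck expr1n ltW.
  have ke : cmod k < e / (M + 1) by rewrite -(@ltr_sqr R) ?nnegrE ?cmod_ge0 ?ck // divr_ge0 // ltW.
  have := segment_bound dG (bG _ (cmod_ge0 k) k1) (w := 0) (h := k).
  rewrite add0r cmod0 => /(_ (cmod_ge0 k) (lexx _)).
  rewrite /G mulr0 mulr0 subr0 (_ : g k - _ - g 0 = g k - g 0 - c / 2 * l); last first.
    by rewrite -[in RHS](kk l) expr2 -/k; ring.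
  move=> /le_trans; apply; rewrite ck mulrAC mulrC [cmod l * _]mulrC ler_wpM2r ?cmod_ge0 //.
  by move: ke; rewrite ltr_pdivlMr // => ke; have := cmod_ge0 k; nra.
(* away from it, the branch closest to sqrt l0 is Lipschitz *)
have k00 : k0 != 0 by rewrite sqrtC_eq0.
have ck0 : 0 < cmod k0 by exact: cmod_gt0.
have [M M0 hM] := has_cder_bounded (cmod k0 + (cmod k0)^-1 + 2) dg.
exists (derive1 g k0 / (2 * k0)).
pose D := M + cmod (derive1 g k0 / (2 * k0)).
apply: (@quadratic_cder _ _ _ _ (D / cmod k0 ^+ 2)).
  by rewrite divr_ge0 ?addr_ge0 ?cmod_ge0 // sqr_ge0.
move=> h h1.
have [k [kl kg kc]] : exists k, [/\ k ^+ 2 = l0 + h, g (sqrtC (l0 + h)) = g k & cmod (k - k0) <= cmod (k + k0)].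
  have [c|/ltW c] := leP (cmod (sqrtC (l0 + h) - k0)) (cmod (sqrtC (l0 + h) + k0)).
    by exists (sqrtC (l0 + h)).
  exists (- sqrtC (l0 + h)); rewrite sqrrN kk even; split => //.
  by rewrite -opprD cmodN (_ : - _ + k0 = - (sqrtC (l0 + h) - k0)) ?cmodN //; ring.
rewrite kg -/k0.
have hk : h = (k - k0) * (k + k0).
  by rewrite -subr_sqr kl /k0 kk; ring.
have kk0 : cmod k0 <= cmod (k + k0).
  have := cmodB (k + k0) (k - k0); rewrite (_ : k + k0 - (k - k0) = 2 * k0); last by ring.
  by rewrite cmodM cmod_nat; lra.
have dk : cmod (k - k0) <= cmod h / cmod k0.
  by rewrite ler_pdivlMr // hk cmodM ler_wpM2l ?cmod_ge0.
have dk1 : cmod (k - k0) <= (cmod k0)^-1.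
  by apply: le_trans dk _; rewrite ler_pdivrMr // mulVf ?gt_eqF.
rewrite (_ : g k - g k0 - _ = (g (k0 + (k - k0)) - g k0 - derive1 g k0 * (k - k0)) -
    derive1 g k0 / (2 * k0) * (k - k0) ^+ 2); last first.
  by rewrite subrKC hk; field.
apply: le_trans (cmodB _ _) _.
have t2 := taylor2 (r := cmod k0 + (cmod k0)^-1) dg M0 hM (w := k0) (h := k - k0).
apply: (@le_trans _ _ (D * cmod (k - k0) ^+ 2)).
  rewrite (cmodM (derive1 g k0 / _)) cmodX [leRHS]mulrDl; apply: lerD => //; apply: t2.
    by rewrite lerDl invr_ge0 ltW.
  by apply: le_trans (cmodD _ _) _; rewrite lerD2l.
rewrite mulrAC -mulrA -expr_div_n ler_wpM2l ?addr_ge0 ?cmod_ge0 //.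
by rewrite ler_sqr ?nnegrE ?cmod_ge0 // divr_ge0 ?cmod_ge0.
Qed.

Definition sinc x l : Cplx R :=
  if l == 0 then rc x else csin (sqrtC l * rc x) / sqrtC l.

Lemma c_funE x l : c_fun x l = (cexp ('i * sqrtC l * rc x) + cexp (- ('i * sqrtC l) * rc x)) / 2.
Proof. by rewrite /c_fun /ccos -/(rc x) !mulrA mulNr. Qed.
Lemma csinE x l : csin (sqrtC l * rc x) = (cexp ('i * sqrtC l * rc x) - cexp (- ('i * sqrtC l) * rc x)) / (2 * 'i).
Proof. by rewrite /csin !mulrA mulNr. Qed.
Lemma sqrtC_sqr l : sqrtC l * sqrtC l = l.
Proof. by rewrite -expr2 sqrtCK. Qed.

Lemma s_funE x l : s_fun x l = l * sinc x l.
Proof.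
rewrite /s_fun /sinc -/(rc x); have [->|l0] := eqVneq l 0; first by rewrite sqrtC0 !mul0r.
have k0 : sqrtC l != 0 by rewrite sqrtC_eq0.
by rewrite -[X in _ = X * _](sqrtC_sqr l); move: (csin _) => a; field.
Qed.

Lemma c_fun_at0 l : c_fun 0 l = 1 :> Cplx R.
Proof. by rewrite c_funE rc0 !mulr0 cexp0; field. Qed.
Lemma sinc_at0 l : sinc 0 l = 0 :> Cplx R.
Proof.
by rewrite /sinc csinE rc0 !mulr0 cexp0 subrr !mul0r if_same.
Qed.
Lemma c_funN x l : c_fun (- x) l = c_fun x l.
Proof. by rewrite !c_funE rcN !mulrN !mulNr opprK addrC. Qed.
Lemma sincN x l : sinc (- x) l = - sinc x l.
Proof.
rewrite /sinc; case: ifP => _; first by rewrite rcN.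
rewrite !csinE rcN !mulrN !mulNr opprK.
by move: (cexp _) (cexp _) ((2 * 'i)^-1) ((sqrtC l)^-1) => E G a b; ring.
Qed.
Lemma cexp_split k x y : cexp (k * rc (x + y)) = cexp (k * rc x) * cexp (k * rc y).
Proof. by rewrite rcD mulrDr cexpD. Qed.

Lemma i_neq0 : ('i : Cplx R) != 0. Proof. exact: neq0Ci. Qed.

Lemma c_funD x y l : c_fun (x + y) l = c_fun x l * c_fun y l - l * (sinc x l * sinc y l).
Proof.
have [->|l0] := eqVneq l 0.
  by rewrite !c_funE sqrtC0 mulr0 oppr0 !mul0r cexp0; field.
rewrite /sinc (negbTE l0) !c_funE !csinE !cexp_split.
have k0 : sqrtC l != 0 by rewrite sqrtC_eq0.
rewrite -[X in _ - X * _](sqrtC_sqr l).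
move: (cexp ('i * _ * rc x)) (cexp (- ('i * _) * rc x)) => E E'.
move: (cexp ('i * _ * rc y)) (cexp (- ('i * _) * rc y)) => G G'.
move: (sqrtC l) k0 => k k0.
rewrite (_ : k * k * _ = (E - E') * (G - G') / (4 * ('i * 'i))); last by field; rewrite k0 i_neq0.
by rewrite ii; field.
Qed.
Lemma sincD x y l : sinc (x + y) l = sinc x l * c_fun y l + c_fun x l * sinc y l.
Proof.
have [->|l0] := eqVneq l 0.
  by rewrite /sinc eqxx !c_funE sqrtC0 mulr0 oppr0 !mul0r cexp0 rcD; field.
rewrite /sinc (negbTE l0) !c_funE !csinE !cexp_split.
have k0 : sqrtC l != 0 by rewrite sqrtC_eq0.
move: (cexp ('i * _ * rc x)) (cexp (- ('i * _) * rc x)) => E E'.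
move: (cexp ('i * _ * rc y)) (cexp (- ('i * _) * rc y)) => G G'.
move: (sqrtC l) k0 => k k0.
by field; rewrite k0 i_neq0.
Qed.

Lemma rcder_c_fun x l : rcder (fun t => c_fun t l) x (- (l * sinc x l)).
Proof.
have d1 := rcder_cexp ('i * sqrtC l) x; have d2 := rcder_cexp (- ('i * sqrtC l)) x.
have := derZ (2^-1) (derD d1 d2); apply: eq_der => [t|].
  by rewrite c_funE mulrC.
rewrite -s_funE /s_fun -/(rc x) csinE.
move: (cexp _) (cexp _) => E E'.
by rewrite invfM invCi; ring.
Qed.
Lemma rcder_sinc x l : rcder (fun t => sinc t l) x (c_fun x l).
Proof.
have [->|l0] := eqVneq l 0.
  apply: eq_der (rcder_rc x) => [t|]; first by rewrite /sinc eqxx.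
  by rewrite c_funE sqrtC0 mulr0 oppr0 !mul0r cexp0; field.
have k0 : sqrtC l != 0 by rewrite sqrtC_eq0.
have d1 := rcder_cexp ('i * sqrtC l) x; have d2 := rcder_cexp (- ('i * sqrtC l)) x.
have := derZ ((2 * 'i * sqrtC l)^-1) (derB d1 d2); apply: eq_der => [t|].
  by rewrite /sinc (negbTE l0) csinE; field; rewrite k0 i_neq0.
rewrite c_funE; move: (cexp _) (cexp _) => E E'.
by field; rewrite k0 i_neq0.
Qed.
Lemma ccont_c_fun x l : ccont (fun t => c_fun t l) x.
Proof. exact: rcder_ccont (rcder_c_fun x l). Qed.
Lemma ccont_sinc x l : ccont (fun t => sinc t l) x.
Proof. exact: rcder_ccont (rcder_sinc x l). Qed.

Lemma entire_c_fun x : entire (fun l => c_fun x l).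
Proof.
apply: (@even_entire_sqrt (fun k => ccos (k * rc x))).
  apply: (@has_cder_entire _ _ (fun k => ('i * rc x * cexp ('i * rc x * k) - 'i * rc x * cexp (- ('i * rc x) * k)) / 2)) => k.
  have d1 := der_comp (u := fun k => 'i * rc x * k) (cder_cexp _) (derZ ('i * rc x) (cder_id k)).
  have d2 := der_comp (u := fun k => - ('i * rc x) * k) (cder_cexp _) (derZ (- ('i * rc x)) (cder_id k)).
  have := derZ (2^-1) (derD d1 d2); apply: eq_der => [h|]; last first.
    by move: (cexp _) (cexp _) => E E'; ring.
  rewrite /ccos mulrC; congr (_ / _); rewrite mulNr.
  by congr (cexp _ + cexp _); ring.
by move=> k; rewrite /ccos mulNr mulrN opprK addrC.
Qed.

Lemma cmod_c_fun (r : R) x l : `|x| <= r -> cmod l <= r -> cmod (c_fun x l) <= expR ((r + 1) * r).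
Proof.
move=> xr lr; have r0 : 0 <= r by apply: le_trans xr.
have kr : cmod (sqrtC l) <= r + 1.
  rewrite -(@ler_sqr R) ?nnegrE ?cmod_ge0 ?addr_ge0 // -cmodX sqrtCK.
  by apply: le_trans lr _; rewrite sqrrD1; have := sqr_ge0 r; lra.
have b k : cmod k <= r + 1 -> cmod (cexp (k * rc x)) <= expR ((r + 1) * r).
  move=> hk; rewrite cmod_cexp ler_expR; apply: le_trans (ler_norm _) _.
  apply: le_trans (Re_le_cmod _) _; rewrite cmodM cmod_rc.
  by apply: ler_pM; rewrite ?cmod_ge0.
rewrite c_funE cmodM cmodV cmod_nat ler_pdivrMr //.
apply: le_trans (cmodD _ _) _.
have := b ('i * sqrtC l); have := b (- ('i * sqrtC l)); rewrite cmodN cmodM cmodi mul1r.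
by move=> /(_ kr) h1 /(_ kr) h2; lra.
Qed.

Lemma Fam_c_fun : Fam (@c_fun R).
Proof.
split=> [t|z|r]; first exact: entire_c_fun.
  by apply: ccont_cmeas => x; exact: ccont_c_fun.
exists (expR ((r + 1) * r)); first exact: expR_ge0.
by move=> t z; exact: cmod_c_fun.
Qed.

Lemma CI_c_fun (a b : R) l : a <= b ->
  CI (fun t => ⟦a <= t <= b⟧ * c_fun t l) = sinc b l - sinc a l.
Proof.
move=> ab; apply: (@CI_FTC R (fun t => sinc t l) (fun t => c_fun t l)) => // x.
  exact: rcder_sinc.
exact: ccont_c_fun.
Qed.

Lemma cmod_sinc (r : R) x l : `|x| <= r -> cmod l <= r -> cmod (sinc x l) <= expR ((r + 1) * r) * r.
Proof.
wlog x0 : x / 0 <= x.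
  move=> H xr lr; have [x0|/ltW x0] := leP 0 x; first exact: H.
  by have := H (- x); rewrite sincN cmodN normrN oppr_ge0; exact.
rewrite (ger0_norm x0) => xr lr; have r0 : 0 <= r by apply: le_trans xr.
have := CI_c_fun l x0; rewrite sinc_at0 subr0 => <-.
apply: (@le_trans _ _ (expR ((r + 1) * r) * (x - 0))); last first.
  by rewrite subr0 ler_wpM2l ?expR_ge0.
rewrite -IR_itv // -IRZ; last exact: rint_itvcc.
have jI : cintb (fun t => ⟦0 <= t <= x⟧ * c_fun t l).
  apply: (cintb_dom _ _ (rint_itv 0 x (expR ((r + 1) * r)))).
    by apply: cmeasM; [apply: cmeas_bool; exact: measurable_itvcc|apply: ccont_cmeas => t; exact: ccont_c_fun].
  move=> t; rewrite cmodM cmod_bool; have [/andP[t0 tx]|_] := boolP (0 <= t <= x).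
    by rewrite mul1r mulr1; apply: cmod_c_fun => //; rewrite ger0_norm //; lra.
  by rewrite mul0r mulr0.
apply: CI_le => //; first exact: rint_itv.
move=> t; rewrite cmodM cmod_bool; have [/andP[t0 tx]|_] := boolP (0 <= t <= x).
  by rewrite mul1r mulr1; apply: cmod_c_fun => //; rewrite ger0_norm //; lra.
by rewrite mul0r mulr0.
Qed.

(** As a primitive of [c_fun] in [x], [sinc] inherits its dependence on [l]. *)
Lemma Fam_sinc : Fam sinc.
Proof.
split=> [x|z|r].
- have pos t : 0 <= t -> entire (sinc t).
    move=> t0; have jb : cintb (fun u : R => ⟦0 <= u <= t⟧ : Cplx R).
      apply: (cintb_dom _ _ (rint_itvcc 0 t)).
        by apply: cmeas_bool; exact: measurable_itvcc.
      by move=> u; rewrite cmod_bool.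
    have := @Fam_int_entire R _ t jb _ _ Fam_c_fun.
    rewrite (_ : (fun z => _) = sinc t).
      apply=> u ut; suff -> : (0 <= u <= t) = false by [].
      by apply/negP => /andP[u0 ut']; move: ut; rewrite ger0_norm // ltNge ut'.
    by apply/funext => l; rewrite CI_c_fun // sinc_at0 subr0.
  have [x0|/ltW x0] := leP 0 x; first exact: pos.
  rewrite (_ : sinc x = fun l => - sinc (- x) l); last by apply/funext => l; rewrite sincN opprK.
  by apply: entireN; apply: pos; rewrite oppr_ge0.
- by apply: ccont_cmeas => x; exact: ccont_sinc.
- exists (expR ((`|r| + 1) * `|r|) * `|r|); first by rewrite mulr_ge0 ?expR_ge0.
  by move=> t z tr zr; apply: cmod_sinc; apply: le_trans (ler_norm r).
Qed.

Lemma Fam_s_fun : Fam (@s_fun R).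
Proof.
rewrite (_ : @s_fun R = fun t l => l * sinc t l).
  by apply: FamM; [exact: entire_id|exact: Fam_sinc].
by apply/funext => t; apply/funext => l; exact: s_funE.
Qed.

End Trigonometric.

(** * The transformation kernel of a potential *)

Section MeasTac.
Context {R : realType}.
Context d (T : measurableType d).
Lemma cmeas_comp2 (A : R * R -> Cplx R) (f g : T -> R) : cmeas A ->
  measurable_fun setT f -> measurable_fun setT g -> cmeas (fun q => A (f q, g q)).
Proof. by move=> mA mf mg; apply: (cmeas_comp mA); exact: measurable_fun_pair. Qed.
Lemma cmeas_comp1 (p : R -> Cplx R) (f : T -> R) : cmeas p ->
  measurable_fun setT f -> cmeas (fun q => p (f q)).
Proof. by move=> mp mf; exact: (cmeas_comp mp mf). Qed.
End MeasTac.

(** Measurability of the integrands below is decided by their syntax. *)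
Ltac meas_real := repeat first
  [ assumption
  | match goal with
    | |- measurable_fun _ (fun _ => ?c) => exact: measurable_cst
    | |- measurable_fun _ (fun q => q) => exact: measurable_id
    | |- measurable_fun _ fst => exact: measurable_fst
    | |- measurable_fun _ snd => exact: measurable_snd
    | |- measurable_fun _ (fun q => q.1) => exact: measurable_fst
    | |- measurable_fun _ (fun q => q.2) => exact: measurable_snd
    | |- measurable_fun _ (fun q => (@?f q).1) => apply: (measurableT_comp measurable_fst)
    | |- measurable_fun _ (fun q => (@?f q).2) => apply: (measurableT_comp measurable_snd)
    end
  | apply: measurable_funB | apply: measurable_funD ].
Ltac meas_bool := repeat first
  [ apply: measurable_and | apply: measurable_fun_ler | apply: measurable_fun_ltr ]; meas_real.
Ltac meas := repeat match goal with
  | H : cmeas ?A |- cmeas ?A => exact: H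
  | |- cmeas (fun _ => ?c) => exact: cmeas_cst
  | |- cmeas (fun q => CI (fun t => @?b q t)) => apply: (@cmeas_CI _ _ _ (fun z => b z.1 z.2))
  | |- cmeas (fun q => (nat_of_bool (@?b q))%:R) => apply: cmeas_bool; meas_bool
  | H : cmeas ?A |- cmeas (fun q => ?A (@?f q, @?g q)) => apply: (cmeas_comp2 H); meas_real
  | H : cmeas ?A |- cmeas (fun q => ?A (@?f q)) => apply: (cmeas_comp1 H); meas_real
  | |- cmeas (fun q => @?f q * @?g q) => apply: (@cmeasM _ _ _ f g)
  | |- cmeas (fun q => @?f q + - @?g q) => apply: (@cmeasB _ _ _ f g)
  | |- cmeas (fun q => @?f q + @?g q) => apply: (@cmeasD _ _ _ f g)
  | |- cmeas (fun q => - @?f q) => apply: (@cmeasN _ _ _ f)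
  end.

Section Kernel.
Context {R : realType}.
Implicit Types (p q : R -> Cplx R) (A B : R * R -> Cplx R) (x y s t : R).

Definition tri x s : bool := (0 <= s) && (s <= x) && (x <= pi).
Definition antisym A y t : Cplx R := A (y, t) - A (y, y - t).
Definition volt A y s : Cplx R := CI (fun t => ⟦t <= s⟧ * antisym A y t).

Definition pot p : Prop := sqint p /\ forall x, ~~ (0 <= x <= pi) -> p x = 0.

Definition tri_fun A : Prop :=
  [/\ cmeas A, exists2 M, 0 <= M & forall o, cmod (A o) <= M &
      forall x s, ~~ tri x s -> A (x, s) = 0].

(** With [U := 1 + volt A], the function
   [S x l = \int_0^x U x s cos (sqrt l (x - 2 s)) ds] solves the equation with
   potential [p] as soon as [A x s = \int_s^x p y U y s dy].  As an equation
   between integrals it makes sense for integrable [p]. *)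
Definition is_kernel p A : Prop :=
  tri_fun A /\ forall x s, tri x s ->
    A (x, s) = CI (fun y => ⟦s < y <= x⟧ * (p y * (1 + volt A y s))).

Lemma tri_funD A B : tri_fun A -> tri_fun B -> tri_fun (fun o => A o + B o).
Proof.
move=> [mA [M M0 hM] zA] [mB [N N0 hN] zB]; split; first exact: cmeasD.
  by exists (M + N); [exact: addr_ge0|move=> o; apply: le_trans (cmodD _ _) _; exact: lerD].
by move=> x s xs; rewrite zA // zB // addr0.
Qed.
Lemma tri_funB A B : tri_fun A -> tri_fun B -> tri_fun (fun o => A o - B o).
Proof.
move=> [mA [M M0 hM] zA] [mB [N N0 hN] zB]; split; first exact: cmeasB.
  by exists (M + N); [exact: addr_ge0|move=> o; apply: le_trans (cmodB _ _) _; exact: lerD].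
by move=> x s xs; rewrite zA // zB // subr0.
Qed.

Section OneKernel.
Variables (A : R * R -> Cplx R).
Hypothesis hA : tri_fun A.
Let mA : cmeas A. Proof. by case: hA. Qed.

Lemma antisym_out y t : ~~ tri y t -> antisym A y t = 0.
Proof.
case: hA => _ _ zA yt; rewrite /antisym !zA ?subr0 //.
apply: contra yt; rewrite /tri subr_ge0 lerBlDr lerDl => /andP[/andP[-> ->] ->].
by [].
Qed.
Lemma antisym_bound y t (w : R) : (forall u, cmod (A (y, u)) <= w) ->
  cmod (antisym A y t) <= 2 * w * ⟦0 <= t <= pi⟧.
Proof.
move=> hw; have [yt|yt] := boolP (tri y t).
  have -> : 0 <= t <= pi by move: yt => /andP[/andP[-> ?] ?] /=; lra.
  rewrite mulr1; apply: le_trans (cmodB _ _) _.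
  by have := hw t; have := hw (y - t); lra.
rewrite antisym_out // cmod0 mulr_ge0 // mulr_ge0 //.
exact: le_trans (cmod_ge0 _) (hw 0).
Qed.
Lemma cmeas_antisym1 y : cmeas (antisym A y).
Proof. by rewrite /antisym; meas. Qed.
Lemma cmeas_volt : cmeas (fun o : R * R => volt A o.1 o.2).
Proof. by rewrite /volt /antisym; meas. Qed.
Lemma cmeas_volt1 s : cmeas (fun y => volt A y s).
Proof. by rewrite /volt /antisym; meas. Qed.
Lemma cmeas_volt2 y : cmeas (volt A y).
Proof. by rewrite /volt /antisym; meas. Qed.
Lemma cintb_antisym y : cintb (antisym A y).
Proof.
case: (hA) => _ [M M0 hM] _.
apply: (cintb_dom (cmeas_antisym1 y) _ (rint_itv 0 pi (2 * M))) => t.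
exact: antisym_bound.
Qed.
Lemma volt_bound y s (w : R) : (forall u, cmod (A (y, u)) <= w) ->
  cmod (volt A y s) <= 2 * pi * w.
Proof.
move=> hw; have w0 : 0 <= w by exact: le_trans (cmod_ge0 _) (hw 0).
rewrite mulrAC -[X in _ <= _ * X](subr0 pi) -IR_itv ?pi_ge0 // -IRZ; last exact: rint_itvcc.
apply: CI_le; [|exact: rint_itv|].
  by apply: cintb_bool; [exact: measurable_le_cst|exact: cintb_antisym].
move=> t; rewrite cmodM cmod_bool; apply: le_trans (antisym_bound t hw).
by rewrite ler_piMl ?cmod_ge0 // lern1; case: (t <= s).
Qed.
Lemma antisymN y t : antisym A y (y - t) = - antisym A y t.
Proof. by rewrite /antisym (_ : y - (y - t) = t); ring. Qed.
(** The reflection [t -> y - t] changes the sign. *)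
Lemma antisym_mean y : CI (antisym A y) = 0.
Proof.
have := CI_reflect y (cintb_antisym y).
under [in X in _ = X]eq_fun do rewrite antisymN.
rewrite CIN; last exact: cintb_antisym.
by move=> /eqP; rewrite -addr_eq0 -mulr2n mulrn_eq0 /= => /eqP.
Qed.
Lemma volt_compl y s : volt A y s = - CI (fun t => ⟦s < t⟧ * antisym A y t).
Proof.
have j := cintb_antisym y.
apply/eqP; rewrite -addr_eq0 /volt -CID; last 2 first.
- by apply: cintb_bool => //; exact: measurable_le_cst.
- by apply: cintb_bool => //; exact: measurable_gt_cst.
rewrite -(antisym_mean y); apply/eqP; apply: eq_CI => t.
by rewrite -mulrDl; case: leP; rewrite ?addr0 ?add0r mul1r.
Qed.
Lemma volt0 y : volt A y 0 = 0.
Proof.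
rewrite /volt -[RHS](@CI0 R); apply: (@CI_point _ 0).
- by case: (cintb_bool (measurable_le_cst 0) (cintb_antisym y)).
- exact: cmeas_cst.
- move=> t t0; have [t1|] := leP t 0; last by rewrite mul0r.
  rewrite antisym_out ?mulr0 // /tri; apply/negP => /andP[/andP[t2 _] _].
  by case/eqP: t0; apply/eqP; rewrite eq_le t1 t2.
Qed.
(** As [antisym] has mean zero, its integral up to [x - s] is minus the integral
   over the rest, which the reflection maps to the integral up to [s]. *)
Lemma volt_sym x s : volt A x (x - s) = volt A x s.
Proof.
have j := cintb_antisym x; have jl := cintb_bool (measurable_lt_cst s) j.
rewrite volt_compl (CI_reflect x); last by apply: cintb_bool => //; exact: measurable_gt_cst.
rewrite (@eq_CI R _ (fun t => - (⟦t < s⟧ * antisym A x t))); last first.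
  by move=> t; rewrite antisymN mulrN ltrD2l ltrN2.
rewrite CIN // opprK; apply: (@CI_point _ s).
- by case: jl.
- by case: (cintb_bool (measurable_le_cst s) j).
- by move=> t ts; rewrite lt_neqAle ts.
Qed.
End OneKernel.
End Kernel.

Section KernelExists.
Context {R : realType}.
Implicit Types (p q : R -> Cplx R) (A B : R * R -> Cplx R) (x y s t : R).

Lemma eq_leq_R (a b : R) : a = b -> a <= b. Proof. by move=> ->. Qed.
Lemma tri_ge0 x s : tri x s -> 0 <= x.
Proof. by rewrite /tri => /andP[/andP[s0 sx] _]; exact: le_trans sx. Qed.
Lemma volt_mono_le A x s (w : R) : tri_fun A -> (forall u, cmod (A (x, u)) <= w) ->
  cmod (1 + volt A x s) <= 1 + 2 * pi * w.
Proof.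
move=> hA hw; apply: le_trans (cmodD _ _) _; rewrite cmod1 lerD2l.
exact: volt_bound.
Qed.
Lemma voltD A B y s : tri_fun A -> tri_fun B ->
  volt (fun o => A o + B o) y s = volt A y s + volt B y s.
Proof.
move=> hA hB; rewrite /volt -CID; try by apply: cintb_bool; [exact: measurable_le_cst|exact: cintb_antisym].
by apply: eq_CI => t; rewrite /antisym; ring.
Qed.
Lemma voltB A B y s : tri_fun A -> tri_fun B ->
  volt (fun o => A o - B o) y s = volt A y s - volt B y s.
Proof.
move=> hA hB; rewrite /volt -CIB; try by apply: cintb_bool; [exact: measurable_le_cst|exact: cintb_antisym].
by apply: eq_CI => t; rewrite /antisym; ring.
Qed.
Lemma cintb_volt A q s : tri_fun A -> cintb q -> cintb (fun y => q y * volt A y s).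
Proof.
move=> hA jq; have [mA [M M0 hM] zA] := hA.
under eq_fun do rewrite mulrC.
apply: (@cintb_bound _ _ _ (2 * pi * M)) => //; first exact: cmeas_volt1.
by move=> y; apply: volt_bound.
Qed.
Lemma tri_fun_of_bound A (w : R -> R) (W : R) : cmeas A -> 0 <= W ->
  (forall x, 0 <= x <= pi -> w x <= W) ->
  (forall o, cmod (A o) <= ⟦tri o.1 o.2⟧ * w o.1) -> tri_fun A.
Proof.
move=> mA W0 wW hA; split => // [|x s xs].
  exists W => // o; apply: le_trans (hA o) _.
  have [xs|_] := boolP (tri o.1 o.2); last by rewrite mul0r.
  by rewrite mul1r; apply: wW; move: xs; rewrite /tri; lra.
apply: cmod_eq0; apply/eqP; rewrite eq_le cmod_ge0 andbT.
by have := hA (x, s); rewrite /= (negbTE xs) mul0r.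
Qed.

Section Forward.
Variables (q : R -> Cplx R) (gam : R).
Hypothesis (jq : cintb q) (gam0 : 0 < gam).
Hypothesis (small : forall x, IR (fun y => cmod (q y) * expw gam x y) <= (4 * pi)^-1).

(** The weighted bound is halved: [volt] costs a factor [2 pi], and the integral
   against [q] at most [1 / (4 pi)] by the choice of [gam]. *)
Lemma volt_forward A (c : R) x s : tri_fun A -> 0 <= c ->
  (forall y u, cmod (A (y, u)) <= c * expR (gam * y)) ->
  cmod (CI (fun y => ⟦s < y <= x⟧ * (q y * volt A y s))) <= c / 2 * expR (gam * x).
Proof.
move=> hA c0 hc.
have p0 : 0 < pi :> R := pi_gt0 R.
set K := 2 * pi * c * expR (gam * x).
have K0 : 0 <= K by rewrite !mulr_ge0 ?expR_ge0 // ltW.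
have j1 : rint (fun y => cmod (q y) * expw gam x y).
  by apply: rint_expw => //; [exact: ltW|move=> y; exact: cmod_ge0|case: jq].
apply: (@le_trans _ _ (IR (fun y => K * (cmod (q y) * expw gam x y)))).
  apply: CI_le; [|exact: rintZ|].
    by apply: cintb_bool; [exact: measurable_itvoc|exact: cintb_volt].
  move=> y; rewrite !cmodM cmod_bool.
  have e0 := expw_gt0 gam x y; have q0 := cmod_ge0 (q y).
  have [/andP[_ yx]|_] := boolP (s < y <= x); last by rewrite mul0r mulr_ge0 // mulr_ge0 // ltW.
  rewrite mul1r; have := volt_bound hA s (hc y); rewrite (expw_forward gam yx) => h.
  apply: le_trans (ler_wpM2l q0 h) _; rewrite /K.
  by move: (expR _) (expw _ _ _) => a b; apply: eq_leq_R; ring.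
rewrite IRZ //; apply: le_trans (ler_wpM2l K0 (small x)) _.
apply: eq_leq_R; rewrite /K; move: p0 (expR _) => /lt0r_neq0; move: (pi : R) => P P0 e.
by field.
Qed.
End Forward.

Lemma steep_weight q : sqint q -> exists2 gam : R, 0 < gam &
  forall x, IR (fun y => cmod (q y) * expw gam x y) <= (4 * pi)^-1.
Proof.
move=> [[mq jq] jq2]; apply: exp_smoothing => //.
  by move=> y; exact: cmod_ge0.
by rewrite invr_gt0 mulr_gt0 // pi_gt0.
Qed.

Lemma cmeas_kernel_op q A : cmeas q -> tri_fun A ->
  cmeas (fun o : R * R => ⟦tri o.1 o.2⟧ * CI (fun y => ⟦o.2 < y <= o.1⟧ * (q y * (1 + volt A y o.2)))).
Proof.
move=> mq [mA _ _]; rewrite /volt /antisym /tri.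
meas.
Qed.

(** Successive approximations in the norm with weight [exp (gam x)]. *)
Lemma kernel_exists q : pot q -> exists A, is_kernel q A.
Proof.
move=> [sq q0]; have [jq jq2] := sq; have [mq rq] := jq.
have [gam gam0 small] := steep_weight sq.
set N := IR (fun y => cmod (q y)).
have N0 : 0 <= N by apply: IR_ge0 => y; exact: cmod_ge0.
(* The free term is bounded by [N], half of the radius; the integral term
   halves the radius. *)
pose rho := 2 * N; have rho0 : 0 <= rho by rewrite /rho; lra.
pose wt (o : R * R) := ⟦tri o.1 o.2⟧ * (rho * expR (gam * o.1)).
pose T A (o : R * R) :=
  ⟦tri o.1 o.2⟧ * CI (fun y => ⟦o.2 < y <= o.1⟧ * (q y * (1 + volt A y o.2))).
have exp_le x : 0 <= x <= pi -> expR (gam * x) <= expR (gam * pi).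
  by move=> /andP[_ xp]; rewrite ler_expR ler_pM2l.
have wt0 o : 0 <= wt o by rewrite !mulr_ge0 ?expR_ge0.
have tf A c : 0 <= c -> cmeas A -> (forall o, cmod (A o) <= c * wt o) -> tri_fun A.
  move=> c0 mA hA; apply: (@tri_fun_of_bound _ (fun x => c * (rho * expR (gam * x))) (c * (rho * expR (gam * pi)))) => //.
  - by rewrite !mulr_ge0 ?expR_ge0.
  - by move=> x xp; rewrite !ler_wpM2l // exp_le.
  - by move=> o; apply: le_trans (hA o) _; rewrite /wt mulrCA.
have tf1 A : cmeas A -> (forall o, cmod (A o) <= wt o) -> tri_fun A.
  by move=> mA hA; apply: (tf _ 1) => // o; rewrite mul1r.
have wt_le A c : 0 <= c -> (forall o, cmod (A o) <= c * wt o) ->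
    forall y u, cmod (A (y, u)) <= (c * rho) * expR (gam * y).
  move=> c0 hA y u; apply: le_trans (hA _) _; rewrite -mulrA ler_wpM2l // /wt /=.
  by rewrite ler_piMl ?mulr_ge0 ?expR_ge0 // lern1; case: tri.
have jV A s : tri_fun A -> cintb (fun y => q y * (1 + volt A y s)).
  by move=> hA; under eq_fun do rewrite mulrDr mulr1; apply: cintbD => //; exact: cintb_volt.
have [A [mA bA eA]] : exists A, [/\ cmeas A, forall o, cmod (A o) <= wt o & forall o, A o = T A o].
  apply: (@picard R _ (fun A => cmeas A) wt T).
  - by move=> w u mw wu; exact: cmeas_lim wu.
  - exact: cmeas_cst.
  - exact: wt0.
  - move=> A mA hA; have tA := tf1 A mA hA; split; first exact: cmeas_kernel_op.
    move=> [x s]; rewrite /T /wt /= cmodM cmod_bool.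
    have [xs|_] := boolP (tri x s); last by rewrite !mul0r.
    rewrite !mul1r.
    rewrite (@eq_CI R _ (fun y => ⟦s < y <= x⟧ * q y + ⟦s < y <= x⟧ * (q y * volt A y s))); last first.
      by move=> y; rewrite mulrDr mulr1 mulrDr.
    have mI := measurable_itvoc s x.
    rewrite CID; [|exact: cintb_bool|by apply: cintb_bool => //; exact: cintb_volt].
    apply: le_trans (cmodD _ _) _.
    have h1 : cmod (CI (fun y => ⟦s < y <= x⟧ * q y)) <= N.
      apply: CI_le => //; first exact: cintb_bool.
      by move=> y; rewrite cmodM cmod_bool ler_piMl ?cmod_ge0 // lern1; case: (_ && _).
    have hA' : forall o, cmod (A o) <= 1 * wt o by move=> o; rewrite mul1r.
    have := @volt_forward q gam jq gam0 small A (1 * rho) x s tA _ (wt_le A 1 ler01 hA').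
    rewrite mul1r => /(_ rho0) h2.
    have : 1 <= expR (gam * x).
      by rewrite -expR0 ler_expR mulr_ge0 ?(ltW gam0) ?(tri_ge0 xs).
    by move: h1 h2; rewrite /rho; move: (expR _) (cmod _) (cmod _) => e a b; nra.
  - move=> A B d mA mB hA hB d0 hd [x s]; have tA := tf1 A mA hA; have tB := tf1 B mB hB.
    rewrite /T /wt /= -mulrBr cmodM cmod_bool.
    have [xs|_] := boolP (tri x s); last by rewrite !mul0r mulr0.
    rewrite !mul1r -CIB; try by apply: cintb_bool; [exact: measurable_itvoc|exact: jV].
    rewrite (@eq_CI R _ (fun y => ⟦s < y <= x⟧ * (q y * volt (fun o => A o - B o) y s))); last first.
      by move=> y; rewrite voltB //; ring.
    have := @volt_forward q gam jq gam0 small (fun o => A o - B o) (d * rho) x s (tri_funB tA tB) _ (wt_le _ d d0 hd).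
    by rewrite mulr_ge0 // => /(_ isT); congr (_ <= _); ring.
exists A; split; first exact: tf1.
by move=> x s xs; rewrite eA /T /= xs mul1r.
Qed.

(** Each application of the equation halves the weighted bound. *)
Lemma kernel_eq0 q B : pot q -> tri_fun B ->
  (forall x s, tri x s -> B (x, s) = CI (fun y => ⟦s < y <= x⟧ * (q y * volt B y s))) ->
  forall o, B o = 0.
Proof.
move=> [sq _] hB eB; have [jq _] := sq.
have [gam gam0 small] := steep_weight sq.
have [_ [M M0 hM] zB] := hB.
have key n y u : cmod (B (y, u)) <= M / 2 ^+ n * expR (gam * y).
  elim: n y u => [|n ih] y u.
    have [yu|yu] := boolP (tri y u); last by rewrite zB // cmod0 !mulr_ge0 ?expR_ge0 ?invr_ge0 ?exprn_ge0.
    rewrite expr0 divr1; apply: le_trans (hM _) _; rewrite ler_peMr //.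
    by rewrite -expR0 ler_expR mulr_ge0 ?(ltW gam0) ?(tri_ge0 yu).
  have [yu|yu] := boolP (tri y u); last by rewrite zB // cmod0 !mulr_ge0 ?expR_ge0 ?invr_ge0 ?exprn_ge0.
  rewrite eB // exprSr invfM mulrA.
  by apply: volt_forward => //; rewrite divr_ge0 ?exprn_ge0.
move=> [y u]; apply: cmod_eq0; apply/eqP; rewrite eq_le cmod_ge0 andbT.
apply/ler_addgt0Pr => e e0; rewrite add0r.
have [n hn] := geometric_lt (M * expR (gam * y)) e0.
apply: le_trans (key n y u) _; rewrite mulrAC; apply: ltW; exact: hn.
Qed.
End KernelExists.

(** * Prescribing the kernel on the side x = pi *)

Section Perturbation.
Context {R : realType}.
Implicit Types (p q r z w : R -> Cplx R) (A B : R * R -> Cplx R) (x y s t : R).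

Lemma pot_bounded w (M : R) : cmeas w -> (forall x, cmod (w x) <= M * ⟦0 <= x <= pi⟧) -> pot w.
Proof.
move=> mw hw; have M0 : 0 <= M.
  have := le_trans (cmod_ge0 _) (hw 0); rewrite lexx pi_ge0 mulr1; exact.
split; last first.
  move=> x xp; apply: cmod_eq0; apply/eqP; rewrite eq_le cmod_ge0 andbT.
  by have := hw x; rewrite (negbTE xp) mulr0.
split; first exact: (cintb_dom mw hw (rint_itv _ _ _)).
apply: (rint_le _ _ (rint_itv 0 pi (M ^+ 2))); first exact: measurable_cmod_sqr.
move=> x; rewrite ger0_norm ?exprn_ge0 ?cmod_ge0 //.
have := hw x; have := cmod_ge0 (w x); case: (_ && _); rewrite ?mulr1 ?mulr0 => h0 h.
  by rewrite lerXn2r // nnegrE.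
have -> : cmod (w x) = 0 by lra.
by rewrite expr0n.
Qed.

Lemma rint_cmod_add2 (f g : R -> R) : rint f -> rint (fun x => f x ^+ 2) ->
  rint g -> rint (fun x => g x ^+ 2) -> rint (fun x => (f x + g x) ^+ 2).
Proof.
move=> jf jf2 jg jg2.
apply: (rint_le _ _ (rintD (rintZ 2 jf2) (rintZ 2 jg2))).
  by apply: measurable_funX; apply: measurable_funD; exact: rint_meas.
move=> x; rewrite ger0_norm ?sqr_ge0 //; have := sqr_ge0 (f x - g x).
by rewrite !expr2; nra.
Qed.
Lemma sqintD p q : sqint p -> sqint q -> sqint (fun x => p x + q x).
Proof.
move=> [jp jp2] [jq jq2]; split; first exact: cintbD.
have [mp rp] := jp; have [mq rq] := jq.
apply: (rint_le _ _ (rint_cmod_add2 rp jp2 rq jq2)).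
  by apply: measurable_cmod_sqr; exact: cmeasD.
move=> x; rewrite ger0_norm ?exprn_ge0 ?cmod_ge0 //.
by rewrite lerXn2r ?nnegrE ?addr_ge0 ?cmod_ge0 // cmodD.
Qed.
Lemma sqintZ (c : Cplx R) p : sqint p -> sqint (fun x => c * p x).
Proof.
move=> [jp jp2]; split; first exact: cintbZ.
by under eq_fun do rewrite cmodM exprMn; exact: rintZ.
Qed.
Lemma potD p q : pot p -> pot q -> pot (fun x => p x + q x).
Proof. by move=> [sp p0] [sq q0]; split; [exact: sqintD|move=> x xp; rewrite p0 // q0 // addr0]. Qed.
Lemma potZ (c : Cplx R) p : pot p -> pot (fun x => c * p x).
Proof. by move=> [sp p0]; split; [exact: sqintZ|move=> x xp; rewrite p0 // mulr0]. Qed.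

(** The counterpart of [volt_forward] for integration from [x] up to [pi]; the
   weight now decreases, and [h] collects the terms that do not carry it. *)
Lemma backward_bound (g : R -> R) (gam kap : R) (b : R -> bool) x (F : R -> Cplx R) (h : R -> R) (c : R) :
  (forall y, 0 <= g y) -> rint g -> 0 < gam -> (forall x, IR (fun y => g y * expw gam x y) <= kap) ->
  measurable_fun setT b -> (forall y, b y -> x <= y) -> cintb F -> rint h -> (forall y, 0 <= h y) ->
  0 <= c -> (forall y, b y -> cmod (F y) <= h y + c * (g y * expR (- gam * y))) ->
  cmod (CI (fun y => ⟦b y⟧ * F y)) <= IR h + c * kap * expR (- gam * x).
Proof.
move=> g0 jg gam0 small mb bx jF jh h0 c0 hF.
have jw : rint (fun y => g y * expw gam x y) by apply: rint_expw => //; exact: ltW.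
set e := expR (- gam * x).
apply: (@le_trans _ _ (IR (fun y => h y + c * e * (g y * expw gam x y)))).
  apply: CI_le; [exact: cintb_bool|by apply: rintD => //; exact: rintZ|].
  move=> y; rewrite cmodM cmod_bool; have [by_|_] := boolP (b y).
    rewrite mul1r; apply: le_trans (hF y by_) _; rewrite (expw_backward gam (bx y by_)) -/e.
    by apply: eq_leq_R; ring.
  by rewrite mul0r addr_ge0 // !mulr_ge0 // ?expR_ge0 // ltW // expw_gt0.
rewrite IRD //; last exact: rintZ.
by rewrite IRZ // lerD2l (mulrAC c kap) ler_wpM2l // mulr_ge0 // expR_ge0.
Qed.

(** The two right-hand sides of the fixed point equation have this shape,
   [a] coming from the given kernel and [b] from the unknown one. *)
Definition rhs (q z w a b : Cplx R) : Cplx R := (z + w) * a + (q + (z + w)) * b.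

(** The terms with [zh] but without the weight [e] carry the factor [eps]; all
   others are absorbed by [e]. *)
Lemma rhs_bound (q zh w a b : Cplx R) (eps i e ka kb : R) : 0 <= eps <= 1 -> 0 <= i <= 1 -> 0 <= e <= 1 ->
  cmod w <= i * e -> cmod a <= ka -> cmod b <= kb * e ->
  cmod (rhs q (rc eps * zh) w a b) <=
    ka * eps * cmod zh + (ka + kb) * ((cmod q + cmod zh + i) * e).
Proof.
move=> /andP[eps0 eps1] /andP[i0 i1] /andP[e0 e1] hw ha hb; rewrite /rhs.
apply: le_trans (cmodD _ _) _; rewrite !cmodM.
have := cmodD (rc eps * zh) w; have := cmodD q (rc eps * zh + w).
rewrite cmodM cmod_rc ger0_norm //.
have := cmod_ge0 (rc eps * zh + w); have := cmod_ge0 (q + (rc eps * zh + w)).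
have := cmod_ge0 w; have := cmod_ge0 a; have := cmod_ge0 b; have := cmod_ge0 q; have := cmod_ge0 zh.
move: (cmod w) (cmod a) (cmod b) (cmod q) (cmod zh) (cmod (_ + w)) (cmod (_ + _)) hw ha hb.
move=> W A B Q Z r p hw ha hb Z0 Q0 B0 A0 W0 p0 r0 hp hr.
have ka0 : 0 <= ka by lra.
have h1 : r * A <= (eps * Z + i * e) * ka by apply: ler_pM => //; lra.
have eZ : eps * Z <= Z by rewrite ler_piMl.
have ie : i * e <= i by rewrite ler_piMr.
have h2 : p * B <= (Q + Z + i) * (kb * e) by apply: ler_pM => //; lra.
have h3 : 0 <= ka * ((Q + Z) * e) by rewrite !mulr_ge0 // addr_ge0.
by nra.
Qed.

(** The unknowns enter through the product [w * b] as well; both factors carry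
   the weight [e <= 1], so that this term is still linear in the weight. *)
Lemma rhs_lip (q zh w1 w2 a b1 b2 : Cplx R) (eps d i e ka kb : R) : 0 <= eps <= 1 -> 0 <= i <= 1 -> 0 <= e <= 1 ->
  0 <= d -> cmod w1 <= i * e -> cmod a <= ka -> cmod b2 <= kb * e ->
  cmod (w1 - w2) <= d * (i * e) -> cmod (b1 - b2) <= d * kb * e ->
  cmod (rhs q (rc eps * zh) w1 a b1 - rhs q (rc eps * zh) w2 a b2) <=
    d * (ka + 2 * kb) * ((cmod q + cmod zh + i) * e).
Proof.
move=> /andP[eps0 eps1] /andP[i0 i1] /andP[e0 e1] d0 hw ha hb hdw hdb.
have -> : rhs q (rc eps * zh) w1 a b1 - rhs q (rc eps * zh) w2 a b2 =
    (w1 - w2) * (a + b2) + (q + (rc eps * zh + w1)) * (b1 - b2).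
  by rewrite /rhs; ring.
apply: le_trans (cmodD _ _) _; rewrite !cmodM.
have := cmodD (rc eps * zh) w1; have := cmodD q (rc eps * zh + w1); have := cmodD a b2.
rewrite cmodM cmod_rc ger0_norm //.
have := cmod_ge0 (q + (rc eps * zh + w1)); have := cmod_ge0 (w1 - w2); have := cmod_ge0 (b1 - b2).
have := cmod_ge0 b2; have := cmod_ge0 a; have := cmod_ge0 q; have := cmod_ge0 zh; have := cmod_ge0 (a + b2).
move: (cmod w1) (cmod a) (cmod b2) (cmod q) (cmod zh) (cmod (_ + w1)) (cmod (_ + _)) (cmod (w1 - w2)) (cmod (b1 - b2)) (cmod (a + b2)) hw ha hb hdw hdb.
move=> W A B Q Z r p D E s hw ha hb hD hE s0 Z0 Q0 A0 B0 E0 D0 p0 hs hp hr.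
have ka0 : 0 <= ka by lra.
have eZ : eps * Z <= Z by rewrite ler_piMl.
have ie : i * e <= i by rewrite ler_piMr.
have kbe : 0 <= kb * e by lra.
have h1 : D * s <= (d * (i * e)) * (ka + kb * e) by apply: ler_pM => //; lra.
have h2 : p * E <= (Q + Z + i) * (d * kb * e) by apply: ler_pM => //; lra.
have h3 : 0 <= d * ka * ((Q + Z) * e) by rewrite !mulr_ge0 // addr_ge0.
have h4 : 0 <= d * (kb * e) * (i * (1 - e)).
  apply: mulr_ge0; first exact: mulr_ge0.
  by apply: mulr_ge0 => //; lra.
have h5 : 0 <= d * (kb * e) * (Q + Z).
  by apply: mulr_ge0; [exact: mulr_ge0|exact: addr_ge0].
by nra.
Qed.
End Perturbation.

Section PerturbExists.
Context {R : realType}.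
Implicit Types (p q r z w : R -> Cplx R) (A B : R * R -> Cplx R) (x y s t : R).

Lemma cintb_rhs q z w (a b : R -> Cplx R) (Ma Mb : R) : cintb q -> cintb z -> cintb w ->
  cmeas a -> cmeas b -> (forall y, cmod (a y) <= Ma) -> (forall y, cmod (b y) <= Mb) ->
  cintb (fun y => rhs (q y) (z y) (w y) (a y) (b y)).
Proof.
move=> jq jz jw ma mb ba bb; apply: cintbD.
  by under eq_fun do rewrite mulrC; apply: (cintb_bound ma ba); exact: cintbD.
by under eq_fun do rewrite mulrC; apply: (cintb_bound mb bb); apply: cintbD => //; exact: cintbD.
Qed.
Lemma tri_bounds A : tri_fun A -> exists2 M, 0 <= M & forall y s,
  [/\ cmod (A (y, s)) <= M, cmod (1 + volt A y s) <= 1 + 2 * pi * M,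
      cmod (volt A y s) <= 2 * pi * M & cmod (antisym A y s) <= 2 * M].
Proof.
move=> hA; have [_ [M M0 hM] _] := hA; exists M => // y s; split => //.
- exact: volt_mono_le.
- exact: volt_bound.
- apply: le_trans (antisym_bound hA s (fun u => hM _)) _.
  by rewrite ler_piMr ?mulr_ge0 // lern1; case: (_ && _).
Qed.
Lemma cintb_rhs_volt q z w A B s : cintb q -> cintb z -> cintb w -> tri_fun A -> tri_fun B ->
  cintb (fun y => rhs (q y) (z y) (w y) (1 + volt A y s) (volt B y s)).
Proof.
move=> jq jz jw hA hB; have [M M0 hM] := tri_bounds hA; have [N N0 hN] := tri_bounds hB.
apply: (cintb_rhs jq jz jw (Ma := 1 + 2 * pi * M) (Mb := 2 * pi * N)).
- by apply: cmeasD; [exact: cmeas_cst|exact: cmeas_volt1].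
- exact: cmeas_volt1.
- by move=> y; have [] := hM y s.
- by move=> y; have [] := hN y s.
Qed.
Lemma cintb_rhs_antisym q z w A B t : cintb q -> cintb z -> cintb w -> tri_fun A -> tri_fun B ->
  cintb (fun y => rhs (q y) (z y) (w y) (antisym A y t) (antisym B y t)).
Proof.
move=> jq jz jw hA hB; have [M M0 hM] := tri_bounds hA; have [N N0 hN] := tri_bounds hB.
have m C : tri_fun C -> cmeas (fun y => antisym C y t).
  by move=> [mC _ _]; rewrite /antisym; meas.
apply: (cintb_rhs jq jz jw (m _ hA) (m _ hB) (Ma := 2 * M) (Mb := 2 * N)).
- by move=> y; have [] := hM y t.
- by move=> y; have [] := hN y t.
Qed.

Lemma cmeas_perturb_tri q z w A B : cmeas q -> cmeas z -> cmeas w -> tri_fun A -> tri_fun B ->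
  cmeas (fun o : R * R => ⟦tri o.1 o.2⟧ * (CI (fun y => ⟦o.2 < y⟧ * z y) -
    CI (fun y => ⟦o.1 < y <= pi⟧ * rhs (q y) (z y) (w y) (1 + volt A y o.2) (volt B y o.2)))).
Proof.
move=> mq mz mw [mA _ _] [mB _ _]; rewrite /rhs /volt /antisym /tri; meas.
Qed.
Lemma cmeas_perturb_pot q z w A B : cmeas q -> cmeas z -> cmeas w -> tri_fun A -> tri_fun B ->
  cmeas (fun x : R => ⟦0 <= x <= pi⟧ * CI (fun y => ⟦x <= y <= pi⟧ *
    rhs (q y) (z y) (w y) (antisym A y x) (antisym B y x))).
Proof.
move=> mq mz mw [mA _ _] [mB _ _]; rewrite /rhs /antisym; meas.
Qed.
End PerturbExists.

Section PerturbFixpoint.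
Context {R : realType}.
Implicit Types (p q r z w : R -> Cplx R) (A B : R * R -> Cplx R) (x y s t : R).

(** The equations for [B] and [w] form a single fixed point problem for a
   function on a disjoint sum.  The weight is chosen before [eps], which then has
   to be small with respect to the least value [exp (- gam pi)] of the weight. *)
Lemma perturb_exists q A0 zh : pot q -> tri_fun A0 -> pot zh ->
  exists2 eps : R, 0 < eps & exists B w, [/\ tri_fun B, pot w,
    forall x s, tri x s -> B (x, s) = CI (fun y => ⟦s < y⟧ * (rc eps * zh y)) -
      CI (fun y => ⟦x < y <= pi⟧ *
        rhs (q y) (rc eps * zh y) (w y) (1 + volt A0 y s) (volt B y s)) &
    forall x, 0 <= x <= pi -> w x = CI (fun y => ⟦x <= y <= pi⟧ *
        rhs (q y) (rc eps * zh y) (w y) (antisym A0 y x) (antisym B y x))].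
Proof.
move=> [sq _] hA0 [sz z0]; have [jq jq2] := sq; have [jz jz2] := sz.
have [mq rq] := jq; have [mz rz] := jz.
have [M M0 hM] := tri_bounds hA0.
have p0 : 0 < pi :> R := pi_gt0 R.
(* A common bound for the constants [ka + 2 * kb] of both equations. *)
pose K := 1 + 2 * pi * M + 2 * M + 2 * (2 * pi + 2).
have pM : 0 <= pi * M by rewrite mulr_ge0 // ltW.
have K1 : 1 <= K by rewrite /K -!mulrA; lra.
have K0 : 0 <= K by lra.
have Ka1 a : K * (8 * K)^-1 * a = a / 8.
  have : K != 0 by rewrite gt_eqF //; lra.
  by move: (K) => k k0; field.
have d82 d : 0 <= d -> d / 8 <= d / 2 :> R by lra.
have kV : 1 + 2 * pi * M + 2 * (2 * pi) <= K by rewrite /K; lra.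
have kA : 2 * M + 2 * 2 <= K by rewrite /K -!mulrA; lra.
have kV1 : 0 <= 1 + 2 * pi * M by rewrite -mulrA; lra.
have kV2 : 0 <= 1 * (2 * pi) :> R by lra.
have kV3 : 1 + 2 * pi * M + 1 * (2 * pi) <= K by lra.
have kA1 : 0 <= 2 * M by lra.
have kA2 : 0 <= 1 * 2 :> R by lra.
have kA3 : 2 * M + 1 * 2 <= K by lra.
have after x y : x < y <= pi -> x <= y by move=> /andP[/ltW].
have upto x y : x <= y <= pi -> x <= y by move=> /andP[].
have Ka a : a * K / (8 * K) = a / 8.
  have : K != 0 by rewrite gt_eqF //; lra.
  by move: (K) => k k0; field.
pose i y : R := ⟦0 <= y <= pi⟧.
have i01 y : 0 <= i y <= 1 by rewrite /i; rewrite ler0n lern1 leq_b1.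
have ri : rint i by exact: rint_itvcc.
pose g y := cmod (q y) + cmod (zh y) + i y.
have g0 y : 0 <= g y by rewrite !addr_ge0 ?cmod_ge0 //; have /andP[] := i01 y.
have jg1 : rint (fun y => cmod (q y) + cmod (zh y)) by exact: rintD.
have jg : rint g by exact: rintD.
have jg2 : rint (fun y => g y ^+ 2).
  apply: rint_cmod_add2 => //; first exact: rint_cmod_add2.
  by under eq_fun do rewrite expr2 -natrM mulnb andbb.
have kap0 : 0 < (8 * K)^-1 by rewrite invr_gt0 mulr_gt0 //; lra.
have [gam gam0 small] := exp_smoothing g0 jg jg2 kap0.
set N := IR (fun y => cmod (zh y)).
have N0 : 0 <= N by apply: IR_ge0 => y; exact: cmod_ge0.
pose e x := expR (- gam * x).
have e_le x : x <= pi -> e pi <= e x by move=> xp; rewrite ler_expR !mulNr lerN2 ler_pM2l.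
have e_01 x : 0 <= x -> 0 <= e x <= 1.
  by move=> x0; rewrite expR_ge0 -expR0 ler_expR mulNr oppr_le0 mulr_ge0 ?(ltW gam0).
have epi0 : 0 < e pi by exact: expR_gt0.
pose eps := e pi / (2 * ((K + 1) * (N + 1))).
have KN : 1 <= (K + 1) * (N + 1) by nra.
have eps0 : 0 < eps by rewrite divr_gt0 // mulr_gt0 //; lra.
have epsE : eps * ((K + 1) * (N + 1)) = e pi / 2.
  by rewrite /eps; move: KN; move: (_ * (N + 1)) (e pi) => a b a1; field; rewrite gt_eqF //; lra.
have eps1 : 0 <= eps <= 1.
  rewrite ltW //=; have /andP[_] := e_01 pi (ltW p0); move: epsE; nra.
have epsN : eps * N * (K + 1) <= e pi / 2.
  rewrite -epsE -mulrA ler_wpM2l ?(ltW eps0) // mulrC ler_wpM2l //; lra.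
have tot x : 0 <= x <= pi -> eps * N + (K * eps * N + e x / 8) <= e x.
  by move=> /andP[_ /e_le h]; move: h epi0 epsN; move: (e x) (e pi) => a b; nra.
exists eps => //; pose z y := rc eps * zh y.
have jz' : cintb z by exact: cintbZ.
have mz' : cmeas z by have [] := jz'.
pose Om := ((R * R) + R)%type.
pose wt (o : Om) := match o with inl o => ⟦tri o.1 o.2⟧ * e o.1 | inr x => i x * e x end.
pose Bof (u : Om -> Cplx R) (o : R * R) := u (inl o).
pose wof (u : Om -> Cplx R) (x : R) := u (inr x).
pose P (u : Om -> Cplx R) := cmeas (Bof u) /\ cmeas (wof u).
pose T (u : Om -> Cplx R) (o : Om) := match o with
  | inl o => ⟦tri o.1 o.2⟧ * (CI (fun y => ⟦o.2 < y⟧ * z y) -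
      CI (fun y => ⟦o.1 < y <= pi⟧ *
        rhs (q y) (z y) (wof u y) (1 + volt A0 y o.2) (volt (Bof u) y o.2)))
  | inr x => ⟦0 <= x <= pi⟧ * CI (fun y => ⟦x <= y <= pi⟧ *
        rhs (q y) (z y) (wof u y) (antisym A0 y x) (antisym (Bof u) y x)) end.
have wt0 o : 0 <= wt o by case: o => [[x s]|x]; rewrite mulr_ge0 ?expR_ge0 //; have /andP[] := i01 x.
have tf B c : 0 <= c -> cmeas B -> (forall o, cmod (B o) <= c * wt (inl o)) -> tri_fun B.
  move=> c0 mB hB; apply: (@tri_fun_of_bound _ _ (fun x => c * e x) c) => //.
    move=> x /andP[x0 _]; rewrite ler_piMr //; by have /andP[] := e_01 x x0.
  by move=> o; apply: le_trans (hB o) _; rewrite /wt mulrCA.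
have tfu u : P u -> (forall o, cmod (u o) <= wt o) -> tri_fun (Bof u).
  by move=> [mB _] hu; apply: (tf _ 1) => // o; rewrite mul1r; exact: hu.
have pw u : P u -> (forall o, cmod (u o) <= wt o) -> pot (wof u).
  move=> [_ mw] hu; apply: (@pot_bounded _ _ 1) => // x; apply: le_trans (hu _) _.
  rewrite /wt mul1r -/(i x); have /andP[i0 i1] := i01 x.
  rewrite /i; have [/andP[x0 _]|_] := boolP (0 <= x <= pi); last by rewrite mul0r.
  by rewrite mul1r; have /andP[] := e_01 x x0.
have Bw B c : 0 <= c -> (forall o, cmod (B o) <= c * wt (inl o)) -> forall y u, cmod (B (y, u)) <= c * e y.
  move=> c0 hB y u; apply: le_trans (hB _) _; rewrite ler_wpM2l // /wt /=.
  by rewrite ler_piMl ?expR_ge0 // lern1; case: tri.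
have volt_e B c y s : 0 <= c -> tri_fun B -> (forall o, cmod (B o) <= c * wt (inl o)) ->
    cmod (volt B y s) <= c * (2 * pi) * e y.
  move=> c0 hB hc; apply: le_trans (volt_bound hB s (Bw _ _ c0 hc y)) _.
  by apply: eq_leq_R; ring.
have anti_e B c y s : 0 <= c -> tri_fun B -> (forall o, cmod (B o) <= c * wt (inl o)) ->
    cmod (antisym B y s) <= c * 2 * e y.
  move=> c0 hB hc; apply: le_trans (antisym_bound hB s (Bw _ _ c0 hc y)) _.
  apply: le_trans (_ : 2 * (c * e y) * 1 <= _).
    by rewrite ler_wpM2l ?mulr_ge0 ?expR_ge0 // lern1; case: (_ && _).
  by apply: eq_leq_R; ring.
have jV u s : P u -> (forall o, cmod (u o) <= wt o) ->
    cintb (fun y => rhs (q y) (z y) (wof u y) (1 + volt A0 y s) (volt (Bof u) y s)).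
  by move=> Pu hu; apply: cintb_rhs_volt => //; [have [[]] := pw u Pu hu|exact: tfu].
have jA u s : P u -> (forall o, cmod (u o) <= wt o) ->
    cintb (fun y => rhs (q y) (z y) (wof u y) (antisym A0 y s) (antisym (Bof u) y s)).
  by move=> Pu hu; apply: cintb_rhs_antisym => //; [have [[]] := pw u Pu hu|exact: tfu].
(* one estimate serves both components of the operator *)
have self (ka kb : R) (b : R -> bool) x (u : Om -> Cplx R) (a c : R -> Cplx R) :
    0 <= x <= pi -> 0 <= ka -> 0 <= kb -> ka + kb <= K -> measurable_fun setT b -> (forall y, b y -> x <= y) ->
    cintb (fun y => rhs (q y) (z y) (wof u y) (a y) (c y)) ->
    (forall o, cmod (u o) <= wt o) -> (forall y, cmod (a y) <= ka) -> (forall y, cmod (c y) <= kb * e y) ->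
    cmod (CI (fun y => ⟦b y⟧ * rhs (q y) (z y) (wof u y) (a y) (c y))) <= K * eps * N + e x / 8.
  move=> /andP[x0 xp] ka0 kb0 kK mb bx jr hu ha hc.
  have jh : rint (fun y => K * eps * cmod (zh y)) by exact: rintZ.
  have -> : K * eps * N = IR (fun y => K * eps * cmod (zh y)) by rewrite IRZ.
  have -> : e x / 8 = K * (8 * K)^-1 * e x.
    by rewrite Ka1.
  apply: (backward_bound (g := g) (gam := gam) (h := fun y => K * eps * cmod (zh y))) => //.
  - by move=> y; apply: mulr_ge0 (mulr_ge0 K0 (ltW eps0)) (cmod_ge0 _).
  move=> y /bx xy; have ey := e_01 y (le_trans x0 xy); have := hu (inr y) => hw.
  apply: le_trans (@rhs_bound R _ _ _ _ _ eps (i y) (e y) ka kb eps1 (i01 y) ey hw (ha y) (hc y)) _.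
  apply: lerD.
    apply: ler_wpM2r; first exact: cmod_ge0.
    by apply: ler_wpM2r; [exact: ltW|lra].
  rewrite ler_wpM2r //; apply: mulr_ge0; [exact: g0|exact: expR_ge0].
have lip (ka kb d : R) (b : R -> bool) x (u v : Om -> Cplx R) (a c1 c2 : R -> Cplx R) :
    0 <= x <= pi -> 0 <= d -> ka + 2 * kb <= K -> measurable_fun setT b -> (forall y, b y -> x <= y) ->
    cintb (fun y => rhs (q y) (z y) (wof u y) (a y) (c1 y)) ->
    cintb (fun y => rhs (q y) (z y) (wof v y) (a y) (c2 y)) ->
    (forall o, cmod (u o) <= wt o) -> (forall o, cmod (u o - v o) <= d * wt o) ->
    (forall y, cmod (a y) <= ka) -> (forall y, cmod (c2 y) <= kb * e y) ->
    (forall y, cmod (c1 y - c2 y) <= d * kb * e y) ->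
    cmod (CI (fun y => ⟦b y⟧ * rhs (q y) (z y) (wof u y) (a y) (c1 y)) -
          CI (fun y => ⟦b y⟧ * rhs (q y) (z y) (wof v y) (a y) (c2 y))) <= d / 2 * e x.
  move=> /andP[x0 xp] d0 kK mb bx j1 j2 hu hd ha hc hdc.
  rewrite -CIB; try exact: cintb_bool.
  under [X in CI X]eq_fun do rewrite -mulrBr.
  have h := @backward_bound R g gam (8 * K)^-1 b x (fun y => rhs (q y) (z y) (wof u y) (a y) (c1 y) - rhs (q y) (z y) (wof v y) (a y) (c2 y)) (fun=> 0) (d * K) g0 jg gam0 small mb bx.
  apply: le_trans (h (cintbB j1 j2) rint0 (fun=> lexx 0) (mulr_ge0 d0 K0) _) _.
  - move=> y /bx xy; rewrite add0r; have ey := e_01 y (le_trans x0 xy).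
    have hw := hu (inr y); have hdw := hd (inr y).
    apply: le_trans (@rhs_lip R _ _ _ _ _ _ _ eps d (i y) (e y) ka kb eps1 (i01 y) ey d0 hw (ha y) (hc y) hdw (hdc y)) _.
    rewrite ler_wpM2r //; first by apply: mulr_ge0; [exact: g0|exact: expR_ge0].
    by rewrite ler_wpM2l.
  rewrite IR0 add0r -/(e x).
  have -> : d * K / (8 * K) = d / 8.
    exact: Ka.
  by apply: ler_wpM2r; [exact: expR_ge0|exact: d82].
have diffE (b X Y : Cplx R) : cmod (b - X - (b - Y)) = cmod (X - Y).
  by rewrite cmodBC; congr cmod; ring.
have [u [[mB mw] bu eu]] : exists u, [/\ P u, forall o, cmod (u o) <= wt o & forall o, u o = T u o].
  apply: (@picard R Om P wt T).
  - move=> v u Pv vu; split.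
      by apply: (@cmeas_lim _ _ _ (fun n => Bof (v n))) => [n|o]; [have [] := Pv n|exact: vu].
    by apply: (@cmeas_lim _ _ _ (fun n => wof (v n))) => [n|o]; [have [] := Pv n|exact: vu].
  - by split; exact: cmeas_cst.
  - exact: wt0.
  - move=> u Pu hu; have tB := tfu u Pu hu; have [[jw _] _] := pw u Pu hu; have [mw _] := jw.
    have hB : forall o, cmod (Bof u o) <= 1 * wt (inl o) by move=> o; rewrite mul1r; exact: hu.
    split.
      by split; [exact: (cmeas_perturb_tri mq mz' mw hA0 tB)|exact: (cmeas_perturb_pot mq mz' mw hA0 tB)].
    move=> [[x s]|x]; rewrite /T /wt cmodM cmod_bool /= /i.
      have [xs|_] := boolP (tri x s); last by rewrite !mul0r.
      have xp : 0 <= x <= pi by rewrite (tri_ge0 xs); move: xs => /andP[].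
      rewrite !mul1r; apply: le_trans (cmodB _ _) _.
      have h1 : cmod (CI (fun y => ⟦s < y⟧ * z y)) <= eps * N.
        rewrite -IRZ //; apply: CI_le; [by apply: cintb_bool => //; exact: measurable_gt_cst|exact: rintZ|].
        move=> y; rewrite !cmodM cmod_bool cmod_rc ger0_norm ?(ltW eps0) //.
        by apply: ler_piMl; [exact: mulr_ge0 (ltW eps0) (cmod_ge0 _)|rewrite lern1 leq_b1].
      have h3 := self (1 + 2 * pi * M) (1 * (2 * pi)) (fun y => x < y <= pi) x u (fun y => 1 + volt A0 y s) (fun y => volt (Bof u) y s)
        xp kV1 kV2 kV3 (measurable_itvoc x pi) (fun y => @after x y) (jV u s Pu hu) hu
        (fun y => let: And4 _ h _ _ := hM y s in h) (fun y => volt_e _ 1 y s ler01 tB hB).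
      exact: le_trans (lerD h1 h3) (tot x xp).
    have [xp|_] := boolP (0 <= x <= pi); last by rewrite !mul0r.
    rewrite !mul1r.
    have h3 := self (2 * M) (1 * 2) (fun y => x <= y <= pi) x u (fun y => antisym A0 y x) (fun y => antisym (Bof u) y x)
      xp kA1 kA2 kA3 (measurable_itvcc x pi) (fun y => @upto x y) (jA u x Pu hu) hu
      (fun y => let: And4 _ _ _ h := hM y x in h) (fun y => anti_e _ 1 y x ler01 tB hB).
    by apply: le_trans h3 (le_trans _ (tot x xp)); rewrite lerDr mulr_ge0 // ltW.
  - move=> u v d Pu Pv hu hv d0 hd; have tBu := tfu u Pu hu; have tBv := tfu v Pv hv.
    have hB : forall o, cmod (Bof v o) <= 1 * wt (inl o) by move=> o; rewrite mul1r; exact: hv.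
    have hD : forall o, cmod (Bof u o - Bof v o) <= d * wt (inl o) by move=> o; exact: hd.
    move=> [[x s]|x]; rewrite /T /wt -mulrBr cmodM cmod_bool /= /i.
      have [xs|_] := boolP (tri x s); last by rewrite !mul0r mulr0.
      have xp : 0 <= x <= pi by rewrite (tri_ge0 xs); move: xs => /andP[].
      rewrite !mul1r diffE.
      apply: (lip (1 + 2 * pi * M) (2 * pi) d (fun y => x < y <= pi) x u v (fun y => 1 + volt A0 y s) (fun y => volt (Bof u) y s) (fun y => volt (Bof v) y s)
        xp d0 kV (measurable_itvoc x pi) (fun y => @after x y) (jV u s Pu hu) (jV v s Pv hv) hu hd
        (fun y => let: And4 _ h _ _ := hM y s in h)).
        by move=> y; have := volt_e _ 1 y s ler01 tBv hB; rewrite mul1r.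
      by move=> y; rewrite -voltB //; exact: (volt_e _ d y s d0 (tri_funB tBu tBv) hD).
    have [xp|_] := boolP (0 <= x <= pi); last by rewrite !mul0r mulr0.
    rewrite !mul1r.
    apply: (lip (2 * M) 2 d (fun y => x <= y <= pi) x u v (fun y => antisym A0 y x) (fun y => antisym (Bof u) y x) (fun y => antisym (Bof v) y x)
      xp d0 kA (measurable_itvcc x pi) (fun y => @upto x y) (jA u x Pu hu) (jA v x Pv hv) hu hd
      (fun y => let: And4 _ _ _ h := hM y x in h)).
      by move=> y; have := anti_e _ 1 y x ler01 tBv hB; rewrite mul1r.
    move=> y; have -> : antisym (Bof u) y x - antisym (Bof v) y x = antisym (fun o => Bof u o - Bof v o) y x.
      by rewrite /antisym; ring.
    exact: (anti_e _ d y x d0 (tri_funB tBu tBv) hD).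
exists (Bof u), (wof u); split.
- exact: tfu.
- exact: pw.
- by move=> x s xs; rewrite {1}/Bof eu /T /= xs mul1r.
- by move=> x xp; rewrite {1}/wof eu /T /= xp mul1r.
Qed.
End PerturbFixpoint.

Section PerturbedKernel.
Context {R : realType}.
Local Notation mu := (@lebesgue_measure R).
Implicit Types (p q r z w : R -> Cplx R) (A B : R * R -> Cplx R) (x y s t : R).

(** On the side [s = 0] the weight [U] is one. *)
Lemma kernel_total p A : pot p -> is_kernel p A -> A (pi, 0) = CI p.
Proof.
move=> [[jp _] p0] [hA eA]; rewrite eA; last by rewrite /tri !lexx pi_ge0.
under eq_CI do rewrite volt0 // addr0 mulr1.
apply: (@CI_point _ 0).
- by case: (cintb_bool (measurable_itvoc 0 pi) jp).
- by case: jp.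
move=> y y0; have [yp|yp] := boolP (0 <= y <= pi); last by rewrite p0 // mulr0.
by rewrite lt_def y0 yp mul1r.
Qed.

Lemma antisym_tail A s x y : tri_fun A ->
  ⟦s < x <= pi⟧ * (⟦x <= y <= pi⟧ * antisym A y x) = ⟦s < y <= pi⟧ * (⟦s < x⟧ * antisym A y x).
Proof.
move=> hA; have [/andP[/andP[x0 xy] yp]|h] := boolP (tri y x).
  have [sx|_] := ltP s x; last by rewrite !mul0r mulr0.
  by rewrite xy yp (le_trans xy yp) (lt_le_trans sx xy).
by rewrite antisym_out // !mulr0.
Qed.

Section Verify.
Variables (q z w : R -> Cplx R) (A0 B : R * R -> Cplx R).
Hypotheses (pq : pot q) (k0 : is_kernel q A0) (pz : pot z) (tB : tri_fun B) (pw : pot w).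
Local Notation rhs_volt y s := (rhs (q y) (z y) (w y) (1 + volt A0 y s) (volt B y s)).
Local Notation rhs_anti y x := (rhs (q y) (z y) (w y) (antisym A0 y x) (antisym B y x)).
Hypothesis eB : forall x s, tri x s ->
  B (x, s) = CI (fun y => ⟦s < y⟧ * z y) - CI (fun y => ⟦x < y <= pi⟧ * rhs_volt y s).
Hypothesis ew : forall x, 0 <= x <= pi -> w x = CI (fun y => ⟦x <= y <= pi⟧ * rhs_anti y x).
Let hA0 : tri_fun A0. Proof. by case: k0. Qed.
Let jq : cintb q. Proof. by case: pq => [[]]. Qed.
Let jz : cintb z. Proof. by case: pz => [[]]. Qed.
Let jw : cintb w. Proof. by case: pw => [[]]. Qed.
Let r y := z y + w y.
Let jr : cintb r. Proof. exact: cintbD. Qed.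

(** Integrating the equation for [w] and exchanging the integrals turns the
   antisymmetric part of the kernel back into [volt]; this is where the mean
   zero of [antisym] is needed. *)
Lemma boundary_mass s : 0 <= s <= pi ->
  CI (fun y => ⟦s < y⟧ * z y) = CI (fun y => ⟦s < y <= pi⟧ * rhs_volt y s).
Proof.
move=> /andP[s0 sp].
have [M M0 hM] := tri_bounds hA0; have [N N0 hN] := tri_bounds tB.
have mI := measurable_itvoc s pi.
pose f x y := ⟦s < x <= pi⟧ * (⟦x <= y <= pi⟧ * rhs_anti y x).
have wE : CI (fun x => ⟦s < x <= pi⟧ * w x) = CI (fun x => CI (fun y => f x y)).
  apply: eq_CI => x; rewrite /f CIZ; last first.
    by apply: cintb_bool; [exact: measurable_itvcc|exact: cintb_rhs_antisym].
  have [/andP[sx xp]|_] := boolP (s < x <= pi); last by rewrite !mul0r.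
  by rewrite ew // xp (le_trans s0 (ltW sx)).
have ci y : cintb (fun x => ⟦s < x⟧ * antisym A0 y x) /\ cintb (fun x => ⟦s < x⟧ * antisym B y x).
  by split; apply: cintb_bool; try exact: measurable_gt_cst; exact: cintb_antisym.
have innerE y : CI (fun x => f x y) = - (⟦s < y <= pi⟧ * rhs (q y) (z y) (w y) (volt A0 y s) (volt B y s)).
  rewrite (@eq_CI R _ (fun x => (⟦s < y <= pi⟧ * r y) * (⟦s < x⟧ * antisym A0 y x) +
      (⟦s < y <= pi⟧ * (q y + r y)) * (⟦s < x⟧ * antisym B y x))).
    have [ca cb] := ci y; rewrite CID; try exact: cintbZ.
    rewrite !CIZ // !volt_compl // /rhs -/(r y); move: (CI _) (CI _) => a b; ring.
  move=> x; have e1 := antisym_tail s x y hA0; have e2 := antisym_tail s x y tB.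
  transitivity (r y * (⟦s < x <= pi⟧ * (⟦x <= y <= pi⟧ * antisym A0 y x)) +
      (q y + r y) * (⟦s < x <= pi⟧ * (⟦x <= y <= pi⟧ * antisym B y x))).
    by rewrite /f /rhs /r; ring.
  by rewrite e1 e2; ring.
have fub : CI (fun x => CI (fun y => f x y)) = CI (fun y => CI (fun x => f x y)).
  apply: (@CI_fubini R f (fun x => ⟦0 <= x <= pi⟧)
    (fun y => 2 * M * cmod (r y) + 2 * N * cmod (q y + r y))).
  - have [mq _] := jq; have [mz _] := jz; have [mw _] := jw.
    have [mA _ _] := hA0; have [mB _ _] := tB.
    by rewrite /f /rhs /antisym; meas.
  - exact: rint_itvcc.
  - have [_ r1] := jr; have [_ r2] := cintbD jq jr.
    by apply: rintD; exact: rintZ.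
  - move=> x y; rewrite /f !cmodM !cmod_bool.
    have [/andP[sx xp]|_] := boolP (s < x <= pi); last first.
      rewrite mul0r; apply: mulr_ge0; first exact: ler0n.
      by rewrite addr_ge0 // mulr_ge0 ?cmod_ge0 // mulr_ge0.
    rewrite (le_trans s0 (ltW sx)) xp !mul1r.
    apply: le_trans (_ : cmod (rhs_anti y x) <= _).
      by apply: ler_piMl; [exact: cmod_ge0|rewrite lern1 leq_b1].
    rewrite /rhs; apply: le_trans (cmodD _ _) _; rewrite !cmodM.
    have [_ _ _ hm] := hM y x; have [_ _ _ hn] := hN y x.
    by apply: lerD; rewrite mulrC; apply: ler_wpM2r => //; exact: cmod_ge0.
have zE : CI (fun y => ⟦s < y⟧ * z y) = CI (fun y => ⟦s < y <= pi⟧ * r y) - CI (fun y => ⟦s < y <= pi⟧ * w y).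
  rewrite -CIB; try exact: cintb_bool.
  apply: eq_CI => y; rewrite -mulrBr /r addrK.
  have [yp|yp] := leP y pi; first by rewrite andbT.
  have yo : ~~ (0 <= y <= pi) by rewrite negb_and -!ltNge yp orbT.
  by have [_ z0] := pz; rewrite (z0 y yo) !mulr0.
rewrite zE wE fub; under [X in _ - CI X]eq_fun do rewrite innerE.
have jV : cintb (fun y => rhs (q y) (z y) (w y) (volt A0 y s) (volt B y s)).
  apply: (cintb_rhs jq jz jw (cmeas_volt1 hA0 s) (cmeas_volt1 tB s) (Ma := 2 * pi * M) (Mb := 2 * pi * N)).
  - by move=> y; have [] := hM y s.
  - by move=> y; have [] := hN y s.
rewrite CIN; last exact: cintb_bool.
rewrite opprK -CID; try exact: cintb_bool.
by apply: eq_CI => y; rewrite /rhs /r; ring.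
Qed.

(** The equation was posed from the side [x = pi]; by [boundary_mass] it can be
   read from the diagonal, as [is_kernel] requires. *)
Lemma perturbed_eq x s : tri x s -> B (x, s) = CI (fun y => ⟦s < y <= x⟧ * rhs_volt y s).
Proof.
move=> xs; rewrite eB //; have /andP[/andP[s0 sx] xp] := xs.
rewrite boundary_mass; last by rewrite s0 (le_trans sx xp).
have jF : cintb (fun y => rhs_volt y s) by exact: cintb_rhs_volt.
rewrite -CIB; try by apply: cintb_bool => //; exact: measurable_itvoc.
apply: eq_CI => y; rewrite -mulrBl; congr (_ * _).
have [yx|xy] := leP y x; first by rewrite (le_trans yx xp) !andbT subr0.
by rewrite (le_lt_trans sx xy) /= subrr.
Qed.

Lemma perturbed_kernel : is_kernel (fun y => q y + r y) (fun o => A0 o + B o).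
Proof.
split; first exact: tri_funD.
move=> x s xs; rewrite perturbed_eq // k0.2 // -CID; last 2 first.
- apply: cintb_bool; first exact: measurable_itvoc.
  by under eq_fun do rewrite mulrDr mulr1; apply: cintbD => //; exact: cintb_volt.
- by apply: cintb_bool; [exact: measurable_itvoc|exact: cintb_rhs_volt].
by apply: eq_CI => y; rewrite voltD // /rhs /r; ring.
Qed.

Lemma perturbed_side s : 0 <= s <= pi -> B (pi, s) = CI (fun y => ⟦s < y⟧ * z y).
Proof.
move=> /andP[s0 sp]; rewrite eB ?/tri ?s0 ?sp ?lexx //.
rewrite (@eq_CI R (fun y => ⟦pi < y <= pi⟧ * _) (fun=> 0)) ?CI0 ?subr0 // => y.
by case: ltgtP; rewrite mul0r.
Qed.

(** The integral of a potential is the value of its kernel at the corner. *)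
Lemma perturbed_mean : CI (fun y => q y + r y) = CI q + CI z.
Proof.
have pr : pot (fun y => q y + r y) by apply: potD => //; exact: potD.
rewrite -(kernel_total pr perturbed_kernel) (kernel_total pq k0) perturbed_side ?lexx ?pi_ge0 //.
congr (_ + _); apply: (@CI_point _ 0).
- by case: (cintb_bool (measurable_gt_cst 0) jz).
- by case: jz.
move=> y y0; have [_ z0] := pz.
have [yp|yp] := boolP (0 <= y <= pi); last by rewrite z0 // mulr0.
by rewrite lt_def y0; case/andP: yp => -> _; rewrite mul1r.
Qed.

(** An unchanged potential has an unchanged kernel. *)
Lemma perturbed_nontrivial : {ae mu, forall y, r y = 0} -> {ae mu, forall y, z y = 0}.
Proof.
move=> r0.
have B0 : forall o, B o = 0.
  apply: (kernel_eq0 pq tB) => x s xs; rewrite perturbed_eq //.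
  apply: CI_ae.
  - by case: (cintb_bool (measurable_itvoc s x) (cintb_rhs_volt s jq jz jw hA0 tB)).
  - by case: (cintb_bool (measurable_itvoc s x) (cintb_volt s tB jq)).
  - apply: ae_imp r0 => y; rewrite /r /rhs => ->; ring.
have w0 x : 0 <= x <= pi -> w x = 0.
  move=> xp; rewrite ew // -[RHS](@CI0 R); apply: CI_ae.
  - by case: (cintb_bool (measurable_itvcc x pi) (cintb_rhs_antisym x jq jz jw hA0 tB)).
  - exact: cmeas_cst.
  - by apply: ae_imp r0 => y; rewrite /r /rhs /antisym => ->; rewrite !B0; ring.
apply: ae_imp r0 => y; rewrite /r.
have [yp|yp] := boolP (0 <= y <= pi); first by rewrite w0 // addr0.
by have [_ z0] := pz; rewrite z0.
Qed.
End Verify.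
End PerturbedKernel.

(** * From a kernel to the solutions of the equation *)

(** [c] and [sn] stand for [cos (sqrt l t)] and [sin (sqrt l t) / sqrt l]. *)
Section Transmutation.
Context {R : realType}.
Variables (c sn : R -> Cplx R) (l : Cplx R).
Hypotheses (dc : forall t, rcder c t (- (l * sn t))) (ds : forall t, rcder sn t (c t)).
Hypotheses (c0 : c 0 = 1) (s0 : sn 0 = 0).
Hypothesis sN : forall t, sn (- t) = - sn t.
Hypothesis cD : forall x y, c (x + y) = c x * c y - l * (sn x * sn y).
Hypothesis sD : forall x y, sn (x + y) = sn x * c y + c x * sn y.
Variables (p : R -> Cplx R) (A : R * R -> Cplx R).
Hypotheses (pp : pot p) (kA : is_kernel p A).
Implicit Types (x y s t u : R).

Let cc t : ccont c t. Proof. exact: rcder_ccont (dc t). Qed.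
Let cs t : ccont sn t. Proof. exact: rcder_ccont (ds t). Qed.
Let ms : cmeas sn. Proof. exact: ccont_cmeas. Qed.
Let hA : tri_fun A. Proof. by case: kA. Qed.
Let mA : cmeas A. Proof. by case: hA. Qed.
Let jp : cintb p. Proof. by case: pp => [[]]. Qed.
Let mp : cmeas p. Proof. by case: jp. Qed.
Local Notation U y s := (1 + volt A y s).

Definition sol x : Cplx R := sn x + CI (fun s => A (x, s) * sn (x - 2 * s)).
Definition dsol x : Cplx R := c x + CI (fun s => A (x, s) * c (x - 2 * s)).

Lemma half_double (a : Cplx R) : (a + a) / 2 = a. Proof. by field. Qed.
Lemma cintb_reflect (a : R) (f : R -> Cplx R) : cintb f -> cintb (fun x => f (a - x)).
Proof.
move=> jf; have n1 : (-1 : R) != 0 by rewrite oppr_eq0 oner_eq0.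
by have := cintb_affine a n1 jf; under eq_fun do rewrite mulN1r.
Qed.
Lemma ccont_bound (k : R -> Cplx R) : (forall t, ccont k t) ->
  exists2 K, 0 <= K & forall x s, 0 <= x <= pi -> 0 <= s <= x -> cmod (k (x - 2 * s)) <= K.
Proof.
move=> ck; have [K hK] := ccont_bounded (- pi) pi ck.
exists `|K| => // x s /andP[x0 xp] /andP[s_0 sx].
by apply: le_trans (ler_norm K); apply: hK; apply/andP; split; lra.
Qed.

Lemma rcder_fold (F f : R -> Cplx R) x s : (forall t, rcder F t (f t)) ->
  rcder (fun t => - (F (x - 2 * t) / 2)) s (f (x - 2 * s)).
Proof.
move=> dF; have := rcder_affine (dF (x + (-2) * s)).
move=> /(derZ (- 2^-1)); apply: eq_der => [y|].
  by rewrite mulNr [x + _]addrC mulNr addrC; ring.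
rewrite (_ : x + -2 * s = x - 2 * s); last by ring.
by rewrite rcN rc_nat mulrA mulrNN mulVf ?mul1r // pnatr_eq0.
Qed.
Lemma ccont_fold (k : R -> Cplx R) x s : (forall t, ccont k t) -> ccont (fun t => k (x - 2 * t)) s.
Proof.
move=> ck e e0; have [d d0 hd] := ck (x - 2 * s) e e0; exists (d / 2); first lra.
move=> h; rewrite cmod_rc => hh.
rewrite (_ : x - 2 * (s + h) = (x - 2 * s) + (-2 * h)); last by ring.
by apply: hd; rewrite cmod_rc normrM normrN normr_nat; lra.
Qed.

Lemma CI_fold_c x a b : a <= b ->
  CI (fun s => ⟦a <= s <= b⟧ * c (x - 2 * s)) = (sn (x - 2 * a) - sn (x - 2 * b)) / 2.
Proof.
move=> ab; rewrite (@CI_FTC R (fun t => - (sn (x - 2 * t) / 2)) (fun t => c (x - 2 * t))) //.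
- by move: (sn _) (sn _) => a1 b1; ring.
- by move=> t; exact: rcder_fold.
- by move=> t; exact: ccont_fold.
Qed.

Lemma cintb_A_fold k x : (forall t, ccont k t) -> cintb (fun s => A (x, s) * k (x - 2 * s)).
Proof.
move=> ck; have [M M0 hM] := tri_bounds hA; have [K K0 hK] := ccont_bound ck.
have mk : cmeas (fun s => k (x - 2 * s)).
  by apply: ccont_cmeas => s; exact: ccont_fold.
apply: (cintb_dom _ _ (rint_itv 0 pi (M * K))); first by meas.
move=> s; have [xs|xs] := boolP (tri x s); last first.
  by have [_ _ zA] := hA; rewrite zA // mul0r cmod0 !mulr_ge0.
have x0 := tri_ge0 xs; have /andP[/andP[sp sx] xp] := xs.
rewrite sp (le_trans sx xp) mulr1 cmodM; apply: ler_pM; rewrite ?cmod_ge0 //.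
  by have [] := hM x s.
by apply: hK; rewrite ?x0 ?sp.
Qed.

(** Integration by parts: the weight [U] against [c] is [A] against [sn],
   the boundary terms cancelling because [antisym] has mean zero. *)
Lemma sol_volt x : 0 <= x <= pi ->
  sol x = CI (fun s => ⟦0 <= s <= x⟧ * (U x s * c (x - 2 * s))).
Proof.
move=> xp; have /andP[x0 xpi] := xp.
have [M M0 hM] := tri_bounds hA; have [K K0 hK] := ccont_bound cc.
have mcf : cmeas (fun s => c (x - 2 * s)) by apply: ccont_cmeas => s; exact: ccont_fold.
have msf : cmeas (fun s => sn (x - 2 * s)) by apply: ccont_cmeas => s; exact: ccont_fold.
have mI := measurable_itvcc 0 x.
have jc a : 0 <= a -> cintb (fun s => ⟦a <= s <= x⟧ * c (x - 2 * s)).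
  move=> a0; apply: (cintb_dom _ _ (rint_itv a x K)).
    by apply: cmeasM => //; apply: cmeas_bool; exact: measurable_itvcc.
  move=> s; rewrite cmodM cmod_bool mulrC; have [/andP[s1 s2]|_] := boolP (a <= s <= x); last by rewrite !mulr0.
  by rewrite !mulr1; apply: hK => //; rewrite (le_trans a0 s1).
have jv : cintb (fun s => volt A x s * (⟦0 <= s <= x⟧ * c (x - 2 * s))).
  apply: (@cintb_bound R _ _ (2 * pi * M)); [exact: cmeas_volt2| |exact: jc].
  by move=> s; have [] := hM x s.
rewrite (@eq_CI R _ (fun s => ⟦0 <= s <= x⟧ * c (x - 2 * s) + volt A x s * (⟦0 <= s <= x⟧ * c (x - 2 * s)))); last first.
  by move=> s; ring.
rewrite CID //; last exact: jc.
rewrite CI_fold_c // mulr0 subr0 (_ : x - 2 * x = - x); last by ring.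
rewrite sN opprK /sol half_double; congr (_ + _).
have ja k : (forall t, ccont k t) -> cintb (fun t => antisym A x t * k (x - 2 * t)).
  move=> ck.
  have [K' K'0 hK'] := ccont_bound ck.
  apply: (cintb_dom _ _ (rint_itv 0 pi (2 * M * K'))).
    apply: cmeasM; first exact: cmeas_antisym1.
    by apply: ccont_cmeas => s; exact: ccont_fold.
  move=> t; have [xt|xt] := boolP (tri x t); last first.
    by rewrite antisym_out // mul0r cmod0 !mulr_ge0.
  have /andP[/andP[t0 tx] _] := xt; rewrite t0 (le_trans tx xpi) mulr1 cmodM.
  apply: ler_pM; rewrite ?cmod_ge0 //; first by have [] := hM x t.
  by apply: hK'; rewrite ?x0 ?t0.
pose f s t := ⟦t <= s⟧ * antisym A x t * (⟦0 <= s <= x⟧ * c (x - 2 * s)).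
have fub : CI (fun s => CI (f s)) = CI (fun t => CI (f ^~ t)).
  apply: (@CI_fubini R f (fun s => K * ⟦0 <= s <= x⟧) (fun t => 2 * M * ⟦0 <= t <= pi⟧)).
  - rewrite /f; apply: cmeasM; first by rewrite /antisym; meas.
    by apply: cmeasM; [apply: cmeas_bool; meas_bool|exact: (@cmeas_comp1 R _ _ _ fst mcf measurable_fst)].
  - exact: rint_itv.
  - exact: rint_itv.
  move=> s t; rewrite /f !cmodM !cmod_bool mulrC; apply: ler_pM; rewrite ?mulr_ge0 ?cmod_ge0 //.
    have [/andP[s1 s2]|_] := boolP (0 <= s <= x); last by rewrite mul0r mulr0.
    by rewrite mul1r mulr1; apply: hK => //; rewrite s1.
  apply: le_trans (_ : cmod (antisym A x t) <= _).
    by apply: ler_piMl; [exact: cmod_ge0|rewrite lern1 leq_b1].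
  by apply: antisym_bound => // u; have [] := hM x u.
have LE : CI (fun s => volt A x s * (⟦0 <= s <= x⟧ * c (x - 2 * s))) = CI (fun s => CI (f s)).
  apply: eq_CI => s; rewrite mulrC -CIZ; last first.
    by apply: cintb_bool; [exact: measurable_le_cst|exact: cintb_antisym].
  by apply: eq_CI => t; rewrite /f mulrC.
have inner t : CI (f ^~ t) = antisym A x t * ((sn (x - 2 * t) + sn x) / 2).
  have [xt|xt] := boolP (tri x t); last first.
    rewrite (antisym_out hA xt) mul0r -[RHS](@CI0 R); apply: eq_CI => s.
    by rewrite /f (antisym_out hA xt) mulr0 mul0r.
  have /andP[/andP[t0 tx] _] := xt.
  rewrite -[sn x]opprK -sN (_ : - x = x - 2 * x); last by ring.
  rewrite -(CI_fold_c x tx) -(CIZ _ (jc t t0)).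
  apply: eq_CI => s.
  have <- : ⟦t <= s⟧ * ⟦0 <= s <= x⟧ = ⟦t <= s <= x⟧ :> Cplx R.
    rewrite -natrM mulnb; congr (nat_of_bool _)%:R.
    by have [ts|//] := leP t s; rewrite (le_trans t0 ts).
  by rewrite /f; ring.
rewrite LE fub; under [RHS]eq_CI do rewrite inner.
clear fub LE inner f.
rewrite (@eq_CI R (fun t => antisym A x t * ((sn (x - 2 * t) + sn x) / 2))
   (fun t => 2^-1 * (antisym A x t * sn (x - 2 * t)) + (sn x / 2) * antisym A x t)); last first.
  by move=> t; ring.
have j0 := cintb_antisym hA x; have js := ja sn cs.
rewrite CID ?CIZ ?antisym_mean ?mulr0 ?addr0 //; try exact: cintbZ.
have jA := cintb_A_fold x cs.
have jA' : cintb (fun t => A (x, x - t) * sn (x - 2 * (x - t))).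
  exact: (cintb_reflect x jA).
rewrite (@eq_CI R (fun t => antisym A x t * sn (x - 2 * t))
   (fun t => A (x, t) * sn (x - 2 * t) + A (x, x - t) * sn (x - 2 * (x - t)))); last first.
  move=> t; rewrite /antisym (_ : x - 2 * (x - t) = - (x - 2 * t)); last by ring.
  by rewrite sN; ring.
by rewrite CID // -(CI_reflect x jA) mulrC half_double.
Qed.

(** [U] is symmetric and [sn] is odd about the middle of the interval. *)
Lemma volt_sn_mean y : 0 <= y <= pi -> CI (fun s => ⟦0 <= s <= y⟧ * (U y s * sn (y - 2 * s))) = 0.
Proof.
move=> yp; have [M M0 hM] := tri_bounds hA; have [K K0 hK] := ccont_bound cs.
have j : cintb (fun s => ⟦0 <= s <= y⟧ * (U y s * sn (y - 2 * s))).
  apply: (cintb_dom _ _ (rint_itv 0 y ((1 + 2 * pi * M) * K))).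
    apply: cmeasM; first by apply: cmeas_bool; exact: measurable_itvcc.
    apply: cmeasM; first by apply: cmeasD; [exact: cmeas_cst|exact: cmeas_volt2].
    by apply: ccont_cmeas => s; exact: ccont_fold.
  move=> s; rewrite !cmodM cmod_bool mulrC.
  have [sy|_] := boolP (0 <= s <= y); last by rewrite !mulr0.
  rewrite !mulr1; apply: ler_pM; rewrite ?cmod_ge0 //; first by have [] := hM y s.
  exact: hK.
have := CI_reflect y j.
rewrite [in X in _ = X](@eq_CI R _ (fun s => - (⟦0 <= s <= y⟧ * (U y s * sn (y - 2 * s))))); last first.
  move=> s; rewrite (volt_sym hA) (_ : y - 2 * (y - s) = - (y - 2 * s)); last by ring.
  rewrite sN !mulrN; congr (- (_ * _)); congr (nat_of_bool _)%:R.
  by rewrite subr_ge0 gerBl andbC.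
rewrite CIN // => /eqP; rewrite -addr_eq0 -mulr2n mulrn_eq0 /= => /eqP; exact.
Qed.

(** Inserting the equation of the kernel and exchanging the integrals. *)
Lemma kernel_fubini (k : R -> Cplx R) x : (forall t, ccont k t) -> 0 <= x <= pi ->
  CI (fun s => A (x, s) * k (x - 2 * s)) =
  CI (fun y => ⟦y <= x⟧ * (p y * CI (fun s => ⟦0 <= s <= y⟧ * (U y s * k (x - 2 * s))))).
Proof.
move=> ck xp; have /andP[x0 xpi] := xp.
have [M M0 hM] := tri_bounds hA; have [K K0 hK] := ccont_bound ck.
have mk : cmeas (fun s => k (x - 2 * s)) by apply: ccont_cmeas => s; exact: ccont_fold.
have mV := cmeas_volt hA.
pose f s y := ⟦0 <= s <= x⟧ * (⟦s < y <= x⟧ * (p y * U y s)) * k (x - 2 * s).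
have jU s : cintb (fun y => p y * U y s).
  by under eq_fun do rewrite mulrDr mulr1; apply: cintbD => //; exact: cintb_volt.
have LE : CI (fun s => A (x, s) * k (x - 2 * s)) = CI (fun s => CI (f s)).
  apply: eq_CI => s; have [xs|xs] := boolP (tri x s); last first.
    have [_ _ zA] := hA; rewrite zA // mul0r /f; have -> : (0 <= s <= x) = false.
      by apply/negbTE; apply: contra xs => sx; rewrite /tri sx xpi.
    by under [RHS]eq_CI do rewrite !mul0r; rewrite CI0.
  have sx : 0 <= s <= x by case/andP: xs.
  rewrite kA.2 // mulrC -CIZ; last by apply: cintb_bool; [exact: measurable_itvoc|exact: jU].
  by apply: eq_CI => y; rewrite /f sx mul1r mulrC.
rewrite LE (@CI_fubini R f (fun s => K * ⟦0 <= s <= x⟧) (fun y => (1 + 2 * pi * M) * cmod (p y))).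
- apply: eq_CI => y; have [yx|xy] := leP y x; last first.
    rewrite mul0r /f -[RHS](@CI0 R); apply: eq_CI => s.
    by rewrite (_ : (y <= x) = false) ?andbF ?mul0r ?mulr0 ?mul0r // leNgt xy.
  rewrite mul1r; have [yp|yp] := boolP (0 <= y <= pi); last first.
    have [_ z0] := pp; rewrite (z0 y yp) mul0r /f -[RHS](@CI0 R); apply: eq_CI => s.
    by rewrite (z0 y yp) mul0r !mulr0 mul0r.
  rewrite -CIZ; last first.
    apply: (cintb_dom _ _ (rint_itv 0 y ((1 + 2 * pi * M) * K))).
      apply: cmeasM; first by apply: cmeas_bool; exact: measurable_itvcc.
      by apply: cmeasM => //; apply: cmeasD; [exact: cmeas_cst|exact: cmeas_volt2].
    move=> s; rewrite !cmodM cmod_bool mulrC.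
    have [/andP[s1 s2]|_] := boolP (0 <= s <= y); last by rewrite !mulr0.
    rewrite !mulr1; apply: ler_pM; rewrite ?cmod_ge0 //; first by have [] := hM y s.
    by apply: hK => //; rewrite s1 (le_trans s2 yx).
  apply: (@CI_point _ y).
  + apply: cmeasM => //; apply: cmeasM; first by apply: cmeas_bool; exact: measurable_itvcc.
    apply: cmeasM; first by apply: cmeas_bool; meas_bool.
    by apply: cmeasM; [exact: cmeas_cst|apply: cmeasD; [exact: cmeas_cst|exact: cmeas_volt2]].
  + apply: cmeasM; first exact: cmeas_cst.
    apply: cmeasM; first by apply: cmeas_bool; exact: measurable_itvcc.
    by apply: cmeasM => //; apply: cmeasD; [exact: cmeas_cst|exact: cmeas_volt2].
  move=> s sy; rewrite /f yx andbT.
  have -> : (⟦0 <= s <= x⟧ * (⟦s < y⟧ * (p y * U y s)) : Cplx R) = ⟦0 <= s <= y⟧ * (p y * U y s).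
    rewrite mulrA; congr (_ * _); rewrite -natrM mulnb; congr (nat_of_bool _)%:R.
    rewrite lt_neqAle sy /=; have [s_y|] := leP s y; last by rewrite !andbF.
    by rewrite (le_trans s_y yx) !andbT.
  by ring.
- apply: cmeasM; last exact: (@cmeas_comp1 R _ _ _ fst mk measurable_fst).
  apply: cmeasM; first by apply: cmeas_bool; meas_bool.
  apply: cmeasM; first by apply: cmeas_bool; meas_bool.
  apply: cmeasM; first exact: (@cmeas_comp1 R _ _ _ snd mp measurable_snd).
  apply: cmeasD; first exact: cmeas_cst.
  exact: (@cmeas_comp2 R _ _ _ snd fst mV measurable_snd measurable_fst).
- exact: rint_itv.
- by apply: rintZ; case: jp.
move=> s y; rewrite /f !cmodM !cmod_bool.
have [sx|_] := boolP (0 <= s <= x); last by rewrite !mul0r mulr0 mul0r.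
rewrite mul1r mulr1 mulrC; apply: ler_pM; rewrite ?cmod_ge0 ?mulr_ge0 ?cmod_ge0 //; first exact: hK.
apply: le_trans (_ : cmod (p y) * cmod (U y s) <= _).
  by apply: ler_piMl; [rewrite mulr_ge0 ?cmod_ge0|rewrite lern1 leq_b1].
by rewrite mulrC; apply: ler_wpM2r; [exact: cmod_ge0|have [] := hM y s].
Qed.

Lemma cintb_U k y : (forall t, ccont k t) -> 0 <= y <= pi ->
  cintb (fun s => ⟦0 <= s <= y⟧ * (U y s * k (y - 2 * s))).
Proof.
move=> ck yp; have [M M0 hM] := tri_bounds hA; have [K K0 hK] := ccont_bound ck.
apply: (cintb_dom _ _ (rint_itv 0 y ((1 + 2 * pi * M) * K))).
  apply: cmeasM; first by apply: cmeas_bool; exact: measurable_itvcc.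
  apply: cmeasM; first by apply: cmeasD; [exact: cmeas_cst|exact: cmeas_volt2].
  by apply: ccont_cmeas => s; exact: ccont_fold.
move=> s; rewrite !cmodM cmod_bool mulrC.
have [sy|_] := boolP (0 <= s <= y); last by rewrite !mulr0.
rewrite !mulr1; apply: ler_pM; rewrite ?cmod_ge0 //; first by have [] := hM y s.
exact: hK.
Qed.

Let h y := p y * sol y.

(** After [kernel_fubini], the addition theorem for [sn] and [c] separates
   [x - y] from [y - 2 s]; the term with [sn (y - 2 s)] integrates to zero. *)
Lemma sol_duhamel x : 0 <= x <= pi ->
  sol x = sn x + CI (fun y => ⟦y <= x⟧ * (sn (x - y) * h y)).
Proof.
move=> xp; rewrite /sol kernel_fubini //; congr (_ + _); apply: eq_CI => y; congr (_ * _).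
have [yp|yp] := boolP (0 <= y <= pi); last first.
  by have [_ z0] := pp; rewrite /h (z0 y yp) !mul0r mulr0.
rewrite (@eq_CI R _ (fun s => sn (x - y) * (⟦0 <= s <= y⟧ * (U y s * c (y - 2 * s))) +
    c (x - y) * (⟦0 <= s <= y⟧ * (U y s * sn (y - 2 * s))))); last first.
  move=> s; rewrite (_ : x - 2 * s = (x - y) + (y - 2 * s)); last by ring.
  by rewrite sD; ring.
rewrite CID; [|by apply: cintbZ; exact: cintb_U|by apply: cintbZ; exact: cintb_U].
rewrite CIZ ?CIZ; try exact: cintb_U.
by rewrite volt_sn_mean // -sol_volt // /h; ring.
Qed.
Lemma dsol_duhamel x : 0 <= x <= pi ->
  dsol x = c x + CI (fun y => ⟦y <= x⟧ * (c (x - y) * h y)).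
Proof.
move=> xp; rewrite /dsol kernel_fubini //; congr (_ + _); apply: eq_CI => y; congr (_ * _).
have [yp|yp] := boolP (0 <= y <= pi); last first.
  by have [_ z0] := pp; rewrite /h (z0 y yp) !mul0r mulr0.
rewrite (@eq_CI R _ (fun s => c (x - y) * (⟦0 <= s <= y⟧ * (U y s * c (y - 2 * s))) +
    - (l * sn (x - y)) * (⟦0 <= s <= y⟧ * (U y s * sn (y - 2 * s))))); last first.
  move=> s; rewrite (_ : x - 2 * s = (x - y) + (y - 2 * s)); last by ring.
  by rewrite cD; ring.
rewrite CID; [|by apply: cintbZ; exact: cintb_U|by apply: cintbZ; exact: cintb_U].
rewrite CIZ ?CIZ; try exact: cintb_U.
by rewrite volt_sn_mean // -sol_volt // /h; ring.
Qed.

Lemma rcder_shift (F f : R -> Cplx R) y u : (forall t, rcder F t (f t)) ->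
  rcder (fun t => F (t - y)) u (f (u - y)).
Proof.
move=> dF; have := rcder_affine (dF (- y + 1 * u)); apply: eq_der => [t|].
  by congr F; ring.
by rewrite rc1 mul1r; congr f; ring.
Qed.
Lemma ccont_shift (k : R -> Cplx R) y u : (forall t, ccont k t) -> ccont (fun t => k (t - y)) u.
Proof.
move=> ck e e0; have [d d0 hd] := ck (u - y) e e0; exists d => // t /hd.
by rewrite addrAC.
Qed.

(** Duhamel's formula integrates termwise. *)
Lemma duhamel_prim (k K g : R -> Cplx R) x : (forall t, rcder K t (k t)) -> (forall t, ccont k t) ->
  pot g -> 0 <= x <= pi ->
  CI (fun u => ⟦0 <= u <= x⟧ * CI (fun y => ⟦y <= u⟧ * (k (u - y) * g y))) =
  CI (fun y => ⟦y <= x⟧ * ((K (x - y) - K 0) * g y)).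
Proof.
move=> dK ck [[jg _] g0] xp; have /andP[x0 xpi] := xp; have [mg rg] := jg.
have mk : cmeas k by exact: ccont_cmeas.
have [N hN] := ccont_bounded (- pi) pi ck.
have ksmall u y : 0 <= u <= x -> 0 <= y <= pi -> cmod (k (u - y)) <= `|N|.
  move=> /andP[u0 ux] /andP[y0 yp]; apply: le_trans (ler_norm N); apply: hN.
  by apply/andP; split; lra.
pose f u y := ⟦0 <= u <= x⟧ * (⟦y <= u⟧ * (k (u - y) * g y)).
have fb u y : cmod (f u y) <= `|N| * ⟦0 <= u <= x⟧ * cmod (g y).
  rewrite /f !cmodM !cmod_bool; have [ux|_] := boolP (0 <= u <= x); last by rewrite !(mul0r, mulr0).
  rewrite mul1r mulr1; have [yp|yp] := boolP (0 <= y <= pi); last by rewrite (g0 y yp) cmod0 !mulr0.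
  apply: le_trans (_ : cmod (k (u - y)) * cmod (g y) <= _).
    by apply: ler_piMl; [rewrite mulr_ge0 ?cmod_ge0|rewrite lern1 leq_b1].
  by apply: ler_wpM2r; [exact: cmod_ge0|exact: ksmall].
have fm : cmeas (fun o : R * R => f o.1 o.2) by rewrite /f; meas.
transitivity (CI (fun u => CI (f u))).
  apply: eq_CI => u; rewrite /f; have [ux|_] := boolP (0 <= u <= x); last first.
    by rewrite mul0r; under [RHS]eq_CI do rewrite mul0r; rewrite CI0.
  by rewrite mul1r; apply: eq_CI => y; rewrite mul1r.
rewrite (CI_fubini fm (rint_itv 0 x `|N|) rg fb); apply: eq_CI => y; rewrite {fb fm}/f.
have [yp|yp] := boolP (0 <= y <= pi); last first.
  by rewrite (g0 y yp) !mulr0 -[RHS](@CI0 R); apply: eq_CI => u; rewrite !mulr0.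
have [yx|xy] := leP y x; last first.
  rewrite mul0r -[RHS](@CI0 R); apply: eq_CI => u.
  have [uy|//] := leP y u; last by rewrite mul0r mulr0.
  by rewrite [u <= x]leNgt (lt_le_trans xy uy) andbF mul0r.
have -> : K (x - y) - K 0 = CI (fun u => ⟦y <= u <= x⟧ * k (u - y)).
  rewrite (@CI_FTC R (fun u => K (u - y)) (fun u => k (u - y)) y x yx) ?subrr // => u.
    exact: rcder_shift.
  exact: ccont_shift.
rewrite mul1r mulrC -CIZ; last first.
  apply: (cintb_dom _ _ (rint_itv y x `|N|)).
    apply: cmeasM; first by apply: cmeas_bool; exact: measurable_itvcc.
    by apply: ccont_cmeas => u; exact: ccont_shift.
  move=> u; rewrite cmodM cmod_bool mulrC; have [/andP[yu ux]|_] := boolP (y <= u <= x); last by rewrite !mulr0.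
  by rewrite !mulr1; apply: ksmall => //; rewrite ux (le_trans _ yu) //; case/andP: yp.
apply: eq_CI => u; have <- : ⟦0 <= u <= x⟧ * ⟦y <= u⟧ = ⟦y <= u <= x⟧ :> Cplx R.
  rewrite -natrM mulnb andbC; congr (nat_of_bool _)%:R.
  by have [yu|//] := leP y u; rewrite (le_trans _ yu) //; case/andP: yp.
by ring.
Qed.

Lemma pot_mul (g : R -> Cplx R) (K : R) : cmeas g -> (forall x, 0 <= x <= pi -> cmod (g x) <= K) ->
  pot (fun x => p x * g x).
Proof.
move=> mg hK; have [[_ rp2] p0] := pp.
have K0 : 0 <= K by apply: le_trans (hK 0 _); rewrite ?cmod_ge0 // lexx pi_ge0.
have hb x : cmod (p x * g x) <= K * cmod (p x).
  rewrite cmodM mulrC; have [xp|xp] := boolP (0 <= x <= pi); last by rewrite (p0 x xp) cmod0 !mulr0.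
  by apply: ler_wpM2r; [exact: cmod_ge0|exact: hK].
split; last by move=> x xp; rewrite (p0 x xp) mul0r.
have mpg : cmeas (fun x => p x * g x) by exact: cmeasM.
split; first by apply: (cintb_dom mpg hb); apply: rintZ; case: jp.
apply: (rint_le _ _ (rintZ (K ^+ 2) rp2)); first exact: measurable_cmod_sqr.
move=> x; rewrite ger0_norm ?exprn_ge0 ?cmod_ge0 // -exprMn.
by rewrite lerXn2r ?nnegrE ?mulr_ge0 ?cmod_ge0.
Qed.

Lemma cmeas_sol : cmeas sol.
Proof.
rewrite /sol; apply: cmeasD => //.
apply: (@cmeas_CI R _ _ (fun z => A (z.1, z.2) * sn (z.1 - 2 * z.2))).
apply: cmeasM; first by meas.
apply: (cmeas_comp ms); apply: measurable_funB; first exact: measurable_fst.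
by apply: measurable_funM; [exact: measurable_cst|exact: measurable_snd].
Qed.
Lemma sol_bounded : exists K, forall x, 0 <= x <= pi -> cmod (sol x) <= K.
Proof.
have [K hK] := ccont_bounded (- pi) pi cs; have [M M0 hM] := tri_bounds hA.
have [K' K'0 hK'] := ccont_bound cs.
exists (K + M * K' * (pi - 0)) => x xp; have /andP[x0 xpi] := xp.
apply: le_trans (cmodD _ _) _; apply: lerD.
  by apply: hK; rewrite xpi andbT (le_trans _ x0) // oppr_le0 pi_ge0.
rewrite -IR_itv ?pi_ge0 // -IRZ; last exact: rint_itvcc.
apply: CI_le; [exact: cintb_A_fold|exact: rint_itv|] => s.
have [xs|xs] := boolP (tri x s); last first.
  by have [_ _ zA] := hA; rewrite zA // mul0r cmod0 !mulr_ge0.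
have /andP[/andP[sp sx] _] := xs.
rewrite sp (le_trans sx xpi) mulr1 cmodM; apply: ler_pM; rewrite ?cmod_ge0 //.
  by have [] := hM x s.
by apply: hK'; rewrite ?x0 ?sp.
Qed.
Let ph : pot h.
Proof. by have [K hK] := sol_bounded; apply: pot_mul hK; exact: cmeas_sol. Qed.
Let g y := h y - l * (⟦0 <= y <= pi⟧ * sol y).
Let psol : pot (fun y => ⟦0 <= y <= pi⟧ * sol y).
Proof.
have [K hK] := sol_bounded; apply: (@pot_bounded R _ K).
  by apply: cmeasM; [apply: cmeas_bool; exact: measurable_itvcc|exact: cmeas_sol].
move=> y; rewrite cmodM cmod_bool mulrC; have [yp|_] := boolP (0 <= y <= pi); last by rewrite !mulr0.
by rewrite !mulr1 hK.
Qed.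
Let pg : pot g.
Proof.
have -> : g = (fun y => h y + - l * (⟦0 <= y <= pi⟧ * sol y)).
  by apply/funext => y; rewrite /g; ring.
by apply: potD => //; exact: potZ.
Qed.
Let jh : cintb h. Proof. by case: ph => [[]]. Qed.
(** Iterated integrals of the equation, defined on the whole line, have the
   required regularity by construction; on [0, pi] they agree with [dsol] and
   [sol]. *)
Definition dsolution x := 1 + prim g x.
Let g2 u := ⟦0 <= u <= pi⟧ * dsolution u.
Definition solution x := prim g2 x.

Let cintb_duh (k : R -> Cplx R) x : (forall t, ccont k t) -> 0 <= x <= pi ->
  cintb (fun y => ⟦y <= x⟧ * (k (x - y) * h y)).
Proof.
move=> ck /andP[x0 xp]; have [mh rh] := jh; have [N hN] := ccont_bounded (- pi) pi ck.
have mk : cmeas k by exact: ccont_cmeas.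
apply: cintb_bool; first exact: measurable_le_cst.
apply: (cintb_dom _ _ (rintZ N rh)); first by meas.
move=> y; rewrite cmodM; have [/andP[y0 yp]|yp] := boolP (0 <= y <= pi).
  by apply: ler_wpM2r; [exact: cmod_ge0|apply: hN; apply/andP; split; lra].
by have [_ h0] := ph; rewrite (h0 y yp) cmod0 !mulr0.
Qed.
Let cintb_itv (k : R -> Cplx R) x : (forall t, ccont k t) -> cintb (fun u => ⟦0 <= u <= x⟧ * k u).
Proof.
move=> ck; have [N hN] := ccont_bounded 0 x ck.
apply: (cintb_dom _ _ (rint_itv 0 x N)).
  by apply: cmeasM; [apply: cmeas_bool; exact: measurable_itvcc|exact: ccont_cmeas].
move=> u; rewrite cmodM cmod_bool mulrC; have [ux|_] := boolP (0 <= u <= x); last by rewrite !mulr0.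
by rewrite !mulr1 hN.
Qed.
Let itv_le u x : x <= pi -> ⟦u <= x⟧ * ⟦0 <= u <= pi⟧ = ⟦0 <= u <= x⟧ :> Cplx R.
Proof.
move=> xp; rewrite -natrM mulnb; congr (nat_of_bool _)%:R.
by have [ux|_] := leP u x; rewrite ?andbF // (le_trans ux xp) !andbT.
Qed.

Let split_duhamel (F k K : R -> Cplx R) x : (forall t, ccont k t) -> 0 <= x <= pi ->
  cintb (fun u => ⟦0 <= u <= x⟧ * F u) ->
  (forall u, 0 <= u <= pi -> F u = k u + CI (fun y => ⟦y <= u⟧ * (K (u - y) * h y))) ->
  cintb (fun u => ⟦0 <= u <= x⟧ * CI (fun y => ⟦y <= u⟧ * (K (u - y) * h y))) /\
  CI (fun u => ⟦0 <= u <= x⟧ * F u) = CI (fun u => ⟦0 <= u <= x⟧ * k u) +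
    CI (fun u => ⟦0 <= u <= x⟧ * CI (fun y => ⟦y <= u⟧ * (K (u - y) * h y))).
Proof.
move=> ck /andP[x0 xpi] jF eF.
have e : (fun u => ⟦0 <= u <= x⟧ * CI (fun y => ⟦y <= u⟧ * (K (u - y) * h y))) =
    (fun u => ⟦0 <= u <= x⟧ * F u - ⟦0 <= u <= x⟧ * k u).
  apply/funext => u; rewrite -mulrBr; have [/andP[u0 ux]|_] := boolP (0 <= u <= x); last by rewrite !mul0r.
  by rewrite eF ?u0 ?(le_trans ux xpi) // addrC addKr.
have jk := cintb_itv x ck.
rewrite e; split; first exact: cintbB.
by rewrite CIB // addrC subrK.
Qed.

(** Both [c] and the integral in Duhamel's formula are integrated with
   [duhamel_prim] for the primitive [c] of [- l sn]. *)
Lemma dsolution_eq x : 0 <= x <= pi -> dsolution x = dsol x.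
Proof.
move=> xp; have /andP[x0 xpi] := xp; have [[jg0 _] _] := pg.
have jps : cintb (fun y => ⟦0 <= y <= pi⟧ * sol y) by case: psol => [[]].
rewrite dsol_duhamel // /dsolution /prim.
have -> : CI (fun y => ⟦y <= x⟧ * g y) = CI (fun y => ⟦y <= x⟧ * h y) - l * CI (fun u => ⟦0 <= u <= x⟧ * sol u).
  rewrite -CIZ; last first.
    by under eq_fun do rewrite -(itv_le _ xpi) -mulrA; apply: cintb_bool => //; exact: measurable_le_cst.
  rewrite -CIB; last 2 first.
  - by apply: cintb_bool => //; exact: measurable_le_cst.
  - by apply: cintbZ; under eq_fun do rewrite -(itv_le _ xpi) -mulrA; apply: cintb_bool => //; exact: measurable_le_cst.
  by apply: eq_CI => y; rewrite /g -(itv_le y xpi); ring.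
have mls : (fun t => - (l * sn t)) = (fun t => - l * sn t) by apply/funext => t; rewrite mulNr.
have cls t : ccont (fun t => - (l * sn t)) t.
  by rewrite mls; exact: rcder_ccont (derZ (- l) (ds t)).
have e1 := @CI_FTC R c (fun t => - (l * sn t)) 0 x x0 dc cls.
have e2 := duhamel_prim dc cls ph xp.
have jsx : cintb (fun u => ⟦0 <= u <= x⟧ * sol u).
  by under eq_fun do rewrite -(itv_le _ xpi) -mulrA; apply: cintb_bool => //; exact: measurable_le_cst.
have [jD e3] := split_duhamel cs xp jsx sol_duhamel.
have -> : l * CI (fun u => ⟦0 <= u <= x⟧ * sol u) =
    - (CI (fun u => ⟦0 <= u <= x⟧ * - (l * sn u)) +
       CI (fun u => ⟦0 <= u <= x⟧ * CI (fun y => ⟦y <= u⟧ * (- (l * sn (u - y)) * h y)))).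
  rewrite e3 (@eq_CI R (fun u => ⟦0 <= u <= x⟧ * - (l * sn u)) (fun u => - l * (⟦0 <= u <= x⟧ * sn u))); last by move=> u; ring.
  rewrite (@eq_CI R (fun u => ⟦0 <= u <= x⟧ * CI (fun y => ⟦y <= u⟧ * (- (l * sn (u - y)) * h y)))
    (fun u => - l * (⟦0 <= u <= x⟧ * CI (fun y => ⟦y <= u⟧ * (sn (u - y) * h y))))); last first.
    move=> u; have [/andP[u0 ux]|_] := boolP (0 <= u <= x); last by rewrite !mul0r mulr0.
    rewrite !mul1r -CIZ; last by apply: cintb_duh => //; rewrite u0 (le_trans ux).
    by apply: eq_CI => y; ring.
  by rewrite !CIZ //; [ring|exact: cintb_itv].
rewrite e1 e2 c0.
have -> : CI (fun y => ⟦y <= x⟧ * ((c (x - y) - 1) * h y)) =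
    CI (fun y => ⟦y <= x⟧ * (c (x - y) * h y)) - CI (fun y => ⟦y <= x⟧ * h y).
  rewrite -CIB; [|exact: cintb_duh|by apply: cintb_bool => //; exact: measurable_le_cst].
  by apply: eq_CI => y; ring.
ring.
Qed.

Lemma ccont_dsolution t : ccont dsolution t.
Proof.
have [sg _] := pg; rewrite /ccont.
rewrite (_ : (fun k => _) = (fun k => prim g (t + k) - prim g t)); first exact: prim_ccont.
by apply/funext => k; rewrite /dsolution; ring.
Qed.
Let pg2 : pot g2.
Proof.
have [K hK] := ccont_bounded 0 pi ccont_dsolution; apply: (@pot_bounded R _ K).
  by apply: cmeasM; [apply: cmeas_bool; exact: measurable_itvcc|exact: ccont_cmeas ccont_dsolution].
move=> y; rewrite cmodM cmod_bool mulrC; have [yp|_] := boolP (0 <= y <= pi); last by rewrite !mulr0.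
by rewrite !mulr1 hK.
Qed.
Lemma solution_eq x : 0 <= x <= pi -> solution x = sol x.
Proof.
move=> xp; have /andP[x0 xpi] := xp.
have [jD e3] := split_duhamel cc xp (cintb_itv x ccont_dsolution)
   (fun u up => etrans (dsolution_eq up) (dsol_duhamel up)).
rewrite sol_duhamel // /solution /prim /g2; under eq_CI do rewrite mulrA (itv_le _ xpi).
rewrite e3 (@CI_FTC R sn c 0 x x0 ds cc) (duhamel_prim ds cc ph xp) s0 subr0.
by congr (_ + _); apply: eq_CI => y; rewrite subr0.
Qed.

Lemma solution_is_solution : is_solution p l solution dsolution.
Proof.
have [sg g0] := pg; have [sg2 g20] := pg2; have [jg _] := sg; have [jg2 _] := sg2.
split.
- have -> : solution = (fun x => 0 + prim g2 x) by apply/funext => x; rewrite add0r.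
  exact: prim_abs_continuous.
- exact: prim_abs_continuous.
- move=> x /andP[x0 xp]; apply/rcder_is_rderive.
  have -> : dsolution x = g2 x by rewrite /g2 (ltW x0) (ltW xp) mul1r.
  apply: rcder_prim => // e e0; have [d d0 hd] := ccont_dsolution x e0.
  exists (Num.min d (Num.min x (pi - x))); first by rewrite !lt_min d0 x0 subr_gt0.
  move=> k; rewrite !lt_min => /andP[kd /andP[kx kp]]; have := hd k kd.
  rewrite /g2; move: kx kp; rewrite cmod_rc !ltr_norml => /andP[k1 k2] /andP[k3 k4].
  have -> : (0 <= x + k <= pi) by apply/andP; split; lra.
  by rewrite (ltW x0) (ltW xp) !mul1r.
- have := ae_prim jg; apply: ae_imp => x dx /andP[x0 xp].
  have xp' : 0 <= x <= pi by rewrite !ltW.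
  exists (g x).
    apply/rcder_is_rderive; apply: eq_der (derD (der_cst rc 1 x) dx) => //.
    by rewrite add0r.
  by rewrite solution_eq // /g /h xp' mul1r; ring.
Qed.
Lemma solution_at0 : solution 0 = 0.
Proof.
have [[[mg2 _] _] g20] := pg2; apply: prim_at0 => // u u0; apply: g20.
by rewrite negb_and -ltNge u0.
Qed.
Lemma dsolution_at0 : dsolution 0 = 1.
Proof.
have [[[mg _] _] g0] := pg; rewrite /dsolution prim_at0 ?addr0 // => u u0; apply: g0.
by rewrite negb_and -ltNge u0.
Qed.
End Transmutation.

(** * Uniqueness for the initial value problem *)

Section Uniqueness.
Context {R : realType}.
Local Notation mu := (@lebesgue_measure R).
Implicit Types (p : R -> Cplx R) (l : Cplx R) (x : R).

(** Gronwall's argument in an exponentially weighted sup norm. *)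
Lemma gronwall_zero (F F1 gF g1 : R -> Cplx R) (g : R -> R) (M : R) :
  (forall u, 0 <= g u) -> rint g -> rint (fun u => g u ^+ 2) ->
  cintb gF -> cintb g1 ->
  (forall u, ~~ (0 <= u <= pi) -> gF u = 0) -> (forall u, ~~ (0 <= u <= pi) -> g1 u = 0) ->
  (forall u, 0 <= u <= pi -> cmod (gF u) <= g u * cmod (F1 u)) ->
  (forall u, 0 <= u <= pi -> cmod (g1 u) <= g u * cmod (F u)) ->
  (forall x, 0 <= x <= pi -> F x = prim gF x) -> (forall x, 0 <= x <= pi -> F1 x = prim g1 x) ->
  (forall x, 0 <= x <= pi -> cmod (F x) <= M /\ cmod (F1 x) <= M) ->
  forall x, 0 <= x <= pi -> F x = 0 /\ F1 x = 0.
Proof.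
move=> g0 jg jg2 jF j1 zF z1 bF b1 eF e1 bM.
have half0 : 0 < (2^-1 : R) by rewrite invr_gt0.
have [gam gam0 small] := exp_smoothing g0 jg jg2 half0.
have M0 : 0 <= M.
  by have [|h _] := bM 0; [rewrite lexx pi_ge0|exact: le_trans (cmod_ge0 _) h].
have est (G H : R -> Cplx R) (c : R) x : cintb G -> (forall u, ~~ (0 <= u <= pi) -> G u = 0) ->
    (forall u, 0 <= u <= pi -> cmod (G u) <= g u * cmod (H u)) -> 0 <= c ->
    (forall u, 0 <= u <= pi -> cmod (H u) <= c * expR (gam * u)) ->
    cmod (prim G x) <= c / 2 * expR (gam * x).
  move=> jG zG bG c0 bH; set e := expR (gam * x).
  have e0 : 0 <= e by exact: expR_ge0.
  have jw : rint (fun y => g y * expw gam x y) by apply: rint_expw => //; exact: ltW.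
  apply: (@le_trans _ _ (IR (fun y => c * e * (g y * expw gam x y)))).
    apply: CI_le; [by apply: cintb_bool => //; exact: measurable_le_cst|exact: rintZ|].
    move=> u; rewrite cmodM cmod_bool; have w0 := expw_gt0 gam x u.
    have rhs0 : 0 <= c * e * (g u * expw gam x u) by rewrite !mulr_ge0 // ltW.
    have [ux|_] := leP u x; last by rewrite mul0r.
    rewrite mul1r; have [up|up] := boolP (0 <= u <= pi); last by rewrite (zG u up) cmod0.
    apply: le_trans (bG u up) _; apply: le_trans (ler_wpM2l (g0 u) (bH u up)) _.
    by rewrite (expw_forward gam ux) -/e; apply: eq_leq_R; ring.
  by rewrite IRZ // (mulrAC c 2^-1) ler_wpM2l // mulr_ge0.
have key n x : 0 <= x <= pi -> cmod (F x) <= M / 2 ^+ n * expR (gam * x) /\ cmod (F1 x) <= M / 2 ^+ n * expR (gam * x).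
  elim: n x => [|n ih] x xp.
    have [h1 h2] := bM x xp; have /andP[x0 _] := xp.
    have e1' : 1 <= expR (gam * x) by rewrite -expR0 ler_expR mulr_ge0 // ltW.
    by rewrite expr0 divr1; split; [apply: le_trans h1 _|apply: le_trans h2 _]; rewrite ler_peMr.
  have Mn : 0 <= M / 2 ^+ n by rewrite divr_ge0 ?exprn_ge0.
  rewrite exprSr invfM mulrA eF // e1 //; split.
    by apply: (est gF F1) => // u /ih[].
  by apply: (est g1 F) => // u /ih[].
have zero (z : Cplx R) x : (forall n, cmod z <= M / 2 ^+ n * expR (gam * x)) -> z = 0.
  move=> h; apply: cmod_eq0; apply/eqP; rewrite eq_le cmod_ge0 andbT.
  apply/ler_addgt0Pr => e e0; rewrite add0r.
  have [n hn] := geometric_lt (M * expR (gam * x)) e0.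
  by apply: le_trans (h n) _; rewrite mulrAC; apply: ltW; exact: hn.
by move=> x xp; split; apply: (zero _ x) => n; have [] := key n x xp.
Qed.

(** The difference of two solutions is the integral of its derivative. *)
Lemma solution_unique p l (y y1 z z1 : R -> Cplx R) : pot p ->
  is_solution p l y y1 -> is_solution p l z z1 -> y 0 = z 0 -> y1 0 = z1 0 ->
  forall x, 0 <= x <= pi -> y x = z x /\ y1 x = z1 x.
Proof.
move=> pp [ay ay1 dy ey] [az az1 dz ez] yz0 yz1.
have p0 : 0 <= pi :> R by exact: pi_ge0.
pose F x := y x - z x; pose F1 x := y1 x - z1 x.
have aF : abs_continuous 0 pi F by exact: abs_continuousB.
have aF1 : abs_continuous 0 pi F1 by exact: abs_continuousB.
have cF := abs_continuous_clamp p0 aF; have cF1 := abs_continuous_clamp p0 aF1.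
have [M hM] := ccont_bounded 0 pi cF; have [M1 hM1] := ccont_bounded 0 pi cF1.
pose gF u := ⟦0 <= u <= pi⟧ * F1 (clamp 0 pi u).
pose g1 u := p u * F (clamp 0 pi u) + - l * (⟦0 <= u <= pi⟧ * F (clamp 0 pi u)).
have pcl (G : R -> Cplx R) (K : R) : (forall x, ccont (fun x => G (clamp 0 pi x)) x) ->
    (forall x, 0 <= x <= pi -> cmod (G (clamp 0 pi x)) <= K) -> pot (fun u => ⟦0 <= u <= pi⟧ * G (clamp 0 pi u)).
  move=> cG hK; apply: (@pot_bounded R _ K).
    by apply: cmeasM; [apply: cmeas_bool; exact: measurable_itvcc|exact: (ccont_cmeas cG)].
  move=> x; rewrite cmodM cmod_bool mulrC; have [xp|_] := boolP (0 <= x <= pi); last by rewrite !mulr0.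
  by rewrite !mulr1; exact: hK.
have pF : pot gF by exact: pcl hM1.
have p1 : pot g1.
  by apply: potD; [exact: (pot_mul pp (ccont_cmeas cF) hM)|apply: potZ; exact: pcl hM].
have [sF zF] := pF; have [s1 z1'] := p1; have [jF _] := sF; have [j1 _] := s1.
have neg (G : R -> Cplx R) : (forall u, ~~ (0 <= u <= pi) -> G u = 0) -> forall u, u < 0 -> G u = 0.
  by move=> zG u u0; apply: zG; rewrite negb_and -ltNge u0.
have eF x : 0 <= x <= pi -> F x = prim gF x.
  move=> xp; rewrite (abs_continuous_prim p0 aF sF (neg _ zF)) //.
    by rewrite /F yz0 subrr add0r.
  apply/nearW => u /andP[u0 up]; have up' : 0 <= u <= pi by rewrite !ltW.
  rewrite /gF up' mul1r clamp_id //; apply: derB; apply/rcder_is_rderive.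
    by apply: dy; rewrite u0.
  by apply: dz; rewrite u0.
have e1 x : 0 <= x <= pi -> F1 x = prim g1 x.
  move=> xp; rewrite (abs_continuous_prim p0 aF1 s1 (neg _ z1')) //.
    by rewrite /F1 yz1 subrr add0r.
  apply: ae_imp (ae_and ey ez) => u [h1 h2] up.
  have [y2 d1 q1] := h1 up; have [z2 d2 q2] := h2 up.
  have up' : 0 <= u <= pi by move: up => /andP[u0 up]; rewrite !ltW.
  have -> : g1 u = y2 - z2.
    rewrite /g1 up' mul1r clamp_id // /F mulNr -mulrBl.
    have -> : y2 = p u * y u - l * y u by rewrite -q1; ring.
    have -> : z2 = p u * z u - l * z u by rewrite -q2; ring.
    ring.
  by apply: derB; apply/rcder_is_rderive.
pose i (u : R) : R := ⟦0 <= u <= pi⟧.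
have [[[_ rp] rp2] _] := pp.
pose g (u : R) : R := cmod (p u) + (cmod l + 1) * i u.
have k0 : 0 <= cmod l + 1 by rewrite addr_ge0 ?cmod_ge0.
have ig : rint (fun u => (cmod l + 1) * i u) by exact: rint_itv.
have ig2 : rint (fun u => ((cmod l + 1) * i u) ^+ 2).
  under eq_fun do rewrite exprMn [X in _ * X]expr2 -natrM mulnb andbb.
  exact: rint_itv.
have ii u : 0 <= u <= pi -> i u = 1 by rewrite /i => ->.
have zero : forall x, 0 <= x <= pi -> F x = 0 /\ F1 x = 0.
  apply: (@gronwall_zero F F1 gF g1 g (Num.max M M1)) => //.
  - by move=> u; rewrite addr_ge0 ?cmod_ge0 // mulr_ge0 // /i ler0n.
  - exact: rintD.
  - exact: rint_cmod_add2.
  - move=> u up; rewrite /gF /g up mul1r clamp_id // ii // mulr1.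
    have c1 : 1 <= cmod (p u) + (cmod l + 1).
      by have := cmod_ge0 (p u); have := cmod_ge0 l; move: (cmod l) (cmod (p u)) => a b; lra.
    by apply: ler_peMl => //; exact: cmod_ge0.
  - move=> u up; rewrite /g1 /g up mul1r clamp_id // ii // mulr1 -mulrDl cmodM.
    apply: ler_wpM2r; first exact: cmod_ge0.
    by apply: le_trans (cmodD _ _) _; rewrite cmodN lerD2l lerDl.
  - move=> x xp; have := hM x xp; have := hM1 x xp; rewrite !clamp_id // => h1 h2.
    by rewrite !le_max h1 h2 orbT.
move=> x /zero[h1 h2]; split; apply/eqP; rewrite -subr_eq0; apply/eqP; [exact: h1|exact: h2].
Qed.
End Uniqueness.

Section KernelSolution.
Context {R : realType}.
Local Notation mu := (@lebesgue_measure R).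
Implicit Types (p q : R -> Cplx R) (l : Cplx R) (x : R).

Lemma is_solution_eq p q l y y1 : (forall x, 0 <= x <= pi -> p x = q x) ->
  is_solution p l y y1 -> is_solution q l y y1.
Proof.
move=> pq [h1 h2 h3 h4]; split => //; apply: ae_imp h4 => x h xp.
have [y2 d e] := h xp; exists y2 => //; rewrite -pq //.
by move: xp => /andP[x0 xp]; rewrite !ltW.
Qed.

Definition kernel_S p (A : R * R -> Cplx R) x l : Cplx R :=
  solution (sinc ^~ l) l p A x.
Definition kernel_S1 p (A : R * R -> Cplx R) x l : Cplx R :=
  dsolution (sinc ^~ l) l p A x.

Lemma kernel_is_S p A : pot p -> is_kernel p A ->
  is_S p (kernel_S p A) (kernel_S1 p A) /\ forall l,
    kernel_S p A pi l = sinc pi l + CI (fun s => A (pi, s) * sinc (pi - 2 * s) l) /\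
    kernel_S1 p A pi l = c_fun pi l + CI (fun s => A (pi, s) * c_fun (pi - 2 * s) l).
Proof.
move=> pp kA.
have pI : 0 <= (pi : R) <= pi by apply/andP; split; [exact: pi_ge0|exact: lexx].
have dc (l : Cplx R) (t : R) : rcder (fun t : R => c_fun t l) t (- (l * sinc t l)) by exact: rcder_c_fun.
have ds (l : Cplx R) (t : R) : rcder (fun t : R => sinc t l) t (c_fun t l) by exact: rcder_sinc.
have s0 l := @sinc_at0 R l; have c0 l := @c_fun_at0 R l.
have sN (l : Cplx R) (t : R) := sincN t l.
have cD (l : Cplx R) (x y : R) := c_funD x y l; have sD (l : Cplx R) (x y : R) := sincD x y l.
split=> l; split.
- exact: (solution_is_solution (dc l) (ds l) (c0 l) (s0 l) (sN l) (cD l) (sD l) pp kA).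
- exact: (solution_at0 l (ds l) pp kA).
- exact: (dsolution_at0 l (ds l) pp kA).
- exact: (solution_eq (dc l) (ds l) (c0 l) (s0 l) (sN l) (cD l) (sD l) pp kA pI).
- exact: (dsolution_eq (dc l) (ds l) (c0 l) (sN l) (cD l) (sD l) pp kA pI).
Qed.
End KernelSolution.

(** * Completeness of the space of square integrable functions *)

Section RieszFischer.
Context {R : realType}.
Local Notation mu := (@lebesgue_measure R).

Lemma rint_integral (f : R -> R) : rint f -> (\int[mu]_x (f x)%:E = (IR f)%:E)%E.
Proof.
by move=> jf; rewrite /IR /Rintegral fineK //; exact: integrable_fin_num.
Qed.

(** By monotone convergence the sum of the series is integrable, hence finite
   almost everywhere. *)
Lemma dominating_sum (D : nat -> R -> R) (B : R) : (forall n x, 0 <= D n x) ->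
  (forall n, rint (D n)) -> 0 <= B -> (forall n, IR (D n) <= B / 2 ^+ n.+1) ->
  exists G : R -> R, [/\ rint G, forall x, 0 <= G x, IR G <= B &
    {ae mu, forall x, forall n, D n x <= G x}].
Proof.
move=> D0 jD B0 DB.
pose Ge x : \bar R := (\sum_(i <oo) (D i x)%:E)%E.
have Ge0 x : (0 <= Ge x)%E by apply: nneseries_ge0 => n _ _; rewrite lee_fin.
have mGe : measurable_fun setT Ge.
  apply: (@ge0_emeasurable_sum _ _ R setT (fun n x => (D n x)%:E) predT) => // [k x _ _|k _].
    by rewrite lee_fin.
  by apply/measurable_EFinP; exact: rint_meas.
have iGe : (\int[mu]_x Ge x <= B%:E)%E.
  rewrite integral_nneseries //; last first.
  - by move=> n x _; rewrite lee_fin.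
  - by move=> n; apply/measurable_EFinP; exact: rint_meas.
  apply: le_trans (epsilon_trick0 predT B0); apply: lee_nneseries => [n _ _|n _].
    by apply: integral_ge0 => x _; rewrite lee_fin.
  by rewrite rint_integral // lee_fin natrX DB.
have jGe : mu.-integrable setT Ge.
  apply/integrableP; split => //; apply: le_lt_trans (ltry B).
  have -> : (\int[mu]_x `|Ge x| = \int[mu]_x Ge x)%E by apply: eq_integral => x _; rewrite gee0_abs.
  exact: iGe.
pose G x := fine (Ge x).
have G0 x : 0 <= G x by exact: fine_ge0.
have mG : measurable_fun setT G.
  by apply: (measurableT_comp _ mGe); exact: (fine_measurable measurableT).
have GGe x : ((G x)%:E <= Ge x)%E by rewrite /G; have := Ge0 x; case: (Ge x) => // ?; rewrite leey.
have jG : rint G.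
  apply: (le_integrable measurableT _ _ jGe); first exact/measurable_EFinP.
  by move=> x _; rewrite /= ger0_norm // gee0_abs.
exists G; split => //.
  rewrite -lee_fin -rint_integral //; apply: le_trans iGe.
  apply: ge0_le_integral => //; first by move=> x _; rewrite lee_fin.
  exact/measurable_EFinP.
have := integrable_ae measurableT jGe; apply: ae_imp => x /(_ I) fx n.
rewrite -lee_fin /G fineK //.
apply: le_trans (@nneseries_lim_ge R (fun i => (D i x)%:E) predT 0 n.+1 _); last first.
  by move=> i _ _; rewrite lee_fin.
rewrite big_nat_recr //= leeDr //; apply: sume_ge0 => i _; by rewrite lee_fin.
Qed.

Lemma pot_L2 (f : R -> Cplx R) : cmeas f -> rint (fun x => cmod (f x) ^+ 2) ->
  (forall x, ~~ (0 <= x <= pi) -> f x = 0) -> pot f.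
Proof.
move=> mf jf f0; split => //; split => //.
apply: (cintb_dom mf _ (rintD (rint_itvcc 0 pi) jf)) => x.
have [xp|xp] := boolP (0 <= x <= pi); last by rewrite (f0 x xp) cmod0 expr0n /= addr0.
by have := cmod_ge0 (f x); have := sqr_ge0 (cmod (f x) - 1); rewrite /=; nra.
Qed.

Lemma sqr_cmodD (z w : Cplx R) : cmod (z + w) ^+ 2 <= 2 * cmod z ^+ 2 + 2 * cmod w ^+ 2.
Proof.
have := cmodD z w; have := cmod_ge0 (z + w); have := sqr_ge0 (cmod z - cmod w).
by move: (cmod z) (cmod w) (cmod _) => a b c; nra.
Qed.

Lemma ae_rint_le (g1 g2 : R -> R) : measurable_fun setT g1 -> (forall x, 0 <= g1 x) ->
  (forall x, 0 <= g2 x) -> rint g2 -> {ae mu, forall x, g1 x <= g2 x} ->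
  rint g1 /\ IR g1 <= IR g2.
Proof.
move=> m1 g10 g20 j2 g12; pose g x := Num.min (g1 x) (g2 x).
have mg : measurable_fun setT g by apply: measurable_minr => //; exact: rint_meas.
have g0 x : 0 <= g x by rewrite le_min g10 g20.
have jg : rint g by apply: (rint_le mg _ j2) => x; rewrite ger0_norm // ge_min lexx orbT.
have ge : {ae mu, forall x, g1 x = g x}.
  by apply: ae_imp g12 => x h; rewrite /g min_l.
have -> : IR g1 = IR g.
  congr fine; apply: ae_eq_integral => //; [exact/measurable_EFinP|exact/measurable_EFinP|].
  by apply: ae_imp ge => x ->.
split; last by apply: IR_le => // x; rewrite ge_min lexx orbT.
apply/integrableP; split; first exact/measurable_EFinP.
have /integrableP[_] := jg; apply: le_lt_trans.
have -> // : (\int[mu]_x `|(EFin \o g1) x| = \int[mu]_x `|(EFin \o g) x|)%E.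
apply: ae_eq_integral => //.
- by apply/measurableT_comp => //; exact/measurable_EFinP.
- by apply/measurableT_comp => //; exact/measurable_EFinP.
- by apply: ae_imp ge => x /= ->.
Qed.

(** The series of the increments is dominated almost everywhere because its
   weighted squares have a finite integral. *)
Lemma riesz_fischer (e : nat -> R -> Cplx R) (C : R) : (forall n, pot (e n)) -> 0 <= C ->
  (forall n, IR (fun x => cmod (e n.+1 x - e n x) ^+ 2) <= C / (2 * 8 ^+ n)) ->
  exists2 f, pot f & forall n, IR (fun x => cmod (f x - e n x) ^+ 2) <= 4 * C / 2 ^+ n.
Proof.
move=> pe C0 he.
have pd n : pot (fun x => e n.+1 x - e n x).
  have := potD (pe n.+1) (potZ (-1) (pe n)).
  by under eq_fun do rewrite mulN1r.
pose D n x := 4 ^+ n * cmod (e n.+1 x - e n x) ^+ 2.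
have D0 n x : 0 <= D n x by rewrite mulr_ge0 ?exprn_ge0 ?cmod_ge0.
have jD n : rint (D n) by apply: rintZ; have [[_]] := pd n.
have DB n : IR (D n) <= C / 2 ^+ n.+1.
  rewrite IRZ; last by have [[_]] := pd n.
  apply: le_trans (ler_wpM2l (exprn_ge0 _ _) (he n)) _ => //.
  have -> : (8 : R) ^+ n = 4 ^+ n * 2 ^+ n by rewrite -exprMn; congr (_ ^+ _); ring.
  have : (4 : R) ^+ n != 0 by rewrite expf_neq0.
  have : (2 : R) ^+ n != 0 by rewrite expf_neq0.
  rewrite exprS; move: (4 ^+ n) (2 ^+ n) => a b b0 a0; apply: eq_leq_R; field.
  by rewrite a0 b0.
have [G [jG G0 GB aeG]] := dominating_sum D0 jD C0 DB.
have key x : (forall n, D n x <= G x) -> forall n, cmod (e n.+1 x - e n x) <= Num.sqrt (G x) / 2 ^+ n.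
  move=> h n; rewrite ler_pdivlMr ?exprn_gt0 //.
  rewrite -[leLHS]ger0_norm ?mulr_ge0 ?cmod_ge0 ?exprn_ge0 // -sqrtr_sqr ler_sqrt //.
  apply: le_trans (h n); rewrite /D exprMn mulrC -!exprM (mulnC n) exprM.
  by apply: eq_leq_R; congr (_ ^+ _ * _); ring.
have [f hf] : exists f : R -> Cplx R, forall x,
    ((forall n, D n x <= G x) -> forall n, cmod (f x - e n x) <= 2 * Num.sqrt (G x) / 2 ^+ n) /\
    (~ (forall n, D n x <= G x) -> f x = 0).
  suff /choice[f hf] : forall x, exists z : Cplx R,
    ((forall n, D n x <= G x) -> forall n, cmod (z - e n x) <= 2 * Num.sqrt (G x) / 2 ^+ n) /\
    (~ (forall n, D n x <= G x) -> z = 0) by exists f.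
  move=> x; have [h|h] := pselect (forall n, D n x <= G x); last by exists 0.
  by have [z _ hz] := cauchy_limit (key x h); exists z.
(* Truncating by finitely many of the conditions makes the approximations
   measurable and lets them converge everywhere. *)
pose good n x := all (fun k => D k x <= G x) (iota 0 n).
have mgood n : measurable_fun setT (good n).
  elim: n => [|n ih]; first exact: measurable_cst.
  have -> : good n.+1 = (fun x => good n x && (D n x <= G x)).
    by apply/funext => x; rewrite /good -addn1 iotaD all_cat /= andbT add0n.
  apply: measurable_and => //; apply: measurable_fun_ler; exact: rint_meas.
have mf : cmeas f.
  apply: (@cmeas_lim _ _ _ (fun n x => ⟦good n x⟧ * e n x)) => [n|x].
    by apply: cmeasM; [exact: cmeas_bool|have [[[]]] := pe n].
  have [h|h] := pselect (forall n, D n x <= G x).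
    move=> d d0; have [N hN] := geometric_lt (2 * Num.sqrt (G x)) d0.
    exists N => n Nn; have -> : good n x by apply/allP => k _; exact: h.
    by rewrite mul1r cmodBC; apply: le_lt_trans (hN n Nn); exact: (hf x).1.
  move=> d d0; have [k hk] : exists k, ~~ (D k x <= G x).
    by apply: contrapT => h'; apply: h => n; apply: contrapT => /negP hn; apply: h'; exists n.
  exists k.+1 => n kn; rewrite (hf x).2 // subr0.
  have -> : good n x = false.
    by apply/negbTE/allPn; exists k => //; rewrite mem_iota add0n.
  by rewrite mul0r cmod0.
have f0 x : ~~ (0 <= x <= pi) -> f x = 0.
  move=> xp; have h : forall n, D n x <= G x.
    move=> n; have [_ e1] := pe n.+1; have [_ e2] := pe n.
    by rewrite /D (e1 x xp) (e2 x xp) subrr cmod0 expr0n mulr0.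
  apply: cmod_eq0; apply/eqP; rewrite eq_le cmod_ge0 andbT; apply/ler_addgt0Pr => d d0.
  have [N hN] := geometric_lt (2 * Num.sqrt (G x)) d0; have [_ e1] := pe N.
  rewrite add0r; apply: le_trans (ltW (hN N (leqnn N))).
  by have := (hf x).1 h N; rewrite (e1 x xp) subr0.
have dist n : rint (fun x => cmod (f x - e n x) ^+ 2) /\ IR (fun x => cmod (f x - e n x) ^+ 2) <= 4 * C / 2 ^+ n.
  have p2 : 0 < (2 : R) ^+ n by rewrite exprn_gt0.
  have [j1 j2] : rint (fun x => cmod (f x - e n x) ^+ 2) /\ IR (fun x => cmod (f x - e n x) ^+ 2) <= IR (fun x => (4 / 2 ^+ n) * G x).
    apply: ae_rint_le.
    - by apply: measurable_cmod_sqr; apply: cmeasB => //; have [[[]]] := pe n.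
    - by move=> x; rewrite exprn_ge0 ?cmod_ge0.
    - by move=> x; rewrite mulr_ge0 // divr_ge0 // ltW.
    - exact: rintZ.
    apply: ae_imp aeG => x h; have := (hf x).1 h n.
    have s0 := sqrtr_ge0 (G x); have sG := sqr_sqrtr (G0 x).
    have p1 : 1 <= (2 : R) ^+ n by rewrite exprn_ege1 // ler1n.
    have i1 : (2 ^+ n)^-1 <= 1 :> R by rewrite invf_le1.
    have i0 : 0 <= (2 ^+ n)^-1 :> R by rewrite invr_ge0 ltW.
    rewrite -{2}sG; have := cmod_ge0 (f x - e n x).
    move: (cmod _) (Num.sqrt _) (2 ^+ n)^-1 s0 i0 i1 => a b c b0 c0 c1 a0 ab.
    have bb : 0 <= b * b * c * (1 - c) by rewrite !mulr_ge0 // subr_ge0.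
    have : a * a <= (2 * b * c) * (2 * b * c) by apply: ler_pM.
    by rewrite !expr2; nra.
  split => //; apply: le_trans j2 _; rewrite IRZ // mulrAC.
  by rewrite ler_wpM2r ?invr_ge0 ?(ltW p2) // ler_wpM2l.
exists f; last by move=> n; have [] := dist n.
apply: pot_L2 => //; have [j1 _] := dist 0%N; have [[_ j2] _] := pe 0%N.
apply: (rint_le _ _ (rintD (rintZ 2 j1) (rintZ 2 j2))); first exact: measurable_cmod_sqr.
move=> x; rewrite ger0_norm ?exprn_ge0 ?cmod_ge0 //.
by have := sqr_cmodD (f x - e 0%N x) (e 0%N x); rewrite subrK.
Qed.
End RieszFischer.

(** * Orthogonal complement of an incomplete sequence *)

Section Projection.
Context {R : realType}.
Local Notation mu := (@lebesgue_measure R).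
Local Notation fpair := (R -> Cplx R * Cplx R).
Implicit Types (f g h w : R -> Cplx R * Cplx R) (t : Cplx R).

Definition pairpot f : Prop := pot (fun x => (f x).1) /\ pot (fun x => (f x).2).
Definition ip g h : Cplx R :=
  CI (fun x => Num.conj (g x).1 * (h x).1 + Num.conj (g x).2 * (h x).2).
Definition nrm2 h : R := IR (fun x => cmod (h x).1 ^+ 2 + cmod (h x).2 ^+ 2).
Definition lin t g f : fpair := fun x => ((f x).1 + t * (g x).1, (f x).2 + t * (g x).2).

Lemma pairpot_lin t g f : pairpot g -> pairpot f -> pairpot (lin t g f).
Proof. by move=> [g1 g2] [f1 f2]; split; apply: potD => //; exact: potZ. Qed.
Lemma rint_nrm2 f : pairpot f -> rint (fun x => cmod (f x).1 ^+ 2 + cmod (f x).2 ^+ 2).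
Proof. by move=> [[[_ r1] _] [[_ r2] _]]; exact: rintD. Qed.
Lemma nrm2_ge0 f : 0 <= nrm2 f.
Proof. by apply: IR_ge0 => x; rewrite addr_ge0 ?exprn_ge0 ?cmod_ge0. Qed.

Lemma cintb_conjM (a b : R -> Cplx R) : sqint a -> sqint b -> cintb (fun x => Num.conj (a x) * b x).
Proof.
move=> [[ma _] ra] [[mb _] rb]; apply: (cintb_dom _ _ (rintD ra rb)).
  by apply: cmeasM => //; exact: cmeas_conj.
move=> x; rewrite cmodM cmod_conj; have := sqr_ge0 (cmod (a x) - cmod (b x)).
have := cmod_ge0 (a x); have := cmod_ge0 (b x).
by move: (cmod _) (cmod _) => u v; rewrite !expr2; nra.
Qed.
Lemma cintb_ip g h : pairpot g -> pairpot h ->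
  cintb (fun x => Num.conj (g x).1 * (h x).1 + Num.conj (g x).2 * (h x).2).
Proof. by move=> [[g1 _] [g2 _]] [[h1 _] [h2 _]]; apply: cintbD; exact: cintb_conjM. Qed.

Lemma nrm2_lin t g f : pairpot g -> pairpot f ->
  nrm2 (lin t g f) = nrm2 f + 2 * Re (t * ip f g) + cmod t ^+ 2 * nrm2 g.
Proof.
move=> pg pf; have jg := rint_nrm2 pg; have jf := rint_nrm2 pf.
have ji := cintbZ t (cintb_ip pf pg).
rewrite /ip -CIZ; last exact: cintb_ip.
rewrite CI_Re -IRZ; last exact: rint_Re.
rewrite -IRZ // -IRD // -?IRD //; last 3 first.
- by apply: rintD => //; apply: rintZ; exact: rint_Re.
- exact: rintZ.
- by apply: rintZ; exact: rint_Re.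
congr IR; apply/funext => x; rewrite /lin /= !cmod_sqr.
move: (f x) (g x) => [a b] [c d] /=.
by rewrite !(cE, Re_conj, Im_conj) /=; ring.
Qed.

Lemma nrm2_young f g (k : R) : pairpot f -> pairpot g -> 0 < k ->
  nrm2 (lin 1 g f) <= (1 + k) * nrm2 f + (1 + k^-1) * nrm2 g.
Proof.
move=> pf pg k0; have jg := rint_nrm2 pg; have jf := rint_nrm2 pf.
rewrite /nrm2 -!IRZ // -IRD; try exact: rintZ.
apply: IR_le.
- by apply: rint_nrm2; exact: pairpot_lin.
- by apply: rintD; exact: rintZ.
have young (z w : Cplx R) : cmod (z + w) ^+ 2 <= (1 + k) * cmod z ^+ 2 + (1 + k^-1) * cmod w ^+ 2.
  have := cmodD z w; have := cmod_ge0 (z + w).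
  have : 0 <= k^-1 * (k * cmod z - cmod w) ^+ 2 by rewrite mulr_ge0 ?sqr_ge0 // invr_ge0 ltW.
  have kk : k^-1 * k = 1 by rewrite mulVf // gt_eqF.
  move: (cmod z) (cmod w) (cmod (z + w)) (k^-1) kk => a b c i kk.
  have -> : i * (k * a - b) ^+ 2 = (i * k) * k * a ^+ 2 - 2 * (i * k) * a * b + i * b ^+ 2 by ring.
  by rewrite kk => h c0 cab; nra.
move=> x; rewrite /lin /= !mul1r.
by have := young (f x).1 (g x).1; have := young (f x).2 (g x).2; lra.
Qed.

(** First [n] tends to infinity, then [k] to zero. *)
Lemma young_limit (a b A : R) : 0 <= b ->
  (forall (k : R) n, 0 < k -> a <= (1 + k) * (b + A / 2 ^+ n) + (1 + k^-1) * (A / 2 ^+ n)) -> a <= b.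
Proof.
move=> b0 h; apply/ler_addgt0Pr => e e0.
pose k := Num.min 1 (e / (2 * (b + 1))).
have k0 : 0 < k by rewrite lt_min ltr01 divr_gt0 // mulr_gt0 //; lra.
have k1 : k <= 1 by rewrite ge_min lexx.
have kb : k * b <= e / 2.
  apply: le_trans (_ : e / (2 * (b + 1)) * b <= _).
    by rewrite ler_wpM2r // ge_min lexx orbT.
  rewrite invfM mulrA -mulrA ler_piMr //; [lra|].
  by rewrite mulrC ler_pdivrMr; lra.
have e2 : 0 < e / 2 by lra.
have A0 : 0 <= 1 + 1 + 1 + k^-1 by have : 0 <= k^-1 by [rewrite invr_ge0 ltW]; lra.
have [n hn] := geometric_lt (`|A| * (1 + 1 + 1 + k^-1)) e2.
have := h k n k0; have := hn n (leqnn n); rewrite mulrAC => h1 h2.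
have p2 : 0 < (2 : R) ^+ n by rewrite exprn_gt0.
have AA : A / 2 ^+ n <= `|A| / 2 ^+ n by rewrite ler_wpM2r ?ler_norm // invr_ge0 ltW.
have i0 : 0 <= k^-1 by rewrite invr_ge0 ltW.
have B0 : 0 <= `|A| / 2 ^+ n by rewrite divr_ge0 // ltW.
move: (A / 2 ^+ n) (`|A| / 2 ^+ n) (k^-1) AA i0 B0 h1 h2 => x y i xy i0 y0 h1 h2.
have h3 : 0 <= (1 + k) * (y - x) by rewrite mulr_ge0 //; lra.
have h4 : 0 <= (1 + i) * (y - x) by rewrite mulr_ge0 //; lra.
have h5 : 0 <= (1 - k) * y by rewrite mulr_ge0 //; lra.
nra.
Qed.

(** The projection theorem: the residues of a minimizing sequence converge by
   the parallelogram law, and the limit is orthogonal to the subspace. *)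
Lemma orthogonal_residue (P : fpair -> Prop) h (eps : R) :
  (forall g, P g -> pairpot g) -> (exists g, P g) ->
  (forall t g g', P g -> P g' -> P (lin t g' g)) ->
  pairpot h -> 0 < eps -> (forall g, P g -> eps <= nrm2 (lin (-1) g h)) ->
  exists2 e, pairpot e & 0 < nrm2 e /\ forall w, P w -> ip e w = 0.
Proof.
move=> PH [g0 Pg0] Plin ph eps0 far.
(* The squared distance from [h] to the subspace. *)
pose E := [set nrm2 (lin (-1) g h) | g in P].
have lbE : lbound E eps by move=> _ [g Pg <-]; exact: far.
have neE : nonempty E by exists (nrm2 (lin (-1) g0 h)); exists g0.
have hiE : has_inf E by split => //; exists eps.
pose d := inf E; have d_eps : eps <= d by exact: lb_le_inf.
have d_le g : P g -> d <= nrm2 (lin (-1) g h).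
  by move=> Pg; apply: ge_inf; [exists eps|exists g].
have [G hG] : exists G : nat -> fpair, forall n, P (G n) /\ nrm2 (lin (-1) (G n) h) <= d + (8 ^+ n)^-1.
  suff /choice[G hG] : forall n, exists g, P g /\ nrm2 (lin (-1) g h) <= d + (8 ^+ n)^-1 by exists G.
  move=> n; have i0 : 0 < (8 ^+ n)^-1 :> R by rewrite invr_gt0 exprn_gt0.
  by have [_ [g Pg <-] /ltW hg] := inf_adherent i0 hiE; exists g.
pose e n := lin (-1) (G n) h.
have PG n : P (G n) by have [] := hG n.
have pe n : pairpot (e n) by apply: pairpot_lin => //; exact: PH.
have en n : nrm2 (e n) <= d + (8 ^+ n)^-1 by have [] := hG n.
have near n t w : P w -> d <= nrm2 (lin t w (e n)).
  move=> Pw; have -> : lin t w (e n) = lin (-1) (lin (- t) w (G n)) h.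
    by apply/funext => x; rewrite /lin /e /=; congr pair; rewrite /lin /=; ring.
  by apply: d_le; exact: Plin.
(* The parallelogram law, the midpoint of two approximations being at least
   as far from [h] as the subspace. *)
have step n : nrm2 (lin (-1) (e n) (e n.+1)) <= 4 / 8 ^+ n.
  have h1 := nrm2_lin (-1) (pe n) (pe n.+1); have h2 := nrm2_lin 1 (pe n) (pe n.+1).
  have h3 : 4 * d <= nrm2 (lin 1 (e n) (e n.+1)).
    pose m := lin (- 2^-1) (lin (-1) (G n) (G n.+1)) (G n.+1).
    have Pm : P m by exact: (Plin _ _ _ (PG _) (Plin _ _ _ (PG _) (PG _))).
    have -> : nrm2 (lin 1 (e n) (e n.+1)) = 4 * nrm2 (lin (-1) m h).
      rewrite -IRZ; last by apply: rint_nrm2; apply: pairpot_lin => //; exact: PH.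
      congr IR; apply/funext => x; rewrite mulrDr.
      have four (z w : Cplx R) : z = 2 * w -> cmod z ^+ 2 = 4 * cmod w ^+ 2.
        by move=> ->; rewrite cmodM cmod_nat exprMn -natrX.
      by congr (_ + _); apply: four; rewrite /lin /e /m /= /lin /=; field.
    by rewrite ler_wpM2l // d_le.
  have h4 := en n; have h5 := en n.+1.
  have h6 : ((8 : R) ^+ n.+1)^-1 <= (8 ^+ n)^-1.
    by rewrite lef_pV2 ?posrE ?exprn_gt0 // exprS ler_peMl ?exprn_ge0 // ler1n.
  move: h1 h2; rewrite cmodN cmod1 expr1n !mul1r mulN1r ReN => h1 h2.
  move: h1 h2 h3 h4 h5 h6; move: (8 ^+ n)^-1 (8 ^+ n.+1)^-1 (Re _) => i j r.
  by lra.
have compl (pr : Cplx R * Cplx R -> Cplx R) :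
    (forall n, pot (fun x => pr (e n x))) ->
    (forall n x, cmod (pr (e n.+1 x) - pr (e n x)) ^+ 2 <= cmod (lin (-1) (e n) (e n.+1) x).1 ^+ 2 + cmod (lin (-1) (e n) (e n.+1) x).2 ^+ 2) ->
    exists2 f, pot f & forall n, IR (fun x => cmod (f x - pr (e n x)) ^+ 2) <= 4 * 8 / 2 ^+ n.
  move=> pp hp; apply: riesz_fischer => // n.
  have -> : 8 / (2 * 8 ^+ n) = 4 / 8 ^+ n :> R.
    by have : (8 : R) ^+ n != 0 by [rewrite expf_neq0]; move: (8 ^+ n) => k k0; field.
  apply: le_trans (step n); apply: IR_le => //; last exact: rint_nrm2 (pairpot_lin _ _ _).
  have := potD (pp n.+1) (potZ (-1) (pp n)).
  by move=> [[_ +] _]; under eq_fun do rewrite mulN1r.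
have [f1 pf1 hf1] : exists2 f, pot f & forall n, IR (fun x => cmod (f x - (e n x).1) ^+ 2) <= 4 * 8 / 2 ^+ n.
  apply: (compl fst) => [n|n x]; first by have [] := pe n.
  by rewrite /lin /= !mulN1r lerDl exprn_ge0 ?cmod_ge0.
have [f2 pf2 hf2] : exists2 f, pot f & forall n, IR (fun x => cmod (f x - (e n x).2) ^+ 2) <= 4 * 8 / 2 ^+ n.
  apply: (compl snd) => [n|n x]; first by have [] := pe n.
  by rewrite /lin /= !mulN1r lerDr exprn_ge0 ?cmod_ge0.
pose f x := (f1 x, f2 x); have pf : pairpot f by split.
have dist n : nrm2 (lin (-1) (e n) f) <= 64 / 2 ^+ n.
  have [[[_ j1] _] [[_ j2] _]] := pairpot_lin (-1) (pe n) pf.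
  rewrite /nrm2 IRD //; have := hf1 n; have := hf2 n.
  under eq_fun do rewrite -mulN1r; move=> h2; under eq_fun do rewrite -mulN1r; move=> h1.
  apply: le_trans (lerD h1 h2) _; lra.
have distC n : nrm2 (lin (-1) f (e n)) <= 64 / 2 ^+ n.
  apply: le_trans (dist n); apply: eq_leq_R; congr IR; apply/funext => x.
  by rewrite /lin /= !mulN1r; congr (_ ^+ 2 + _ ^+ 2); exact: cmodBC.
have f_le : nrm2 f <= d.
  apply: (@young_limit _ _ 64) => [|k n k0]; first exact: le_trans (ltW eps0) d_eps.
  have -> : f = lin 1 (lin (-1) (e n) f) (e n).
    by apply/funext => x; rewrite /lin /= !mulN1r !mul1r !subrKC.
  apply: le_trans (nrm2_young (pe n) (pairpot_lin (-1) (pe n) pf) k0) _.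
  apply: lerD.
    rewrite ler_wpM2l //; first lra.
    apply: le_trans (en n) _; rewrite lerD2l.
    rewrite -[leLHS]mul1r; apply: ler_pM => //; rewrite ?invr_ge0 ?exprn_ge0 ?ler1n //.
    by rewrite lef_pV2 ?posrE ?exprn_gt0 // lerXn2r ?nnegrE // ler_nat.
  by rewrite ler_wpM2l // addr_ge0 // invr_ge0 ltW.
have f_ge t w : P w -> d <= nrm2 (lin t w f).
  move=> Pw; have pw := PH w Pw.
  apply: (@young_limit _ _ 64) => [|k n k0]; first exact: nrm2_ge0.
  apply: le_trans (near n t w Pw) _.
  have -> : lin t w (e n) = lin 1 (lin (-1) f (e n)) (lin t w f).
    by apply/funext => x; rewrite /lin /= !mulN1r !mul1r; congr pair; ring.
  apply: le_trans (nrm2_young (pairpot_lin t pw pf) (pairpot_lin (-1) pf (pe n)) k0) _.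
  apply: lerD.
    rewrite ler_wpM2l //; [lra|].
    by rewrite lerDl divr_ge0 // exprn_ge0.
  by rewrite ler_wpM2l // addr_ge0 // invr_ge0 ltW.
exists f => //; split.
  apply: lt_le_trans eps0 _; apply: le_trans d_eps _.
  have := f_ge 0 g0 Pg0; rewrite nrm2_lin //; last exact: PH.
  by rewrite mul0r Re0 cmod0 expr0n /= !(mulr0, mul0r, addr0).
move=> w Pw; have pw := PH w Pw; have W0 := nrm2_ge0 w.
(* Moving [f] along [w] by a small multiple of the conjugate inner product
   would bring it closer. *)
pose s := (nrm2 w + 1)^-1; have s0 : 0 < s by rewrite invr_gt0 ltr_wpDl.
have sw : s * nrm2 w <= 1.
  by rewrite mulrC ler_pdivrMr ?ltr_wpDl // mul1r lerDl.
have := f_ge (- rc s * Num.conj (ip f w)) w Pw; rewrite nrm2_lin //.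
rewrite -mulrA mul_conj -rcN -rcM Re_rc cmodM cmod_rc cmod_conj normrN (gtr0_norm s0) => hh.
apply: cmod_eq0; apply/eqP; rewrite -sqrf_eq0.
have c0 := sqr_ge0 (cmod (ip f w)).
move: hh f_le; rewrite exprMn; move: (cmod (ip f w) ^+ 2) c0 => c c0 hh f_le.
rewrite eq_le c0 andbT.
have h1 : 0 <= - (s * c) * 2 + s ^+ 2 * c * nrm2 w by lra.
have h2 : s ^+ 2 * c * nrm2 w <= s * c.
  rewrite (_ : s ^+ 2 * c * nrm2 w = (s * c) * (s * nrm2 w)); last by ring.
  by rewrite ler_piMr // mulr_ge0 // ltW.
have : s * c <= 0 by lra.
by rewrite pmulr_rle0.
Qed.

Lemma lin_sum (v : nat -> fpair) N (a : nat -> Cplx R) :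
  (forall k, pairpot (v k)) -> pairpot (lincomb v N a).
Proof.
move=> pv; split; rewrite /lincomb /=.
  elim: N => [|N ih].
    under eq_fun do rewrite big_ord0; apply: (@pot_bounded R _ 0) => [|x]; first exact: cmeas_cst.
    by rewrite cmod0 mul0r.
  by under eq_fun do rewrite big_ord_recr /=; apply: potD => //; apply: potZ; have [] := pv N.
elim: N => [|N ih].
  under eq_fun do rewrite big_ord0; apply: (@pot_bounded R _ 0) => [|x]; first exact: cmeas_cst.
  by rewrite cmod0 mul0r.
by under eq_fun do rewrite big_ord_recr /=; apply: potD => //; apply: potZ; have [] := pv N.
Qed.
Lemma lincomb_widen (v : nat -> fpair) N M (a : nat -> Cplx R) : (N <= M)%N ->
  lincomb v N a = lincomb v M (fun k => if (k < N)%N then a k else 0).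
Proof.
move=> NM; apply/funext => x; rewrite /lincomb; congr pair.
  rewrite (big_ord_widen M (fun k => a k * (v k x).1)) // big_mkcond /=.
  by apply: eq_bigr => i _; case: ifP; rewrite ?mul0r.
rewrite (big_ord_widen M (fun k => a k * (v k x).2)) // big_mkcond /=.
by apply: eq_bigr => i _; case: ifP; rewrite ?mul0r.
Qed.
Lemma lincomb_lin (v : nat -> fpair) N N' t (a a' : nat -> Cplx R) :
  exists M b, lin t (lincomb v N' a') (lincomb v N a) = lincomb v M b.
Proof.
exists (N + N')%N; rewrite (lincomb_widen v a (leq_addr N' N)) (lincomb_widen v a' (leq_addl N N')).
exists (fun k => (if (k < N)%N then a k else 0) + t * (if (k < N')%N then a' k else 0)).
apply/funext => x; rewrite /lin /lincomb /=; congr pair.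
  by rewrite mulr_sumr -big_split; apply: eq_bigr => i _ /=; ring.
by rewrite mulr_sumr -big_split; apply: eq_bigr => i _ /=; ring.
Qed.

Definition trunc f : fpair := fun x => (⟦0 <= x <= pi⟧ * (f x).1, ⟦0 <= x <= pi⟧ * (f x).2).

Lemma mem_itv0pi x : (x \in `[0, pi : R]%classic) = (0 <= x <= pi).
Proof. by rewrite mem_setE in_itv. Qed.
Lemma patch_itv (u : R -> R) : u \_ `[0, pi] = (fun x => ⟦0 <= x <= pi⟧ * u x).
Proof.
by apply/funext => x; rewrite patchE mem_itv0pi; case: (_ && _); rewrite ?mul1r ?mul0r.
Qed.
Lemma patch_itvE (u : R -> R) : (EFin \o u) \_ `[0, pi] = (fun x => (⟦0 <= x <= pi⟧ * u x)%:E).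
Proof.
by apply/funext => x; rewrite patchE mem_itv0pi; case: (_ && _); rewrite ?mul1r ?mul0r.
Qed.
Lemma Re_boolM (b : bool) (z : Cplx R) : Re (⟦b⟧ * z) = ⟦b⟧ * Re z.
Proof. by rewrite -rc_nat ReM Re_rc Im_rc mul0r subr0. Qed.
Lemma Im_boolM (b : bool) (z : Cplx R) : Im (⟦b⟧ * z) = ⟦b⟧ * Im z.
Proof. by rewrite -rc_nat ImM Re_rc Im_rc mul0r addr0. Qed.

Lemma cint_CI (f : R -> Cplx R) : cint f = CI (fun x => ⟦0 <= x <= pi⟧ * f x).
Proof.
have e (u : R -> R) : Rintegral mu `[0, pi] u = IR (fun x => ⟦0 <= x <= pi⟧ * u x).
  by rewrite /IR /Rintegral integral_mkcond patch_itvE.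
rewrite /cint !e; apply: cplx_eq => /=; congr IR; apply/funext => x.
  by rewrite Re_boolM.
by rewrite Im_boolM.
Qed.
Lemma L2_pot (f : R -> Cplx R) : L2 f -> pot (fun x => ⟦0 <= x <= pi⟧ * f x).
Proof.
move=> [m1 m2 i2]; have mD : measurable `[0, pi : R] by exact: measurable_itv.
have mf : cmeas (fun x : R => ⟦0 <= x <= pi⟧ * f x).
  split.
    under eq_fun do rewrite Re_boolM; rewrite -patch_itv.
    by apply/(measurable_restrictT _ mD).
  under eq_fun do rewrite Im_boolM; rewrite -patch_itv.
  by apply/(measurable_restrictT _ mD).
apply: pot_L2 => //; last by move=> x xp; rewrite (negbTE xp) mul0r.
apply/integrableP; split; first by apply/measurable_EFinP; exact: measurable_cmod_sqr.
move: i2; rewrite (_ : (fun x => _) = EFin \o (fun x => cmod (f x) ^+ 2)) // integral_mkcond patch_itvE.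
congr (_ < _)%E; apply: eq_integral => x _.
rewrite /= ger0_norm ?exprn_ge0 ?cmod_ge0 // cmodM cmod_bool exprMn; congr (_ * _)%:E.
by case: (_ && _); rewrite ?expr1n ?expr0n.
Qed.
Lemma pot_is_L2 (f p : R -> Cplx R) : pot p -> (forall x, 0 <= x <= pi -> f x = p x) -> L2 f.
Proof.
move=> [[[[m1 m2] _] r2] _] fp; have mD : measurable `[0, pi : R] by exact: measurable_itv.
have eD x : x \in `[0, pi : R]%classic -> p x = f x by rewrite mem_itv0pi => /fp.
split.
- by apply: (eq_measurable_fun (fun x => Re (p x))) => [x /eD ->//|]; exact: measurable_funTS.
- by apply: (eq_measurable_fun (fun x => Im (p x))) => [x /eD ->//|]; exact: measurable_funTS.
have /integrableP[_] := @integrableS _ _ _ mu setT `[0, pi] _ measurableT mD (@subsetT _ _) r2; apply: le_lt_trans.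
rewrite le_eqVlt; apply/orP; left; apply/eqP; apply: eq_integral => x /eD <- /=.
by rewrite ger0_norm // exprn_ge0 ?cmod_ge0.
Qed.

Lemma Hinner_ip g h : Hinner g h = ip (trunc g) (trunc h).
Proof.
rewrite /Hinner cint_CI /ip /trunc; apply: eq_CI => x /=.
have cb (b : bool) : Num.conj (⟦b⟧ : Cplx R) = ⟦b⟧ by rewrite -rc_nat conj_rc.
rewrite !rmorphM /= cb; case: (_ && _); rewrite ?mul1r //.
by rewrite !mul0r addr0.
Qed.
Lemma ip_nrm2 h : pairpot h -> Re (ip h h) = nrm2 h.
Proof.
move=> ph; rewrite CI_Re; congr IR; apply/funext => x.
by rewrite !mul_conj ReD.
Qed.

Lemma incomplete_orthogonal (v : nat -> fpair) : (forall k, inH (v k)) -> ~ complete_in_H v ->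
  exists2 u, pairpot u & 0 < nrm2 u /\ forall k, ip u (trunc (v k)) = 0.
Proof.
move=> vH nc; have pv k : pairpot (trunc (v k)) by have [v1 v2] := vH k; split; exact: L2_pot.
have [h [hH [eps [eps0 far]]]] : exists h, inH h /\ exists eps : R, 0 < eps /\
    forall N a, eps <= Hnorm (fun t : R => h t - lincomb v N a t).
  apply: contrapT => no; apply: nc => h hH eps eps0; apply: contrapT => no'; apply: no.
  exists h; split => //; exists eps; split => // N a; rewrite leNgt; apply/negP => lt.
  by apply: no'; exists N, a.
have ph : pairpot (trunc h) by have [h1 h2] := hH; split; exact: L2_pot.
pose V k := trunc (v k); pose P g := exists N a, g = lincomb V N a.
have PH g : P g -> pairpot g by move=> [N [a ->]]; exact: lin_sum.
have PV k : P (V k).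
  have pick (g : nat -> Cplx R) : g k = \sum_(i < k.+1) ⟦(i : nat) == k⟧ * g i.
    by rewrite big_ord_recr /= eqxx mul1r big1 ?add0r // => i _; rewrite ltn_eqF // mul0r.
  exists k.+1, (fun i => ⟦i == k⟧); apply/funext => x; rewrite /lincomb.
  rewrite -(pick (fun i => (V i x).1)) -(pick (fun i => (V i x).2)).
  by case: (V k x).
have [u pu [u0 uo]] : exists2 e, pairpot e & 0 < nrm2 e /\ forall w, P w -> ip e w = 0.
  apply: (orthogonal_residue PH _ _ ph (exprn_gt0 2 eps0)).
  - by exists (V 0%N).
  - by move=> t _ _ [N [a ->]] [N' [a' ->]]; exact: lincomb_lin.
  move=> _ [N [a ->]]; have := far N a; rewrite /Hnorm Hinner_ip.
  have -> : trunc (fun t : R => h t - lincomb v N a t) = lin (-1) (lincomb V N a) (trunc h).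
    apply/funext => x; rewrite /trunc /lin /lincomb /=; congr pair.
      rewrite mulrBr mulN1r mulr_sumr; congr (_ - _); apply: eq_bigr => i _.
      by rewrite mulrCA.
    rewrite mulrBr mulN1r mulr_sumr; congr (_ - _); apply: eq_bigr => i _.
    by rewrite mulrCA.
  have pl := pairpot_lin (-1) (lin_sum N a pv) ph.
  rewrite ip_nrm2 // => hn; rewrite -[leRHS]sqr_sqrtr ?nrm2_ge0 //.
  by rewrite lerXn2r ?nnegrE ?sqrtr_ge0 // ltW.
by exists u => //; split => // k; exact: (uo _ (PV k)).
Qed.
End Projection.

(** * The perturbation attached to an orthogonal vector *)

Section Folding.
Context {R : realType}.
Local Notation mu := (@lebesgue_measure R).
Implicit Types (t x y : R) (l : Cplx R).

Lemma pot_bool (p : R -> Cplx R) : pot p -> forall x, ⟦0 <= x <= pi⟧ * p x = p x.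
Proof.
move=> [_ p0] x; have [xp|xp] := boolP (0 <= x <= pi); first by rewrite mul1r.
by rewrite (p0 x xp) mulr0.
Qed.
Lemma pot_conj (p : R -> Cplx R) : pot p -> pot (fun x => Num.conj (p x)).
Proof.
move=> [[[mp rp] rp2] p0]; split; last by move=> x /p0 ->; rewrite rmorph0.
split; last by under eq_fun do rewrite cmod_conj.
by split; [exact: cmeas_conj|under eq_fun do rewrite cmod_conj].
Qed.

Variables (u1 u2 : R -> Cplx R).
Hypotheses (pu1 : pot u1) (pu2 : pot u2).

Definition fwd t : Cplx R := Num.conj (u2 t) + Num.conj (u1 t).
Definition bwd t : Cplx R := Num.conj (u2 t) - Num.conj (u1 t).
(** The two halves of [0, pi] carry the sum and the difference of the
   components, so that integrating against an even function of [pi - 2 y]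
   sees only [u2], against an odd one only [u1]. *)
Definition fold y : Cplx R := 2 * (fwd (- pi + 2 * y) + bwd (pi + (- 2) * y)).

Let pfwd : pot fwd. Proof. by apply: potD; exact: pot_conj. Qed.
Let pbwd : pot bwd.
Proof.
have -> : bwd = (fun t => Num.conj (u2 t) + (-1) * Num.conj (u1 t)).
  by apply/funext => t; rewrite mulN1r.
by apply: potD; [exact: pot_conj|apply: potZ; exact: pot_conj].
Qed.
Let two0 : (2 : R) != 0. Proof. by rewrite pnatr_eq0. Qed.
Let mtwo0 : (- 2 : R) != 0. Proof. by rewrite oppr_eq0. Qed.

Lemma pot_fold : pot fold.
Proof.
have [[jf jf2] f0] := pfwd; have [[jb jb2] b0] := pbwd.
have pF : pot (fun y => fwd (- pi + 2 * y)).
  split; first by split; [exact: cintb_affine|exact: (rint_affine (- pi) two0 jf2)].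
  move=> x xp; apply: f0; apply: contra xp => /andP[h1 h2]; apply/andP; split; lra.
have pB : pot (fun y => bwd (pi + (- 2) * y)).
  split; first by split; [exact: cintb_affine|exact: (rint_affine pi mtwo0 jb2)].
  move=> x xp; apply: b0; apply: contra xp => /andP[h1 h2]; apply/andP; split; lra.
by apply: potZ; exact: potD.
Qed.

Lemma cintb_pot_cont (p k : R -> Cplx R) : pot p -> (forall t, ccont k t) -> cintb (fun t => p t * k t).
Proof.
move=> [[jp _] p0] ck; have [K hK] := ccont_bounded 0 pi ck; have [mp rp] := jp.
apply: (cintb_dom _ _ (rintZ K rp)); first by apply: cmeasM => //; exact: ccont_cmeas.
move=> t; rewrite cmodM mulrC; have [tp|tp] := boolP (0 <= t <= pi).
  by rewrite ler_wpM2r ?cmod_ge0 // hK.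
by rewrite (p0 t tp) cmod0 !mulr0.
Qed.

(** The substitutions [t = 2 y - pi] and [t = pi - 2 y] on the two halves. *)
Lemma CI_fold (g : R -> Cplx R) : (forall t, ccont g t) ->
  CI (fun y => fold y * g (pi - 2 * y)) = CI (fun t => fwd t * g (- t)) + CI (fun t => bwd t * g t).
Proof.
move=> cg.
have cgN t : ccont (fun t => g (- t)) t.
  move=> e e0; have [d d0 hd] := cg (- t) e e0; exists d => // k hk.
  by rewrite opprD; apply: hd; rewrite cmod_rc normrN -cmod_rc.
have jF := cintb_pot_cont pfwd cgN; have jB := cintb_pot_cont pbwd cg.
rewrite (CI_affine (- pi) two0 jF) (CI_affine pi mtwo0 jB).
have j1 := cintb_affine (- pi) two0 jF; have j2 := cintb_affine pi mtwo0 jB.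
rewrite normrN normr_nat rc_nat -!CIZ // -CID; [|exact: (cintbZ 2 j1)|exact: (cintbZ 2 j2)].
apply: eq_CI => y; rewrite /fold.
have -> : - (- pi + 2 * y) = pi - 2 * y by ring.
have -> : pi + (- 2) * y = pi - 2 * y by ring.
by ring.
Qed.
Lemma CI_fold_even (g : R -> Cplx R) : (forall t, ccont g t) -> (forall t, g (- t) = g t) ->
  CI (fun y => fold y * g (pi - 2 * y)) = 2 * CI (fun t => Num.conj (u2 t) * g t).
Proof.
move=> cg gN; have jB := cintb_pot_cont pbwd cg.
have jF : cintb (fun t => fwd t * g (- t)).
  by under eq_fun do rewrite gN; exact: cintb_pot_cont.
rewrite CI_fold // -CID //.
rewrite -CIZ; last by apply: cintb_pot_cont => //; exact: pot_conj.
by apply: eq_CI => t; rewrite gN /fwd /bwd; ring.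
Qed.
Lemma CI_fold_odd (g : R -> Cplx R) : (forall t, ccont g t) -> (forall t, g (- t) = - g t) ->
  CI (fun y => fold y * g (pi - 2 * y)) = - 2 * CI (fun t => Num.conj (u1 t) * g t).
Proof.
move=> cg gN; have jB := cintb_pot_cont pbwd cg.
have jF : cintb (fun t => fwd t * g (- t)).
  by under eq_fun do rewrite gN mulrN; apply: cintbN; exact: cintb_pot_cont.
rewrite CI_fold // -CID //.
rewrite -CIZ; last by apply: cintb_pot_cont => //; exact: pot_conj.
by apply: eq_CI => t; rewrite gN /fwd /bwd; ring.
Qed.

Lemma IR_ae0 (f : R -> R) : measurable_fun setT f -> (forall x, 0 <= f x) ->
  {ae mu, forall x, f x = 0} -> IR f = 0.
Proof.
move=> mf f0 h; apply/eqP; rewrite eq_le IR_ge0 // andbT.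
have [|_] := ae_rint_le mf f0 (fun=> lexx 0) rint0.
  by apply: ae_imp h => x ->.
by rewrite IR0.
Qed.

(** The halves have disjoint supports, so both vanish; the parallelogram law
   gives back the components. *)
Lemma fold_eq0 : {ae mu, forall y, fold y = 0} ->
  IR (fun x => cmod (u1 x) ^+ 2 + cmod (u2 x) ^+ 2) = 0.
Proof.
move=> h; have [[[mF _] jf2] f0] := pfwd; have [[[mB _] jb2] b0] := pbwd.
have hp := ae_and h (ae_neq (pi / 2)).
have out (t : R) : t < 0 -> ~~ (0 <= t <= pi) by move=> t0; rewrite negb_and -ltNge t0.
have aeF : {ae mu, forall y, fwd (- pi + 2 * y) = 0 /\ bwd (pi + (- 2) * y) = 0}.
  apply: ae_imp hp => y [fy yp].
  have s0 : fwd (- pi + 2 * y) + bwd (pi + (- 2) * y) = 0.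
    by apply/eqP; move/eqP: fy; rewrite mulf_eq0 pnatr_eq0.
  have [y1|y1] := ltP y (pi / 2).
    have e : fwd (- pi + 2 * y) = 0 by apply: f0; apply: out; lra.
    by split => //; move: s0; rewrite e add0r.
  have e : bwd (pi + (- 2) * y) = 0.
    apply: b0; apply: out; move/eqP: yp => yp.
    have : pi / 2 < y by rewrite lt_def y1 yp.
    lra.
  by split => //; move: s0; rewrite e addr0.
have IF : IR (fun t => cmod (fwd t) ^+ 2) = 0.
  rewrite (IR_affine (- pi) two0 jf2) IR_ae0 ?mulr0 //.
  - by apply: measurable_cmod_sqr; exact: cmeas_affine.
  - by move=> x; rewrite exprn_ge0 ?cmod_ge0.
  - by apply: ae_imp aeF => x [-> _]; rewrite cmod0 expr0n.
have IB : IR (fun t => cmod (bwd t) ^+ 2) = 0.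
  rewrite (IR_affine pi mtwo0 jb2) IR_ae0 ?mulr0 //.
  - by apply: measurable_cmod_sqr; exact: cmeas_affine.
  - by move=> x; rewrite exprn_ge0 ?cmod_ge0.
  - by apply: ae_imp aeF => x [_ ->]; rewrite cmod0 expr0n.
have : 2 * IR (fun x => cmod (u1 x) ^+ 2 + cmod (u2 x) ^+ 2) = 0.
  rewrite -IRZ; last by apply: rintD; [have [[]] := pu1|have [[]] := pu2].
  rewrite -[RHS]addr0 -{1}IF -IB -IRD //; congr IR; apply/funext => x.
  by rewrite /fwd /bwd !cmod_sqr !(cE, Re_conj, Im_conj); ring.
by move/eqP; rewrite mulf_eq0 pnatr_eq0 => /eqP.
Qed.

End Folding.

(** * Characteristic functions *)

Section Characteristic.
Context {R : realType}.
Local Notation mu := (@lebesgue_measure R).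
Implicit Types (x y t s : R) (l : Cplx R).

(** Exchanging the integrals turns the kernel on the side into the density [z],
   and [g] into its primitive. *)
Lemma side_integral (z g G : R -> Cplx R) : pot z ->
  (forall t, rcder G t (g t)) -> (forall t, ccont g t) ->
  CI (fun s => (⟦0 <= s <= pi⟧ * CI (fun y => ⟦s < y⟧ * z y)) * g (pi - 2 * s)) =
  CI (fun y => z y * ((G pi - G (pi - 2 * y)) / 2)).
Proof.
move=> [[jz _] z0] dG cg; have [mz rz] := jz.
have pI : 0 <= (pi : R) <= pi by apply/andP; split; [exact: pi_ge0|exact: lexx].
have [K K0 hK] := ccont_bound cg.
have mg : cmeas (fun s => g (pi - 2 * s)) by apply: ccont_cmeas => s; exact: ccont_fold.
have jb s : cintb (fun y => ⟦s < y⟧ * z y) by apply: cintb_bool => //; exact: measurable_gt_cst.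
pose f s y := (⟦0 <= s <= pi⟧ * (⟦s < y⟧ * z y)) * g (pi - 2 * s).
transitivity (CI (fun s => CI (f s))).
  apply: eq_CI => s; rewrite mulrC -CIZ; last exact: jb.
  by rewrite -CIZ; [apply: eq_CI => y; rewrite /f mulrC|exact: cintbZ].
rewrite (@CI_fubini R f (fun s => K * ⟦0 <= s <= pi⟧) (fun y => cmod (z y))).
- apply: eq_CI => y; have [yp|yp] := boolP (0 <= y <= pi); last first.
    rewrite (z0 y yp) mul0r -[RHS](@CI0 R); apply: eq_CI => s.
    by rewrite /f (z0 y yp) !mulr0 mul0r.
  have /andP[y0 ypi] := yp.
  have jg : cintb (fun s => ⟦0 <= s <= y⟧ * g (pi - 2 * s)).
    apply: (cintb_dom _ _ (rint_itv 0 y K)).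
      by apply: cmeasM => //; apply: cmeas_bool; exact: measurable_itvcc.
    move=> s; rewrite cmodM cmod_bool mulrC; have [/andP[s0 sy]|_] := boolP (0 <= s <= y); last by rewrite !mulr0.
    by rewrite !mulr1; apply: hK => //; rewrite s0 (le_trans sy ypi).
  have -> : (G pi - G (pi - 2 * y)) / 2 = CI (fun s => ⟦0 <= s <= y⟧ * g (pi - 2 * s)).
    rewrite (@CI_FTC R (fun t => - (G (pi - 2 * t) / 2)) (fun t => g (pi - 2 * t)) 0 y y0).
    + by rewrite mulr0 subr0; move: (G _) (G _) => a1 b1; ring.
    + by move=> t; exact: rcder_fold.
    + by move=> t; exact: ccont_fold.
  rewrite -CIZ //; apply: (@CI_point _ y).
  + apply: cmeasM => //; apply: cmeasM; first by apply: cmeas_bool; exact: measurable_itvcc.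
    by apply: cmeasM; [apply: cmeas_bool; exact: measurable_lt_cst|exact: cmeas_cst].
  + by have [] := cintbZ (z y) jg.
  move=> s sy; rewrite /f; have <- : ⟦0 <= s <= pi⟧ * ⟦s < y⟧ = ⟦0 <= s <= y⟧ :> Cplx R.
    rewrite -natrM mulnb lt_neqAle sy /=; congr (nat_of_bool _)%:R.
    by have [h|] := leP s y; rewrite ?andbF // (le_trans h ypi) !andbT.
  by ring.
- rewrite /f; apply: cmeasM; last exact: (@cmeas_comp1 R _ _ _ fst mg measurable_fst).
  by meas.
- exact: rint_itv.
- exact: rz.
move=> s y; rewrite /f !cmodM !cmod_bool.
have [sp|_] := boolP (0 <= s <= pi); last by rewrite !mul0r mulr0 mul0r.
rewrite mul1r mulr1 mulrC; apply: ler_pM; rewrite ?mulr_ge0 ?cmod_ge0 //; first exact: hK.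
by apply: ler_piMl; [exact: cmod_ge0|rewrite lern1 leq_b1].
Qed.

Section Orthogonality.
Variables (f1 f2 : Cplx R -> Cplx R) (u : R -> Cplx R * Cplx R).
Hypotheses (ef1 : entire f1) (ef2 : entire f2) (pu : pairpot u).
Let pu1 : pot (fun x => (u x).1). Proof. by case: pu. Qed.
Let pu2 : pot (fun x => (u x).2). Proof. by case: pu. Qed.

(** The entire function whose Taylor coefficients are the inner products of
   [u] with the sequence. *)
Definition gen l : Cplx R :=
  CI (fun t => Num.conj (u t).1 * (f1 l * s_fun t l)) +
  CI (fun t => Num.conj (u t).2 * (f2 l * c_fun t l)).

Let F1 t l := f1 l * s_fun t l.
Let F2 t l := f2 l * c_fun t l.
Let Fam1 : Fam F1. Proof. exact: (FamM ef1 (@Fam_s_fun R)). Qed.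
Let Fam2 : Fam F2. Proof. exact: (FamM ef2 (@Fam_c_fun R)). Qed.
Lemma pot_far (p : R -> Cplx R) : pot p -> forall t, pi < `|t| -> p t = 0.
Proof.
move=> [_ p0] t pt; apply: p0; apply/negP => /andP[t0 tp].
by move: pt; rewrite ger0_norm // ltNge tp.
Qed.
Let c1 : cintb (fun t => Num.conj (u t).1). Proof. by case: (pot_conj pu1) => [[]]. Qed.
Let c2 : cintb (fun t => Num.conj (u t).2). Proof. by case: (pot_conj pu2) => [[]]. Qed.
Let far1 := pot_far (pot_conj pu1).
Let far2 := pot_far (pot_conj pu2).

Lemma entire_gen : entire gen.
Proof. by apply: entireD; [exact: (Fam_int_entire c1 far1 Fam1)|exact: (Fam_int_entire c2 far2 Fam2)]. Qed.

Lemma gen_derive n l : derive1n n gen l =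
  n`!%:R * ip u (trunc (fun t => (taylor_coef n (F1 t) l, taylor_coef n (F2 t) l))).
Proof.
rewrite /gen derive1nD; [|exact: (Fam_int_entire c1 far1 Fam1)|exact: (Fam_int_entire c2 far2 Fam2)].
rewrite (Fam_int_derive1n n c1 far1 Fam1) (Fam_int_derive1n n c2 far2 Fam2) /ip.
have D1 := Fam_derive1n n Fam1; have D2 := Fam_derive1n n Fam2.
have j1 := Fam_cintb c1 far1 l D1; have j2 := Fam_cintb c2 far2 l D2.
rewrite -CID //.
have fact0 : (n`!%:R : Cplx R) != 0 by rewrite pnatr_eq0 -lt0n fact_gt0.
have b1 := pot_bool (pot_conj pu1); have b2 := pot_bool (pot_conj pu2).
rewrite -CIZ.
  apply: eq_CI => t; rewrite /trunc /taylor_coef /= -{1}b1 -{1}b2.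
  by move: (n`!%:R) fact0 (derive1n n (F1 t) l) (derive1n n (F2 t) l) => c c0 d1 d2; field.
apply: (@eq_ind_r _ _ cintb (cintbZ (n`!%:R)^-1 (cintbD j1 j2))).
apply/funext => t; rewrite /trunc /taylor_coef /= -{2}b1 -{2}b2; ring.
Qed.
End Orthogonality.
End Characteristic.

(** * Multiplicities *)

Section Multiplicity.
Context {R : realType}.
Implicit Types (lam : nat -> Cplx R) (m z : Cplx R).

Lemma first_index_min lam n0 nu m : (forall n, lam n = m -> (n0 <= n)%N) -> lam n0 = m ->
  lam (n0 + nu)%N = m -> first_index lam (n0 + nu) = n0.
Proof.
move=> min0 e0 e; rewrite /first_index e; set s := mkseq _ _; apply/eqP; rewrite eqn_leq.
have sz : size s = (n0 + nu).+1 by rewrite size_mkseq.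
have n0s : (n0 < (n0 + nu).+1)%N by rewrite ltnS leq_addr.
have le : (index m s <= n0)%N.
  rewrite leqNgt; apply/negP => /(before_find 0); rewrite nth_mkseq //= e0 eqxx; exact.
rewrite le /=; apply: min0.
have lt : (index m s < (n0 + nu).+1)%N by exact: leq_ltn_trans le n0s.
by rewrite -(nth_mkseq 0 lam lt) nth_index // -index_mem sz.
Qed.

Lemma card_le_inj (g : nat -> nat) n (B : set nat) : {in `I_n &, injective g} ->
  (forall i, (i < n)%N -> B (g i)) -> (`I_n #<= B)%card.
Proof.
move=> gi gB; have := inj_card_eq gi; rewrite card_eq_sym => e.
rewrite (card_le_eql e); apply: subset_card_le => _ [i /= ni <-]; exact: gB.
Qed.

Lemma occurrences lam m j : numbered_consecutively lam -> lam 0%N = 0 -> m != 0 ->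
  (`I_j.+1 #<= [set n | (0 < n)%N /\ lam n = m])%card ->
  exists2 n0, (0 < n0)%N & forall nu, (nu <= j)%N ->
    lam (n0 + nu)%N = m /\ first_index lam (n0 + nu) = n0.
Proof.
move=> cons l0 m0 le.
have ex : exists n, lam n == m.
  have /pcard_leP[f] := le; have /(_ 0%N isT) := @funS _ _ _ _ f.
  by move=> [_ h]; exists (f 0%N); apply/eqP.
have [n0 /eqP e0 min0] := ex_minnP ex.
have min0' n : lam n = m -> (n0 <= n)%N by move=> h; apply: min0; apply/eqP.
exists n0 => [|nu nuj].
  by rewrite lt0n; apply: contra m0 => /eqP n00; rewrite -e0 n00 l0.
have e : lam (n0 + nu)%N = m.
  rewrite -e0; apply: cons.
    by move=> k kn0 ek; have := min0' k; rewrite -ek e0 => /(_ erefl); rewrite leqNgt kn0.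
  apply: card_le_trans (card_le_trans le _).
    by rewrite card_le_II.
  by apply: subset_card_le => k /= [_ ->].
by split => //; exact: (first_index_min min0' e0 e).
Qed.
(** The term [lam 0 = 0] is one more occurrence of zero. *)
Lemma occurrences0 lam j : numbered_consecutively lam -> lam 0%N = 0 ->
  (`I_j.+1 #<= [set n | (0 < n)%N /\ lam n = 0])%card ->
  forall nu, (nu <= j.+1)%N -> lam nu = 0 /\ first_index lam nu = 0%N.
Proof.
move=> cons l0 /pcard_leP[f] nu nuj.
have fS i : (i < j.+1)%N -> (0 < f i)%N /\ lam (f i) = 0 by move=> ij; exact: (@funS _ _ _ _ f).
have e : lam nu = 0.
  rewrite -l0 -[nu]add0n; apply: cons => //.
  apply: (@card_le_trans _ _ _ `I_j.+2); first by rewrite card_le_II.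
  pose g i := if i is i'.+1 then f i' else 0%N.
  apply: (@card_le_inj g) => [[|i] [|k] /=|[|i] ij] //.
  - by rewrite !inE /= => _ kj e; have [] := fS k kj; rewrite -e.
  - by rewrite !inE /= => ij _ e; have [] := fS i ij; rewrite e.
  - rewrite !inE /= => ij kj; move=> h; congr S; apply: (@inj _ _ _ f) => //; by rewrite inE.
  - by rewrite /g /= l0; have [] := fS i ij.
by split => //; exact: (@first_index_min lam 0 nu 0 (fun n _ => leq0n n) l0 e).
Qed.

(** Leibniz' rule for the left-hand side. *)
Lemma derive_quotient (D E : Cplx R -> Cplx R) (c : Cplx R) n z : entire D -> entire E ->
  (forall l, l * D l = c * E l) ->
  z * derive1n n.+1 D z + n.+1%:R * derive1n n D z = c * derive1n n.+1 E z.
Proof.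
move=> eD eE h; have e : (fun l => l * D l) = (fun l => c * E l) by apply/funext.
by have := congr1 (fun F => derive1n n.+1 F z) e; rewrite derive1n_idM // derive1nZ.
Qed.
Lemma derive_quotient0 (D E : Cplx R -> Cplx R) (c : Cplx R) n : entire D -> entire E ->
  (forall l, l * D l = c * E l) -> derive1n n.+1 E 0 = 0 -> derive1n n D 0 = 0.
Proof.
move=> eD eE h E0; have := derive_quotient n 0 eD eE h; rewrite E0 mul0r add0r mulr0.
by move/eqP; rewrite mulf_eq0 pnatr_eq0 => /eqP.
Qed.
(** By induction on the order, as [z] can be cancelled. *)
Lemma derive_quotient_neq0 (D E : Cplx R -> Cplx R) (c : Cplx R) j z : entire D -> entire E ->
  (forall l, l * D l = c * E l) -> z != 0 ->
  (forall n, (n <= j)%N -> derive1n n E z = 0) -> derive1n j D z = 0.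
Proof.
move=> eD eE h z0 Ez.
suff : forall n, (n <= j)%N -> derive1n n D z = 0 by apply.
elim=> [_|n ih nj].
  have := h z; have := Ez 0%N (leq0n _); rewrite !derive1n0 => ->; rewrite mulr0.
  by move/eqP; rewrite mulf_eq0 (negbTE z0) => /eqP.
have := derive_quotient n z eD eE h; rewrite (Ez _ nj) (ih (ltnW nj)) !mulr0 addr0.
by move/eqP; rewrite mulf_eq0 (negbTE z0) => /eqP.
Qed.
End Multiplicity.

(** * Conclusion *)

Section Conclusion.
Context {R : realType}.
Local Notation mu := (@lebesgue_measure R).

Lemma Fam_L2 (F : R -> Cplx R -> Cplx R) z : Fam F -> L2 (fun t => F t z).
Proof.
move=> [_ mF bF]; have [M M0 hM] := bF (Num.max pi (cmod z)).
apply: (@pot_is_L2 R _ (fun t => ⟦0 <= t <= pi⟧ * F t z)); last by move=> t ->; rewrite mul1r.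
apply: (@pot_bounded R _ M).
  by apply: cmeasM => //; apply: cmeas_bool; exact: measurable_itvcc.
move=> t; rewrite cmodM cmod_bool mulrC; have [/andP[t0 tp]|_] := boolP (0 <= t <= pi); last by rewrite !mulr0.
by rewrite !mulr1; apply: hM; rewrite le_max ?lexx ?orbT // ger0_norm // tp.
Qed.
Lemma Fam_cst (c : Cplx R) : Fam (fun (_ : R) (_ : Cplx R) => c).
Proof.
split=> [t|z|r]; [exact: entire_cst|exact: cmeas_cst|].
by exists (cmod c); [exact: cmod_ge0|].
Qed.

Lemma inH_v_seq (f1 f2 : Cplx R -> Cplx R) lam k : entire f1 -> entire f2 ->
  inH (v_seq f1 f2 lam k).
Proof.
move=> e1 e2; rewrite /inH /v_seq; case: (k == 0)%N.
  by split; [exact: (Fam_L2 0 (Fam_cst 0))|exact: (Fam_L2 0 (Fam_cst 1))].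
set n := first_index lam k; set j := (k - n)%N.
have F1 := Fam_derive1n j (FamM e1 (@Fam_s_fun R)).
have F2 := Fam_derive1n j (FamM e2 (@Fam_c_fun R)).
split.
  exact: (Fam_L2 (lam n) (FamM (@entire_cst R (j`!%:R)^-1) F1)).
exact: (Fam_L2 (lam n) (FamM (@entire_cst R (j`!%:R)^-1) F2)).
Qed.

Section Side.
Variable A : R * R -> Cplx R.
Hypothesis hA : tri_fun A.
Let side0 s : pi < `|s| -> A (pi, s) = 0.
Proof.
move=> ps; have [_ _ zA] := hA; apply: zA; apply/negP => /andP[/andP[s0 sp] _].
by move: ps; rewrite ger0_norm // ltNge sp.
Qed.
Let jside : cintb (fun s => A (pi, s)).
Proof.
have [mA [M M0 hM] zA] := hA; apply: (cintb_dom _ _ (rint_itv 0 pi M)); first by meas.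
move=> s; have [/andP[/andP[s0 sp] _]|s_out] := boolP (tri pi s); first by rewrite s0 sp mulr1.
by rewrite zA // cmod0 mulr_ge0.
Qed.
Lemma side_entire (F : R -> Cplx R -> Cplx R) : Fam F ->
  entire (fun l => CI (fun s => A (pi, s) * F (pi - 2 * s) l)).
Proof.
move=> hF; have := Fam_int_entire jside side0 (Fam_affine pi (- 2) hF).
rewrite (_ : (fun l => CI (fun s => A (pi, s) * F (pi - 2 * s) l)) =
  (fun l => CI (fun s => A (pi, s) * F (pi + - 2 * s) l))) //.
by apply/funext => l; apply: eq_CI => s; rewrite mulNr.
Qed.
Lemma side_cintb (F : R -> Cplx R -> Cplx R) l : Fam F ->
  cintb (fun s => A (pi, s) * F (pi - 2 * s) l).
Proof.
by move=> hF; have := Fam_cintb jside side0 l (Fam_affine pi (- 2) hF); under eq_fun do rewrite mulNr.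
Qed.
Definition side (f1 f2 : Cplx R -> Cplx R) l : Cplx R :=
  f1 l * CI (fun s => A (pi, s) * c_fun (pi - 2 * s) l) +
  f2 l * CI (fun s => A (pi, s) * sinc (pi - 2 * s) l).
Lemma entire_side f1 f2 : entire f1 -> entire f2 -> entire (side f1 f2).
Proof.
move=> e1 e2; apply: entireD.
  exact: (entireM e1 (side_entire (@Fam_c_fun R))).
exact: (entireM e2 (side_entire (@Fam_sinc R))).
Qed.
End Side.

Lemma sideD (A B : R * R -> Cplx R) f1 f2 l : tri_fun A -> tri_fun B ->
  side (fun o => A o + B o) f1 f2 l = side A f1 f2 l + side B f1 f2 l.
Proof.
move=> hA hB; rewrite /side.
have e (F : R -> Cplx R -> Cplx R) : Fam F -> CI (fun s => (A (pi, s) + B (pi, s)) * F (pi - 2 * s) l) =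
    CI (fun s => A (pi, s) * F (pi - 2 * s) l) + CI (fun s => B (pi, s) * F (pi - 2 * s) l).
  move=> hF; rewrite -CID; [|exact: side_cintb|exact: side_cintb].
  by apply: eq_CI => s; rewrite mulrDl.
rewrite (e _ (@Fam_c_fun R)) (e _ (@Fam_sinc R)); ring.
Qed.

Lemma Delta_kernel p A (f1 f2 : Cplx R -> Cplx R) l : pot p -> is_kernel p A ->
  Delta f1 f2 (kernel_S p A) (kernel_S1 p A) l =
  (f1 l * c_fun pi l + f2 l * sinc pi l) + side A f1 f2 l.
Proof.
move=> pp kA; have [_ /(_ l)[eS eS1]] := kernel_is_S pp kA.
rewrite /Delta eS eS1 /side; ring.
Qed.
Lemma entire_free (f1 f2 : Cplx R -> Cplx R) : entire f1 -> entire f2 ->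
  entire (fun l => f1 l * c_fun pi l + f2 l * sinc pi l).
Proof.
move=> e1 e2; have [ec _ _] := @Fam_c_fun R; have [es _ _] := @Fam_sinc R.
exact: (entireD (entireM e1 (ec pi)) (entireM e2 (es pi))).
Qed.

(** Uniqueness identifies a given fundamental solution with the one built
   from the kernel. *)
Lemma Delta_given (q p : R -> Cplx R) A S S1 (f1 f2 : Cplx R -> Cplx R) : pot p -> is_kernel p A ->
  (forall x, 0 <= x <= pi -> q x = p x) -> is_S q S S1 ->
  Delta f1 f2 S S1 = Delta f1 f2 (kernel_S p A) (kernel_S1 p A).
Proof.
move=> pp kA qp hS; apply/funext => l.
have [hq y0 y10] := hS l; have [hK _] := kernel_is_S pp kA; have [hk k0 k10] := hK l.
have pI : 0 <= (pi : R) <= pi by apply/andP; split; [exact: pi_ge0|exact: lexx].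
have e0 : S 0 l = kernel_S p A 0 l by rewrite y0 k0.
have e1 : S1 0 l = kernel_S1 p A 0 l by rewrite y10 k10.
have [h1 h2] := solution_unique pp (is_solution_eq qp hq) hk e0 e1 pI.
by rewrite /Delta h1 h2.
Qed.

(** The factor [l] turns both [cos] and [sin / sqrt l] into primitives of the
   components of the sequence, and the folding separates them. *)
Lemma side_gen (f1 f2 : Cplx R -> Cplx R) (u : R -> Cplx R * Cplx R) (eps : R) (B : R * R -> Cplx R) l :
  pairpot u -> CI (fold (fun t => (u t).1) (fun t => (u t).2)) = 0 -> tri_fun B ->
  (forall s, 0 <= s <= pi -> B (pi, s) =
     CI (fun y => ⟦s < y⟧ * (rc eps * fold (fun t => (u t).1) (fun t => (u t).2) y))) ->
  l * side B f1 f2 l = rc eps * gen f1 f2 u l.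
Proof.
move=> [pu1 pu2]; set z := fold _ _ => z_mean hB eB.
have pz : pot z by exact: pot_fold.
have jz : cintb z by case: pz => [[]].
have pez : pot (fun y => rc eps * z y) by exact: potZ.
have zB s : B (pi, s) = ⟦0 <= s <= pi⟧ * CI (fun y => ⟦s < y⟧ * (rc eps * z y)).
  have [sp|sp] := boolP (0 <= s <= pi); first by rewrite mul1r eB.
  rewrite mul0r; have [_ _ ->] := hB => //; apply: contra sp => /andP[h _]; exact: h.
have val (g G : R -> Cplx R) : (forall t, rcder G t (g t)) -> (forall t, ccont g t) ->
    CI (fun s => B (pi, s) * g (pi - 2 * s)) = - (rc eps / 2) * CI (fun y => z y * G (pi - 2 * y)).
  move=> dG cg; under eq_CI do rewrite zB.
  rewrite (side_integral pez dG cg).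
  have cG t : ccont (fun t => G (pi - 2 * t)) t by apply: ccont_fold => y; exact: rcder_ccont (dG y).
  have jG : cintb (fun y => z y * G (pi - 2 * y)) by exact: cintb_pot_cont.
  rewrite (@eq_CI R _ (fun y => (rc eps * G pi / 2) * z y + - (rc eps / 2) * (z y * G (pi - 2 * y)))); last first.
    by move=> y; ring.
  have j1 := cintbZ (rc eps * G pi / 2) jz; have j2 := cintbZ (- (rc eps / 2)) jG.
  by rewrite (CID j1 j2) (CIZ _ jz) (CIZ _ jG) z_mean mulr0 add0r.
have ds (t : R) : rcder (fun t : R => sinc t l) t (c_fun t l) by exact: rcder_sinc.
have dc (t : R) : rcder (fun t : R => - c_fun t l) t (l * sinc t l).
  by rewrite -[l * _]opprK; apply: derN; exact: rcder_c_fun.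
have cc (t : R) : ccont (fun t : R => c_fun t l) t by exact: ccont_c_fun.
have cs (t : R) : ccont (fun t : R => sinc t l) t by exact: ccont_sinc.
have cls (t : R) : ccont (fun t : R => l * sinc t l) t.
  exact: rcder_ccont (derZ l (ds t)).
have e1 := val _ _ ds cc; have e2 := val _ _ dc cls.
have j1 := side_cintb hB l (@Fam_sinc R).
have e2' : l * CI (fun s => B (pi, s) * sinc (pi - 2 * s) l) =
    - (rc eps / 2) * CI (fun y => z y * - c_fun (pi - 2 * y) l).
  by rewrite -e2 -CIZ //; apply: eq_CI => s; ring.
have f_odd := CI_fold_odd pu1 pu2 cs (fun t => sincN t l).
have f_even := CI_fold_even pu1 pu2 cc (fun t => c_funN t l).
have e3 : CI (fun y => z y * - c_fun (pi - 2 * y) l) = - (2 * CI (fun t => Num.conj (u t).2 * c_fun t l)).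
  rewrite -f_even -CIN; first by apply: eq_CI => y; rewrite mulrN.
  have cf (y : R) : ccont (fun t : R => c_fun (pi - 2 * t) l) y.
    exact: (@ccont_fold R (fun t => c_fun t l) pi y cc).
  exact: (cintb_pot_cont pz cf).
rewrite /side mulrDr (mulrCA l (f2 l)) e2' e3 e1 f_odd /gen.
have c1 : CI (fun t => Num.conj (u t).1 * (f1 l * s_fun t l)) = f1 l * (l * CI (fun t => Num.conj (u t).1 * sinc t l)).
  rewrite mulrA -CIZ; first by apply: eq_CI => t; rewrite s_funE; ring.
  by apply: cintb_pot_cont => //; exact: pot_conj.
have c2 : CI (fun t => Num.conj (u t).2 * (f2 l * c_fun t l)) = f2 l * CI (fun t => Num.conj (u t).2 * c_fun t l).
  rewrite -CIZ; first by apply: eq_CI => t; ring.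
  by apply: cintb_pot_cont => //; exact: pot_conj.
rewrite c1 c2; move: (CI _) (CI _) => a b; by field.
Qed.

Lemma orthogonal_gen (f1 f2 : Cplx R -> Cplx R) lam (u : R -> Cplx R * Cplx R) k :
  entire f1 -> entire f2 -> pairpot u -> (0 < k)%N ->
  ip u (trunc (v_seq f1 f2 lam k)) = 0 ->
  derive1n (k - first_index lam k) (gen f1 f2 u) (lam (first_index lam k)) = 0.
Proof.
move=> e1 e2 pu k0; rewrite (gen_derive e1 e2 pu) /v_seq (gtn_eqF k0) /= => ->.
by rewrite mulr0.
Qed.

(** [CI_fold_even] for the constant function one. *)
Lemma orthogonal_mean (f1 f2 : Cplx R -> Cplx R) lam (u : R -> Cplx R * Cplx R) : pairpot u ->
  ip u (trunc (v_seq f1 f2 lam 0)) = 0 ->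
  CI (fold (fun t => (u t).1) (fun t => (u t).2)) = 0.
Proof.
move=> [pu1 pu2] h0; have one (t : R) : ccont (fun=> 1) t by exact: ccont_cst.
have := CI_fold_even pu1 pu2 one (fun t => erefl).
under [X in X = _]eq_CI do rewrite mulr1.
move=> ->; rewrite -[RHS](mulr0 2) -h0; congr (_ * _); apply: eq_CI => t.
have b2 := pot_bool (pot_conj pu2).
by rewrite /trunc /= !mulr0 add0r !mulr1 mulrC b2.
Qed.

(** The old characteristic function vanishes to the required order by
   hypothesis, the increment because [l] times it does to a higher or equal
   order. *)
Lemma subspectrum_perturb (f1 f2 : Cplx R -> Cplx R) (q p pt : R -> Cplx R) (A B : R * R -> Cplx R)
    (E : Cplx R -> Cplx R) (c : Cplx R) lam :
  entire f1 -> entire f2 -> pot p -> pot pt -> is_kernel p A -> tri_fun B ->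
  is_kernel pt (fun o => A o + B o) -> (forall x, 0 <= x <= pi -> q x = p x) ->
  entire E -> (forall l, l * side B f1 f2 l = c * E l) ->
  (forall k, (0 < k)%N -> derive1n (k - first_index lam k) E (lam (first_index lam k)) = 0) ->
  numbered_consecutively lam -> lam 0%N = 0 ->
  subspectrum f1 f2 q lam -> subspectrum f1 f2 pt lam.
Proof.
move=> e1 e2 pp ppt kA hB kAB qp eE DE Ev cons l0 [S [S1 [hS van]]].
have hA : tri_fun A by case: kA.
exists (kernel_S pt (fun o => A o + B o)), (kernel_S1 pt (fun o => A o + B o)).
split=> [|m j le]; first by have [] := kernel_is_S ppt kAB.
have eD := entire_side hB e1 e2.
have eDelta : Delta f1 f2 (kernel_S pt (fun o => A o + B o)) (kernel_S1 pt (fun o => A o + B o)) =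
    (fun l => Delta f1 f2 S S1 l + side B f1 f2 l).
  apply/funext => l; rewrite (Delta_given f1 f2 pp kA qp hS).
  apply: (etrans (Delta_kernel f1 f2 l ppt kAB)); rewrite (sideD f1 f2 l hA hB) addrA.
  exact: (congr1 (fun x => x + side B f1 f2 l) (esym (Delta_kernel f1 f2 l pp kA))).
have entD : entire (Delta f1 f2 S S1).
  rewrite (Delta_given f1 f2 pp kA qp hS).
  rewrite (_ : Delta _ _ _ _ = fun l => (f1 l * c_fun pi l + f2 l * sinc pi l) + side A f1 f2 l).
    by apply: entireD; [exact: entire_free|exact: entire_side].
  by apply/funext => l; exact: Delta_kernel.
have fact0 : ((j`!%:R : Cplx R)^-1) != 0 by rewrite invr_eq0 pnatr_eq0 -lt0n fact_gt0.
have van0 : derive1n j (Delta f1 f2 S S1) m = 0.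
  by have /eqP := van m j le; rewrite mulf_eq0 (negbTE fact0) => /eqP.
rewrite /taylor_coef eDelta derive1nD // van0 add0r.
suff -> : derive1n j (side B f1 f2) m = 0 by rewrite mulr0.
have [m0|m0] := eqVneq m 0.
  rewrite m0; apply: (derive_quotient0 eD eE DE).
  have occ := occurrences0 cons l0 (_ : (`I_j.+1 #<= [set n | (0 < n)%N /\ lam n = 0])%card).
  rewrite -m0 in occ; have [e f] := occ le j.+1 (leqnn _).
  by have := Ev j.+1 isT; rewrite f l0 subn0.
have [n0 n00 occ] := occurrences cons l0 m0 le.
apply: (derive_quotient_neq0 eD eE DE m0) => n nj.
have [e f] := occ n nj; have [e0 _] := occ 0%N (leq0n _).
have := Ev (n0 + n)%N; rewrite f addn_gt0 n00 addKn => /(_ isT).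
by rewrite -[n0 in lam n0]addn0 e0.
Qed.
End Conclusion.

Unset Implicit Arguments.
Unset Strict Implicit.

Theorem theorem2p3 (R : realType) (f1 f2 : Cplx R -> Cplx R)
    (q : R -> Cplx R) (lam : nat -> Cplx R)
    (f1_entire : entire f1) (f2_entire : entire f2)
    (q_L2 : L2 q)
    (lam0 : lam 0%N = 0)
    (lam_consecutive : numbered_consecutively lam)
    (lam_subspectrum : subspectrum f1 f2 q lam)
    (v_incomplete : ~ complete_in_H (v_seq f1 f2 lam)) :
  exists qt : R -> Cplx R,
    [/\ L2 qt,
        ~ ae_eq0pi qt q,
        2^-1 * cint qt = 2^-1 * cint q &
        subspectrum f1 f2 qt lam].
Proof.
have [u pu [u0 orth]] := incomplete_orthogonal (fun k => inH_v_seq lam k f1_entire f2_entire) v_incomplete.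
have [pu1 pu2] := pu.
pose p x := ⟦0 <= x <= pi⟧ * q x.
have pp : pot p by exact: L2_pot.
have qp x : 0 <= x <= pi -> q x = p x by rewrite /p => ->; rewrite mul1r.
have [A kA] := kernel_exists pp; have [hA _] := kA.
pose zh := fold (fun t => (u t).1) (fun t => (u t).2).
have pzh : pot zh by exact: pot_fold.
have zmean : CI zh = 0 by exact: (orthogonal_mean pu (orth 0%N)).
have [eps eps0 [B [w [hB pw eB ew]]]] := perturb_exists pp hA pzh.
pose z y := rc eps * zh y.
have pz : pot z by exact: potZ.
have kAB := perturbed_kernel pp kA pz hB pw eB ew.
pose pt y := p y + (z y + w y).
have ppt : pot pt := potD pp (potD pz pw).
have jzh : cintb zh by case: pzh => [[]].
have zm : CI z = 0 by rewrite /z (CIZ _ jzh) zmean mulr0.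
exists pt; split.
- exact: (pot_is_L2 ppt).
- move=> ae_eq.
  have r0 : {ae (@lebesgue_measure R), forall y, z y + w y = 0}.
    apply: ae_imp ae_eq => y h; have [yp|yp] := boolP (0 <= y <= pi).
      by have := h yp; rewrite (qp y yp) /pt => /eqP; rewrite -subr_eq0 addrC addKr => /eqP.
    by have [_ z0] := pz; have [_ w0] := pw; rewrite (z0 y yp) (w0 y yp) addr0.
  have z0 := perturbed_nontrivial pp kA pz hB pw eB ew r0.
  have zh0 : {ae (@lebesgue_measure R), forall y, zh y = 0}.
    apply: ae_imp z0 => y /eqP; rewrite /z mulf_eq0 => /orP[/eqP h|/eqP //].
    by move: eps0; rewrite -(Re_rc eps) h ltxx.
  by move: u0; rewrite /nrm2 (fold_eq0 pu1 pu2 zh0) ltxx.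
- congr (_ * _); rewrite !cint_CI (_ : (fun x => ⟦0 <= x <= pi⟧ * pt x) = pt).
    by rewrite (perturbed_mean pp kA pz hB pw eB ew) zm addr0.
  by apply/funext => x; exact: pot_bool.
apply: (subspectrum_perturb f1_entire f2_entire pp ppt kA hB kAB qp (entire_gen f1_entire f2_entire pu)
  (c := rc eps)) => // [l|k k0].
  apply: side_gen => // s sp; exact: (perturbed_side eB sp).
exact: (orthogonal_gen f1_entire f2_entire pu k0 (orth k)).
Qed.
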